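(* Let $0<2\nu<1$, $\mu=1-2\nu$, and $0<\varepsilon<1$. Suppose that the initial data $(\widetilde q_{\mathrm{in}},\widetilde{\mathcal H}_{\mathrm{in}},v_{\mathrm{in}},w_{\mathrm{in}})$ for the system (CE) satisfy $$\sum_{\substack{\alpha,\beta\in\mathbb N,\ \alpha+\beta\le3\\ \partial\in\{\partial_x,\partial_y,\partial_z\}}}\Big(\|[\partial^\beta(\varepsilon^\sigma\partial_t)^\alpha\widetilde q]_{\mathrm{in}},[\partial^\beta(\varepsilon^\sigma\partial_t)^\alpha\widetilde{\mathcal H}]_{\mathrm{in}}\|_{L^2(\mathbb T^3)}^2+\|[\partial^\beta(\varepsilon^\sigma\partial_t)^\alpha v]_{\mathrm{in}},[\partial^\beta(\varepsilon^\sigma\partial_t)^\alpha w]_{\mathrm{in}}\|_{L^2(\mathbb T^3)}^2\Big)\le\mathcal C_{\mathrm{in}}$$ for some $\mathcal C_{\mathrm{in}}\in(0,\infty)$ and $\sigma\in(0,\mu]$. Let $(\widetilde q(s),\widetilde{\mathcal H}(s),v(s),w(s))$ be the smooth solution to (CE) with this initial data. Then there exists $T_\sigma\in(0,\infty)$, depending only on $\mathcal C_{\mathrm{in}}$, such that $$\sup_{0\le s\le T_\sigma}\sum_{\substack{\alpha,\beta\in\mathbb N,\ \alpha+\beta\le3\\ \partial\in\{\partial_x,\partial_y,\partial_z\}}}\Big(\|(\varepsilon^\sigma\partial_t)^\alpha\partial^\beta\widetilde q(s),(\varepsilon^\sigma\partial_t)^\alpha\partial^\beta\widetilde{\mathcal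 H}(s)\|_{L^2(\mathbb T^3)}^2+\|(\varepsilon^\sigma\partial_t)^\alpha\partial^\beta v(s),(\varepsilon^\sigma\partial_t)^\alpha\partial^\beta w(s)\|_{L^2(\mathbb T^3)}^2\Big)\le\mathcal C\,\mathcal C_{\mathrm{in}}$$ with some constant $\mathcal C\in(0,\infty)$ independent of $\varepsilon$.
   Context: Domain and notation: $\mathbb T^3=(\mathbb R/\mathbb Z)^3$ with coordinates $(x,y,z)$; $\nabla_h=(\partial_x,\partial_y)^\top$, $\mathrm{div}_h=\nabla_h\cdot$; $v$ is $\mathbb R^2$-valued, $w$ scalar; $\|A,B\|_X=\|A\|_X+\|B\|_X$. Parameters: $\mu\in(0,1)$, $\mu+2\nu=1$; $\gamma>1$, $\varpi_0>0$, $\theta_0>0$ constants; $\mathcal A=\frac1{(\gamma-1)\varpi_0}$; the constant in $\vartheta$ below is $\mathcal C_0:=\theta_0^{-1}$. The functions $G,\overline{\mathcal H}_0,\widetilde G$ of $z$ are odd in $z$ and smooth on $\mathbb T^3$, and $\mathcal B=-\frac1{G\partial_z(G^{-1}\overline{\mathcal H}_0)}$ is assumed to be a positive constant. These are fixed and constants may depend on them. System (CE), with $\vartheta=\mathcal C_0+\varepsilon^\mu\widetilde G\,\overline{\mathcal H}_0+\varepsilon^{\mu+\nu}\widetilde G\,\widetilde{\mathcal H}$: $$\mathcal A(\partial_t\widetilde q+v\cdot\nabla_h\widetilde q+w\partial_z\widetilde q)+\tfrac1\varepsilon(\mathrm{div}_hv+\partial_zw)=\mathcal A\mathcal C_0Gw+\varepsilon^\mu\mathcal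 A\overline{\mathcal H}_0w-\varpi_0^{-1}\widetilde q(\mathrm{div}_hv+\partial_zw)+\varpi_0^{-1}(\mathrm{div}_hv+\partial_zw)\Big(\mathcal C_0\int_0^zG\,dz'+\varepsilon^\mu\int_0^z\overline{\mathcal H}_0\,dz'\Big),$$ $$\mathcal B(\partial_t\widetilde{\mathcal H}+v\cdot\nabla_h\widetilde{\mathcal H}+w\partial_z\widetilde{\mathcal H})-\tfrac1{\varepsilon^\nu}w=\mathcal B\widetilde G\widetilde{\mathcal H}w,$$ $$\vartheta(\partial_tv+v\cdot\nabla_hv+w\partial_zv)+\tfrac1\varepsilon\nabla_h\widetilde q=0,$$ $$\vartheta(\partial_tw+v\cdot\nabla_hw+w\partial_zw)+\tfrac1\varepsilon\partial_z\widetilde q+\tfrac1{\varepsilon^\nu}\widetilde{\mathcal H}=0,$$ on $\mathbb T^3$, where $\widetilde q,\widetilde{\mathcal H},v,w$ are respectively even, odd, even, odd in $z$. The quantities $[\partial_t^\alpha\widetilde q]_{\mathrm{in}}$, etc., $\alpha\ge1$, are the initial values of time derivatives, defined inductively by expressing time derivatives through spatial derivatives using (CE).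
   Formalization: Added: initially ϑ and 1+εϖ₀⁻¹(q̃−𝒞₀∫G−ε^μ∫H̄₀) are at least some κ>0, on which T_σ and 𝒞 may depend (automatic for small ε; otherwise (CE) may be degenerate or elliptic and the claim fails); 𝒞 may also depend on 𝒞_in, not on ε. *)

(* Defs.v *)
From Stdlib Require Import Reals List Factorial.
From Coquelicot Require Import Coquelicot.

Open Scope R_scope.

(* Functions on T^3 = (R/Z)^3 are functions of (x, y, z) that are 1-periodic
    in each variable; time-dependent ones take the time first. *)

Definition sfield := R -> R -> R -> R.
Definition tfield := R -> sfield.

Definition periodic (f : sfield) : Prop := forall x y z,
  f (x + 1) y z = f x y z /\ f x (y + 1) z = f x y z /\ f x y (z + 1) = f x y z.

Definition even_z (f : sfield) : Prop := forall x y z, f x y (- z) = f x y z.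
Definition odd_z (f : sfield) : Prop := forall x y z, f x y (- z) = - f x y z.

Inductive axis := AxX | AxY | AxZ.

Definition pd (d : axis) (f : sfield) : sfield := fun x y z =>
  match d with
  | AxX => Derive (fun r => f r y z) x
  | AxY => Derive (fun r => f x r z) y
  | AxZ => Derive (fun r => f x y r) z
  end.

Definition ex_pd (d : axis) (f : sfield) (x y z : R) : Prop :=
  match d with
  | AxX => ex_derive (fun r => f r y z) x
  | AxY => ex_derive (fun r => f x r z) y
  | AxZ => ex_derive (fun r => f x y r) z
  end.

Definition dt (f : tfield) : tfield := fun t x y z => Derive (fun s => f s x y z) t.

(* [None] is the time direction. *)
Definition pdt (d : option axis) (f : tfield) : tfield :=
  match d with None => dt f | Some a => fun t => pd a (f t) end.

Definition ex_pdt (d : option axis) (f : tfield) (t x y z : R) : Prop :=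
  match d with
  | None => ex_derive (fun s => f s x y z) t
  | Some a => ex_pd a (f t) x y z
  end.

(* C^infinity on I x R^3 (I open): the iterated partial derivatives of all
   orders, in any order of differentiation, exist and are jointly continuous. *)
Definition smooth_on (I : R -> Prop) (f : tfield) : Prop :=
  forall (l : list (option axis)) (t x y z : R), I t ->
    let g := fold_right pdt f l in
    (forall d, ex_pdt d g t x y z) /\
    continuous (fun p : R * R * R * R => let '(t', x', y', z') := p in g t' x' y' z')
               (t, x, y, z).

Record params := Params {
  nu : R; gam : R; varpi0 : R; theta0 : R;
  G : R -> R;
  Hbar : R -> R;    (* \overline{\mathcal H}_0 *)
  Gt : R -> R;      (* \widetilde G *)
  calB : R }.

Definition mu (P : params) : R := 1 - 2 * nu P.
Definition calA (P : params) : R := / ((gam P - 1) * varpi0 P).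
Definition C0 (P : params) : R := / theta0 P.

Definition smooth_odd_periodic (g : R -> R) : Prop :=
  (forall n z, ex_derive_n g n z) /\
  (forall z, g (z + 1) = g z) /\ (forall z, g (- z) = - g z).

(* G is odd, hence vanishes at z = 0 and z = 1/2: the formula defining calB is
   imposed where G does not vanish, and that set is dense, so that the formula
   determines calB everywhere by continuity. *)
Definition admissible (P : params) : Prop :=
  0 < 2 * nu P < 1 /\ 1 < gam P /\ 0 < varpi0 P /\ 0 < theta0 P /\
  smooth_odd_periodic (G P) /\ smooth_odd_periodic (Hbar P) /\
  smooth_odd_periodic (Gt P) /\
  0 < calB P /\
  (forall z, G P z <> 0 ->
     calB P = - (1 / (G P z * Derive (fun r => / G P r * Hbar P r) z))) /\
  (forall z d, 0 < d -> exists r, Rabs (r - z) < d /\ G P r <> 0).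

(* The unknowns (q~, H~, v, w), with v = (v1, v2). *)
Record state := State { q : sfield; h : sfield; v1 : sfield; v2 : sfield; w : sfield }.

Definition divergence (U : state) : sfield := fun x y z =>
  (pd AxX (v1 U) x y z + pd AxY (v2 U) x y z) + pd AxZ (w U) x y z.

Definition advect (U : state) (f : sfield) : sfield := fun x y z =>
  v1 U x y z * pd AxX f x y z + v2 U x y z * pd AxY f x y z + w U x y z * pd AxZ f x y z.

Definition vartheta (P : params) (eps : R) (U : state) : sfield := fun x y z =>
  C0 P + Rpower eps (mu P) * Gt P z * Hbar P z
  + Rpower eps (mu P + nu P) * Gt P z * h U x y z.

Definition Phi (P : params) (eps z : R) : R :=
  C0 P * RInt (G P) 0 z + Rpower eps (mu P) * RInt (Hbar P) 0 z.

(* The rescaled compressible Euler system (CE) at the point (t, x, y, z). *)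
Definition CE_at (P : params) (eps : R) (U : R -> state) (t x y z : R) : Prop :=
  let V := U t in
  let D := divergence V x y z in
  let th := vartheta P eps V x y z in
  let mat (c : state -> sfield) :=
    dt (fun s => c (U s)) t x y z + advect V (c V) x y z in
  calA P * mat q + 1 / eps * D
  = calA P * C0 P * G P z * w V x y z
    + Rpower eps (mu P) * calA P * Hbar P z * w V x y z
    - / varpi0 P * q V x y z * D
    + / varpi0 P * D * Phi P eps z
  /\ calB P * mat h - 1 / Rpower eps (nu P) * w V x y z
     = calB P * Gt P z * h V x y z * w V x y z
  /\ th * mat v1 + 1 / eps * pd AxX (q V) x y z = 0
  /\ th * mat v2 + 1 / eps * pd AxY (q V) x y z = 0
  /\ th * mat w + 1 / eps * pd AxZ (q V) x y z
     + 1 / Rpower eps (nu P) * h V x y z = 0.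

(* Time derivatives are those of a function smooth across t = 0; a function
   smooth on [0,T) x T^3 up to t = 0 always has such an extension, and nothing
   else is asked of the values at negative times. *)
Definition smooth_solution (P : params) (eps : R) (U0 : state) (T : Rbar)
    (U : R -> state) : Prop :=
  Rbar_lt 0 T /\
  (exists delta, 0 < delta /\
     forall c, In c (q :: h :: v1 :: v2 :: w :: nil) ->
       smooth_on (fun t => - delta < t /\ Rbar_lt t T) (fun t => c (U t))) /\
  (forall t, 0 <= t -> Rbar_lt t T ->
     (forall c, In c (q :: h :: v1 :: v2 :: w :: nil) -> periodic (c (U t))) /\
     even_z (q (U t)) /\ odd_z (h (U t)) /\
     even_z (v1 (U t)) /\ even_z (v2 (U t)) /\ odd_z (w (U t)) /\
     forall x y z, CE_at P eps U t x y z) /\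
  U 0 = U0.

Definition maximal_smooth_solution (P : params) (eps : R) (U0 : state) (T : Rbar)
    (U : R -> state) : Prop :=
  smooth_solution P eps U0 T U /\
  forall T' U', Rbar_lt T T' -> smooth_solution P eps U0 T' U' ->
    ~ (forall t, 0 <= t -> Rbar_lt t T -> U' t = U t).

(* (CE) solved for the time derivatives: dU/dt = CE_rhs U. *)
Definition CE_rhs (P : params) (eps : R) (U : state) : state :=
  let D := divergence U in
  let th := vartheta P eps U in
  {| q := fun x y z =>
       - advect U (q U) x y z
       + / calA P * (- (1 / eps * D x y z)
           + calA P * C0 P * G P z * w U x y z
           + Rpower eps (mu P) * calA P * Hbar P z * w U x y z
           - / varpi0 P * q U x y z * D x y z
           + / varpi0 P * D x y z * Phi P eps z);
     h := fun x y z =>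
       - advect U (h U) x y z
       + / calB P * (1 / Rpower eps (nu P) * w U x y z
                     + calB P * Gt P z * h U x y z * w U x y z);
     v1 := fun x y z =>
       - advect U (v1 U) x y z - / th x y z * (1 / eps * pd AxX (q U) x y z);
     v2 := fun x y z =>
       - advect U (v2 U) x y z - / th x y z * (1 / eps * pd AxY (q U) x y z);
     w := fun x y z =>
       - advect U (w U) x y z
       - / th x y z * (1 / eps * pd AxZ (q U) x y z
                       + 1 / Rpower eps (nu P) * h U x y z) |}.

Definition axpy (a : R) (U V : state) : state :=
  let f c := fun x y z : R => a * c U x y z + c V x y z in
  {| q := f q; h := f h; v1 := f v1; v2 := f v2; w := f w |}.

Definition dtn (U : R -> state) (t : R) (n : nat) : state :=
  let f (c : state -> sfield) := fun x y z => Derive_n (fun s => c (U s) x y z) n t in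
  {| q := f q; h := f h; v1 := f v1; v2 := f v2; w := f w |}.

(* The n-th time derivative of CE_rhs U at t = 0 involves U only through its time
   derivatives of order <= n at t = 0, i.e. through its Taylor polynomial
   [taylor_in n]; this yields the time derivative of U of order n + 1. *)
Fixpoint taylor_in (P : params) (eps : R) (U0 : state) (n : nat) (t : R) : state :=
  match n with
  | O => U0
  | S m => axpy (t ^ S m / INR (fact (S m)))
             (dtn (fun s => CE_rhs P eps (taylor_in P eps U0 m s)) 0 m)
             (taylor_in P eps U0 m t)
  end.

(* [d_t^n U]_in *)
Definition dt_in (P : params) (eps : R) (U0 : state) (n : nat) : state :=
  match n with
  | O => U0
  | S m => dtn (fun s => CE_rhs P eps (taylor_in P eps U0 m s)) 0 m
  end.

Definition L2sq (f : sfield) : R :=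
  RInt (fun x => RInt (fun y => RInt (fun z => f x y z ^ 2) 0 1) 0 1) 0 1.
Definition L2 (f : sfield) : R := sqrt (L2sq f).
Definition L2_vec (f g : sfield) : R := sqrt (L2sq f + L2sq g).

(* The sum over alpha + beta <= 3 and d in {d_x, d_y, d_z} of
   || d^beta (eps^sigma d_t)^alpha (q, h) ||^2 + || d^beta (eps^sigma d_t)^alpha (v, w) ||^2,
   where [J alpha] is the alpha-th time derivative and ||A, B|| = ||A|| + ||B||. *)
Definition energy (eps sigma : R) (J : nat -> state) : R :=
  let D (a b : nat) (d : axis) (c : state -> sfield) : sfield :=
    Nat.iter b (pd d) (fun x y z => Rpower eps sigma ^ a * c (J a) x y z) in
  let term (a b : nat) (d : axis) : R :=
    (L2 (D a b d q) + L2 (D a b d h)) ^ 2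
    + (L2_vec (D a b d v1) (D a b d v2) + L2 (D a b d w)) ^ 2 in
  sum_f_R0 (fun a => sum_f_R0 (fun b => term a b AxX + term a b AxY + term a b AxZ) (3 - a)) 3.

(* The two coefficients whose positivity makes (CE) symmetric hyperbolic: vartheta,
   and 1 + eps varpi0^{-1} (q~ - Phi), which is eps times the full coefficient
   of div_h v + d_z w in the first equation. *)
Definition uniformly_hyperbolic (P : params) (eps kappa : R) (U : state) : Prop :=
  forall x y z,
    kappa <= vartheta P eps U x y z /\
    kappa <= 1 + eps * / varpi0 P * (q U x y z - Phi P eps z).

(* Main.v *)
Require Import Defs.
From Stdlib Require Import Reals Arith Lra Lia List ClassicalEpsilon FunctionalExtensionality.
From Coquelicot Require Import Coquelicot.

(** Multiplying all equations of (CE) but the first by [1 + eps (q - Phi) / varpi0] gives a symmetric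
  system whose singular part is antisymmetric. The words of length at most 3 in the spatial
  derivatives and [e = eps^sigma] times the time derivative therefore satisfy an energy estimate
  with constants independent of [eps]: as [sigma <= mu], the weights of the time derivatives are
  constant up to [O(e)], so their commutators cost nothing singular. A bootstrap on the energy,
  during which the weights stay bounded below, gives the bound on a time interval that depends only
  on the data; at time 0 the energy of the solution is that of [dt_in], because both sequences of
  time derivatives are determined by the same recursion on Taylor jets.

  Maximality turns the bound into existence. Local solutions are limits of an iteration in which
  the system is frozen at the previous iterate and space derivatives are centred differences, so
  that each step is an ordinary differential equation; the iterates are bounded at every order
  and contract in [L^2]. Their lifespan depends only on the norm of order 3 and on the
  hyperbolicity constant, hence a solution with bounded energy can be continued. *)

Open Scope R_scope.

Local Notation RC := R_CompleteNormedModule.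
Local Notation RN := R_NormedModule.
Local Notation RA := R_AbsRing.
Local Notation cid := constructive_indefinite_description.

Ltac etr := eapply Rle_trans.
Tactic Notation "ext3" ident(x) ident(y) ident(z) := extensionality x; extensionality y; extensionality z.
Tactic Notation "have" ident(x) ":=" lconstr(t) := assert (x := t).

(** The multiplier is forced: [1 / eps] times it is the full coefficient of the divergence in the
    first equation, so multiplying the momentum equations by it gives divergence and gradient one
    common coefficient; multiplying the equation of [h] as well keeps the buoyancy terms
    antisymmetric. That coefficient is [1 / eps] plus a bounded field, so none of its derivatives or
    commutators sees [1 / eps]. Order 3 is what bounds the gradients of the coefficients in
    dimension 3. All Sobolev inequalities come from one-dimensional oscillation bounds on the
    circle, averaged along the axes, and are stated for smooth periodic fields only. The choice of
    centred differences fits this: they are skew-adjoint up to a commutator and keep fields smooth,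
    so that weak solutions and completions never occur. Two features of the statement need separate
    arguments. The parities in [z] are not tracked by the iteration; they follow from uniqueness
    applied to the reflected solution. The energy contains only powers of a single spatial
    derivative; mixed derivatives are recovered by integration by parts. *)

Lemma continuous_pair {T U V : UniformSpace} (f : T -> U) (g : T -> V) (x : T) :
 continuous f x -> continuous g x -> continuous (fun u => (f u, g u)) x.
Proof.
 intros Hf Hg.
 apply (continuous_comp_2 f g (fun a b => (a, b)) x Hf Hg).
 apply continuous_ext with (fun p => p); [now intros [a b] | apply continuous_id].
Qed.

Lemma ball_R (x e y : R) : ball x e y -> Rabs (y - x) < e.
Proof. easy. Qed.

Lemma R_ball (x e y : R) : Rabs (y - x) < e -> ball x e y.
Proof. easy. Qed.

(** * Joint continuity, integrals with parameters and Fubini *)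

Definition c4 (f : tfield) (t x y z : R) : Prop :=
 continuous (fun p : R * R * R * R => let '(t', x', y', z') := p in f t' x' y' z')
      (t, x, y, z).

(** A spatial field is read as a field constant in time, so that every closure property of [c4]
    applies to it directly. *)
Definition c3 (f : sfield) : Prop := forall t x y z, c4 (fun _ => f) t x y z.

Lemma c4_comp {T : UniformSpace} (f : tfield) (A X Y Z : T -> R) (u : T) :
 continuous A u -> continuous X u -> continuous Y u -> continuous Z u ->
 c4 f (A u) (X u) (Y u) (Z u) ->
 continuous (fun s => f (A s) (X s) (Y s) (Z s)) u.
Proof.
 intros HA HX HY HZ Hf.
 apply (continuous_comp (fun s => (A s, X s, Y s, Z s))
  (fun p : R * R * R * R => let '(t', x', y', z') := p in f t' x' y' z') u).
 - now repeat apply continuous_pair.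
 - exact Hf.
Qed.

Lemma c3_comp {T : UniformSpace} (f : sfield) (X Y Z : T -> R) (u : T) :
 c3 f -> continuous X u -> continuous Y u -> continuous Z u ->
 continuous (fun s => f (X s) (Y s) (Z s)) u.
Proof.
 intros Hf HX HY HZ.
 apply (c4_comp (fun _ => f) (fun _ => 0) X Y Z u); try easy.
 apply continuous_const.
Qed.

Lemma c4_intro (f : tfield) (t x y z : R) :
 continuous (fun p : R * R * R * R => f (fst (fst (fst p))) (snd (fst (fst p)))
  (snd (fst p)) (snd p)) (t, x, y, z) -> c4 f t x y z.
Proof.
 intros H; unfold c4.
 eapply continuous_ext; [|exact H].
 now intros [[[a b] c] d].
Qed.

Lemma c3_intro (f : sfield) :
 (forall x y z, continuous (fun p : R * R * R => f (fst (fst p)) (snd (fst p)) (snd p))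
  (x, y, z)) -> c3 f.
Proof.
 intros H t x y z; apply c4_intro.
 apply (continuous_comp (fun p : R * R * R * R => ((snd (fst (fst p)), snd (fst p)), snd p))
  (fun p : R * R * R => f (fst (fst p)) (snd (fst p)) (snd p)) (t, x, y, z)); [|apply H].
 repeat apply continuous_pair.
 - apply (continuous_comp (fun p : R*R*R*R => fst (fst p)) snd); [|apply continuous_snd].
  apply (continuous_comp (fun p : R*R*R*R => fst p) fst); apply continuous_fst.
 - apply (continuous_comp (fun p : R*R*R*R => fst p) snd); [apply continuous_fst|apply continuous_snd].
 - apply continuous_snd.
Qed.

Ltac cproj :=
 first [ apply continuous_id | apply continuous_const | apply continuous_fst | apply continuous_snd
  | (apply (continuous_comp _ snd); [|apply continuous_snd]; cproj)
  | (apply (continuous_comp _ fst); [|apply continuous_fst]; cproj) ].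

Lemma c4_slice (f : tfield) (t x y z : R) : c4 f t x y z -> forall s, c4 (fun _ => f t) s x y z.
Proof.
 intros H s. apply c4_intro.
 apply (c4_comp f (fun _ => t) (fun p : R*R*R*R => snd (fst (fst p))) (fun p => snd (fst p)) snd
     (s, x, y, z)); [cproj..|exact H].
Qed.

Lemma c4_plus (f g : tfield) (t x y z : R) : c4 f t x y z -> c4 g t x y z ->
 c4 (fun t x y z => f t x y z + g t x y z) t x y z.
Proof.
 intros Hf Hg; unfold c4.
 eapply continuous_ext; [|exact (continuous_plus _ _ _ Hf Hg)].
 now intros [[[a b] c] d].
Qed.

Lemma c4_mult (f g : tfield) (t x y z : R) : c4 f t x y z -> c4 g t x y z ->
 c4 (fun t x y z => f t x y z * g t x y z) t x y z.
Proof.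
 intros Hf Hg; unfold c4.
 eapply continuous_ext; [|exact (continuous_mult (K:=RA) _ _ _ Hf Hg)].
 now intros [[[a b] c] d].
Qed.

Lemma c4_const (k t x y z : R) : c4 (fun _ _ _ _ => k) t x y z.
Proof.
 unfold c4. eapply continuous_ext; [|apply (continuous_const k)].
 now intros [[[a b] c] d].
Qed.

Lemma c4_inv (f : tfield) (t x y z : R) : c4 f t x y z -> f t x y z <> 0 ->
 c4 (fun t x y z => / f t x y z) t x y z.
Proof.
 intros Hf H0.
 apply c4_intro.
 apply (continuous_comp (fun p : R * R * R * R => f (fst (fst (fst p))) (snd (fst (fst p)))
  (snd (fst p)) (snd p)) Rinv).
 - apply (c4_comp f); [cproj..|exact Hf].
 - now apply continuous_Rinv.
Qed.

Lemma c4_ext_loc (f g : tfield) (I : R -> Prop) (t x y z : R) :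
 open I -> I t -> (forall t x y z, I t -> f t x y z = g t x y z) ->
 c4 f t x y z -> c4 g t x y z.
Proof.
 intros HI Ht Hfg Hf.
 refine (continuous_ext_loc _ _ _ _ Hf).
 destruct (HI t Ht) as [d Hd].
 exists d. intros [[[a b] c] e] [[[Ha _] _] _].
 apply Hfg, Hd, Ha.
Qed.

(** Tube lemma. Joint continuity at [(p0, s)] gives a radius around each [s], inside which both
    values are compared with [f p0 s]; compactness of [[c, d]] makes the radius in [p] uniform. *)
Lemma tube {T : UniformSpace} (f : T -> R -> R) (p0 : T) (c d : R) :
 (forall s, c <= s <= d -> continuous (fun q : T * R => f (fst q) (snd q)) (p0, s)) ->
 forall eps, 0 < eps -> exists del : posreal, forall p, ball p0 del p ->
  forall s, c <= s <= d -> Rabs (f p s - f p0 s) < eps.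
Proof.
 intros Hf eps Heps.
 assert (H : forall s, exists del : posreal, c <= s <= d -> forall p s', ball p0 del p ->
  Rabs (s' - s) < del -> Rabs (f p s' - f p0 s') < eps).
 { intros s. destruct (classic (c <= s <= d)) as [Hs|Hs]; [|exists (mkposreal 1 Rlt_0_1); easy].
  assert (He2 : 0 < eps / 2) by lra.
  destruct (proj1 (filterlim_locally _ _) (Hf s Hs) (mkposreal _ He2)) as [del Hdel].
  exists del; intros _ p s' Hp Hs'.
  have H1 := Hdel (p, s') (conj Hp Hs').
  have H2 := Hdel (p0, s') (conj (ball_center p0 del) Hs').
  simpl in H1, H2. unfold ball in H1, H2; simpl in H1, H2.
  unfold AbsRing_ball, abs, minus, plus, opp in H1, H2; simpl in H1, H2.
  replace (f p s' - f p0 s') with ((f p s' + - f p0 s) - (f p0 s' + - f p0 s)) by ring.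
  eapply Rle_lt_trans; [apply Rabs_triang|]. rewrite Rabs_Ropp. lra. }
 destruct (choice _ H) as [dl Hdl].
 destruct (compactness_value_1d c d dl) as [del Hdel].
 exists del. intros p Hp s Hs.
 destruct (NNPP _ (Hdel s Hs)) as [u [Hu [H1 H2]]].
 apply (Hdl u Hu p s); [|exact H1].
 now apply ball_le with del.
Qed.

Lemma continuous_slice {T : UniformSpace} (f : T -> R -> R) (p : T) (s : R) :
 continuous (fun q : T * R => f (fst q) (snd q)) (p, s) -> continuous (f p) s.
Proof.
 intros H. apply (continuous_comp (fun r => (p, r)) (fun q : T * R => f (fst q) (snd q)) s).
 - apply continuous_pair; [apply continuous_const | apply continuous_id].
 - exact H.
Qed.

Lemma RInt_param_continuous {T : UniformSpace} (f : T -> R -> R) (p0 : T) (c d : R) :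
 c <= d ->
 locally p0 (fun p => ex_RInt (f p) c d) ->
 (forall s, c <= s <= d -> continuous (fun q : T * R => f (fst q) (snd q)) (p0, s)) ->
 continuous (fun p => RInt (f p) c d) p0.
Proof.
 intros Hcd [dl Hdl] Hf.
 apply filterlim_locally; intros eps.
 set (M := d - c + 1).
 assert (HM : 0 < M) by (unfold M; lra).
 assert (He : 0 < eps / M) by (apply Rdiv_lt_0_compat; [apply cond_pos | lra]).
 destruct (tube f p0 c d Hf (eps / M) He) as [del Hdel].
 exists (mkposreal _ (Rmin_stable_in_posreal dl del)). simpl; intros p Hp.
 assert (E1 : ex_RInt (f p) c d) by (apply Hdl; eapply ball_le; [apply Rmin_l|exact Hp]).
 assert (E0 : ex_RInt (f p0) c d) by (apply Hdl, ball_center).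
 assert (Hp' : ball p0 del p) by (eapply ball_le; [apply Rmin_r|exact Hp]).
 unfold ball; simpl; unfold AbsRing_ball, abs, minus, plus, opp; simpl.
 replace (RInt (f p) c d + - RInt (f p0) c d) with (RInt (fun s => f p s - f p0 s) c d).
 2: { apply is_RInt_unique. apply (is_RInt_minus (f p) (f p0)); now apply (RInt_correct (V:=RC)). }
 eapply Rle_lt_trans.
 - apply (abs_RInt_le_const _ c d (eps / M)); [exact Hcd| |].
  + apply (ex_RInt_minus (f p) (f p0)); easy.
  + intros t Ht. left. now apply Hdel.
 - apply Rlt_le_trans with (M * (eps / M)).
  + apply Rmult_lt_compat_r; [lra | unfold M; lra].
  + right; field; lra.
Qed.

Lemma continuity_2d_of_continuous (f : R -> R -> R) (x y : R) :
 continuous (fun q : R * R => f (fst q) (snd q)) (x, y) -> continuity_2d_pt f x y.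
Proof.
 intros H eps.
 destruct (proj1 (filterlim_locally _ _) H eps) as [d Hd].
 exists d; intros u v Hu Hv. exact (Hd (u, v) (conj Hu Hv)).
Qed.

Lemma continuous_of_ex_derive (f : R -> R) x : ex_derive f x -> continuous f x.
Proof. apply (ex_derive_continuous (K:=RA) (V:=RN)). Qed.

Lemma ex_RInt_cont (f : R -> R) a b : (forall x, continuous f x) -> ex_RInt f a b.
Proof. intros H. apply (ex_RInt_continuous (V:=RC)). intros; apply H. Qed.

Lemma RInt_param_derive (f df : R -> R -> R) (u c d : R) (I : R -> Prop) :
 c <= d -> open I -> I u ->
 (forall v s, I v -> is_derive (fun r => f r s) v (df v s)) ->
 (forall v s, I v -> continuous (f v) s) ->
 (forall s, continuous (fun q : R * R => df (fst q) (snd q)) (u, s)) ->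
 is_derive (fun v => RInt (f v) c d) u (RInt (df u) c d).
Proof.
 intros Hcd HI Hu Hd Hc Hdc.
 destruct (HI u Hu) as [dl Hdl].
 replace (RInt (df u) c d) with (RInt (fun t => Derive (fun r => f r t) u) c d).
 2: { apply RInt_ext; intros s _. apply is_derive_unique, Hd, Hu. }
 apply is_derive_RInt_param.
 - exists dl; intros v Hv s _. eexists; apply Hd, Hdl, Hv.
 - intros s _. apply continuity_2d_of_continuous.
  refine (continuous_ext_loc _ _ _ _ (Hdc s)).
  exists dl; intros [v r] [Hv _]; simpl. symmetry; apply is_derive_unique, Hd, Hdl, Hv.
 - exists dl; intros v Hv. apply ex_RInt_cont; intros s; apply Hc, Hdl, Hv.
Qed.

Lemma RInt_primitive (f : R -> R) (a x : R) : (forall s, continuous f s) ->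
 is_derive (fun b => RInt f a b) x (f x).
Proof.
 intros H. apply (is_derive_RInt f (fun b => RInt f a b) a x); [|apply H].
 exists (mkposreal 1 Rlt_0_1); intros y _.
 apply (RInt_correct (V:=RC)), ex_RInt_cont, H.
Qed.

Lemma derive_zero_const (f : R -> R) (a b : R) : a <= b ->
 (forall x, a <= x <= b -> is_derive f x 0) -> f b = f a.
Proof.
 intros Hab H.
 destruct (MVT_gen f a b (fun _ => 0)) as [c [_ Hc]].
 - rewrite Rmin_left, Rmax_right by lra. intros x Hx; apply H; lra.
 - rewrite Rmin_left, Rmax_right by lra. intros x Hx.
  apply continuity_pt_filterlim. apply continuous_of_ex_derive. eexists; now apply H.
 - lra.
Qed.

(** As functions of the upper limit [r] of the [x]-integral, both iterated integrals have derivative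
    [RInt (f r) c d], and both vanish at [r = a]. *)
Lemma fubini (f : R -> R -> R) (a b c d : R) : a <= b -> c <= d ->
 (forall x y, continuous (fun q : R * R => f (fst q) (snd q)) (x, y)) ->
 RInt (fun x => RInt (fun y => f x y) c d) a b = RInt (fun y => RInt (fun x => f x y) a b) c d.
Proof.
 intros Hab Hcd Hf.
 assert (Hf1 : forall x y, continuous (f x) y) by (intros; now apply continuous_slice).
 assert (Hf2 : forall x y, continuous (fun x => f x y) x).
 { intros x y. apply (continuous_comp (fun r => (r, y)) (fun q : R * R => f (fst q) (snd q)) x).
  - apply continuous_pair; [apply continuous_id | apply continuous_const].
  - apply Hf. }
 assert (H1 : forall x, continuous (fun x => RInt (fun y => f x y) c d) x).
 { intros x. apply (RInt_param_continuous f); [easy| |easy].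
  exists (mkposreal 1 Rlt_0_1); intros; now apply ex_RInt_cont. }
 set (F := fun r => RInt (fun x => RInt (fun y => f x y) c d) a r
          - RInt (fun y => RInt (fun x => f x y) a r) c d).
 assert (HF : F b = F a).
 { apply derive_zero_const; [easy|]. intros r Hr. unfold F.
  replace 0 with (RInt (fun y => f r y) c d - RInt (fun y => f r y) c d) by ring.
  apply (is_derive_minus (K:=RA) (V:=RN)).
  - exact (RInt_primitive (fun x => RInt (fun y => f x y) c d) a r H1).
  - apply (RInt_param_derive (fun r y => RInt (fun x => f x y) a r) (fun r y => f r y)
    r c d (fun v => a - 1 < v)); [easy|apply open_gt|lra| | |easy].
   + intros v s _. apply (RInt_primitive (fun x => f x s)). intros; apply Hf2.
   + intros v s Hv.
    (* The derivative at [r = a] involves upper limits slightly below [a], hence both orientations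
       of the integral. *)
    destruct (Rle_dec a v) as [Hav|Hav].
    * apply (RInt_param_continuous (fun s x => f x s)); [easy| |].
     -- exists (mkposreal 1 Rlt_0_1); intros; apply ex_RInt_cont; intros; apply Hf2.
     -- intros x _. apply (continuous_comp_2 snd fst f (s, x));
       [apply continuous_snd | apply continuous_fst | apply Hf].
    * apply continuous_ext with (fun s => - RInt (fun x => f x s) v a).
     { intros s'. rewrite <- (opp_RInt_swap (V:=RC) (fun x => f x s') a v).
      - unfold opp; simpl; ring.
      - apply ex_RInt_cont; intros; apply Hf2. }
     apply (continuous_opp (K:=RA) (V:=RN)).
     apply (RInt_param_continuous (fun s x => f x s)); [lra| |].
     -- exists (mkposreal 1 Rlt_0_1); intros; apply ex_RInt_cont; intros; apply Hf2.
     -- intros x _. apply (continuous_comp_2 snd fst f (s, x));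
       [apply continuous_snd | apply continuous_fst | apply Hf]. }
 unfold F in HF. rewrite RInt_point in HF.
 assert (HG : RInt (fun y => RInt (fun x => f x y) a a) c d = 0).
 { rewrite (RInt_ext _ (fun _ => 0)).
  - rewrite RInt_const. unfold scal; simpl; unfold mult; simpl; ring.
  - intros; rewrite RInt_point; reflexivity. }
 rewrite HG in HF. unfold zero in HF; simpl in HF. lra.
Qed.

(** * Integrals over the torus *)

Definition slice (d : axis) (f : sfield) (x y z r : R) : R :=
 match d with AxX => f r y z | AxY => f x r z | AxZ => f x y r end.

Definition coord (d : axis) (x y z : R) : R :=
 match d with AxX => x | AxY => y | AxZ => z end.

(** The mean over one period stays a field of three variables, constant in the direction [d]: means
    along different axes can then be composed, swapped and multiplied. [I3] evaluates the triple
    mean at an arbitrary point. *)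
Definition Av (d : axis) (f : sfield) : sfield := fun x y z => RInt (slice d f x y z) 0 1.

Definition I3 (f : sfield) : R := Av AxX (Av AxY (Av AxZ f)) 0 0 0.

Lemma slice_coord d f x y z : slice d f x y z (coord d x y z) = f x y z.
Proof. now destruct d. Qed.

Lemma slice_continuous d f x y z r : c3 f -> continuous (slice d f x y z) r.
Proof.
 intros Hf; destruct d; simpl; apply (c3_comp f); try easy;
  first [apply continuous_id | apply continuous_const].
Qed.

Lemma slice_ex_RInt d f x y z a b : c3 f -> ex_RInt (slice d f x y z) a b.
Proof. intros Hf; apply ex_RInt_cont; intros; now apply slice_continuous. Qed.

Lemma c3_Av d f : c3 f -> c3 (Av d f).
Proof.
 intros Hf; apply c3_intro; intros x y z. unfold Av.
 apply (RInt_param_continuous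
  (fun (p : R * R * R) r => slice d f (fst (fst p)) (snd (fst p)) (snd p) r)); [lra| |].
 - exists (mkposreal 1 Rlt_0_1); intros; now apply slice_ex_RInt.
 - intros s _. destruct d; simpl; apply (c3_comp f); try easy; cproj.
Qed.

Lemma c3_plus f g : c3 f -> c3 g -> c3 (fun x y z => f x y z + g x y z).
Proof. intros Hf Hg t x y z. now apply (c4_plus (fun _ => f) (fun _ => g)). Qed.

Lemma c3_mult f g : c3 f -> c3 g -> c3 (fun x y z => f x y z * g x y z).
Proof. intros Hf Hg t x y z. now apply (c4_mult (fun _ => f) (fun _ => g)). Qed.

Lemma c3_const k : c3 (fun _ _ _ => k).
Proof. intros t x y z; apply c4_const. Qed.

Lemma c3_pow f n : c3 f -> c3 (fun x y z => f x y z ^ n).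
Proof.
 intros Hf; induction n; simpl; [apply c3_const|now apply c3_mult].
Qed.

Ltac c3t := repeat first [ assumption | match goal with |- c3 (Av _ _) => apply c3_Av
 | |- c3 (fun _ _ _ => ?k) => apply c3_const | |- c3 (fun x y z => _ ^ _) => apply c3_pow
 | |- c3 (fun x y z => _ + _) => apply c3_plus | |- c3 (fun x y z => _ * _) => apply c3_mult end ].

Lemma Av_swap d e f : c3 f -> Av d (Av e f) = Av e (Av d f).
Proof.
 intros Hf.
 ext3 x y z.
 assert (Hsw : forall g : R -> R -> R,
  (forall x y, continuous (fun q : R * R => g (fst q) (snd q)) (x, y)) ->
  RInt (fun x => RInt (fun y => g x y) 0 1) 0 1 = RInt (fun y => RInt (fun x => g x y) 0 1) 0 1)
  by (intros; apply fubini; try lra; easy).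
 destruct d, e; unfold Av; simpl; try reflexivity.
 - apply (Hsw (fun r s => f r s z)); intros; apply (c3_comp f); try easy; cproj.
 - apply (Hsw (fun r s => f r y s)); intros; apply (c3_comp f); try easy; cproj.
 - apply (Hsw (fun r s => f s r z)); intros; apply (c3_comp f); try easy; cproj.
 - apply (Hsw (fun r s => f x r s)); intros; apply (c3_comp f); try easy; cproj.
 - apply (Hsw (fun r s => f s y r)); intros; apply (c3_comp f); try easy; cproj.
 - apply (Hsw (fun r s => f x s r)); intros; apply (c3_comp f); try easy; cproj.
Qed.

Lemma Av_le d f g : c3 f -> c3 g -> (forall x y z, f x y z <= g x y z) ->
 forall x y z, Av d f x y z <= Av d g x y z.
Proof.
 intros Hf Hg H x y z; unfold Av.
 apply RInt_le; [lra|now apply slice_ex_RInt..|].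
 intros r _; destruct d; apply H.
Qed.

Lemma Av_plus d f g : c3 f -> c3 g ->
 Av d (fun x y z => f x y z + g x y z) = (fun x y z => Av d f x y z + Av d g x y z).
Proof.
 intros Hf Hg. ext3 x y z. unfold Av.
 rewrite <- (RInt_plus (V:=RC)) by now apply slice_ex_RInt.
 apply RInt_ext; intros; now destruct d.
Qed.

(** The condition on [slice] says that [g] does not depend on the coordinate [d]. *)
Lemma Av_mult_indep d f g : c3 f -> (forall x y z r, slice d g x y z r = g x y z) ->
 Av d (fun x y z => g x y z * f x y z) = (fun x y z => g x y z * Av d f x y z).
Proof.
 intros Hf Hg. ext3 x y z. unfold Av.
 rewrite <- (RInt_scal (V:=RC)) by now apply slice_ex_RInt.
 apply RInt_ext; intros r _. rewrite <- (Hg x y z r). now destruct d.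
Qed.

Lemma Av_scal d k f : c3 f -> Av d (fun x y z => k * f x y z) = (fun x y z => k * Av d f x y z).
Proof. intros Hf. apply (Av_mult_indep d f (fun _ _ _ => k) Hf). now destruct d. Qed.

Lemma Av_const d k : Av d (fun _ _ _ => k) = (fun _ _ _ => k).
Proof.
 ext3 x y z. unfold Av.
 rewrite (RInt_ext _ (fun _ => k)) by now destruct d.
 rewrite RInt_const. unfold scal; simpl; unfold mult; simpl; ring.
Qed.

Lemma Av_indep d f x y z r : slice d (Av d f) x y z r = Av d f x y z.
Proof. now destruct d. Qed.

Lemma Av_indep_other d e f : (forall x y z r, slice d f x y z r = f x y z) ->
 forall x y z r, slice d (Av e f) x y z r = Av e f x y z.
Proof.
 intros H x y z r. destruct d, e; unfold Av; simpl in *; try reflexivity;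
  apply RInt_ext; intros; apply H.
Qed.

Lemma I3_le f g : c3 f -> c3 g -> (forall x y z, f x y z <= g x y z) -> I3 f <= I3 g.
Proof. intros Hf Hg H. unfold I3. do 3 (apply Av_le; [c3t..|]; intros). apply H. Qed.

Lemma I3_plus f g : c3 f -> c3 g -> I3 (fun x y z => f x y z + g x y z) = I3 f + I3 g.
Proof.
 intros Hf Hg; unfold I3.
 rewrite (Av_plus AxZ), (Av_plus AxY), (Av_plus AxX); try easy; c3t.
Qed.

Lemma I3_scal k f : c3 f -> I3 (fun x y z => k * f x y z) = k * I3 f.
Proof.
 intros Hf; unfold I3.
 rewrite (Av_scal AxZ), (Av_scal AxY), (Av_scal AxX); try easy; c3t.
Qed.

Lemma I3_const k : I3 (fun _ _ _ => k) = k.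
Proof. unfold I3; now rewrite !Av_const. Qed.

Lemma I3_Av d f : c3 f -> I3 (Av d f) = I3 f.
Proof.
 intros Hf. unfold I3.
 assert (E : forall g, Av d (Av d g) = Av d g).
 { intros g. ext3 x y z. unfold Av at 1.
  rewrite (RInt_ext _ (fun _ => Av d g x y z)).
  - rewrite RInt_const. unfold scal; simpl; unfold mult; simpl; ring.
  - intros; apply Av_indep. }
 destruct d.
 - rewrite (Av_swap AxZ AxX f), (Av_swap AxY AxX); [now rewrite E|c3t|easy].
 - rewrite (Av_swap AxZ AxY f); [now rewrite E|easy].
 - now rewrite E.
Qed.

Lemma I3_nonneg f : c3 f -> (forall x y z, 0 <= f x y z) -> 0 <= I3 f.
Proof. intros Hf H. rewrite <- (I3_const 0). apply I3_le; try easy; apply c3_const. Qed.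

Lemma I3_ext f g : (forall x y z, f x y z = g x y z) -> I3 f = I3 g.
Proof.
 intros H. f_equal. ext3 x y z; apply H.
Qed.

(** * Oscillation on the circle and the L^4 inequality *)

Lemma RInt_periodic (f : R -> R) x : (forall s, continuous f s) -> (forall s, f (s + 1) = f s) ->
 RInt f x (x + 1) = RInt f 0 1.
Proof.
 intros Hf Hp.
 assert (E : forall a b, ex_RInt f a b) by (intros; now apply ex_RInt_cont).
 assert (H1 : RInt f 1 (x + 1) = RInt f 0 x).
 { have Q := RInt_comp_lin (V:=RC) f 1 1 0 x (E _ _).
  replace (1 * 0 + 1) with 1 in Q by ring. replace (1 * x + 1) with (x + 1) in Q by ring.
  rewrite <- Q. apply RInt_ext. intros s _. unfold scal; simpl; unfold mult; simpl.
  rewrite Rmult_1_l, Rmult_1_l. apply Hp. }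
 have H2 := RInt_Chasles f 0 x (x + 1) (E _ _) (E _ _).
 have H3 := RInt_Chasles f 0 1 (x + 1) (E _ _) (E _ _).
 unfold plus in H2, H3; simpl in H2, H3. lra.
Qed.

Lemma RInt_periodic_shift (f : R -> R) c : (forall s, continuous f s) ->
 (forall s, f (s + 1) = f s) -> RInt (fun x => f (x + c)) 0 1 = RInt f 0 1.
Proof.
 intros Hf Hp. rewrite <- (RInt_periodic f c) by easy.
 have Q := RInt_comp_lin (V:=RC) f 1 c 0 1 (ex_RInt_cont _ _ _ Hf).
 replace (1 * 0 + c) with c in Q by ring. replace (1 * 1 + c) with (c + 1) in Q by ring.
 rewrite <- Q. apply RInt_ext. intros s _. unfold scal; simpl; unfold mult; simpl. now rewrite !Rmult_1_l.
Qed.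

Lemma periodic_IZR (f : R -> R) n : (forall s, f (s + 1) = f s) -> forall s, f (s + IZR n) = f s.
Proof.
 intros H. induction n as [|n IH|n IH] using Z.peano_ind; intros s.
 - now rewrite Rplus_0_r.
 - rewrite succ_IZR, <- Rplus_assoc, H. apply IH.
 - rewrite <- (IH s), <- H. f_equal. unfold Z.pred. rewrite plus_IZR. ring.
Qed.

(** An integer translation brings [s] into [[x, x + 1]]; the variation between the two points is
    then at most the integral of [g] over that single period. *)
Lemma osc_1d (f df g : R -> R) (x s : R) :
 (forall s, is_derive f s (df s)) -> (forall s, continuous df s) -> (forall s, continuous g s) ->
 (forall s, f (s + 1) = f s) -> (forall s, g (s + 1) = g s) ->
 (forall s, Rabs (df s) <= g s) -> f x - f s <= RInt g 0 1.
Proof.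
 intros Hf Hdf Hg Pf Pg Hle. rewrite <- (RInt_periodic g x) by easy.
 set (n := Int_part (s - x)). destruct (base_Int_part (s - x)) as [N1 N2]. fold n in N1, N2.
 rewrite <- (periodic_IZR f (- n) Pf s), opp_IZR. set (r := s + - IZR n).
 assert (Hr : x <= r <= x + 1) by (unfold r; lra).
 assert (H1 : RInt df x r = f r - f x).
 { apply is_RInt_unique, (is_RInt_derive f df); intros; [apply Hf|apply Hdf]. }
 assert (H2 : Rabs (RInt df x r) <= RInt g x r).
 { apply (norm_RInt_le df g x r (RInt df x r) (RInt g x r)); [lra|intros; apply Hle| |];
   apply (RInt_correct (V:=RC)); now apply ex_RInt_cont. }
 rewrite <- (RInt_Chasles g x r (x + 1)) by now apply ex_RInt_cont. unfold plus; simpl.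
 assert (0 <= RInt g r (x + 1)).
 { apply RInt_ge_0; [lra|now apply ex_RInt_cont|]. intros; etr; [apply Rabs_pos|apply Hle]. }
 rewrite H1 in H2. apply Rabs_le_between in H2. lra.
Qed.

Definition C1p (f : sfield) : Prop :=
 c3 f /\ periodic f /\ (forall d, c3 (pd d f) /\ periodic (pd d f)) /\
 forall d x y z, ex_pd d f x y z.

Lemma periodic_slice d f x y z r : periodic f -> slice d f x y z (r + 1) = slice d f x y z r.
Proof. intros H; destruct d; simpl; apply H. Qed.

Lemma C1p_slice_derive d f x y z r : C1p f ->
 is_derive (slice d f x y z) r (slice d (pd d f) x y z r).
Proof.
 intros (_ & _ & _ & H). destruct d.
 - exact (Derive_correct _ _ (H AxX r y z)).
 - exact (Derive_correct _ _ (H AxY x r z)).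
 - exact (Derive_correct _ _ (H AxZ x y r)).
Qed.

Lemma osc_axis d f df g : c3 df -> c3 g -> periodic f -> periodic g ->
 (forall x y z r, is_derive (slice d f x y z) r (slice d df x y z r)) ->
 (forall x y z, Rabs (df x y z) <= g x y z) -> forall x y z r, f x y z - slice d f x y z r <= Av d g x y z.
Proof.
 intros Cd Cg Pf Pg Hd H x y z r. rewrite <- (slice_coord d f x y z) at 1.
 apply (osc_1d _ (slice d df x y z)); intros; try (now apply slice_continuous); try now apply periodic_slice.
 - apply Hd.
 - destruct d; apply H.
Qed.

(** Averaging the oscillation bound over the second point bounds the value of [f] by its mean plus
    the mean of [g], which dominates its derivative. *)
Lemma sup_axis d f df g : c3 f -> c3 df -> c3 g -> periodic f -> periodic g ->
 (forall x y z r, is_derive (slice d f x y z) r (slice d df x y z r)) ->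
 (forall x y z, Rabs (df x y z) <= g x y z) ->
 forall x y z, f x y z <= Av d (fun x y z => f x y z + g x y z) x y z.
Proof.
 intros Cf Cd Cg Pf Pg Hd H x y z. rewrite Av_plus by easy.
 assert (Q : RInt (fun _ => f x y z - Av d g x y z) 0 1 <= Av d f x y z).
 { apply RInt_le; [lra|apply ex_RInt_const|now apply slice_ex_RInt|]. intros r _.
  have E := osc_axis d f df g Cd Cg Pf Pg Hd H x y z r. lra. }
 rewrite RInt_const in Q. unfold scal in Q; simpl in Q; unfold mult in Q; simpl in Q. lra.
Qed.

(* A Young weight [l] is kept free so that it can be optimised at each height in [ladyzhenskaya]. *)
Lemma sup_axis_sq d f l : C1p f -> 0 < l -> forall x y z,
 f x y z ^ 2 <= Av d (fun x y z => (1 + l) * f x y z ^ 2 + / l * pd d f x y z ^ 2) x y z.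
Proof.
 intros Hf Hl x y z.
 have Hf' := Hf. destruct Hf' as (Cf & Pf & Hd & _). destruct (Hd d) as [Cd Pd].
 etr; [apply (sup_axis d (fun x y z => f x y z ^ 2) (fun x y z => 2 * f x y z * pd d f x y z)
  (fun x y z => l * f x y z ^ 2 + / l * pd d f x y z ^ 2))|].
 - c3t.
 - c3t.
 - c3t.
 - intros u v w. destruct (Pf u v w) as (-> & -> & ->). easy.
 - intros u v w. destruct (Pf u v w) as (-> & -> & ->), (Pd u v w) as (-> & -> & ->). easy.
 - intros u v w r. have Q := is_derive_pow _ 2 r _ (C1p_slice_derive d f u v w r Hf).
  replace (slice d (fun x y z => 2 * f x y z * pd d f x y z) u v w r)
   with (INR 2 * slice d (pd d f) u v w r * slice d f u v w r ^ pred 2) by (destruct d; simpl; ring).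
  destruct d; exact Q.
 - intros u v w. set (A := f u v w). set (b := pd d f u v w).
  assert (Hl' : 0 < / l) by now apply Rinv_0_lt_compat.
  assert (E : l * / l = 1) by (apply Rinv_r; lra).
  apply Rabs_le. set (m := / l) in *.
  assert (H0 : 0 <= m * (l * A - b) ^ 2) by (apply Rmult_le_pos; [lra|apply pow2_ge_0]).
  assert (H1 : 0 <= m * (l * A + b) ^ 2) by (apply Rmult_le_pos; [lra|apply pow2_ge_0]).
  replace (m * (l * A - b) ^ 2) with (l * m * (l * A ^ 2) - 2 * (l * m) * (A * b) + m * b ^ 2) in H0 by ring.
  replace (m * (l * A + b) ^ 2) with (l * m * (l * A ^ 2) + 2 * (l * m) * (A * b) + m * b ^ 2) in H1 by ring.
  rewrite E in H0, H1. lra.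
 - right. unfold Av. apply RInt_ext. intros r _. destruct d; simpl; ring.
Qed.

Definition H1sq (f : sfield) : R :=
 I3 (fun x y z => f x y z ^ 2) + I3 (fun x y z => pd AxX f x y z ^ 2)
 + I3 (fun x y z => pd AxY f x y z ^ 2) + I3 (fun x y z => pd AxZ f x y z ^ 2).

(** The choice [l = sqrt ((a + b) / a)] balances the two terms: [l^2 a = a + b] and [b / l <= l a].
    When [a = 0] a large [l] makes the right side smaller than [A] unless [A <= 0]. *)
Lemma young_opt (A a b : R) : 0 <= a -> 0 <= b -> 0 <= A ->
 (forall l, 0 < l -> A <= ((1 + l) * a + / l * b) ^ 2) -> A <= 9 * a * (a + b).
Proof.
 intros Ha Hb HA H.
 destruct (Rle_lt_or_eq_dec 0 a Ha) as [Ha'|<-].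
 - set (l := sqrt ((a + b) / a)).
  assert (Hq : 1 <= (a + b) / a) by (apply Rle_div_r; lra).
  assert (Hl : 1 <= l) by (unfold l; rewrite <- sqrt_1; now apply sqrt_le_1_alt).
  assert (Hl2 : l * l * a = a + b).
  { unfold l. rewrite sqrt_sqrt by lra. field; lra. }
  assert (Hb2 : / l * b <= l * a).
  { apply Rmult_le_reg_l with l; [lra|]. rewrite <- Rmult_assoc, Rinv_r by lra. lra. }
  assert (Hp : 0 <= / l * b) by (apply Rmult_le_pos; [left; apply Rinv_0_lt_compat; lra|easy]).
  etr; [apply (H l); lra|].
  apply Rle_trans with ((3 * (l * a)) ^ 2); [apply pow_incr; nra|].
  replace ((3 * (l * a)) ^ 2) with (9 * a * (l * l * a)) by ring. rewrite Hl2. lra.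
 - rewrite Rmult_0_r, Rmult_0_l.
  destruct (Rle_dec A 0) as [|HA']; [easy|exfalso].
  assert (HA0 : 0 < A) by lra.
  set (l := (1 + b) / sqrt A * 2).
  assert (Hs : 0 < sqrt A) by now apply sqrt_lt_R0.
  assert (Hl : 0 < l) by (unfold l; apply Rmult_lt_0_compat; [apply Rdiv_lt_0_compat; lra|lra]).
  specialize (H l Hl).
  assert (E : / l * b <= sqrt A / 2).
  { unfold l. replace (/ ((1 + b) / sqrt A * 2) * b) with (sqrt A / 2 * (b / (1 + b))) by (field; lra).
   rewrite <- (Rmult_1_r (sqrt A / 2)) at 2. apply Rmult_le_compat_l; [lra|].
   apply Rle_div_l; lra. }
  assert (Hp : 0 <= / l * b) by (apply Rmult_le_pos; [left; now apply Rinv_0_lt_compat|easy]).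
  assert (((1 + l) * 0 + / l * b) ^ 2 <= (sqrt A / 2) ^ 2) by (apply pow_incr; lra).
  assert (sqrt A * sqrt A = A) by (apply sqrt_sqrt; lra). nra.
Qed.

(** At fixed height, one factor [f^2] of [f^4] is bounded by a mean in [x] and the other by a mean
    in [y]. With [a] and [b] the plane integrals of [f^2] and of the squared horizontal gradient,
    optimising the Young weight gives [9 a (a + b)] at each height. The one-dimensional bound in [z]
    then controls [a] by [K], uniformly in the height, and what remains is integrated in [z]. *)
Lemma ladyzhenskaya f : C1p f -> I3 (fun x y z => f x y z ^ 4) <= 18 * H1sq f ^ 2.
Proof.
 intros Hf. have Hf' := Hf. destruct Hf' as (Cf & _ & Hd & _).
 have Cx := proj1 (Hd AxX). have Cy := proj1 (Hd AxY). have Cz := proj1 (Hd AxZ).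
 set (f2 := fun x y z => f x y z ^ 2). set (f4 := fun x y z => f x y z ^ 4).
 set (x2 := fun x y z => pd AxX f x y z ^ 2). set (y2 := fun x y z => pd AxY f x y z ^ 2).
 set (z2 := fun x y z => pd AxZ f x y z ^ 2).
 assert (C2 : c3 f2) by (unfold f2; c3t). assert (C4 : c3 f4) by (unfold f4; c3t).
 assert (Cx2 : c3 x2) by (unfold x2; c3t). assert (Cy2 : c3 y2) by (unfold y2; c3t). assert (Cz2 : c3 z2) by (unfold z2; c3t).
 assert (Sq : forall (g : sfield) x y z, 0 <= g x y z ^ 2) by (intros; apply pow2_ge_0).
 have P2 := Sq f : forall x y z, 0 <= f2 x y z. have Pz2 := Sq (pd AxZ f) : forall x y z, 0 <= z2 x y z.
 have Px2 := Sq (pd AxX f) : forall x y z, 0 <= x2 x y z. have Py2 := Sq (pd AxY f) : forall x y z, 0 <= y2 x y z.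
 assert (P4 : forall x y z, 0 <= f4 x y z).
 { intros; unfold f4. replace (f x y z ^ 4) with ((f x y z ^ 2) ^ 2) by ring. apply pow2_ge_0. }
 set (S := fun g => Av AxX (Av AxY g)).
 assert (CS : forall g, c3 g -> c3 (S g)) by (intros; unfold S; c3t).
 assert (SP : forall g h, c3 g -> c3 h -> S (fun x y z => g x y z + h x y z) = fun x y z => S g x y z + S h x y z).
 { intros g h Hg Hh. unfold S. rewrite (Av_plus AxY), (Av_plus AxX); try easy; c3t. }
 assert (SK : forall k g, c3 g -> S (fun x y z => k * g x y z) = fun x y z => k * S g x y z).
 { intros k g Hg. unfold S. rewrite (Av_scal AxY), (Av_scal AxX); try easy; c3t. }
 assert (SL : forall g h, c3 g -> c3 h -> (forall x y z, g x y z <= h x y z) -> forall x y z, S g x y z <= S h x y z).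
 { intros g h Hg Hh H. unfold S. apply Av_le; [c3t..|]. now apply Av_le. }
 assert (S0 : forall g, c3 g -> (forall x y z, 0 <= g x y z) -> forall x y z, 0 <= S g x y z).
 { intros g Hg H x y z. have E := SL (fun _ _ _ => 0) g (c3_const 0) Hg H x y z.
  unfold S in E at 1. rewrite !Av_const in E. exact E. }
 set (a := S f2). set (b := fun x y z => S x2 x y z + S y2 x y z).
 assert (Ca : c3 a) by now apply CS. assert (Cb : c3 b) by (apply c3_plus; now apply CS).
 assert (Ha0 : forall x y z, 0 <= a x y z) by now apply S0.
 assert (Hb0 : forall x y z, 0 <= b x y z).
 { intros x y z; unfold b. have H1 := S0 x2 Cx2 Px2 x y z. have H2 := S0 y2 Cy2 Py2 x y z. lra. }
 assert (Hopt : forall x y z, S f4 x y z <= 9 * a x y z * (a x y z + b x y z)).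
 { intros x y z. apply young_opt; [easy|easy|now apply S0|]. intros l Hl.
   assert (Hl' : 0 < / l) by now apply Rinv_0_lt_compat.
   set (p := fun x y z => (1 + l) * f2 x y z + / l * x2 x y z).
   set (r := fun x y z => (1 + l) * f2 x y z + / l * y2 x y z).
   assert (Cp : c3 p) by (unfold p; c3t). assert (Cr : c3 r) by (unfold r; c3t).
   assert (E1 : forall x y z, f4 x y z <= Av AxX p x y z * Av AxY r x y z).
   { intros x' y' z'. have H1 := sup_axis_sq AxX f l Hf Hl x' y' z'.
    have H2 := sup_axis_sq AxY f l Hf Hl x' y' z'.
    unfold f4. replace (f x' y' z' ^ 4) with (f x' y' z' ^ 2 * f x' y' z' ^ 2) by ring.
    apply Rmult_le_compat; try apply pow2_ge_0; easy. }
   assert (CP : c3 (fun x y z => Av AxX p x y z * Av AxY r x y z)) by c3t.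
   have E2 := SL f4 _ C4 CP E1 x y z.
   (* The first factor no longer depends on [x] and the second no longer on [y], so the plane
      integral of the product factorises. *)
   assert (E3 : S (fun x y z => Av AxX p x y z * Av AxY r x y z) x y z = S p x y z * S r x y z).
   { unfold S. rewrite (Av_swap AxX AxY p Cp).
    replace (fun x y z => Av AxX p x y z * Av AxY r x y z)
     with (fun x y z => Av AxY r x y z * Av AxX p x y z)
     by (ext3 u v s; ring).
    rewrite (Av_mult_indep AxY (Av AxX p) (Av AxY r)); [|c3t|intros; apply Av_indep].
    replace (fun x y z => Av AxY r x y z * Av AxY (Av AxX p) x y z)
     with (fun x y z => Av AxY (Av AxX p) x y z * Av AxY r x y z)
     by (ext3 u v s; ring).
    rewrite (Av_mult_indep AxX (Av AxY r) (Av AxY (Av AxX p))); [reflexivity|c3t|].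
    apply Av_indep_other. intros; apply Av_indep. }
   rewrite E3 in E2. etr; [exact E2|].
   unfold p, r. rewrite !SP, !SK; c3t.
   have H1 := S0 x2 Cx2 Px2 x y z. have H2 := S0 y2 Cy2 Py2 x y z.
   have H3 := S0 f2 C2 P2 x y z. unfold a, b. rewrite <- Rsqr_pow2; unfold Rsqr.
   assert (0 <= / l * S x2 x y z) by (apply Rmult_le_pos; lra).
   assert (0 <= / l * S y2 x y z) by (apply Rmult_le_pos; lra).
   assert (0 <= (1 + l) * S f2 x y z) by (apply Rmult_le_pos; lra).
   apply Rmult_le_compat; lra. }
 set (K := 2 * I3 f2 + I3 z2).
 assert (HK : forall x y z, a x y z <= K).
 { intros x y z.
  set (g := fun x y z => (1 + 1) * f2 x y z + / 1 * z2 x y z).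
  assert (Cg : c3 g) by (unfold g; c3t).
  have E := SL f2 (Av AxZ g) C2 (c3_Av AxZ g Cg) (sup_axis_sq AxZ f 1 Hf Rlt_0_1) x y z.
  etr; [exact E|]. unfold S. change (I3 g <= K). unfold g, K.
  rewrite I3_plus, !I3_scal, Rinv_1; c3t; lra. }
 assert (HI : forall g, c3 g -> I3 (S g) = I3 g).
 { intros g Hg. unfold S. rewrite !I3_Av; try easy. c3t. }
 rewrite <- (HI f4 C4).
 apply Rle_trans with (I3 (fun x y z => (9 * K) * (a x y z + b x y z))).
 - apply I3_le; [now apply CS|c3t|].
  intros x y z. etr; [apply Hopt|].
  apply Rmult_le_compat_r; [specialize (Ha0 x y z); specialize (Hb0 x y z); lra|].
  specialize (HK x y z); lra.
 - rewrite I3_scal by now apply c3_plus. rewrite I3_plus by easy. unfold b.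
  rewrite I3_plus by (now apply CS). unfold a. rewrite !HI by easy.
  unfold K, H1sq. fold f2 x2 y2 z2.
  assert (0 <= I3 f2) by now apply I3_nonneg. assert (0 <= I3 x2) by now apply I3_nonneg.
  assert (0 <= I3 y2) by now apply I3_nonneg. assert (0 <= I3 z2) by now apply I3_nonneg.
  nra.
Qed.

Lemma c4_AvT (I : R -> Prop) d (g : tfield) : open I ->
 (forall t x y z, I t -> c4 g t x y z) ->
 forall t x y z, I t -> c4 (fun t => Av d (g t)) t x y z.
Proof.
 intros HI Hg t x y z Ht. apply c4_intro. unfold Av.
 apply (RInt_param_continuous (fun (p : R * R * R * R) r =>
  slice d (g (fst (fst (fst p)))) (snd (fst (fst p))) (snd (fst p)) (snd p) r)); [lra| |].
 - destruct (HI t Ht) as [dl Hdl]. exists dl. intros [[[t' x'] y'] z'] [[[Hb _] _] _]; simpl.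
  apply slice_ex_RInt. intros u x0 y0 z0. apply c4_slice, Hg, Hdl, Hb.
 - intros s _. destruct d; simpl; apply (c4_comp g); try cproj; simpl; now apply Hg.
Qed.

Lemma AvT_derive (I : R -> Prop) d (g dg : tfield) : open I ->
 (forall t x y z, I t -> is_derive (fun s => g s x y z) t (dg t x y z)) ->
 (forall t x y z, I t -> c4 g t x y z) -> (forall t x y z, I t -> c4 dg t x y z) ->
 forall t x y z, I t -> is_derive (fun s => Av d (g s) x y z) t (Av d (dg t) x y z).
Proof.
 intros HI Hd Hg Hdg t x y z Ht. unfold Av.
 apply (RInt_param_derive (fun s r => slice d (g s) x y z r) (fun s r => slice d (dg s) x y z r)
  t 0 1 I); [lra|easy|easy| | |].
 - intros v s Hv. destruct d; simpl; now apply Hd.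
 - intros v s Hv. apply slice_continuous. intros u x0 y0 z0. now apply c4_slice, Hg.
 - intros s. destruct d; simpl; apply (c4_comp dg); try cproj; simpl; now apply Hdg.
Qed.

Lemma I3_derive (I : R -> Prop) (g dg : tfield) : open I ->
 (forall t x y z, I t -> is_derive (fun s => g s x y z) t (dg t x y z)) ->
 (forall t x y z, I t -> c4 g t x y z) -> (forall t x y z, I t -> c4 dg t x y z) ->
 forall t, I t -> is_derive (fun s => I3 (g s)) t (I3 (dg t)).
Proof.
 intros HI Hd Hg Hdg t Ht. unfold I3.
 have C1 := c4_AvT I AxZ g HI Hg. have D1 := c4_AvT I AxZ dg HI Hdg.
 have E1 := AvT_derive I AxZ g dg HI Hd Hg Hdg.
 have C2 := c4_AvT I AxY _ HI C1. have D2 := c4_AvT I AxY _ HI D1.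
 have E2 := AvT_derive I AxY _ _ HI E1 C1 D1.
 exact (AvT_derive I AxX _ _ HI E2 C2 D2 t 0 0 0 Ht).
Qed.

Lemma I3_continuous (I : R -> Prop) (g : tfield) : open I ->
 (forall t x y z, I t -> c4 g t x y z) ->
 forall t, I t -> continuous (fun s => I3 (g s)) t.
Proof.
 intros HI Hg t Ht. unfold I3.
 have C3 := c4_AvT I AxX _ HI (c4_AvT I AxY _ HI (c4_AvT I AxZ g HI Hg)) t 0 0 0 Ht.
 apply (c4_comp (fun t0 : R => Av AxX (Av AxY (Av AxZ (g t0)))) (fun s => s) (fun _ => 0) (fun _ => 0) (fun _ => 0)); try easy;
 try apply continuous_const; apply continuous_id.
Qed.

Lemma quad_discr (a b c : R) : 0 <= a -> 0 <= c ->
 (forall l, 0 <= a * l ^ 2 + 2 * b * l + c) -> b ^ 2 <= a * c.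
Proof.
 intros Ha Hc H.
 destruct (Rle_lt_or_eq_dec 0 a Ha) as [Ha'|<-].
 - specialize (H (- b / a)).
  replace (a * (- b / a) ^ 2 + 2 * b * (- b / a) + c) with ((a * c - b ^ 2) / a) in H by (field; lra).
  assert (0 <= (a * c - b ^ 2) / a * a) by (apply Rmult_le_pos; lra).
  replace ((a * c - b ^ 2) / a * a) with (a * c - b ^ 2) in H0 by (field; lra). lra.
 - assert (b = 0); [|subst; lra].
  have H1 := H ((- c - 1) * b). assert (0 <= c) by easy.
  destruct (Req_dec b 0); [easy|exfalso].
  assert (0 < b ^ 2) by (apply pow2_gt_0; easy).
  specialize (H (- (c + 1) / (2 * b))).
  replace (0 * (- (c + 1) / (2 * b)) ^ 2 + 2 * b * (- (c + 1) / (2 * b)) + c) with (-1) in H by (field; lra).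
  lra.
Qed.

Lemma I3_cauchy_schwarz f g : c3 f -> c3 g ->
 I3 (fun x y z => f x y z * g x y z) ^ 2
 <= I3 (fun x y z => f x y z ^ 2) * I3 (fun x y z => g x y z ^ 2).
Proof.
 intros Hf Hg. apply quad_discr; [apply I3_nonneg; [c3t|intros; apply pow2_ge_0]..|]. intros l.
 rewrite <- (I3_scal 2) by c3t. rewrite (Rmult_comm (I3 _) (l ^ 2)), (Rmult_comm (I3 _) l), <- !I3_scal, <- !I3_plus by c3t.
 apply I3_nonneg; [c3t|]. intros x y z. have Q := pow2_ge_0 (l * f x y z + g x y z). lra.
Qed.

Lemma MVT_Rabs_le (f df : R -> R) (a b K : R) :
 (forall x, Rmin a b < x < Rmax a b -> is_derive f x (df x)) ->
 (forall x, Rmin a b <= x <= Rmax a b -> continuous f x) ->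
 (forall x, Rmin a b < x < Rmax a b -> Rabs (df x) <= K) ->
 Rabs (f b - f a) <= K * Rabs (b - a).
Proof.
 intros Hd Hc HK.
 destruct (Req_dec a b) as [<-|Hab].
 { replace (f a - f a) with 0 by ring. replace (a - a) with 0 by ring. rewrite Rabs_R0; lra. }
 assert (W : forall a b, a < b -> (forall x, a < x < b -> is_derive f x (df x)) ->
  (forall x, a <= x <= b -> continuous f x) -> (forall x, a < x < b -> Rabs (df x) <= K) ->
  Rabs (f b - f a) <= K * (b - a)).
 { clear. intros a b Hab Hd Hc HK.
  destruct (MVT f (fun x => x) a b
   (fun c Hc => exist _ (df c) (proj1 (is_derive_Reals f c (df c)) (Hd c Hc)))
   (fun c _ => derivable_pt_id c) Hab) as [c [Hcc Hm]].
  - intros c Hc0; apply continuity_pt_filterlim, Hc; exact Hc0.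
  - intros c Hc0; apply derivable_continuous_pt, derivable_pt_id.
  - rewrite derive_pt_id in Hm; unfold derive_pt in Hm; simpl in Hm.
   replace (f b - f a) with ((b - a) * df c) by lra.
   rewrite Rabs_mult, (Rabs_right (b - a)) by lra.
   specialize (HK c Hcc); nra. }
 destruct (Rlt_or_le a b).
 - rewrite Rmin_left, Rmax_right in * by lra. rewrite (Rabs_right (b - a)) by lra. now apply W.
 - rewrite Rmin_right, Rmax_left in * by lra. rewrite <- Rabs_Ropp, (Rabs_left (b - a)) by lra.
  replace (- (f b - f a)) with (f a - f b) by ring. replace (- (b - a)) with (a - b) by ring.
  apply W; try easy; lra.
Qed.

Lemma periodic_Av d f : periodic f -> periodic (Av d f).
Proof.
 intros H x y z; unfold Av; repeat split; apply RInt_ext; intros r _; destruct d; simpl; try reflexivity; apply H.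
Qed.

Lemma Av_abs_le d f g : c3 f -> c3 g -> (forall x y z, Rabs (f x y z) <= g x y z) ->
 forall x y z, Rabs (Av d f x y z) <= Av d g x y z.
Proof.
 intros Hf Hg H x y z. apply (norm_RInt_le (slice d f x y z) (slice d g x y z) 0 1); [lra|intros; destruct d; apply H|..];
  apply (RInt_correct (V:=RC)); now apply slice_ex_RInt.
Qed.

Lemma I3_abs_le f g : c3 f -> c3 g -> (forall x y z, Rabs (f x y z) <= g x y z) -> Rabs (I3 f) <= I3 g.
Proof. intros Hf Hg H. unfold I3. do 3 (apply Av_abs_le; [c3t..|]; intros). apply H. Qed.

Lemma Av_Z_derive d f : d <> AxZ -> C1p f ->
 forall x y z r, is_derive (slice d (Av AxZ f) x y z) r (slice d (Av AxZ (pd d f)) x y z r).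
Proof.
 intros Hd Hf x y z r. have Hd' := proj1 (proj1 (proj2 (proj2 Hf)) d). destruct d; [| |easy].
 - apply (RInt_param_derive (fun r s => f r y s) (fun r s => pd AxX f r y s) r 0 1 (fun _ => True)); [lra|apply open_true|easy|..].
  + intros v s _. exact (C1p_slice_derive AxX f v y s v Hf).
  + intros v s _. now apply (slice_continuous AxZ f v y 0), Hf.
  + intros s. apply (c3_comp (pd AxX f)); [easy|cproj|apply continuous_const|cproj].
 - apply (RInt_param_derive (fun r s => f x r s) (fun r s => pd AxY f x r s) r 0 1 (fun _ => True)); [lra|apply open_true|easy|..].
  + intros v s _. exact (C1p_slice_derive AxY f x v s v Hf).
  + intros v s _. now apply (slice_continuous AxZ f x v 0), Hf.
  + intros s. apply (c3_comp (pd AxY f)); [easy|apply continuous_const|cproj|cproj].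
Qed.

(* The mixed derivative enters only through its vertical mean, so [w] may be obtained from it by
 integrating by parts in [z]. *)
Lemma sup_plane h w k1 k2 k : C1p h -> C1p (pd AxX h) -> c3 w -> c3 k1 -> c3 k2 -> c3 k ->
 periodic k1 -> periodic k2 -> periodic k -> Av AxZ (pd AxY (pd AxX h)) = Av AxZ w ->
 (forall x y z, Rabs (pd AxX h x y z) <= k1 x y z) -> (forall x y z, Rabs (pd AxY h x y z) <= k2 x y z) ->
 (forall x y z, Rabs (w x y z) <= k x y z) ->
 forall x y z, Av AxZ h x y z <= I3 h + I3 k1 + I3 k2 + I3 k.
Proof.
 intros Hh Hx Cw C1 C2 C Q1 Q2 Q E B1 B2 B x y z.
 have Ch := proj1 Hh. have Ph := proj1 (proj2 Hh). have Cx := proj1 Hx. have Px := proj1 (proj2 Hx).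
 have Cy := proj1 (proj1 (proj2 (proj2 Hh)) AxY).
 assert (Oy : forall x y z r, Rabs (Av AxZ (pd AxX h) x y z - Av AxZ (pd AxX h) x r z) <= Av AxY (Av AxZ k) x y z).
 { intros u v s r.
  assert (O : forall v r, Av AxZ (pd AxX h) u v s - Av AxZ (pd AxX h) u r s <= Av AxY (Av AxZ k) u v s).
  { intros v' r'. apply (osc_axis AxY (Av AxZ (pd AxX h)) (Av AxZ w) (Av AxZ k)); [c3t|c3t|now apply periodic_Av|now apply periodic_Av| |now apply Av_abs_le].
   rewrite <- E. now apply Av_Z_derive. }
  apply Rabs_le. have O1 := O v r. have O2 := O r v. change (Av AxY (Av AxZ k) u r s) with (Av AxY (Av AxZ k) u v s) in O2. lra. }
 have Dx := Av_Z_derive AxX h ltac:(easy) Hh.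
 (* The value at [(x, y)] is the value at [(x', y')] plus one increment in [x], one in [y] and a
    mixed second difference; only the last one meets the mixed derivative. The bound is then
    averaged over [(x', y', z')]. *)
 assert (R0 : forall x' y' z', Av AxZ h x y z
  <= Av AxZ h x' y' z' + Av AxX (Av AxZ k1) x' y' z' + Av AxY (Av AxZ k2) x' y' z' + I3 k).
 { intros x' y' z'.
  assert (O1 : Av AxZ h x y' z' - Av AxZ h x' y' z' <= Av AxX (Av AxZ k1) x y' z').
  { apply (osc_axis AxX (Av AxZ h) (Av AxZ (pd AxX h)) (Av AxZ k1)) with (r := x'); [c3t|c3t|now apply periodic_Av|now apply periodic_Av|easy|now apply Av_abs_le]. }
  assert (O2 : Av AxZ h x' y z' - Av AxZ h x' y' z' <= Av AxY (Av AxZ k2) x' y z').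
  { apply (osc_axis AxY (Av AxZ h) (Av AxZ (pd AxY h)) (Av AxZ k2)) with (r := y'); [c3t|c3t|now apply periodic_Av|now apply periodic_Av|now apply Av_Z_derive|now apply Av_abs_le]. }
  assert (O3 : (Av AxZ h x y z' - Av AxZ h x y' z') - (Av AxZ h x' y z' - Av AxZ h x' y' z') <= I3 k).
  { apply (osc_1d (fun r => Av AxZ h r y z' - Av AxZ h r y' z') (fun r => Av AxZ (pd AxX h) r y z' - Av AxZ (pd AxX h) r y' z')
    (slice AxX (Av AxY (Av AxZ k)) x y z')).
   - intros r. apply (is_derive_minus (K:=RA) (V:=RN)); [apply (Dx x y z')|apply (Dx x y' z')].
   - intros r. apply (continuous_minus (V:=RN)); [apply (slice_continuous AxX _ x y z')|apply (slice_continuous AxX _ x y' z')]; c3t.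
   - intros r. apply slice_continuous; c3t.
   - intros r. destruct (periodic_Av AxZ h Ph r y z') as (-> & _), (periodic_Av AxZ h Ph r y' z') as (-> & _). easy.
   - intros r. apply periodic_slice. now apply periodic_Av, periodic_Av.
   - intros r. apply Oy. }
  change (Av AxZ h x y z) with (Av AxZ h x y z'). change (Av AxX (Av AxZ k1) x' y' z') with (Av AxX (Av AxZ k1) x y' z').
  change (Av AxY (Av AxZ k2) x' y' z') with (Av AxY (Av AxZ k2) x' y z'). lra. }
 rewrite <- (I3_const (Av AxZ h x y z)).
 etr; [refine (I3_le _ _ (c3_const _) _ R0); c3t|].
 rewrite !I3_plus, !I3_Av, I3_const; c3t; lra.
Qed.

(** * Smooth periodic fields *)

Definition tslice (d : option axis) (f : tfield) (t x y z r : R) : R :=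
 match d with None => f r x y z | Some a => slice a (f t) x y z r end.

Definition tcoord (d : option axis) (t x y z : R) : R :=
 match d with None => t | Some a => coord a x y z end.

Definition is_pdt (d : option axis) (f : tfield) (t x y z l : R) : Prop :=
 is_derive (tslice d f t x y z) (tcoord d t x y z) l.

Lemma ex_pdt_is d f t x y z : ex_pdt d f t x y z -> is_pdt d f t x y z (pdt d f t x y z).
Proof. intros H; destruct d as [[]|]; exact (Derive_correct _ _ H). Qed.

Lemma is_pdt_ex d f t x y z l : is_pdt d f t x y z l -> ex_pdt d f t x y z.
Proof. intros H; destruct d as [[]|]; exists l; exact H. Qed.

Lemma is_pdt_unique d f t x y z l : is_pdt d f t x y z l -> pdt d f t x y z = l.
Proof. intros H; destruct d as [[]|]; exact (is_derive_unique _ _ _ H). Qed.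

Lemma tslice_coord d f t x y z : tslice d f t x y z (tcoord d t x y z) = f t x y z.
Proof. destruct d as [[]|]; reflexivity. Qed.

Lemma is_pdt_ext (I : R -> Prop) d f g t x y z l : open I -> I t ->
 (forall t x y z, I t -> f t x y z = g t x y z) ->
 is_pdt d f t x y z l -> is_pdt d g t x y z l.
Proof.
 intros HI Ht E H. destruct (HI t Ht) as [dl Hdl].
 unfold is_pdt in *. refine (is_derive_ext_loc _ _ _ _ _ H).
 exists dl. intros r Hr. destruct d as [[]|]; simpl in *; apply E; auto.
Qed.

Lemma is_pdt_plus d f g t x y z l m : is_pdt d f t x y z l -> is_pdt d g t x y z m ->
 is_pdt d (fun t x y z => f t x y z + g t x y z) t x y z (l + m).
Proof.
 intros Hf Hg. unfold is_pdt in *.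
 apply (is_derive_ext (fun r => plus (tslice d f t x y z r) (tslice d g t x y z r)));
  [intros; destruct d as [[]|]; reflexivity|].
 exact (is_derive_plus (K:=RA) (V:=RN) _ _ _ _ _ Hf Hg).
Qed.

Lemma is_pdt_mult d f g t x y z l m : is_pdt d f t x y z l -> is_pdt d g t x y z m ->
 is_pdt d (fun t x y z => f t x y z * g t x y z) t x y z (l * g t x y z + f t x y z * m).
Proof.
 intros Hf Hg. unfold is_pdt in *.
 apply (is_derive_ext (fun r => mult (tslice d f t x y z r) (tslice d g t x y z r)));
  [intros; destruct d as [[]|]; reflexivity|].
 have H := is_derive_mult (K:=RA) _ _ _ _ _ Hf Hg Rmult_comm.
 rewrite !tslice_coord in H. exact H.
Qed.

Lemma is_pdt_inv d f t x y z l : is_pdt d f t x y z l -> f t x y z <> 0 ->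
 is_pdt d (fun t x y z => / f t x y z) t x y z (- l * (/ f t x y z * / f t x y z)).
Proof.
 intros Hf H0. unfold is_pdt in *.
 apply (is_derive_ext (fun r => / (tslice d f t x y z r)));
  [intros; destruct d as [[]|]; reflexivity|].
 have H := is_derive_inv (tslice d f t x y z) (tcoord d t x y z) l Hf.
 rewrite tslice_coord in H. specialize (H H0).
 replace (- l * (/ f t x y z * / f t x y z)) with (- l / f t x y z ^ 2) by (field; easy). exact H.
Qed.

Lemma is_pdt_const d k t x y z : is_pdt d (fun _ _ _ _ => k) t x y z 0.
Proof.
 unfold is_pdt. apply (is_derive_ext (fun _ => k)); [intros; destruct d as [[]|]; reflexivity|].
 apply (is_derive_const (K:=RA) (V:=RN)).
Qed.

(** Smoothness by recursion on the order, the form suited to induction: the derivatives of a sum,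
    product or inverse are expressions of the same kind in fields of one order less. [smooth_on_Sm]
    links it to the list form of the definitions. *)
Fixpoint Cn (n : nat) (I : R -> Prop) (f : tfield) : Prop :=
 (forall t x y z, I t -> c4 f t x y z) /\
 match n with
 | O => True
 | S m => forall d, (forall t x y z, I t -> ex_pdt d f t x y z) /\ Cn m I (pdt d f)
 end.

Definition Sm (I : R -> Prop) (f : tfield) : Prop := forall n, Cn n I f.

Lemma Cn_c4 n I f : Cn n I f -> forall t x y z, I t -> c4 f t x y z.
Proof. destruct n; intros [H _]; exact H. Qed.

Lemma Cn_ex n I f d : Cn (S n) I f -> forall t x y z, I t -> ex_pdt d f t x y z.
Proof. intros [_ H]; exact (proj1 (H d)). Qed.

Lemma Cn_pdt n I f d : Cn (S n) I f -> Cn n I (pdt d f).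
Proof. intros [_ H]; exact (proj2 (H d)). Qed.

Lemma Cn_S n I f : Cn (S n) I f -> Cn n I f.
Proof.
 revert f; induction n; intros f [H1 H2]; split; try easy.
 intros d. split; [exact (proj1 (H2 d))|apply IHn; exact (proj2 (H2 d))].
Qed.

Lemma Sm_pdt I f d : Sm I f -> Sm I (pdt d f).
Proof. intros H n. exact (Cn_pdt n I f d (H (S n))). Qed.

Lemma Sm_c4 I f : Sm I f -> forall t x y z, I t -> c4 f t x y z.
Proof. intros H. exact (Cn_c4 0 I f (H 0%nat)). Qed.

Lemma Sm_ex I f d : Sm I f -> forall t x y z, I t -> ex_pdt d f t x y z.
Proof. intros H. exact (Cn_ex 0 I f d (H 1%nat)). Qed.

Lemma Sm_is I f d : Sm I f -> forall t x y z, I t -> is_pdt d f t x y z (pdt d f t x y z).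
Proof. intros H t x y z Ht. apply ex_pdt_is. now apply (Sm_ex I). Qed.

Lemma Sm_fold I f l : Sm I f -> Sm I (fold_right pdt f l).
Proof. intros H; induction l as [|d l IH]; simpl; [easy|now apply Sm_pdt]. Qed.

Lemma smooth_on_pdt I f d : smooth_on I f -> smooth_on I (pdt d f).
Proof.
 intros H l t x y z Ht.
 specialize (H (l ++ d :: nil)%list t x y z Ht).
 rewrite fold_right_app in H. exact H.
Qed.

Lemma smooth_on_Sm I f : smooth_on I f <-> Sm I f.
Proof.
 split.
 - intros H n; revert f H; induction n; intros f H; split; try easy.
  + intros t x y z Ht. apply (H nil t x y z Ht).
  + intros t x y z Ht. apply (H nil t x y z Ht).
  + intros d; split; [intros t x y z Ht; apply (H nil t x y z Ht)|].
   now apply IHn, smooth_on_pdt.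
 - intros H l t x y z Ht. have H' := Sm_fold I f l H. split.
  + intros d. now apply (Sm_ex I).
  + now apply (Sm_c4 I).
Qed.

Lemma pdt_ext (I : R -> Prop) d f g : open I ->
 (forall t x y z, I t -> f t x y z = g t x y z) ->
 forall t x y z, I t -> pdt d f t x y z = pdt d g t x y z.
Proof.
 intros HI E t x y z Ht. destruct (HI t Ht) as [dl Hdl].
 destruct d as [[]|]; simpl.
 1-3: apply Derive_ext; intros; now apply E.
 apply Derive_ext_loc. exists dl. intros s Hs. apply E, Hdl, Hs.
Qed.

Lemma Cn_ext n I f g : open I -> (forall t x y z, I t -> f t x y z = g t x y z) ->
 Cn n I f -> Cn n I g.
Proof.
 intros HI. revert f g; induction n; intros f g E [H1 H2].
 - split; [|easy]. intros t x y z Ht. now apply (c4_ext_loc f g I); auto.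
 - split; [intros t x y z Ht; now apply (c4_ext_loc f g I); auto|].
  intros d. destruct (H2 d) as [H3 H4]. split.
  + intros t x y z Ht. eapply is_pdt_ex, is_pdt_ext; [exact HI|exact Ht|exact E|].
   apply ex_pdt_is, H3, Ht.
  + eapply IHn; [|exact H4]. intros; now apply (pdt_ext I).
Qed.

Lemma Sm_ext I f g : open I -> (forall t x y z, I t -> f t x y z = g t x y z) -> Sm I f -> Sm I g.
Proof. intros HI E H n. now apply (Cn_ext n I f g). Qed.

(** Introduction rule used throughout: it is enough to exhibit the first derivatives in closed form
    and to know that they are of class [n]. *)
Lemma Cn_step n I f (df : option axis -> tfield) : open I ->
 (forall t x y z, I t -> c4 f t x y z) ->
 (forall d t x y z, I t -> is_pdt d f t x y z (df d t x y z)) ->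
 (forall d, Cn n I (df d)) -> Cn (S n) I f.
Proof.
 intros HI Hc Hd Hn. split; [exact Hc|]. intros d. split.
 - intros t x y z Ht. eapply is_pdt_ex, Hd, Ht.
 - apply (Cn_ext n I (df d)); [easy| |apply Hn].
  intros t x y z Ht. symmetry. now apply is_pdt_unique, Hd.
Qed.

Lemma Cn_plus n I f g : open I -> Cn n I f -> Cn n I g ->
 Cn n I (fun t x y z => f t x y z + g t x y z).
Proof.
 intros HI. revert f g; induction n; intros f g Hf Hg.
 - split; [|easy]. intros; apply c4_plus; now apply (Cn_c4 0 I).
 - apply (Cn_step n I _ (fun d t x y z => pdt d f t x y z + pdt d g t x y z)); [easy| | |].
  + intros; apply c4_plus; now apply (Cn_c4 (S n) I).
  + intros d t x y z Ht. apply is_pdt_plus; apply ex_pdt_is; now apply (Cn_ex n I).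
  + intros d. apply IHn; now apply Cn_pdt.
Qed.

Lemma Cn_mult n I f g : open I -> Cn n I f -> Cn n I g ->
 Cn n I (fun t x y z => f t x y z * g t x y z).
Proof.
 intros HI. revert f g; induction n; intros f g Hf Hg.
 - split; [|easy]. intros; apply c4_mult; now apply (Cn_c4 0 I).
 - apply (Cn_step n I _ (fun d t x y z => pdt d f t x y z * g t x y z + f t x y z * pdt d g t x y z)); [easy| | |].
  + intros; apply c4_mult; now apply (Cn_c4 (S n) I).
  + intros d t x y z Ht. apply is_pdt_mult; apply ex_pdt_is; now apply (Cn_ex n I).
  + intros d. apply Cn_plus; [easy| |]; apply IHn; try (now apply Cn_pdt); now apply Cn_S.
Qed.

Lemma Cn_const n I k : open I -> Cn n I (fun _ _ _ _ => k).
Proof.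
 intros HI. revert k; induction n; intros k.
 - split; [|easy]. intros; apply c4_const.
 - apply (Cn_step n I _ (fun _ _ _ _ _ => 0)); [easy| | |].
  + intros; apply c4_const.
  + intros; apply is_pdt_const.
  + intros; apply IHn.
Qed.

Lemma Cn_opp n I f : open I -> Cn n I f -> Cn n I (fun t x y z => - f t x y z).
Proof.
 intros HI Hf. apply (Cn_ext n I (fun t x y z => (-1) * f t x y z)); [easy|intros; ring|].
 apply Cn_mult; [easy|now apply Cn_const|easy].
Qed.

Lemma Cn_inv n I f : open I -> (forall t x y z, I t -> f t x y z <> 0) -> Cn n I f ->
 Cn n I (fun t x y z => / f t x y z).
Proof.
 intros HI H0 Hf. induction n.
 - split; [|easy]. intros; apply c4_inv; [now apply (Cn_c4 0 I)|now apply H0].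
 - apply (Cn_step n I _ (fun d t x y z => - pdt d f t x y z * (/ f t x y z * / f t x y z))); [easy| | |].
  + intros; apply c4_inv; [now apply (Cn_c4 (S n) I)|now apply H0].
  + intros d t x y z Ht. apply is_pdt_inv; [|now apply H0]. apply ex_pdt_is; now apply (Cn_ex n I).
  + have IH := IHn (Cn_S n I f Hf).
   intros d. apply Cn_mult; [easy|apply Cn_opp; [easy|now apply Cn_pdt]|now apply Cn_mult].
Qed.

Lemma Sm_plus I f g : open I -> Sm I f -> Sm I g -> Sm I (fun t x y z => f t x y z + g t x y z).
Proof. intros HI Hf Hg n; now apply Cn_plus. Qed.
Lemma Sm_mult I f g : open I -> Sm I f -> Sm I g -> Sm I (fun t x y z => f t x y z * g t x y z).
Proof. intros HI Hf Hg n; now apply Cn_mult. Qed.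
Lemma Sm_const I k : open I -> Sm I (fun _ _ _ _ => k).
Proof. intros HI n; now apply Cn_const. Qed.
Lemma Sm_inv I f : open I -> (forall t x y z, I t -> f t x y z <> 0) -> Sm I f ->
 Sm I (fun t x y z => / f t x y z).
Proof. intros HI H0 Hf n; now apply Cn_inv. Qed.

Definition smooth1 (g : R -> R) : Prop := forall n z, ex_derive_n g n z.

Lemma smooth1_Derive g : smooth1 g -> smooth1 (Derive g).
Proof.
 intros H n z. destruct n as [|n]; [easy|].
 apply (ex_derive_ext (Derive_n g (S n))).
 - intros s. replace (S n) with (n + 1)%nat by lia. symmetry. exact (Derive_n_comp g n 1 s).
 - exact (H (S (S n)) z).
Qed.

Lemma c4_zfun g t x y z : continuous g z -> c4 (fun _ _ _ z => g z) t x y z.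
Proof.
 intros H. apply c4_intro. apply (continuous_comp (fun p : R*R*R*R => snd p) g); [cproj|exact H].
Qed.

Lemma smooth1_continuous g z : smooth1 g -> continuous g z.
Proof. intros H. apply continuous_of_ex_derive. exact (H 1%nat z). Qed.

Lemma Sm_zfun I g : open I -> smooth1 g -> Sm I (fun _ _ _ z => g z).
Proof.
 intros HI Hg n. revert g Hg; induction n; intros g Hg.
 - split; [|easy]. intros; apply c4_zfun; now apply smooth1_continuous.
 - apply (Cn_step n I _ (fun d _ _ _ z => match d with Some AxZ => Derive g z | _ => 0 end)); [easy| | |].
  + intros; apply c4_zfun; now apply smooth1_continuous.
  + intros d t x y z Ht. destruct d as [[]|]; unfold is_pdt; simpl;
    try apply (is_derive_const (K:=RA) (V:=RN)).
   apply Derive_correct. exact (Hg 1%nat z).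
  + intros d. destruct d as [[]|]; try (now apply Cn_const). now apply (IHn (Derive g)), smooth1_Derive.
Qed.

Definition tshift (a : axis) (s : R) (f : tfield) : tfield := fun t x y z =>
 match a with AxX => f t (x + s) y z | AxY => f t x (y + s) z | AxZ => f t x y (z + s) end.

Lemma is_derive_shift (f : R -> R) s x l : is_derive f (x + s) l -> is_derive (fun r => f (r + s)) x l.
Proof.
 intros H. replace l with (scal 1 l) by (unfold scal; simpl; unfold mult; simpl; ring).
 apply (is_derive_comp f (fun r => r + s)); [exact H|auto_derive; [easy|ring]].
Qed.

Lemma c4_tshift a s f t x y z :
 (forall x y z, c4 f t x y z) -> c4 (tshift a s f) t x y z.
Proof.
 intros H. apply c4_intro.
 assert (A : forall (X : R*R*R*R -> R) p, continuous X p -> continuous (fun q => X q + s) p).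
 { intros X p HX. apply (continuous_plus (V:=RN)); [exact HX|apply continuous_const]. }
 destruct a; simpl.
 - apply (c4_comp f); [cproj|apply A; cproj|cproj|cproj|apply H].
 - apply (c4_comp f); [cproj|cproj|apply A; cproj|cproj|apply H].
 - apply (c4_comp f); [cproj|cproj|cproj|apply A; cproj|apply H].
Qed.

Lemma is_pdt_tshift a s d f I t x y z : Sm I f -> I t ->
 is_pdt d (tshift a s f) t x y z (tshift a s (pdt d f) t x y z).
Proof.
 intros Hf Ht. unfold is_pdt.
 assert (H : forall x y z, is_pdt d f t x y z (pdt d f t x y z)) by (intros; now apply (Sm_is I)).
 destruct a, d as [[]|]; simpl;
  first [ exact (H (x + s) y z) | exact (H x (y + s) z) | exact (H x y (z + s)) | idtac ].
 - exact (is_derive_shift (fun r => f t r y z) s x _ (H (x + s) y z)).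
 - exact (is_derive_shift (fun r => f t x r z) s y _ (H x (y + s) z)).
 - exact (is_derive_shift (fun r => f t x y r) s z _ (H x y (z + s))).
Qed.

Lemma Sm_tshift I a s f : open I -> Sm I f -> Sm I (tshift a s f).
Proof.
 intros HI Hf n. revert f Hf; induction n; intros f Hf.
 - split; [|easy]. intros; apply c4_tshift; intros; now apply (Sm_c4 I).
 - apply (Cn_step n I _ (fun d => tshift a s (pdt d f))); [easy| | |].
  + intros; apply c4_tshift; intros; now apply (Sm_c4 I).
  + intros; now apply (is_pdt_tshift a s d f I).
  + intros d. apply IHn. now apply Sm_pdt.
Qed.

Definition trefl (f : tfield) : tfield := fun t x y z => f t x y (- z).

Lemma Sm_trefl I f : open I -> Sm I f -> Sm I (trefl f).
Proof.
 intros HI Hf n. revert f Hf; induction n; intros f Hf.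
 all: assert (Hc : forall t x y z, I t -> c4 (trefl f) t x y z).
 1, 3: intros t x y z Ht; apply c4_intro; unfold trefl; apply (c4_comp f); try cproj;
  [apply (continuous_opp (V:=RN)); cproj|now apply (Sm_c4 I)].
 - split; [exact Hc|easy].
 - apply (Cn_step n I _ (fun d => match d with
   | Some AxZ => fun t x y z => - trefl (pdt d f) t x y z | _ => trefl (pdt d f) end)); [easy|easy| |].
  + intros d t x y z Ht. have H := Sm_is I f d Hf t x y (- z) Ht. unfold is_pdt in *.
   destruct d as [[]|]; try exact H.
   replace (- trefl (pdt (Some AxZ) f) t x y z) with (scal (- (1)) (pdt (Some AxZ) f t x y (- z)))
    by (unfold scal, trefl; simpl; unfold mult; simpl; ring).
   apply (is_derive_comp (fun r => f t x y r) (fun r => - r)); [exact H|].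
   auto_derive; [easy|ring].
  + intros d. destruct d as [[]|]; try (apply Cn_opp; [easy|]); apply IHn; now apply Sm_pdt.
Qed.

Lemma c4_2d (f : tfield) t x y z (A X Y Z : R * R -> R) u v :
 A (u, v) = t -> X (u, v) = x -> Y (u, v) = y -> Z (u, v) = z ->
 continuous A (u, v) -> continuous X (u, v) -> continuous Y (u, v) -> continuous Z (u, v) ->
 c4 f t x y z ->
 continuity_2d_pt (fun u v => f (A (u, v)) (X (u, v)) (Y (u, v)) (Z (u, v))) u v.
Proof.
 intros <- <- <- <- HA HX HY HZ Hf. apply continuity_2d_of_continuous.
 apply (continuous_ext (fun q => f (A q) (X q) (Y q) (Z q))); [now intros []|].
 now apply (c4_comp f).
Qed.

Ltac schwarz F A X Y Z u v d e dl H1 H2 H3 := apply (Schwarz F u v);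
 [ exists dl; intros; repeat split; [refine (H1 d _ _ _ _ _)|refine (H1 e _ _ _ _ _)|refine (H2 d e _ _ _ _ _)|refine (H2 e d _ _ _ _ _)]; auto
 | exact (c4_2d _ _ _ _ _ A X Y Z u v eq_refl eq_refl eq_refl eq_refl ltac:(cproj) ltac:(cproj) ltac:(cproj) ltac:(cproj) (H3 d e _ _ _ _ ltac:(eassumption)))
 | exact (c4_2d _ _ _ _ _ A X Y Z u v eq_refl eq_refl eq_refl eq_refl ltac:(cproj) ltac:(cproj) ltac:(cproj) ltac:(cproj) (H3 e d _ _ _ _ ltac:(eassumption))) ].

Lemma pdt_comm I d e f : open I -> Sm I f -> forall t x y z, I t ->
 pdt d (pdt e f) t x y z = pdt e (pdt d f) t x y z.
Proof.
 intros HI Hf t x y z Ht.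
 have H1 := fun d => Sm_ex I f d Hf.
 have H2 := fun d e => Sm_ex I (pdt e f) d (Sm_pdt I f e Hf).
 have H3 := fun d e t x y z => Sm_c4 I (pdt d (pdt e f)) (Sm_pdt I _ d (Sm_pdt I f e Hf)) t x y z.
 destruct (HI t Ht) as [dl Hdl].
 assert (S1 : pdt None (pdt (Some AxX) f) t x y z = pdt (Some AxX) (pdt None f) t x y z)
  by schwarz (fun u v => f u v y z) (@fst R R) (@snd R R) (fun _ : R * R => y) (fun _ : R * R => z) t x (@None axis) (Some AxX) dl H1 H2 H3.
 assert (S2 : pdt None (pdt (Some AxY) f) t x y z = pdt (Some AxY) (pdt None f) t x y z)
  by schwarz (fun u v => f u x v z) (@fst R R) (fun _ : R * R => x) (@snd R R) (fun _ : R * R => z) t y (@None axis) (Some AxY) dl H1 H2 H3.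
 assert (S3 : pdt None (pdt (Some AxZ) f) t x y z = pdt (Some AxZ) (pdt None f) t x y z)
  by schwarz (fun u v => f u x y v) (@fst R R) (fun _ : R * R => x) (fun _ : R * R => y) (@snd R R) t z (@None axis) (Some AxZ) dl H1 H2 H3.
 assert (S4 : pdt (Some AxX) (pdt (Some AxY) f) t x y z = pdt (Some AxY) (pdt (Some AxX) f) t x y z)
  by schwarz (fun u v => f t u v z) (fun _ : R * R => t) (@fst R R) (@snd R R) (fun _ : R * R => z) x y (Some AxX) (Some AxY) dl H1 H2 H3.
 assert (S5 : pdt (Some AxX) (pdt (Some AxZ) f) t x y z = pdt (Some AxZ) (pdt (Some AxX) f) t x y z)
  by schwarz (fun u v => f t u y v) (fun _ : R * R => t) (@fst R R) (fun _ : R * R => y) (@snd R R) x z (Some AxX) (Some AxZ) dl H1 H2 H3.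
 assert (S6 : pdt (Some AxY) (pdt (Some AxZ) f) t x y z = pdt (Some AxZ) (pdt (Some AxY) f) t x y z)
  by schwarz (fun u v => f t x u v) (fun _ : R * R => t) (fun _ : R * R => x) (@fst R R) (@snd R R) y z (Some AxY) (Some AxZ) dl H1 H2 H3.
 destruct d as [[]|], e as [[]|]; first [ reflexivity | assumption | symmetry; assumption ].
Qed.

Lemma periodic_pdt I d f : open I -> (forall t, I t -> periodic (f t)) ->
 forall t, I t -> periodic (pdt d f t).
Proof.
 intros HI Hp t Ht x y z. destruct (HI t Ht) as [dl Hdl].
 assert (SH : forall g c s, Derive (fun r : R => g (r + c)) s = Derive g (s + c)).
 { intros g c s. unfold Derive. f_equal. apply Lim_ext. intros r. f_equal. f_equal. f_equal. ring. }
 destruct d as [[]|]; simpl.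
 1-3: repeat split; try (apply Derive_ext; intros; apply (Hp t Ht)).
 - rewrite <- (SH (fun r => f t r y z)). apply Derive_ext; intros; apply (Hp t Ht).
 - rewrite <- (SH (fun r => f t x r z)). apply Derive_ext; intros; apply (Hp t Ht).
 - rewrite <- (SH (fun r => f t x y r)). apply Derive_ext; intros; apply (Hp t Ht).
 - unfold dt. repeat split; apply Derive_ext_loc; exists dl; intros s Hs; apply (Hp s (Hdl s Hs)).
Qed.

Lemma c4_tint (I : R -> Prop) f t0 : (forall t x y z, I t -> c4 f t x y z) ->
 (forall s t r, I s -> I t -> Rmin s t <= r <= Rmax s t -> I r) -> open I -> I t0 ->
 forall t x y z, I t -> c4 (fun t x y z => RInt (fun s => f s x y z) t0 t) t x y z.
Proof.
 intros Hf Hconv HI Ht0 t x y z Ht.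
 assert (Iu : forall t u, I t -> 0 <= u <= 1 -> I ((t - t0) * u + t0)).
 { intros t' u It Hu. apply (Hconv t0 t' _ Ht0 It). unfold Rmin, Rmax. destruct Rle_dec; split; nra. }
 (* the substitution [s = t0 + u (t - t0)] makes the bounds constant *)
 apply (c4_ext_loc (fun t x y z => RInt (fun u => (t - t0) * f ((t - t0) * u + t0) x y z) 0 1) _ I); [easy|easy| |].
 - intros t' x' y' z' It. replace (RInt (fun s => f s x' y' z') t0 t') with (RInt (fun s => f s x' y' z') ((t' - t0) * 0 + t0) ((t' - t0) * 1 + t0)) by (f_equal; ring).
  rewrite <- (RInt_comp_lin (V:=RC) (fun s => f s x' y' z')); [reflexivity|].
  apply (ex_RInt_continuous (V:=RC)). intros s Hs.
  apply (c4_comp f (fun r => r) (fun _ => x') (fun _ => y') (fun _ => z')); try apply continuous_const; [apply continuous_id|].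
  apply Hf. apply (Hconv t0 t'); try easy. replace ((t' - t0) * 0 + t0) with t0 in Hs by ring. replace ((t' - t0) * 1 + t0) with t' in Hs by ring. exact Hs.
 - assert (C : forall (T : UniformSpace) (A X Y Z u : T -> R) p, continuous A p -> continuous X p -> continuous Y p -> continuous Z p -> continuous u p ->
   I (A p) -> 0 <= u p <= 1 -> continuous (fun q => (A q - t0) * f ((A q - t0) * u q + t0) (X q) (Y q) (Z q)) p).
  { intros T A X Y Z u p HA HX HY HZ Hu Ip Hp.
   assert (HA' : continuous (fun q => A q - t0) p) by (apply (continuous_minus (V:=RN)); [exact HA|apply continuous_const]).
   apply (continuous_mult (K:=RA)); [exact HA'|]. apply (c4_comp f (fun q => (A q - t0) * u q + t0)); [|easy|easy|easy|apply Hf, Iu; easy].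
   apply (continuous_plus (V:=RN)); [|apply continuous_const]. now apply (continuous_mult (K:=RA)). }
  apply c4_intro. apply (RInt_param_continuous (fun (p : R * R * R * R) u => (fst (fst (fst p)) - t0) * f ((fst (fst (fst p)) - t0) * u + t0) (snd (fst (fst p))) (snd (fst p)) (snd p))); [lra| |].
  + destruct (HI t Ht) as [dl Hdl]. exists dl. intros [[[t' x'] y'] z'] [[[Hb _] _] _]; simpl.
   apply (ex_RInt_continuous (V:=RC)). intros u Hu. rewrite Rmin_left, Rmax_right in Hu by lra.
   apply (C _ (fun _ => t') (fun _ => x') (fun _ => y') (fun _ => z') (fun u => u)); try apply continuous_const; [apply continuous_id|now apply Hdl|easy].
  + intros u Hu. apply (C _ (fun q : R * R * R * R * R => fst (fst (fst (fst q)))) (fun q => snd (fst (fst (fst q)))) (fun q => snd (fst (fst q))) (fun q => snd (fst q)) snd); try cproj; easy.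
Qed.

Definition tint (t0 : R) (f : tfield) : tfield := fun t x y z => RInt (fun s => f s x y z) t0 t.

Definition oi (a b : R) : R -> Prop := fun t => a < t < b.

Lemma open_oi a b : open (oi a b).
Proof. apply open_and; [apply open_gt|apply open_lt]. Qed.

Lemma oi_conv a b s t r : oi a b s -> oi a b t -> Rmin s t <= r <= Rmax s t -> oi a b r.
Proof.
 unfold oi, Rmin, Rmax. destruct (Rle_dec s t); lra.
Qed.

Lemma Sm_time_continuous I f t x y z : Sm I f -> I t -> continuous (fun s => f s x y z) t.
Proof.
 intros Hf Ht. apply continuous_of_ex_derive. exact (Sm_ex I f None Hf t x y z Ht).
Qed.

Lemma Sm_ex_RInt a b f s t x y z : Sm (oi a b) f -> oi a b s -> oi a b t ->
 ex_RInt (fun r => f r x y z) s t.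
Proof.
 intros Hf Hs Ht. apply (ex_RInt_continuous (V:=RC)).
 intros r Hr. apply (Sm_time_continuous (oi a b)); [easy|]. now apply (oi_conv a b s t).
Qed.

Lemma is_pdt_tint_None a b f t0 t x y z : Sm (oi a b) f -> oi a b t0 -> oi a b t ->
 is_pdt None (tint t0 f) t x y z (f t x y z).
Proof.
 intros Hf H0 Ht. unfold is_pdt; simpl. unfold tint.
 apply (is_derive_RInt (fun s => f s x y z) (fun b => RInt (fun s => f s x y z) t0 b) t0 t).
 - destruct (open_oi a b t Ht) as [dl Hdl]. exists dl. intros s Hs.
  apply (RInt_correct (V:=RC)). apply (Sm_ex_RInt a b); auto.
 - now apply (Sm_time_continuous (oi a b)).
Qed.

Lemma is_pdt_tint_Some a b c f t0 t x y z : Sm (oi a b) f -> oi a b t0 -> oi a b t ->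
 is_pdt (Some c) (tint t0 f) t x y z (tint t0 (pdt (Some c) f) t x y z).
Proof.
 intros Hf H0 Ht. unfold is_pdt.
 have H1 := Sm_ex _ f (Some c) Hf.
 have C1 := Sm_c4 _ (pdt (Some c) f) (Sm_pdt _ f (Some c) Hf).
 assert (HC : forall s, Rmin t0 t <= s <= Rmax t0 t -> oi a b s) by (intros; now apply (oi_conv a b t0 t)).
 destruct c; simpl; unfold tint.
 - apply (is_derive_RInt_param (fun r s => f s r y z)).
  + exists (mkposreal 1 Rlt_0_1). intros r _ s Hs. exact (H1 s r y z (HC s Hs)).
  + intros s Hs. exact (c4_2d _ s x y z snd fst (fun _ => y) (fun _ => z) x s eq_refl eq_refl eq_refl eq_refl
    ltac:(cproj) ltac:(cproj) ltac:(cproj) ltac:(cproj) (C1 s x y z (HC s Hs))).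
  + exists (mkposreal 1 Rlt_0_1). intros r _. now apply (Sm_ex_RInt a b).
 - apply (is_derive_RInt_param (fun r s => f s x r z)).
  + exists (mkposreal 1 Rlt_0_1). intros r _ s Hs. exact (H1 s x r z (HC s Hs)).
  + intros s Hs. exact (c4_2d _ s x y z snd (fun _ => x) fst (fun _ => z) y s eq_refl eq_refl eq_refl eq_refl
    ltac:(cproj) ltac:(cproj) ltac:(cproj) ltac:(cproj) (C1 s x y z (HC s Hs))).
  + exists (mkposreal 1 Rlt_0_1). intros r _. now apply (Sm_ex_RInt a b).
 - apply (is_derive_RInt_param (fun r s => f s x y r)).
  + exists (mkposreal 1 Rlt_0_1). intros r _ s Hs. exact (H1 s x y r (HC s Hs)).
  + intros s Hs. exact (c4_2d _ s x y z snd (fun _ => x) (fun _ => y) fst z s eq_refl eq_refl eq_refl eq_refl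
    ltac:(cproj) ltac:(cproj) ltac:(cproj) ltac:(cproj) (C1 s x y z (HC s Hs))).
  + exists (mkposreal 1 Rlt_0_1). intros r _. now apply (Sm_ex_RInt a b).
Qed.

Lemma Sm_tint a b f t0 : Sm (oi a b) f -> oi a b t0 -> Sm (oi a b) (tint t0 f).
Proof.
 intros Hf H0 n. have HI := open_oi a b. revert f Hf; induction n; intros f Hf.
 all: assert (Hc : forall t x y z, oi a b t -> c4 (tint t0 f) t x y z) by
  (intros; apply (c4_tint (oi a b) f t0); try easy; [now apply Sm_c4|apply oi_conv]).
 - split; [exact Hc|easy].
 - apply (Cn_step n _ _ (fun d => match d with None => f | Some c => tint t0 (pdt (Some c) f) end)); [easy|easy| |].
  + intros d t x y z Ht. destruct d as [c|].
   * now apply (is_pdt_tint_Some a b).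
   * now apply (is_pdt_tint_None a b).
  + intros d. destruct d as [c|]; [apply IHn; now apply Sm_pdt|apply Hf].
Qed.

(* Bundled smooth periodic fields and their calculus *)
Identity Coercion tfield_fun : tfield >-> Funclass.

(* Fields vanish outside the time interval, so that fields which agree on it are equal. *)
Record fld (a b : R) := Fld {
 fv :> tfield;
 fv_sm : Sm (oi a b) fv;
 fv_per : forall t, oi a b t -> periodic (fv t);
 fv_out : forall t x y z, ~ oi a b t -> fv t x y z = 0 }.

Arguments Fld {a b}. Arguments fv {a b}. Arguments fv_sm {a b}. Arguments fv_per {a b}. Arguments fv_out {a b}.

Lemma fld_eq {a b} (f g : fld a b) :
 (forall t x y z, oi a b t -> f t x y z = g t x y z) -> f = g.
Proof.
 intros H. destruct f as [f f1 f2 f3], g as [g g1 g2 g3]. simpl in H.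
 assert (E : f = g).
 { ext3 t x y; extensionality z.
  destruct (classic (oi a b t)); [now apply H|]. now rewrite f3, g3. }
 subst g. f_equal; apply proof_irrelevance.
Qed.

Definition oi_dec a b t : {oi a b t} + {~ oi a b t}.
Proof. unfold oi. destruct (Rlt_dec a t), (Rlt_dec t b); [left; easy|right; lra..]. Defined.

Definition rst (a b : R) (f : tfield) : tfield := fun t x y z => if oi_dec a b t then f t x y z else 0.

Lemma rst_in a b f t x y z : oi a b t -> rst a b f t x y z = f t x y z.
Proof. intros H; unfold rst; now destruct oi_dec. Qed.

Definition mkfld (a b : R) (f : tfield) (Hs : Sm (oi a b) f)
 (Hp : forall t, oi a b t -> periodic (f t)) : fld a b.
Proof.
 refine (Fld (rst a b f) _ _ _).
 - apply (Sm_ext _ f); [apply open_oi|intros; now rewrite rst_in|exact Hs].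
 - intros t Ht x y z. rewrite !rst_in by exact Ht. now apply Hp.
 - intros t x y z Ht. unfold rst. now destruct oi_dec.
Defined.

Lemma mkfld_at a b f Hs Hp t x y z : oi a b t -> (mkfld a b f Hs Hp) t x y z = f t x y z.
Proof. apply rst_in. Qed.

Definition fadd {a b} (f g : fld a b) : fld a b.
Proof.
 refine (Fld (fun t x y z => f t x y z + g t x y z) _ _ _).
 - apply Sm_plus; [apply open_oi|apply fv_sm..].
 - intros t Ht x y z. destruct (fv_per f t Ht x y z) as (-> & -> & ->).
  now destruct (fv_per g t Ht x y z) as (-> & -> & ->).
 - intros. rewrite !fv_out by easy. ring.
Defined.

Definition fmul {a b} (f g : fld a b) : fld a b.
Proof.
 refine (Fld (fun t x y z => f t x y z * g t x y z) _ _ _).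
 - apply Sm_mult; [apply open_oi|apply fv_sm..].
 - intros t Ht x y z. destruct (fv_per f t Ht x y z) as (-> & -> & ->).
  now destruct (fv_per g t Ht x y z) as (-> & -> & ->).
 - intros. rewrite !fv_out by easy. ring.
Defined.

Definition fscal {a b} (k : R) (f : fld a b) : fld a b.
Proof.
 refine (Fld (fun t x y z => k * f t x y z) _ _ _).
 - apply (Sm_mult _ (fun _ _ _ _ => k)); [apply open_oi|apply Sm_const, open_oi|apply fv_sm].
 - intros t Ht x y z. now destruct (fv_per f t Ht x y z) as (-> & -> & ->).
 - intros. rewrite !fv_out by easy. ring.
Defined.

Definition fopp {a b} (f : fld a b) : fld a b := fscal (-1) f.
Definition fsub {a b} (f g : fld a b) : fld a b := fadd f (fopp g).

Definition fcst {a b} (k : R) : fld a b :=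
 mkfld a b (fun _ _ _ _ => k) (Sm_const _ k (open_oi a b)) (fun _ _ _ _ _ => conj eq_refl (conj eq_refl eq_refl)).

Definition fder {a b} (d : option axis) (f : fld a b) : fld a b :=
 mkfld a b (pdt d f) (Sm_pdt _ f d (fv_sm f)) (periodic_pdt _ d f (open_oi a b) (fv_per f)).

Lemma periodic_tshift a s (f : tfield) t : periodic (f t) -> periodic (tshift a s f t).
Proof.
 intros H x y z. destruct a; simpl; repeat split; try apply H.
 - replace (x + 1 + s) with (x + s + 1) by ring. apply H.
 - replace (y + 1 + s) with (y + s + 1) by ring. apply H.
 - replace (z + 1 + s) with (z + s + 1) by ring. apply H.
Qed.

Definition fsh {a b} (c : axis) (s : R) (f : fld a b) : fld a b.
Proof.
 refine (Fld (tshift c s f) _ _ _).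
 - apply Sm_tshift; [apply open_oi|apply fv_sm].
 - intros t Ht. apply periodic_tshift, fv_per, Ht.
 - intros t x y z Ht. destruct c; simpl; now apply fv_out.
Defined.

Definition fzf {a b} (g : R -> R) (Hs : smooth1 g) (Hp : forall z, g (z + 1) = g z) : fld a b :=
 mkfld a b (fun _ _ _ z => g z) (Sm_zfun _ g (open_oi a b) Hs)
  (fun _ _ _ _ z => conj eq_refl (conj eq_refl (Hp z))).

Definition ftint {a b} (t0 : R) (H0 : oi a b t0) (f : fld a b) : fld a b.
Proof.
 refine (mkfld a b (tint t0 f) (Sm_tint a b f t0 (fv_sm f) H0) _).
 intros t Ht x y z. unfold tint. repeat split; apply RInt_ext; intros s Hs;
  apply (fv_per f s); apply (oi_conv a b t0 t); try easy; lra.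
Defined.

(** The inverse is made total by returning the zero field when [f] vanishes somewhere on the
    interval; each use therefore comes with a nonvanishing condition. *)
Definition finv {a b} (f : fld a b) : fld a b.
Proof.
 destruct (excluded_middle_informative (forall t x y z, oi a b t -> f t x y z <> 0)) as [H|H].
 - refine (Fld (fun t x y z => / f t x y z) _ _ _).
  + apply Sm_inv; [apply open_oi|exact H|apply fv_sm].
  + intros t Ht x y z. now destruct (fv_per f t Ht x y z) as (-> & -> & ->).
  + intros. rewrite fv_out by easy. apply Rinv_0.
 - exact (fcst 0).
Defined.

Definition frefl {a b} (f : fld a b) : fld a b.
Proof.
 refine (Fld (trefl f) _ _ _).
 - apply Sm_trefl; [apply open_oi|apply fv_sm].
 - intros t Ht x y z. unfold trefl. repeat split; try apply (fv_per f t Ht).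
  rewrite <- (proj2 (proj2 (fv_per f t Ht x y (- (z + 1))))). f_equal; ring.
 - intros. unfold trefl. now apply fv_out.
Defined.

Declare Scope fld_scope.
Delimit Scope fld_scope with fld.
Bind Scope fld_scope with fld.
Infix "+" := fadd : fld_scope.
Infix "*" := fmul : fld_scope.
Infix "-" := fsub : fld_scope.
Infix "*:" := fscal (at level 40, left associativity) : fld_scope.

Lemma fadd_at {a b} (f g : fld a b) t x y z : fadd f g t x y z = f t x y z + g t x y z.
Proof. reflexivity. Qed.
Lemma fmul_at {a b} (f g : fld a b) t x y z : fmul f g t x y z = f t x y z * g t x y z.
Proof. reflexivity. Qed.
Lemma fscal_at {a b} k (f : fld a b) t x y z : fscal k f t x y z = k * f t x y z.
Proof. reflexivity. Qed.
Lemma fopp_at {a b} (f : fld a b) t x y z : fopp f t x y z = - f t x y z.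
Proof. unfold fopp. rewrite fscal_at. ring. Qed.
Lemma fsub_at {a b} (f g : fld a b) t x y z : fsub f g t x y z = f t x y z - g t x y z.
Proof. unfold fsub. rewrite fadd_at, fopp_at. ring. Qed.
Lemma fsh_at {a b} c s (f : fld a b) t x y z : fsh c s f t x y z = tshift c s f t x y z.
Proof. reflexivity. Qed.
Lemma frefl_at {a b} (f : fld a b) t x y z : frefl f t x y z = f t x y (- z).
Proof. reflexivity. Qed.
Lemma fcst_at {a b} k t x y z : oi a b t -> (@fcst a b k) t x y z = k.
Proof. apply rst_in. Qed.
Lemma fzf_at {a b} g Hs Hp t x y z : oi a b t -> (@fzf a b g Hs Hp) t x y z = g z.
Proof. apply rst_in. Qed.
Lemma fder_at {a b} d (f : fld a b) t x y z : oi a b t -> fder d f t x y z = pdt d f t x y z.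
Proof. apply rst_in. Qed.
Lemma ftint_at {a b} t0 H0 (f : fld a b) t x y z : oi a b t -> ftint t0 H0 f t x y z = RInt (fun s => f s x y z) t0 t.
Proof. apply rst_in. Qed.
Lemma finv_at {a b} (f : fld a b) t x y z : (forall t x y z, oi a b t -> f t x y z <> 0) ->
 finv f t x y z = / f t x y z.
Proof. intros H. unfold finv. now destruct excluded_middle_informative. Qed.

Ltac fat := repeat progress (rewrite ?fsub_at, ?fopp_at, ?fadd_at, ?fmul_at, ?fscal_at; try (rewrite ?fcst_at by assumption)).
Ltac fring := apply fld_eq; intros; fat; try ring.

Lemma fld_is {a b} d (f : fld a b) t x y z : oi a b t -> is_pdt d f t x y z (fder d f t x y z).
Proof. intros Ht. rewrite fder_at by exact Ht. apply (Sm_is (oi a b)); [apply fv_sm|exact Ht]. Qed.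

Lemma fder_unique {a b} d (f g : fld a b) :
 (forall t x y z, oi a b t -> is_pdt d f t x y z (g t x y z)) -> fder d f = g.
Proof.
 intros H. apply fld_eq. intros t x y z Ht. rewrite fder_at by exact Ht. now apply is_pdt_unique, H.
Qed.

Lemma fder_add {a b} d (f g : fld a b) : fder d (f + g)%fld = (fder d f + fder d g)%fld.
Proof. apply fder_unique. intros. apply is_pdt_plus; now apply fld_is. Qed.

Lemma fder_mul {a b} d (f g : fld a b) : fder d (f * g)%fld = (fder d f * g + f * fder d g)%fld.
Proof. apply fder_unique. intros. apply is_pdt_mult; now apply fld_is. Qed.

Lemma fder_cst {a b} d k : fder d (@fcst a b k) = fcst 0.
Proof.
 apply fder_unique. intros. rewrite fcst_at by easy.
 apply (is_pdt_ext (oi a b) _ (fun _ _ _ _ => k)); [apply open_oi|easy|intros; now rewrite fcst_at|].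
 apply is_pdt_const.
Qed.

Lemma fscal_cst {a b} k (f : fld a b) : fscal k f = (fcst k * f)%fld.
Proof. fring. Qed.

Lemma fder_scal {a b} d k (f : fld a b) : fder d (k *: f)%fld = (k *: fder d f)%fld.
Proof. rewrite !fscal_cst, fder_mul, fder_cst. fring. Qed.

Lemma fder_opp {a b} d (f : fld a b) : fder d (fopp f) = fopp (fder d f).
Proof. apply fder_scal. Qed.

Lemma fder_sub {a b} d (f g : fld a b) : fder d (f - g)%fld = (fder d f - fder d g)%fld.
Proof. unfold fsub. now rewrite fder_add, fder_opp. Qed.

Lemma fder_comm {a b} d e (f : fld a b) : fder d (fder e f) = fder e (fder d f).
Proof.
 apply fld_eq. intros t x y z Ht. rewrite !(fder_at _ (fder _ _)) by exact Ht.
 assert (E : forall d e, pdt d (fder e f) t x y z = pdt d (pdt e f) t x y z).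
 { intros d' e'. apply (pdt_ext (oi a b)); [apply open_oi| |exact Ht]. intros; now apply fder_at. }
 rewrite !E. apply (pdt_comm (oi a b)); [apply open_oi|apply fv_sm|exact Ht].
Qed.

Lemma fder_sh {a b} d c s (f : fld a b) : fder d (fsh c s f) = fsh c s (fder d f).
Proof.
 apply fder_unique. intros t x y z Ht. rewrite fsh_at.
 have H := is_pdt_tshift c s d f (oi a b) t x y z (fv_sm f) Ht.
 replace (tshift c s (fder d f) t x y z) with (tshift c s (pdt d f) t x y z); [exact H|].
 destruct c; cbn [tshift]; now rewrite fder_at.
Qed.

Lemma fder_inv {a b} d (f : fld a b) : (forall t x y z, oi a b t -> f t x y z <> 0) ->
 fder d (finv f) = fopp (fder d f * (finv f * finv f))%fld.
Proof.
 intros H. apply fder_unique. intros t x y z Ht. fat. rewrite !finv_at by exact H.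
 rewrite <- Ropp_mult_distr_l_reverse.
 apply (is_pdt_ext (oi a b) _ (fun t x y z => / f t x y z)); [apply open_oi|exact Ht|intros; now rewrite finv_at|].
 apply is_pdt_inv; [now apply fld_is|now apply H].
Qed.

Lemma fder_tint_None {a b} t0 H0 (f : fld a b) : fder None (ftint t0 H0 f) = f.
Proof.
 apply fder_unique. intros t x y z Ht.
 apply (is_pdt_ext (oi a b) _ (tint t0 f)); [apply open_oi|exact Ht|intros; now rewrite ftint_at|].
 apply (is_pdt_tint_None a b); try easy. apply fv_sm.
Qed.

Lemma fder_tint_Some {a b} t0 H0 c (f : fld a b) : fder (Some c) (ftint t0 H0 f) = ftint t0 H0 (fder (Some c) f).
Proof.
 apply fder_unique. intros t x y z Ht.
 apply (is_pdt_ext (oi a b) _ (tint t0 f)); [apply open_oi|exact Ht|intros; now rewrite ftint_at|].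
 rewrite ftint_at by exact Ht.
 replace (RInt (fun s => fder (Some c) f s x y z) t0 t) with (tint t0 (pdt (Some c) f) t x y z).
 - apply (is_pdt_tint_Some a b); try easy. apply fv_sm.
 - unfold tint. apply RInt_ext. intros s Hs. rewrite fder_at; [easy|].
  apply (oi_conv a b t0 t); try easy; lra.
Qed.

Lemma fder_zf {a b} d g Hs Hp (Hs' : smooth1 (Derive g)) (Hp' : forall z, Derive g (z + 1) = Derive g z) :
 fder d (@fzf a b g Hs Hp) = match d with Some AxZ => fzf (Derive g) Hs' Hp' | _ => fcst 0 end.
Proof.
 apply fder_unique. intros t x y z Ht.
 apply (is_pdt_ext (oi a b) _ (fun _ _ _ z => g z)); [apply open_oi|exact Ht|intros; now rewrite fzf_at|].
 destruct d as [[]|]; rewrite ?fcst_at, ?fzf_at by exact Ht; unfold is_pdt;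
  try exact (is_derive_const (K:=RA) (V:=RN) (g z) _).
 exact (Derive_correct _ _ (Hs 1%nat z)).
Qed.

Lemma fder_refl {a b} d (f : fld a b) :
 fder d (frefl f) = match d with Some AxZ => fopp (frefl (fder d f)) | _ => frefl (fder d f) end.
Proof.
 apply fder_unique. intros t x y z Ht.
 have H := fld_is d f t x y (- z) Ht. unfold is_pdt in *.
 destruct d as [[]|]; try exact H.
 rewrite fopp_at, frefl_at.
 replace (- fder (Some AxZ) f t x y (- z)) with (scal (- (1)) (fder (Some AxZ) f t x y (- z)))
  by (unfold scal; simpl; unfold mult; simpl; ring).
 apply (is_derive_comp (fun r => f t x y r) (fun r => - r)); [exact H|].
 auto_derive; [easy|ring].
Qed.

Global Opaque fadd fmul fscal fcst fder fsh fzf ftint finv frefl mkfld.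

(** * Integrals and L^2 norms of fields on a time slice *)

Definition Iint {a b} (t : R) (f : fld a b) : R := I3 (f t).

Definition nrm2 {a b} (t : R) (f : fld a b) : R := Iint t (f * f)%fld.

Lemma fld_c3 {a b} (f : fld a b) t : oi a b t -> c3 (f t).
Proof. intros Ht s x y z. apply c4_slice. apply (Sm_c4 (oi a b)); [apply fv_sm|exact Ht]. Qed.

Lemma fld_pd {a b} (f : fld a b) c t : oi a b t -> pd c (f t) = fder (Some c) f t.
Proof.
 intros Ht. ext3 x y z. now rewrite fder_at.
Qed.

Lemma fld_C1p {a b} (f : fld a b) t : oi a b t -> C1p (f t).
Proof.
 intros Ht. split; [now apply fld_c3|]. split; [now apply fv_per|]. split.
 - intros d. rewrite fld_pd by exact Ht. split; [now apply fld_c3|now apply fv_per].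
 - intros d x y z. exact (Sm_ex (oi a b) f (Some d) (fv_sm f) t x y z Ht).
Qed.

Lemma Iint_add {a b} t (f g : fld a b) : oi a b t -> Iint t (f + g)%fld = Iint t f + Iint t g.
Proof.
 intros Ht. unfold Iint. rewrite <- I3_plus by now apply fld_c3.
 apply I3_ext; intros; now rewrite fadd_at.
Qed.

Lemma Iint_scal {a b} t k (f : fld a b) : oi a b t -> Iint t (k *: f)%fld = k * Iint t f.
Proof.
 intros Ht. unfold Iint. rewrite <- I3_scal by now apply fld_c3.
 apply I3_ext; intros; now rewrite fscal_at.
Qed.

Lemma Iint_opp {a b} t (f : fld a b) : oi a b t -> Iint t (fopp f) = - Iint t f.
Proof. intros Ht. unfold fopp. rewrite Iint_scal by exact Ht. ring. Qed.

Lemma Iint_sub {a b} t (f g : fld a b) : oi a b t -> Iint t (f - g)%fld = Iint t f - Iint t g.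
Proof. intros Ht. unfold fsub. rewrite Iint_add, Iint_opp by exact Ht. ring. Qed.

Lemma Iint_le {a b} t (f g : fld a b) : oi a b t ->
 (forall x y z, f t x y z <= g t x y z) -> Iint t f <= Iint t g.
Proof. intros Ht H. apply I3_le; [now apply fld_c3..|exact H]. Qed.

Lemma Iint_nonneg {a b} t (f : fld a b) : oi a b t -> (forall x y z, 0 <= f t x y z) -> 0 <= Iint t f.
Proof. intros Ht H. apply I3_nonneg; [now apply fld_c3|exact H]. Qed.

Lemma Iint_cst {a b} t k : oi a b t -> Iint t (@fcst a b k) = k.
Proof.
 intros Ht. unfold Iint. rewrite (I3_ext _ (fun _ _ _ => k)); [apply I3_const|]. intros; now apply fcst_at.
Qed.

Lemma Iint_abs_le {a b} t (f g : fld a b) : oi a b t ->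
 (forall x y z, Rabs (f t x y z) <= g t x y z) -> Rabs (Iint t f) <= Iint t g.
Proof. intros Ht H. apply I3_abs_le; [now apply fld_c3..|intros; apply H]. Qed.

Lemma nrm2_nonneg {a b} t (f : fld a b) : oi a b t -> 0 <= nrm2 t f.
Proof. intros Ht. unfold nrm2. apply Iint_nonneg; [exact Ht|]. intros. rewrite fmul_at. apply Rle_0_sqr. Qed.

Lemma nrm2_scal {a b} t k (f : fld a b) : oi a b t -> nrm2 t (k *: f)%fld = k ^ 2 * nrm2 t f.
Proof.
 intros Ht. unfold nrm2. rewrite <- Iint_scal by exact Ht. f_equal. fring.
Qed.

Lemma nrm2_add {a b} t (f g : fld a b) : oi a b t -> nrm2 t (f + g)%fld <= 2 * (nrm2 t f + nrm2 t g).
Proof.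
 intros Ht. unfold nrm2. rewrite <- Iint_add, <- Iint_scal by exact Ht.
 apply Iint_le; [exact Ht|]. intros. fat. have H := Rle_0_sqr (f t x y z - g t x y z). unfold Rsqr in H. lra.
Qed.

Lemma nrm2_opp {a b} t (f : fld a b) : oi a b t -> nrm2 t (fopp f) = nrm2 t f.
Proof. intros Ht. unfold fopp. rewrite nrm2_scal by exact Ht. ring. Qed.

Lemma nrm2_sub {a b} t (f g : fld a b) : oi a b t -> nrm2 t (f - g)%fld <= 2 * (nrm2 t f + nrm2 t g).
Proof.
 intros Ht. unfold fsub. etr; [now apply nrm2_add|]. rewrite nrm2_opp by exact Ht. lra.
Qed.

Lemma nrm2_cst0 {a b} t : oi a b t -> nrm2 t (@fcst a b 0) = 0.
Proof.
 intros Ht. unfold nrm2. replace (@fcst a b 0 * fcst 0)%fld with (@fcst a b 0) by fring. now apply Iint_cst.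
Qed.

Lemma Iint_young {a b} t (f g : fld a b) : oi a b t -> 2 * Rabs (Iint t (f * g)%fld) <= nrm2 t f + nrm2 t g.
Proof.
 intros Ht.
 assert (H : Rabs (Iint t (f * g)%fld) <= Iint t ((/ 2) *: (f * f + g * g))%fld).
 { apply Iint_abs_le; [exact Ht|]. intros. fat. apply Rabs_le.
  have H1 := Rle_0_sqr (f t x y z - g t x y z). have H2 := Rle_0_sqr (f t x y z + g t x y z).
  unfold Rsqr in H1, H2. lra. }
 rewrite Iint_scal, Iint_add in H by exact Ht. unfold nrm2. lra.
Qed.

Lemma nrm2_I3 {a b} t (f : fld a b) : nrm2 t f = I3 (fun x y z => f t x y z ^ 2).
Proof. apply I3_ext. intros. rewrite fmul_at. ring. Qed.

Lemma Iint_cs {a b} t (f g : fld a b) : oi a b t -> Iint t (f * g)%fld ^ 2 <= nrm2 t f * nrm2 t g.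
Proof.
 intros Ht. rewrite (nrm2_I3 t f), (nrm2_I3 t g).
 replace (Iint t (f * g)%fld) with (I3 (fun x y z => f t x y z * g t x y z))
  by (apply I3_ext; intros; now rewrite fmul_at).
 apply I3_cauchy_schwarz; now apply fld_c3.
Qed.

Lemma Av_fder {a b} t c (f : fld a b) : oi a b t -> Av c (fder (Some c) f t) = fun _ _ _ => 0.
Proof.
 intros Ht. ext3 x y z. unfold Av.
 rewrite <- (fld_pd f c t Ht). have HC := fld_C1p f t Ht.
 transitivity (slice c (f t) x y z 1 - slice c (f t) x y z 0).
 - apply is_RInt_unique. apply (is_RInt_derive (slice c (f t) x y z)); intros r _; [now apply C1p_slice_derive|].
  apply slice_continuous, HC.
 - replace 1 with (0 + 1) at 1 by ring. rewrite periodic_slice; [ring|]. now apply fv_per.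
Qed.

Lemma Iint_der {a b} t c (f : fld a b) : oi a b t -> Iint t (fder (Some c) f) = 0.
Proof.
 intros Ht. unfold Iint. rewrite <- (I3_Av c) by now apply fld_c3. rewrite Av_fder by exact Ht. apply I3_const.
Qed.

Lemma Iint_parts {a b} t c (f g : fld a b) : oi a b t ->
 Iint t (fder (Some c) f * g)%fld = - Iint t (f * fder (Some c) g)%fld.
Proof.
 intros Ht. have H := Iint_der t c (f * g)%fld Ht.
 rewrite fder_mul, Iint_add in H by exact Ht. lra.
Qed.

Lemma Iint_time {a b} t (f : fld a b) : oi a b t -> is_derive (fun s => Iint s f) t (Iint t (fder None f)).
Proof.
 intros Ht. apply (I3_derive (oi a b) f (fder None f)).
 - apply open_oi.
 - intros s x y z Hs. exact (fld_is None f s x y z Hs).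
 - intros. now apply (Sm_c4 (oi a b)); [apply fv_sm|].
 - intros. now apply (Sm_c4 (oi a b)); [apply fv_sm|].
 - exact Ht.
Qed.

Lemma Iint_sh {a b} t c s (f : fld a b) : oi a b t -> Iint t (fsh c s f) = Iint t f.
Proof.
 intros Ht. unfold Iint. rewrite <- (I3_Av c (fsh c s f t)), <- (I3_Av c (f t)) by now apply fld_c3.
 apply I3_ext. intros x y z. unfold Av.
 rewrite <- (RInt_periodic_shift (slice c (f t) x y z) s).
 - apply RInt_ext. intros. now destruct c.
 - intros. apply slice_continuous. now apply fld_c3.
 - intros. apply periodic_slice. now apply fv_per.
Qed.

Lemma nrm2_sh {a b} t c s (f : fld a b) : oi a b t -> nrm2 t (fsh c s f) = nrm2 t f.
Proof.
 intros Ht. unfold nrm2. rewrite <- (Iint_sh t c s (f * f)%fld) by exact Ht. f_equal.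
 apply fld_eq. intros. rewrite fmul_at, !fsh_at. now destruct c.
Qed.

(** * Weighted Sobolev norms *)

(* [e = 0] is allowed and turns the norms below into purely spatial ones. *)
Definition Zd {a b} (e : R) (d : option axis) (f : fld a b) : fld a b :=
 match d with None => (e *: fder None f)%fld | Some c => fder (Some c) f end.

Definition Zw {a b} (e : R) (l : list (option axis)) (f : fld a b) : fld a b := fold_right (Zd e) f l.

Lemma Zw_app {a b} e l d (f : fld a b) : Zw e (l ++ d :: nil) f = Zw e l (Zd e d f).
Proof. unfold Zw. now rewrite fold_right_app. Qed.

Lemma Z_add {a b} e d (f g : fld a b) : Zd e d (f + g)%fld = (Zd e d f + Zd e d g)%fld.
Proof. destruct d; simpl; rewrite fder_add; [easy|fring]. Qed.

Lemma Z_scal {a b} e d k (f : fld a b) : Zd e d (k *: f)%fld = (k *: Zd e d f)%fld.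
Proof. destruct d; simpl; rewrite fder_scal; [easy|fring]. Qed.

Lemma Z_mul {a b} e d (f g : fld a b) : Zd e d (f * g)%fld = (Zd e d f * g + f * Zd e d g)%fld.
Proof. destruct d; simpl; rewrite fder_mul; [easy|fring]. Qed.

Lemma Z_cst {a b} e d k : Zd e d (@fcst a b k) = fcst 0.
Proof. destruct d; simpl; rewrite fder_cst; [easy|fring]. Qed.

Lemma Z_der {a b} e d c (f : fld a b) : Zd e d (fder c f) = fder c (Zd e d f).
Proof. destruct d; simpl; rewrite ?fder_scal; now rewrite (fder_comm _ c). Qed.

Lemma Z_comm {a b} e d c (f : fld a b) : Zd e d (Zd e c f) = Zd e c (Zd e d f).
Proof. destruct c as [c|]; simpl; rewrite ?Z_scal, Z_der; easy. Qed.

Lemma Zw_add {a b} e l (f g : fld a b) : Zw e l (f + g)%fld = (Zw e l f + Zw e l g)%fld.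
Proof. induction l; simpl; [easy|]. fold (Zw e l (f + g)%fld). now rewrite IHl, Z_add. Qed.

Lemma Zw_scal {a b} e l k (f : fld a b) : Zw e l (k *: f)%fld = (k *: Zw e l f)%fld.
Proof. induction l; simpl; [easy|]. fold (Zw e l (k *: f)%fld). now rewrite IHl, Z_scal. Qed.

Lemma Zw_sub {a b} e l (f g : fld a b) : Zw e l (f - g)%fld = (Zw e l f - Zw e l g)%fld.
Proof. unfold fsub, fopp. now rewrite Zw_add, Zw_scal. Qed.

Lemma Zw_der {a b} e l c (f : fld a b) : Zw e l (fder c f) = fder c (Zw e l f).
Proof. induction l; simpl; [easy|]. fold (Zw e l (fder c f)). now rewrite IHl, Z_der. Qed.

Lemma Zw_Z {a b} e l d (f : fld a b) : Zw e l (Zd e d f) = Zd e d (Zw e l f).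
Proof. induction l; simpl; [easy|]. fold (Zw e l (Zd e d f)). now rewrite IHl, Z_comm. Qed.

Definition sum4 (F : option axis -> R) : R :=
 F None + F (Some AxX) + F (Some AxY) + F (Some AxZ).

(** Each word of length at most [k] is counted once. Words grow on the right, and the rightmost
    letter is the derivative applied first: so the norm of order [k + 1] of [f] splits into norms of
    order [k] of the fields [Zd e d f], which is [N_S]. *)
Fixpoint SW (k : nat) (F : list (option axis) -> R) : R :=
 match k with
 | O => F nil
 | S m => F nil + sum4 (fun d => SW m (fun l => F (l ++ d :: nil)%list))
 end.

Lemma sum4_le F G : (forall d, F d <= G d) -> sum4 F <= sum4 G.
Proof. intros H; unfold sum4. have H0 := H None. have H1 := H (Some AxX).
 have H2 := H (Some AxY). have H3 := H (Some AxZ). lra. Qed.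

Lemma sum4_ext F G : (forall d, F d = G d) -> sum4 F = sum4 G.
Proof. intros H; unfold sum4. now rewrite !H. Qed.

Lemma sum4_term F d : (forall d, 0 <= F d) -> F d <= sum4 F.
Proof. intros H; unfold sum4. have H0 := H None. have H1 := H (Some AxX).
 have H2 := H (Some AxY). have H3 := H (Some AxZ). destruct d as [[]|]; lra. Qed.

Lemma sum4_scal k F : sum4 (fun d => k * F d) = k * sum4 F.
Proof. unfold sum4; ring. Qed.

Lemma sum4_nonneg F : (forall d, 0 <= F d) -> 0 <= sum4 F.
Proof. intros H. etr; [apply (H None)|now apply sum4_term]. Qed.

Lemma SW_ext k F G : (forall l, F l = G l) -> SW k F = SW k G.
Proof.
 revert F G; induction k; intros F G H; simpl; [apply H|].
 rewrite H. f_equal. apply sum4_ext. intros d. now apply IHk.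
Qed.

Lemma SW_le k F G : (forall l, (length l <= k)%nat -> F l <= G l) -> SW k F <= SW k G.
Proof.
 revert F G; induction k; intros F G H; simpl; [now apply H|].
 apply Rplus_le_compat; [apply H; simpl; lia|]. apply sum4_le. intros d. apply IHk.
 intros l Hl. apply H. rewrite length_app; simpl; lia.
Qed.

Lemma SW_plus k F G : SW k (fun l => F l + G l) = SW k F + SW k G.
Proof.
 revert F G; induction k; intros F G; simpl; [easy|].
 rewrite (sum4_ext _ (fun d => SW k (fun l => F (l ++ d :: nil)%list) + SW k (fun l => G (l ++ d :: nil)%list))).
 - unfold sum4; ring.
 - intros d. now rewrite <- IHk.
Qed.

Lemma SW_scal k c F : SW k (fun l => c * F l) = c * SW k F.
Proof.
 revert F; induction k; intros F; simpl; [easy|].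
 rewrite (sum4_ext _ (fun d => c * SW k (fun l => F (l ++ d :: nil)%list))).
 - rewrite sum4_scal; ring.
 - intros d. now rewrite <- IHk.
Qed.

Lemma SW_nonneg k F : (forall l, (length l <= k)%nat -> 0 <= F l) -> 0 <= SW k F.
Proof.
 revert F; induction k; intros F H; simpl; [now apply H|].
 assert (0 <= F nil) by (apply H; simpl; lia).
 assert (0 <= sum4 (fun d => SW k (fun l => F (l ++ d :: nil)%list))).
 { apply sum4_nonneg. intros d. apply IHk. intros l Hl. apply H. rewrite length_app; simpl; lia. }
 lra.
Qed.

Lemma SW_term k F l : (forall l, (length l <= k)%nat -> 0 <= F l) -> (length l <= k)%nat -> F l <= SW k F.
Proof.
 revert F l; induction k; intros F l H Hl.
 - destruct l; [simpl; lra|simpl in Hl; lia].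
 - simpl. assert (P : forall d, 0 <= SW k (fun l => F (l ++ d :: nil)%list)).
  { intros d. apply SW_nonneg. intros l' Hl'. apply H. rewrite length_app; simpl; lia. }
  destruct l as [|d l] using rev_ind.
  + have Q := sum4_nonneg _ P. lra.
  + have Q := sum4_term _ d P. simpl in Q.
   assert (0 <= F nil) by (apply H; simpl; lia).
   rewrite length_app in Hl; simpl in Hl.
   have E := IHk (fun l => F (l ++ d :: nil)%list) l. simpl in E.
   assert (F (l ++ d :: nil)%list <= SW k (fun l => F (l ++ d :: nil)%list)); [|lra].
   apply E; [|lia]. intros l' Hl'. apply H. rewrite length_app; simpl; lia.
Qed.

Lemma SW_derive k (F dF : list (option axis) -> R -> R) t :
 (forall l, is_derive (F l) t (dF l t)) -> is_derive (fun s => SW k (fun l => F l s)) t (SW k (fun l => dF l t)).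
Proof.
 revert F dF; induction k; intros F dF H; simpl; [apply H|].
 assert (D : forall d, is_derive (fun s => SW k (fun l => F (l ++ d :: nil)%list s)) t
  (SW k (fun l => dF (l ++ d :: nil)%list t))).
 { intros d. exact (IHk (fun l => F (l ++ d :: nil)%list) (fun l => dF (l ++ d :: nil)%list) (fun l => H _)). }
 unfold sum4.
 apply (is_derive_plus (K:=RA) (V:=RN)); [apply H|].
 apply (is_derive_plus (K:=RA) (V:=RN)); [|apply D].
 apply (is_derive_plus (K:=RA) (V:=RN)); [|apply D].
 apply (is_derive_plus (K:=RA) (V:=RN)); apply D.
Qed.

(** [m] is the number of words of length at most [k]. *)
Lemma SW_const k c : exists m, 0 <= m /\ SW k (fun _ => c) = m * c.
Proof.
 induction k as [|k [m [Hm IH]]]; simpl.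
 - exists 1; split; [lra|ring].
 - exists (1 + 4 * m). split; [lra|]. unfold sum4. rewrite IH. ring.
Qed.

(** This is a squared Sobolev norm: scalars come out squared and the triangle inequality is replaced
    by a factor 2. *)
Definition Nk {a b} (e : R) (k : nat) (t : R) (f : fld a b) : R := SW k (fun l => nrm2 t (Zw e l f)).

Lemma N_0 {a b} e t (f : fld a b) : Nk e 0 t f = nrm2 t f.
Proof. reflexivity. Qed.

Lemma N_S {a b} e k t (f : fld a b) : Nk e (S k) t f = nrm2 t f + sum4 (fun d => Nk e k t (Zd e d f)).
Proof.
 unfold Nk. cbn [SW]. apply Rplus_eq_compat_l. apply sum4_ext. intros d. apply SW_ext. intros l. now rewrite Zw_app.
Qed.

Lemma N_nonneg {a b} e k t (f : fld a b) : oi a b t -> 0 <= Nk e k t f.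
Proof. intros Ht. apply SW_nonneg. intros. now apply nrm2_nonneg. Qed.

Lemma N_word {a b} e k t l (f : fld a b) : oi a b t -> (length l <= k)%nat -> nrm2 t (Zw e l f) <= Nk e k t f.
Proof. intros Ht Hl. apply (SW_term k (fun l => nrm2 t (Zw e l f))); [|exact Hl]. intros; now apply nrm2_nonneg. Qed.

Lemma N_Z {a b} e k t d (f : fld a b) : oi a b t -> Nk e k t (Zd e d f) <= Nk e (S k) t f.
Proof.
 intros Ht. rewrite N_S. have H := nrm2_nonneg t f Ht.
 have Q := sum4_term (fun d => Nk e k t (Zd e d f)) d. simpl in Q.
 assert (Nk e k t (Zd e d f) <= sum4 (fun d => Nk e k t (Zd e d f))); [|lra].
 apply Q. intros; now apply N_nonneg.
Qed.

Lemma N_mono_S {a b} e k t (f : fld a b) : oi a b t -> Nk e k t f <= Nk e (S k) t f.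
Proof.
 intros Ht. revert f; induction k; intros f.
 - rewrite N_S, N_0. assert (0 <= sum4 (fun d => Nk e 0 t (Zd e d f))) by (apply sum4_nonneg; intros; now apply N_nonneg). lra.
 - rewrite (N_S e (S k)), (N_S e k). apply Rplus_le_compat_l. apply sum4_le. intros; apply IHk.
Qed.

Lemma N_mono {a b} e k m t (f : fld a b) : oi a b t -> (k <= m)%nat -> Nk e k t f <= Nk e m t f.
Proof.
 intros Ht H. induction H; [lra|]. etr; [exact IHle|now apply N_mono_S].
Qed.

Lemma N_scal {a b} e k t c (f : fld a b) : oi a b t -> Nk e k t (c *: f)%fld = c ^ 2 * Nk e k t f.
Proof.
 intros Ht. unfold Nk. rewrite <- SW_scal. apply SW_ext. intros l. rewrite Zw_scal. now apply nrm2_scal.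
Qed.

Lemma N_add {a b} e k t (f g : fld a b) : oi a b t -> Nk e k t (f + g)%fld <= 2 * (Nk e k t f + Nk e k t g).
Proof.
 intros Ht. unfold Nk. rewrite <- SW_plus, <- SW_scal. apply SW_le. intros l _. rewrite Zw_add. now apply nrm2_add.
Qed.

Lemma N_sub {a b} e k t (f g : fld a b) : oi a b t -> Nk e k t (f - g)%fld <= 2 * (Nk e k t f + Nk e k t g).
Proof.
 intros Ht. unfold fsub, fopp. etr; [now apply N_add|]. rewrite N_scal by exact Ht. lra.
Qed.

Lemma N_cst {a b} e k t c : oi a b t -> Nk e k t (@fcst a b c) = c ^ 2.
Proof.
 intros Ht.
 assert (E : nrm2 t (@fcst a b c) = c ^ 2).
 { unfold nrm2. replace (@fcst a b c * fcst c)%fld with (@fcst a b (c ^ 2)) by fring. now apply Iint_cst. }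
 assert (Z0 : forall k, Nk e k t (@fcst a b 0) = 0).
 { intros m; induction m; [now apply nrm2_cst0|]. rewrite N_S, nrm2_cst0 by exact Ht.
  unfold sum4. rewrite !Z_cst, IHm. ring. }
 destruct k; [exact E|]. rewrite N_S, E. unfold sum4. rewrite !Z_cst, Z0. ring.
Qed.

Lemma L4_bound {a b} e t (f : fld a b) : oi a b t ->
 nrm2 t (f * f)%fld <= 18 * Nk e 1 t f ^ 2.
Proof.
 intros Ht.
 have H := ladyzhenskaya (f t) (fld_C1p f t Ht).
 assert (E : nrm2 t (f * f)%fld = I3 (fun x y z => f t x y z ^ 4)).
 { apply I3_ext. intros. fat. ring. }
 rewrite E. etr; [exact H|].
 apply Rmult_le_compat_l; [lra|]. apply pow_incr.
 assert (Q : forall g : fld a b, 0 <= I3 (fun x y z => g t x y z ^ 2)).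
 { intros g. rewrite <- nrm2_I3. now apply nrm2_nonneg. }
 unfold H1sq. rewrite !(fld_pd f _ t Ht). split.
 - have Q0 := Q f. have Q1 := Q (fder (Some AxX) f). have Q2 := Q (fder (Some AxY) f). have Q3 := Q (fder (Some AxZ) f). lra.
 - rewrite <- !nrm2_I3. rewrite N_S. unfold sum4. rewrite !N_0. simpl Zd.
  have Q1 := nrm2_nonneg t (e *: fder None f)%fld Ht. lra.
Qed.

Lemma le_of_sq_le x y : 0 <= y -> x ^ 2 <= y ^ 2 -> x <= y.
Proof. intros Hy H. destruct (Rle_dec x y); [easy|]. nra. Qed.

(** Cauchy-Schwarz for [f^2] and [g^2], followed by the L^4 bound on each factor. *)
Lemma prod_11 {a b} e t (f g : fld a b) : oi a b t ->
 nrm2 t (f * g)%fld <= 18 * (Nk e 1 t f * Nk e 1 t g).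
Proof.
 intros Ht.
 have P1 := N_nonneg e 1 t f Ht. have P2 := N_nonneg e 1 t g Ht.
 apply le_of_sq_le.
 { apply Rmult_le_pos; [lra|]. now apply Rmult_le_pos. }
 have H := Iint_cs t (f * f)%fld (g * g)%fld Ht.
 replace (Iint t ((f * f) * (g * g))%fld) with (nrm2 t (f * g)%fld) in H by (unfold nrm2; f_equal; fring).
 etr; [exact H|].
 have L1 := L4_bound e t f Ht. have L2 := L4_bound e t g Ht.
 etr; [apply Rmult_le_compat; [now apply nrm2_nonneg|now apply nrm2_nonneg|exact L1|exact L2]|].
 right; ring.
Qed.

(* [H^2] controls the vertical mean of [2 f^2 + f_z^2] uniformly in [(x, y)], because
 [\int f_z f_xyz dz = - \int f_zz f_xy dz]; the supremum in [z] is then one-dimensional. *)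
Lemma sup_bound {a b} e t (f : fld a b) x y z : oi a b t -> f t x y z ^ 2 <= 27 * Nk e 2 t f.
Proof.
 intros Ht. etr; [apply (sup_axis_sq AxZ (f t) 1 (fld_C1p f t Ht) Rlt_0_1)|]. rewrite fld_pd by exact Ht.
 set (fx := fder (Some AxX) f). set (fy := fder (Some AxY) f). set (fz := fder (Some AxZ) f).
 set (fxy := fder (Some AxY) fx). set (fxz := fder (Some AxX) fz). set (fyz := fder (Some AxY) fz). set (fzz := fder (Some AxZ) fz).
 set (h := (2 *: (f * f) + fz * fz)%fld).
 set (w := (2 *: (2 *: (fx * fy) + 2 *: (f * fxy) + fyz * fxz - fzz * fxy))%fld).
 set (k1 := (2 *: (f * f + fx * fx) + (fz * fz + fxz * fxz))%fld).
 set (k2 := (2 *: (f * f + fy * fy) + (fz * fz + fyz * fyz))%fld).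
 set (k := (2 *: (fx * fx + fy * fy) + 2 *: (f * f + fxy * fxy) + (fyz * fyz + fxz * fxz) + (fzz * fzz + fxy * fxy))%fld).
 assert (Y : forall u v, - (u * u + v * v) <= 2 * (u * v) <= u * u + v * v).
 { intros u v. have Q1 := Rle_0_sqr (u + v). have Q2 := Rle_0_sqr (u - v). unfold Rsqr in *. lra. }
 assert (Hx : fder (Some AxX) h = (2 *: (2 *: (f * fx)) + 2 *: (fz * fxz))%fld)
  by (unfold h; rewrite fder_add, fder_scal, !fder_mul; fold fx fxz; fring).
 assert (Hy : fder (Some AxY) h = (2 *: (2 *: (f * fy)) + 2 *: (fz * fyz))%fld)
  by (unfold h; rewrite fder_add, fder_scal, !fder_mul; fold fy fyz; fring).
 assert (Hxy : fder (Some AxY) (fder (Some AxX) h) = (w + fder (Some AxZ) (2 *: (fz * fxy)))%fld).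
 { rewrite Hx, fder_add, !fder_scal, !fder_mul. fold fy fxy fyz fzz.
  replace (fder (Some AxZ) fxy) with (fder (Some AxY) fxz)
   by (unfold fxy, fxz, fx, fz; now rewrite (fder_comm (Some AxX)), fder_comm).
  unfold w. fring. }
 assert (HB : Av AxZ (h t) x y z <= I3 (h t) + I3 (k1 t) + I3 (k2 t) + I3 (k t)).
 { apply (sup_plane (h t) (w t) (k1 t) (k2 t) (k t)); rewrite ?fld_pd by exact Ht;
   [now apply fld_C1p|now apply fld_C1p|now apply fld_c3|now apply fld_c3|now apply fld_c3|now apply fld_c3|now apply fv_per|now apply fv_per|now apply fv_per|..].
  - rewrite Hxy.
   change (Av AxZ (fun x y z => w t x y z + fder (Some AxZ) (2 *: (fz * fxy))%fld t x y z) = Av AxZ (w t)).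
   rewrite Av_plus, Av_fder by (easy || now apply fld_c3). ext3 x' y' z'. ring.
  - intros u v s. rewrite Hx. unfold k1. fat. apply Rabs_le.
   have Q1 := Y (f t u v s) (fx t u v s). have Q2 := Y (fz t u v s) (fxz t u v s). lra.
  - intros u v s. rewrite Hy. unfold k2. fat. apply Rabs_le.
   have Q1 := Y (f t u v s) (fy t u v s). have Q2 := Y (fz t u v s) (fyz t u v s). lra.
  - intros u v s. unfold w, k. fat. apply Rabs_le.
   have Q1 := Y (fx t u v s) (fy t u v s). have Q2 := Y (f t u v s) (fxy t u v s).
   have Q3 := Y (fyz t u v s) (fxz t u v s). have Q4 := Y (fzz t u v s) (fxy t u v s). lra. }
 apply Rle_trans with (Av AxZ (h t) x y z).
 { right. unfold Av. apply RInt_ext. intros r _. unfold h. simpl. fat. rewrite Rinv_1. unfold fz; ring. }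
 change (Av AxZ (h t) x y z <= Iint t h + Iint t k1 + Iint t k2 + Iint t k) in HB.
 unfold h at 2, k1, k2, k in HB. rewrite !Iint_add, !Iint_scal, !Iint_add in HB by exact Ht.
 have W := fun l => N_word e 2 t l f Ht.
 have W0 := W nil ltac:(simpl; lia). have W1 := W (Some AxX :: nil) ltac:(simpl; lia). have W2 := W (Some AxY :: nil) ltac:(simpl; lia).
 have W3 := W (Some AxZ :: nil) ltac:(simpl; lia). have W4 := W (Some AxY :: Some AxX :: nil) ltac:(simpl; lia).
 have W5 := W (Some AxX :: Some AxZ :: nil) ltac:(simpl; lia). have W6 := W (Some AxY :: Some AxZ :: nil) ltac:(simpl; lia).
 have W7 := W (Some AxZ :: Some AxZ :: nil) ltac:(simpl; lia).
 unfold Zw in *; simpl in W0, W1, W2, W3, W4, W5, W6, W7. unfold nrm2 in *. fold fx fy fz in W1, W2, W3, W4, W5, W6, W7.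
 fold fxy fxz fyz fzz in W4, W5, W6, W7. lra.
Qed.

Lemma prod_sup {a b} t (f g : fld a b) K : oi a b t -> (forall x y z, f t x y z ^ 2 <= K) ->
 nrm2 t (f * g)%fld <= K * nrm2 t g.
Proof.
 intros Ht H. unfold nrm2. rewrite <- Iint_scal by exact Ht. apply Iint_le; [exact Ht|].
 intros x y z. fat. replace (f t x y z * g t x y z * (f t x y z * g t x y z)) with (f t x y z ^ 2 * (g t x y z * g t x y z)) by ring.
 apply Rmult_le_compat_r; [apply Rle_0_sqr|apply H].
Qed.

(** * Product and commutator estimates *)

Lemma fmul_comm {a b} (f g : fld a b) : (f * g = g * f)%fld.
Proof. fring. Qed.

(** At order 0 the condition [i + j >= 2] allows L^2 times L^infinity, or L^4 times L^4. The Leibniz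
    rule lowers [k] and one of the two indices together, which preserves [k + 2 <= i + j]. *)
Lemma prod_bound k : forall i j, (k <= i)%nat -> (k <= j)%nat -> (k + 2 <= i + j)%nat ->
 exists C, 0 <= C /\ forall a b e t (f g : fld a b), oi a b t ->
  Nk e k t (f * g)%fld <= C * (Nk e i t f * Nk e j t g).
Proof.
 assert (B0 : forall i j, (2 <= i + j)%nat -> exists C, 0 <= C /\ forall a b e t (f g : fld a b), oi a b t ->
  nrm2 t (f * g)%fld <= C * (Nk e i t f * Nk e j t g)).
 { intros i j Hij. destruct i as [|[|i]].
  - exists 27. split; [lra|]. intros a b e t f g Ht. rewrite fmul_comm.
   etr; [apply (prod_sup t g f (27 * Nk e 2 t g) Ht); intros; now apply sup_bound|].
   have H := N_mono e 2 j t g Ht ltac:(lia). have P := N_nonneg e 0 t f Ht. rewrite N_0 in *.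
   assert (Nk e 2 t g * nrm2 t f <= Nk e j t g * nrm2 t f) by now apply Rmult_le_compat_r. lra.
  - exists 18. split; [lra|]. intros a b e t f g Ht.
   etr; [now apply (prod_11 e)|].
   have H := N_mono e 1 j t g Ht ltac:(lia). have P := N_nonneg e 1 t f Ht.
   assert (Nk e 1 t f * Nk e 1 t g <= Nk e 1 t f * Nk e j t g) by now apply Rmult_le_compat_l. lra.
  - exists 27. split; [lra|]. intros a b e t f g Ht.
   etr; [apply (prod_sup t f g (27 * Nk e 2 t f) Ht); intros; now apply sup_bound|].
   have H := N_mono e 2 (S (S i)) t f Ht ltac:(lia). have H' := N_mono e 0 j t g Ht ltac:(lia).
   rewrite N_0 in H'. have P := N_nonneg e 2 t f Ht. have P' := nrm2_nonneg t g Ht.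
   assert (Nk e 2 t f * nrm2 t g <= Nk e (S (S i)) t f * Nk e j t g) by now apply Rmult_le_compat. lra. }
 induction k; intros i j Hi Hj Hij; [destruct (B0 i j ltac:(lia)) as [C HC]; exists C; exact HC|].
 destruct i as [|i]; [lia|]. destruct j as [|j]; [lia|].
 destruct (B0 (S i) (S j) ltac:(lia)) as [C0 [P0 H0]].
 destruct (IHk i (S j)) as [C1 [P1 H1]]; [lia..|].
 destruct (IHk (S i) j) as [C2 [P2 H2]]; [lia..|].
 exists (C0 + 8 * C1 + 8 * C2). split; [lra|]. intros a b e t f g Ht. rewrite N_S.
 set (X := Nk e (S i) t f * Nk e (S j) t g).
 assert (Hd : forall d, Nk e k t (Zd e d (f * g)%fld) <= 2 * (C1 + C2) * X).
 { intros d. rewrite Z_mul. etr; [now apply N_add|].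
  have E1 := H1 a b e t (Zd e d f) g Ht. have E2 := H2 a b e t f (Zd e d g) Ht.
  assert (D1 : Nk e i t (Zd e d f) * Nk e (S j) t g <= X).
  { apply Rmult_le_compat_r; [now apply N_nonneg|now apply N_Z]. }
  assert (D2 : Nk e (S i) t f * Nk e j t (Zd e d g) <= X).
  { apply Rmult_le_compat_l; [now apply N_nonneg|now apply N_Z]. }
  assert (C1 * (Nk e i t (Zd e d f) * Nk e (S j) t g) <= C1 * X) by now apply Rmult_le_compat_l.
  assert (C2 * (Nk e (S i) t f * Nk e j t (Zd e d g)) <= C2 * X) by now apply Rmult_le_compat_l. lra. }
 have E0 := H0 a b e t f g Ht. fold X in E0.
 have Q := sum4_le (fun d => Nk e k t (Zd e d (f * g)%fld)) (fun _ => 2 * (C1 + C2) * X) Hd.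
 unfold sum4 at 2 in Q. lra.
Qed.

(** A single derivative is distributed by the Leibniz rule, and the algebra property is used at
    order [2 + m]; the top order therefore falls on one factor at a time and the estimate is linear
    in it. *)
Lemma prod_tame m : exists C, 0 <= C /\ forall a b e t (f g : fld a b), oi a b t ->
 Nk e (3 + m) t (f * g)%fld
 <= C * (Nk e (3 + m) t f * Nk e (2 + m) t g + Nk e (2 + m) t f * Nk e (3 + m) t g).
Proof.
 destruct (prod_bound (2 + m) (2 + m) (2 + m)) as [C1 [P1 H1]]; [lia..|].
 destruct (prod_bound 0 (3 + m) (2 + m)) as [C0 [P0 H0]]; [lia..|].
 exists (C0 + 8 * C1). split; [lra|]. intros a b e t f g Ht. change (3 + m)%nat with (S (2 + m)) in *. rewrite N_S.
 set (X := Nk e (S (2 + m)) t f * Nk e (2 + m) t g + Nk e (2 + m) t f * Nk e (S (2 + m)) t g).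
 assert (N2 : forall k (h : fld a b), 0 <= Nk e k t h) by (intros; now apply N_nonneg).
 assert (X0 : Nk e (S (2 + m)) t f * Nk e (2 + m) t g <= X) by (unfold X; assert (0 <= Nk e (2 + m) t f * Nk e (S (2 + m)) t g) by (now apply Rmult_le_pos); lra).
 assert (Hd : forall d, Nk e (2 + m) t (Zd e d (f * g)%fld) <= 2 * C1 * X).
 { intros d. rewrite Z_mul. etr; [now apply N_add|].
  have E1 := H1 a b e t (Zd e d f) g Ht. have E2 := H1 a b e t f (Zd e d g) Ht.
  assert (C1 * (Nk e (2 + m) t (Zd e d f) * Nk e (2 + m) t g + Nk e (2 + m) t f * Nk e (2 + m) t (Zd e d g)) <= C1 * X)
   by (apply Rmult_le_compat_l; [easy|]; apply Rplus_le_compat; [apply Rmult_le_compat_r|apply Rmult_le_compat_l]; easy || now apply N_Z). lra. }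
 have E0 := H0 a b e t f g Ht. rewrite N_0 in E0.
 assert (C0 * (Nk e (S (2 + m)) t f * Nk e (2 + m) t g) <= C0 * X) by now apply Rmult_le_compat_l.
 have Q := sum4_le (fun d => Nk e (2 + m) t (Zd e d (f * g)%fld)) (fun _ => 2 * C1 * X) Hd.
 unfold sum4 at 2 in Q. lra.
Qed.

Definition com {a b} (e : R) (l : list (option axis)) (f g : fld a b) : fld a b :=
 (Zw e l (f * g) - f * Zw e l g)%fld.

Lemma com_nil {a b} e (f g : fld a b) : com e nil f g = fcst 0.
Proof. unfold com, Zw; simpl. fring. Qed.

Lemma com_app {a b} e l d (f g : fld a b) :
 com e (l ++ d :: nil) f g = (Zw e l (Zd e d f * g) + com e l f (Zd e d g))%fld.
Proof. unfold com. rewrite !Zw_app, Z_mul, Zw_add. fring. Qed.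

Lemma com_add {a b} e l (f f' g : fld a b) : com e l (f + f')%fld g = (com e l f g + com e l f' g)%fld.
Proof.
 unfold com. replace ((f + f') * g)%fld with (f * g + f' * g)%fld by fring. rewrite Zw_add. fring.
Qed.

Lemma com_cst {a b} e l k (g : fld a b) : com e l (fcst k) g = fcst 0.
Proof. unfold com. rewrite <- fscal_cst, Zw_scal. fring. Qed.

Lemma com_scal_swap {a b} e l k (f g : fld a b) : com e l (k *: f)%fld g = com e l f (k *: g)%fld.
Proof.
 unfold com. rewrite Zw_scal. replace (k *: f * g)%fld with (f * (k *: g))%fld by fring. fring.
Qed.

(** A commutator never puts all its letters on [g]. [com_app] splits it into a product in which the
    innermost letter falls on [f], covered by [prod_bound], and a shorter commutator in which that
    letter falls on [g]; this explains the shift from [i] to [S i] on [f] alone. *)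
Lemma com_bound m : forall i j, (m <= i)%nat -> (m <= j)%nat -> (m + 2 <= i + j)%nat ->
 exists C, 0 <= C /\ forall a b e t (f g : fld a b) l, oi a b t -> (length l <= S m)%nat ->
  nrm2 t (com e l f g) <= C * (Nk e (S i) t f * Nk e j t g).
Proof.
 assert (Hnil : forall C i j, 0 <= C -> forall a b e t (f g : fld a b), oi a b t ->
  nrm2 t (com e nil f g) <= C * (Nk e (S i) t f * Nk e j t g)).
 { intros C i j HC a b e t f g Ht. rewrite com_nil, nrm2_cst0 by exact Ht.
  apply Rmult_le_pos; [easy|]. apply Rmult_le_pos; now apply N_nonneg. }
 assert (H1st : forall m i j, (m <= i)%nat -> (m <= j)%nat -> (m + 2 <= i + j)%nat ->
  exists C, 0 <= C /\ forall a b e t (f g : fld a b) l d, oi a b t -> (length l <= m)%nat ->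
  nrm2 t (Zw e l (Zd e d f * g)%fld) <= C * (Nk e (S i) t f * Nk e j t g)).
 { intros m' i j Hi Hj Hij. destruct (prod_bound m' i j Hi Hj Hij) as [C [P H]].
  exists C. split; [easy|]. intros a b e t f g l d Ht Hl.
  etr; [apply (N_word e m'); easy|]. etr; [now apply H|].
  apply Rmult_le_compat_l; [easy|]. apply Rmult_le_compat_r; [now apply N_nonneg|now apply N_Z]. }
 induction m; intros i j Hi Hj Hij; destruct (H1st _ i j Hi Hj Hij) as [C1 [P1 E1]].
 - exists (2 * C1). split; [lra|]. intros a b e t f g l Ht Hl.
  destruct l as [|d l _] using rev_ind; [apply Hnil; [lra|easy]|].
  rewrite length_app in Hl; simpl in Hl. destruct l; [|simpl in Hl; lia].
  rewrite com_app, com_nil. etr; [now apply nrm2_add|]. rewrite nrm2_cst0 by easy.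
  have Q := E1 a b e t f g nil d Ht ltac:(simpl; lia). lra.
 - destruct j as [|j]; [lia|].
  destruct (IHm i j) as [C2 [P2 E2]]; [lia..|].
  exists (2 * (C1 + C2)). split; [lra|]. intros a b e t f g l Ht Hl.
  destruct l as [|d l _] using rev_ind; [apply Hnil; [lra|easy]|].
  rewrite length_app in Hl; simpl in Hl. rewrite com_app.
  etr; [now apply nrm2_add|].
  have Q1 := E1 a b e t f g l d Ht ltac:(lia).
  have Q2 := E2 a b e t f (Zd e d g) l Ht ltac:(lia).
  assert (C2 * (Nk e (S i) t f * Nk e j t (Zd e d g)) <= C2 * (Nk e (S i) t f * Nk e (S j) t g)).
  { apply Rmult_le_compat_l; [easy|]. apply Rmult_le_compat_l; [now apply N_nonneg|now apply N_Z]. }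
  lra.
Qed.

(** The innermost letter is split off once: its product with [g] is estimated by [prod_tame], while
    the remaining commutator is one letter shorter and is covered by [com_bound] at order
    [2 + m]. *)
Lemma com_tame m : exists C, 0 <= C /\ forall a b e t (f g : fld a b) l, oi a b t -> (length l <= 4 + m)%nat ->
 nrm2 t (com e l f g) <= C * (Nk e (4 + m) t f * Nk e (2 + m) t g + Nk e (3 + m) t f * Nk e (3 + m) t g).
Proof.
 destruct (prod_tame m) as [C1 [P1 E1]]. destruct (com_bound (2 + m) (2 + m) (2 + m)) as [C2 [P2 E2]]; [lia..|].
 exists (2 * (C1 + C2)). split; [lra|]. intros a b e t f g l Ht Hl.
 set (X := Nk e (4 + m) t f * Nk e (2 + m) t g + Nk e (3 + m) t f * Nk e (3 + m) t g).
 assert (N2 : forall k (h : fld a b), 0 <= Nk e k t h) by (intros; now apply N_nonneg).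
 assert (X1 : forall k k', 0 <= Nk e k t f * Nk e k' t g) by (intros; now apply Rmult_le_pos).
 have Y1 := X1 (4 + m)%nat (2 + m)%nat. have Y2 := X1 (3 + m)%nat (3 + m)%nat.
 destruct l as [|d l _] using rev_ind.
 { rewrite com_nil, nrm2_cst0 by exact Ht. apply Rmult_le_pos; unfold X; lra. }
 rewrite length_app in Hl; cbn [length] in Hl. rewrite com_app.
 etr; [now apply nrm2_add|].
 assert (Q1 : nrm2 t (Zw e l (Zd e d f * g)%fld) <= C1 * X).
 { etr; [apply (N_word e (3 + m)); [easy|lia]|]. etr; [now apply E1|].
  apply Rmult_le_compat_l; [easy|]. apply Rplus_le_compat; apply Rmult_le_compat_r; [easy|now apply (N_Z e (3 + m))|easy|now apply (N_Z e (2 + m))]. }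
 have Q2 := E2 a b e t f (Zd e d g) l Ht ltac:(lia).
 assert (C2 * (Nk e (3 + m) t f * Nk e (2 + m) t (Zd e d g)) <= C2 * X).
 { apply Rmult_le_compat_l; [easy|]. unfold X.
  assert (Nk e (3 + m) t f * Nk e (2 + m) t (Zd e d g) <= Nk e (3 + m) t f * Nk e (3 + m) t g) by (apply Rmult_le_compat_l; [easy|now apply (N_Z e (2 + m))]). lra. }
 change (S (2 + m)) with (3 + m)%nat in Q2. lra.
Qed.

Global Opaque nrm2 Iint.

(** * The difference-regularised energy estimate *)

(* The centred difference quotient; [h = 0] stands for the derivative itself. *)
Definition Dh {a b} (h : R) (c : axis) (f : fld a b) : fld a b :=
 if Req_dec_T h 0 then fder (Some c) f else (/ (2 * h) *: (fsh c h f - fsh c (- h) f))%fld.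

Lemma fsh_add {a b} c s (f g : fld a b) : fsh c s (f + g)%fld = (fsh c s f + fsh c s g)%fld.
Proof. apply fld_eq; intros. rewrite fadd_at, !fsh_at. destruct c; unfold tshift; now rewrite fadd_at. Qed.

Lemma fsh_mul {a b} c s (f g : fld a b) : fsh c s (f * g)%fld = (fsh c s f * fsh c s g)%fld.
Proof. apply fld_eq; intros. rewrite fmul_at, !fsh_at. destruct c; unfold tshift; now rewrite fmul_at. Qed.

Lemma fsh_scal {a b} c s k (f : fld a b) : fsh c s (k *: f)%fld = (k *: fsh c s f)%fld.
Proof. apply fld_eq; intros. rewrite fscal_at, !fsh_at. destruct c; unfold tshift; now rewrite fscal_at. Qed.

Lemma fsh_sh {a b} c s r (f : fld a b) : fsh c s (fsh c r f) = fsh c (s + r) f.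
Proof.
 apply fld_eq; intros. rewrite !fsh_at. destruct c; unfold tshift; rewrite fsh_at; unfold tshift; f_equal; ring.
Qed.

Lemma fsh_0 {a b} c (f : fld a b) : fsh c 0 f = f.
Proof. apply fld_eq; intros. rewrite !fsh_at. destruct c; unfold tshift; f_equal; ring. Qed.

Lemma Dh_add {a b} h c (f g : fld a b) : Dh h c (f + g)%fld = (Dh h c f + Dh h c g)%fld.
Proof. unfold Dh. destruct Req_dec_T; [apply fder_add|]. rewrite !fsh_add. fring. Qed.

Lemma Dh_scal {a b} h c k (f : fld a b) : Dh h c (k *: f)%fld = (k *: Dh h c f)%fld.
Proof. unfold Dh. destruct Req_dec_T; [apply fder_scal|]. rewrite !fsh_scal. fring. Qed.

Lemma Dh_sub {a b} h c (f g : fld a b) : Dh h c (f - g)%fld = (Dh h c f - Dh h c g)%fld.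
Proof. unfold fsub, fopp. now rewrite Dh_add, Dh_scal. Qed.

Lemma fder_Dh {a b} h c d (f : fld a b) : fder d (Dh h c f) = Dh h c (fder d f).
Proof.
 unfold Dh. destruct Req_dec_T; [apply fder_comm|]. now rewrite fder_scal, fder_sub, !fder_sh.
Qed.

Lemma Z_Dh {a b} h c e d (f : fld a b) : Zd e d (Dh h c f) = Dh h c (Zd e d f).
Proof. destruct d; simpl; rewrite fder_Dh; [easy|]. now rewrite Dh_scal. Qed.

Lemma Zw_Dh {a b} h c e l (f : fld a b) : Zw e l (Dh h c f) = Dh h c (Zw e l f).
Proof. induction l; simpl; [easy|]. fold (Zw e l (Dh h c f)). now rewrite IHl, Z_Dh. Qed.

Lemma Dh_at {a b} h c (f : fld a b) t x y z : h <> 0 ->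
 Dh h c f t x y z = (slice c (f t) x y z (coord c x y z + h) - slice c (f t) x y z (coord c x y z - h)) / (2 * h).
Proof.
 intros Hh. unfold Dh. destruct Req_dec_T; [easy|]. fat. rewrite !fsh_at.
 destruct c; unfold tshift, slice, coord, Rminus; field; easy.
Qed.

Lemma fld_slice_derive {a b} c (f : fld a b) t x y z r : oi a b t ->
 is_derive (slice c (f t) x y z) r (slice c (fder (Some c) f t) x y z r).
Proof.
 intros Ht. rewrite <- fld_pd by exact Ht. apply C1p_slice_derive. now apply fld_C1p.
Qed.

Lemma slice_bound c (f : sfield) K : (forall x y z, Rabs (f x y z) <= K) -> forall x y z r, Rabs (slice c f x y z r) <= K.
Proof. intros H x y z r. destruct c; apply H. Qed.

Lemma shift_bound {a b} c s (f : fld a b) t K x y z : oi a b t ->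
 (forall x y z, Rabs (fder (Some c) f t x y z) <= K) -> Rabs (fsh c s f t x y z - f t x y z) <= K * Rabs s.
Proof.
 intros Ht HK. rewrite fsh_at.
 replace (tshift c s f t x y z) with (slice c (f t) x y z (coord c x y z + s)) by now destruct c.
 rewrite <- (slice_coord c (f t) x y z).
 replace (Rabs s) with (Rabs (coord c x y z + s - coord c x y z)) by (f_equal; ring).
 apply (MVT_Rabs_le (slice c (f t) x y z) (slice c (fder (Some c) f t) x y z)).
 - intros. now apply fld_slice_derive.
 - intros. apply slice_continuous. now apply fld_c3.
 - intros. now apply slice_bound.
Qed.

Lemma Dh_sup {a b} h c (f : fld a b) t K : oi a b t ->
 (forall x y z, Rabs (fder (Some c) f t x y z) <= K) -> forall x y z, Rabs (Dh h c f t x y z) <= K.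
Proof.
 intros Ht HK x y z. destruct (Req_dec h 0) as [->|Hh].
 - unfold Dh. destruct Req_dec_T; [apply HK|easy].
 - rewrite Dh_at by exact Hh. unfold Rdiv. rewrite Rabs_mult, Rabs_inv.
  assert (Hp : 0 < Rabs (2 * h)) by (apply Rabs_pos_lt; lra).
  apply Rmult_le_reg_r with (Rabs (2 * h)); [exact Hp|].
  rewrite Rmult_assoc, Rinv_l, Rmult_1_r by lra.
  replace (Rabs (2 * h)) with (Rabs (coord c x y z + h - (coord c x y z - h))) by (f_equal; ring).
  apply (MVT_Rabs_le (slice c (f t) x y z) (slice c (fder (Some c) f t) x y z)).
  + intros. now apply fld_slice_derive.
  + intros. apply slice_continuous. now apply fld_c3.
  + intros. now apply slice_bound.
Qed.

(** Two applications of the mean value theorem: to [g r - l r] between the two shifted points, and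
    to the derivative between the centre and an intermediate point. The error is of first order in
    [h] at the price of two derivatives. *)
Lemma Dh_consistent {a b} h c (f : fld a b) t K : oi a b t -> 0 <= h ->
 (forall x y z, Rabs (fder (Some c) (fder (Some c) f) t x y z) <= K) ->
 forall x y z, Rabs (Dh h c f t x y z - fder (Some c) f t x y z) <= K * h.
Proof.
 intros Ht Hh HK x y z.
 destruct (Req_dec h 0) as [->|Hh0].
 { unfold Dh. destruct Req_dec_T; [|easy]. rewrite Rminus_diag, Rabs_R0. lra. }
 rewrite Dh_at by exact Hh0.
 set (g := slice c (f t) x y z). set (u := coord c x y z). set (l := fder (Some c) f t x y z).
 assert (El : l = slice c (fder (Some c) f t) x y z u) by (unfold l, u; now rewrite slice_coord).
 replace ((g (u + h) - g (u - h)) / (2 * h) - l)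
  with (((g (u + h) - l * (u + h)) - (g (u - h) - l * (u - h))) / (2 * h)) by (field; easy).
 unfold Rdiv. rewrite Rabs_mult, Rabs_inv, (Rabs_right (2 * h)) by lra.
 apply Rmult_le_reg_r with (2 * h); [lra|]. rewrite Rmult_assoc, Rinv_l, Rmult_1_r by lra.
 replace (K * h * (2 * h)) with (K * h * Rabs (u + h - (u - h))) by (rewrite Rabs_right; [ring|lra]).
 apply (MVT_Rabs_le (fun r => g r - l * r) (fun r => slice c (fder (Some c) f t) x y z r - l)).
 - intros r _. apply (is_derive_minus (K:=RA) (V:=RN)); [now apply fld_slice_derive|].
  auto_derive; [easy|ring].
 - intros r _. apply continuous_of_ex_derive. eexists.
  apply (is_derive_minus (K:=RA) (V:=RN)); [now apply fld_slice_derive|].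
  auto_derive; [easy|reflexivity].
 - intros r Hr. rewrite Rmin_left, Rmax_right in Hr by lra. rewrite El.
  etr.
  + apply (MVT_Rabs_le (slice c (fder (Some c) f t) x y z) (slice c (fder (Some c) (fder (Some c) f) t) x y z) u r K).
   * intros. now apply fld_slice_derive.
   * intros. apply slice_continuous. now apply fld_c3.
   * intros. now apply slice_bound.
  + apply Rmult_le_compat_l.
   * etr; [apply Rabs_pos|apply (HK x y z)].
   * apply Rabs_le; lra.
Qed.

(* By duality: pairing the difference with any [g], the mean value theorem in the
 shift [s] bounds the pairing by [2 h] times the norms, and then [g] is the difference. *)
Lemma shift_diff_L2 {a b} h c (f : fld a b) t : oi a b t -> 0 <= h ->
 nrm2 t (fsh c h f - fsh c (- h) f)%fld <= 4 * h ^ 2 * nrm2 t (fder (Some c) f).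
Proof.
 intros Ht Hh. set (w := (fsh c h f - fsh c (- h) f)%fld). set (A := nrm2 t (fder (Some c) f)). set (W := nrm2 t w).
 assert (PA : 0 <= A) by now apply nrm2_nonneg. assert (PW : 0 <= W) by now apply nrm2_nonneg.
 assert (C : forall (u : fld a b) s x y z, c4 (fun s x y z => fsh c s u t x y z) s x y z).
 { intros u s x y z. apply c4_intro.
  assert (Ad : forall X p, continuous X p -> continuous (fun q : R * R * R * R => X q + fst (fst (fst q))) p) by (intros; apply (continuous_plus (V:=RN)); [easy|cproj]).
  apply (continuous_ext (fun q => tshift c (fst (fst (fst q))) u t (snd (fst (fst q))) (snd (fst q)) (snd q))); [intros; now rewrite fsh_at|].
  destruct c; cbn [tshift]; (apply c3_comp; [now apply fld_c3|..]).
  - apply Ad; cproj. - cproj. - cproj.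
  - cproj. - apply Ad; cproj. - cproj.
  - cproj. - cproj. - apply Ad; cproj. }
 assert (D : forall s, is_derive (fun s => Iint t (fsh c s f * w)%fld) s (Iint t (fsh c s (fder (Some c) f) * w)%fld)).
 { intros s. Transparent Iint. unfold Iint. Opaque Iint.
  apply (I3_derive (fun _ => True) (fun s => (fsh c s f * w)%fld t) (fun s => (fsh c s (fder (Some c) f) * w)%fld t)); [apply open_true| | | |easy].
  - intros r x y z _. apply (is_derive_ext (fun r => w t x y z * fsh c r f t x y z)); [intros r'; rewrite fmul_at; apply Rmult_comm|].
   rewrite fmul_at, Rmult_comm. apply (is_derive_scal (fun r => fsh c r f t x y z)).
   apply (is_derive_ext (fun r => slice c (f t) x y z (coord c x y z + r))); [intros; rewrite fsh_at; now destruct c|].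
   rewrite fsh_at. replace (tshift c r (fder (Some c) f) t x y z) with (1 * slice c (fder (Some c) f t) x y z (coord c x y z + r)) by (destruct c; cbn [tshift slice coord]; ring).
   apply (is_derive_comp (slice c (f t) x y z) (fun r => coord c x y z + r)); [now apply fld_slice_derive|]. auto_derive; [easy|ring].
  - intros r x y z _. apply (c4_ext_loc (fun r x y z => fsh c r f t x y z * w t x y z) _ (fun _ => True)); [apply open_true|easy|intros; now rewrite fmul_at|].
   apply c4_mult; [apply C|now apply fld_c3].
  - intros r x y z _. apply (c4_ext_loc (fun r x y z => fsh c r (fder (Some c) f) t x y z * w t x y z) _ (fun _ => True)); [apply open_true|easy|intros; now rewrite fmul_at|].
   apply c4_mult; [apply C|now apply fld_c3]. }
 assert (B : forall s, Rabs (Iint t (fsh c s (fder (Some c) f) * w)%fld) <= sqrt (A * W)).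
 { intros s. apply le_of_sq_le; [apply sqrt_pos|]. rewrite pow2_abs, pow2_sqrt by now apply Rmult_le_pos.
  etr; [now apply Iint_cs|]. rewrite nrm2_sh by easy. apply Rle_refl. }
 assert (M : Rabs (Iint t (fsh c h f * w)%fld - Iint t (fsh c (- h) f * w)%fld) <= sqrt (A * W) * Rabs (h - - h)).
 { apply (MVT_Rabs_le (fun s => Iint t (fsh c s f * w)%fld) (fun s => Iint t (fsh c s (fder (Some c) f) * w)%fld)); intros s _; [apply D| |apply B].
  apply continuous_of_ex_derive. eexists. apply D. }
 rewrite (Rabs_right (h - - h)) in M by lra.
 assert (E : W = Iint t (fsh c h f * w)%fld - Iint t (fsh c (- h) f * w)%fld).
 { rewrite <- Iint_sub by easy. unfold W. Transparent nrm2. unfold nrm2. Opaque nrm2. f_equal. unfold w at 1. fring. }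
 rewrite <- E, Rabs_right in M by lra.
 assert (S : W ^ 2 <= (sqrt (A * W) * (2 * h)) ^ 2) by (apply pow_incr; lra).
 rewrite Rpow_mult_distr, pow2_sqrt in S by now apply Rmult_le_pos.
 destruct (Req_dec W 0) as [->|N]; [apply Rmult_le_pos; [nra|easy]|]. apply Rmult_le_reg_l with W; [lra|]. nra.
Qed.

Lemma Dh_L2 {a b} h c (f : fld a b) t : oi a b t -> 0 <= h -> nrm2 t (Dh h c f) <= nrm2 t (fder (Some c) f).
Proof.
 intros Ht Hh. unfold Dh. destruct Req_dec_T as [E|N]; [apply Rle_refl|].
 rewrite nrm2_scal by easy. have Q := shift_diff_L2 h c f t Ht Hh. assert (P2 : 0 < (/ (2 * h)) ^ 2) by (apply pow_lt, Rinv_0_lt_compat; lra).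
 etr; [apply Rmult_le_compat_l; [lra|exact Q]|]. right. field. easy.
Qed.

Lemma N_Dh {a b} e k h c (f : fld a b) t : oi a b t -> 0 <= h -> Nk e k t (Dh h c f) <= Nk e (S k) t f.
Proof.
 intros Ht Hh. apply Rle_trans with (Nk e k t (Zd e (Some c) f)); [|now apply N_Z].
 apply SW_le. intros l _. rewrite Zw_Dh, Zw_Z. now apply Dh_L2.
Qed.

Lemma Iint_bound {a b} t (g f : fld a b) K : oi a b t -> (forall x y z, Rabs (g t x y z) <= K) ->
 Rabs (Iint t (g * (f * f))%fld) <= K * nrm2 t f.
Proof.
 intros Ht HK. replace (K * nrm2 t f) with (Iint t (K *: (f * f))%fld).
 - apply Iint_abs_le; [exact Ht|]. intros. fat. rewrite Rabs_mult, (Rabs_right (f t x y z * f t x y z)).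
  + apply Rmult_le_compat_r; [apply Rle_0_sqr|apply HK].
  + apply Rle_ge, Rle_0_sqr.
 - rewrite Iint_scal by exact Ht. reflexivity.
Qed.

Lemma Iint_bound2 {a b} t (g f f' : fld a b) K : oi a b t -> (forall x y z, Rabs (g t x y z) <= K) ->
 2 * Rabs (Iint t (g * (f * f'))%fld) <= K * (nrm2 t f + nrm2 t f').
Proof.
 intros Ht HK.
 replace (K * (nrm2 t f + nrm2 t f')) with (2 * Iint t ((K / 2) *: (f * f + f' * f'))%fld).
 - apply Rmult_le_compat_l; [lra|]. apply Iint_abs_le; [exact Ht|]. intros. fat. rewrite Rabs_mult.
  assert (A : 2 * Rabs (f t x y z * f' t x y z) <= f t x y z * f t x y z + f' t x y z * f' t x y z).
  { have H1 := Rle_0_sqr (f t x y z - f' t x y z). have H2 := Rle_0_sqr (f t x y z + f' t x y z).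
   unfold Rsqr in H1, H2. unfold Rabs; destruct Rcase_abs; lra. }
  specialize (HK x y z). assert (0 <= Rabs (g t x y z)) by apply Rabs_pos.
  assert (0 <= Rabs (f t x y z * f' t x y z)) by apply Rabs_pos. nra.
 - rewrite Iint_scal, Iint_add by exact Ht. change (Iint t (f * f)%fld) with (nrm2 t f).
  change (Iint t (f' * f')%fld) with (nrm2 t f'). field.
Qed.

(** Discrete integration by parts. Translating the backward-shifted terms by [h] leaves the factor
    [(g - g(. + h)) / (2 h)], bounded by the derivative of [g]; no derivative falls on [f] or [f'],
    and the bound is uniform in [h]. At [h = 0] it is the usual integration by parts. *)
Lemma Dh_skew {a b} h c t (g f f' : fld a b) K : oi a b t -> 0 <= h ->
 (forall x y z, Rabs (fder (Some c) g t x y z) <= K) ->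
 Rabs (Iint t (g * (Dh h c f * f' + f * Dh h c f'))%fld) <= K * (nrm2 t f + nrm2 t f').
Proof.
 intros Ht Hh HK.
 assert (K0 : 0 <= K) by (etr; [apply Rabs_pos|apply (HK 0 0 0)]).
 have P1 := nrm2_nonneg t f Ht. have P2 := nrm2_nonneg t f' Ht.
 assert (P : 0 <= K * (nrm2 t f + nrm2 t f')) by (apply Rmult_le_pos; lra).
 unfold Dh. destruct Req_dec_T as [E|Hh0].
 - replace (g * (fder (Some c) f * f' + f * fder (Some c) f'))%fld with (g * fder (Some c) (f * f'))%fld
   by (rewrite fder_mul; fring).
  rewrite fmul_comm, Iint_parts by exact Ht. rewrite Rabs_Ropp, fmul_comm.
  have H := Iint_bound2 t (fder (Some c) g) f f' K Ht HK. lra.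
 - set (p := fsh c h). set (m := fsh c (- h)).
  assert (E : Iint t (g * (/ (2 * h) *: (p f - m f) * f' + f * (/ (2 * h) *: (p f' - m f'))))%fld
   = / (2 * h) * Iint t ((g - p g) * (p f * f' + f * p f'))%fld).
  { rewrite <- Iint_scal by exact Ht.
   assert (S1 : Iint t (g * (m f * f'))%fld = Iint t (p g * (f * p f'))%fld).
   { rewrite <- (Iint_sh t c h (g * (m f * f'))%fld) by exact Ht. rewrite !fsh_mul. unfold m. rewrite fsh_sh.
    replace (h + - h) with 0 by ring. rewrite fsh_0. reflexivity. }
   assert (S2 : Iint t (g * (f * m f'))%fld = Iint t (p g * (p f * f'))%fld).
   { rewrite <- (Iint_sh t c h (g * (f * m f'))%fld) by exact Ht. rewrite !fsh_mul. unfold m. rewrite fsh_sh.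
    replace (h + - h) with 0 by ring. rewrite fsh_0. reflexivity. }
   replace (g * (/ (2 * h) *: (p f - m f) * f' + f * (/ (2 * h) *: (p f' - m f'))))%fld
    with (/ (2 * h) *: (g * (p f * f') + g * (f * p f') - g * (m f * f') - g * (f * m f')))%fld by fring.
   replace (/ (2 * h) *: ((g - p g) * (p f * f' + f * p f')))%fld
    with (/ (2 * h) *: (g * (p f * f') + g * (f * p f') - p g * (f * p f') - p g * (p f * f')))%fld by fring.
   rewrite !Iint_scal, !Iint_sub, !Iint_add by exact Ht. rewrite S1, S2. ring. }
  rewrite E. rewrite Rabs_mult, Rabs_inv, (Rabs_right (2 * h)) by lra.
  assert (B : Rabs (Iint t ((g - p g) * (p f * f' + f * p f'))%fld) <= K * h * (nrm2 t f + nrm2 t f')).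
  { replace ((g - p g) * (p f * f' + f * p f'))%fld with ((g - p g) * (p f * f') + (g - p g) * (f * p f'))%fld by fring.
   rewrite Iint_add by exact Ht. etr; [apply Rabs_triang|].
   assert (HG : forall x y z, Rabs ((g - p g)%fld t x y z) <= K * h).
   { intros x y z. rewrite fsub_at, Rabs_minus_sym.
    replace (K * h) with (K * Rabs h) by (rewrite (Rabs_right h); lra). now apply shift_bound. }
   have B1 := Iint_bound2 t (g - p g)%fld (p f) f' (K * h) Ht HG.
   have B2 := Iint_bound2 t (g - p g)%fld f (p f') (K * h) Ht HG.
   assert (F1 : nrm2 t (p f) = nrm2 t f) by (now apply nrm2_sh).
   assert (F2 : nrm2 t (p f') = nrm2 t f') by (now apply nrm2_sh).
   rewrite F1 in B1. rewrite F2 in B2. lra. }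
  apply Rmult_le_reg_l with (2 * h); [lra|]. rewrite <- Rmult_assoc, Rinv_r, Rmult_1_l by lra.
  etr; [exact B|].
  replace (K * h * (nrm2 t f + nrm2 t f')) with (h * (K * (nrm2 t f + nrm2 t f'))) by ring. nra.
Qed.

Inductive cmp := cQ | cH | cV1 | cV2 | cW.

Definition sumc (F : cmp -> R) : R := F cQ + F cH + F cV1 + F cV2 + F cW.

Definition vel (i : axis) : cmp := match i with AxX => cV1 | AxY => cV2 | AxZ => cW end.

Definition sum3 {a b} (F : axis -> fld a b) : fld a b := (F AxX + F AxY + F AxZ)%fld.

(** The antisymmetric part: divergence against gradient with the common coefficient [bb], and the
    exchange between [cH] and [cW] with coefficient [ss]. Paired with [V] and summed, the [ss] terms
    cancel pointwise and the [bb] terms form the combinations treated by [Dh_skew]. *)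
Definition coupling {a b} (h : R) (bb ss : fld a b) (V : cmp -> fld a b) (c : cmp) : fld a b :=
 match c with
 | cQ => sum3 (fun i => bb * Dh h i (V (vel i)))%fld
 | cH => fopp (ss * V cW)%fld
 | cV1 => (bb * Dh h AxX (V cQ))%fld
 | cV2 => (bb * Dh h AxY (V cQ))%fld
 | cW => (bb * Dh h AxZ (V cQ) + ss * V cH)%fld
 end.

Definition Lop {a b} (h : R) (m : cmp -> fld a b) (al : cmp -> axis -> fld a b) (bb ss : fld a b)
  (V : cmp -> fld a b) (c : cmp) : fld a b :=
 (m c * fder None (V c) + sum3 (fun i => al c i * Dh h i (V c)) + coupling h bb ss V c)%fld.

Definition nS {a b} (t : R) (V : cmp -> fld a b) : R := sumc (fun c => nrm2 t (V c)).
Definition NS {a b} (e : R) (k : nat) (t : R) (V : cmp -> fld a b) : R := sumc (fun c => Nk e k t (V c)).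
Definition E0 {a b} (m : cmp -> fld a b) (t : R) (V : cmp -> fld a b) : R :=
 sumc (fun c => Iint t (m c * (V c * V c))%fld).

Lemma sumc_le F G : (forall c, F c <= G c) -> sumc F <= sumc G.
Proof.
 intros H. unfold sumc. have H1 := H cQ. have H2 := H cH. have H3 := H cV1.
 have H4 := H cV2. have H5 := H cW. lra.
Qed.

Lemma sumc_term F c : (forall c, 0 <= F c) -> F c <= sumc F.
Proof.
 intros H. unfold sumc. have H1 := H cQ. have H2 := H cH. have H3 := H cV1.
 have H4 := H cV2. have H5 := H cW. destruct c; lra.
Qed.

Lemma sumc_ext F G : (forall c, F c = G c) -> sumc F = sumc G.
Proof. intros H. unfold sumc. now rewrite !H. Qed.

Lemma NS_term {a b} e k t (V : cmp -> fld a b) c : oi a b t -> Nk e k t (V c) <= NS e k t V.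
Proof. intros Ht. apply (sumc_term (fun c => Nk e k t (V c))). intros; now apply N_nonneg. Qed.

Lemma nS_nonneg {a b} t (V : cmp -> fld a b) : oi a b t -> 0 <= nS t V.
Proof.
 intros Ht. etr; [apply (nrm2_nonneg t (V cQ) Ht)|].
 apply (sumc_term (fun c => nrm2 t (V c))). intros; now apply nrm2_nonneg.
Qed.

Lemma NS_nonneg {a b} e k t (V : cmp -> fld a b) : oi a b t -> 0 <= NS e k t V.
Proof. intros Ht. etr; [apply (N_nonneg e k t (V cQ) Ht)|now apply NS_term]. Qed.

Lemma energy_derive {a b} (m V : cmp -> fld a b) t : oi a b t ->
 is_derive (fun s => E0 m s V) t
  (sumc (fun c => Iint t (fder None (m c) * (V c * V c))%fld + 2 * Iint t (V c * (m c * fder None (V c)))%fld)).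
Proof.
 intros Ht. unfold E0.
 assert (D : forall c, is_derive (fun s => Iint s (m c * (V c * V c))%fld) t
  (Iint t (fder None (m c) * (V c * V c))%fld + 2 * Iint t (V c * (m c * fder None (V c)))%fld)).
 { intros c. have H := Iint_time t (m c * (V c * V c))%fld Ht.
  replace (fder None (m c * (V c * V c))%fld)
   with (fder None (m c) * (V c * V c) + 2 *: (V c * (m c * fder None (V c))))%fld in H
   by (rewrite !fder_mul; fring).
  rewrite Iint_add, Iint_scal in H by exact Ht. exact H. }
 unfold sumc.
 exact (is_derive_plus _ _ _ _ _ (is_derive_plus _ _ _ _ _ (is_derive_plus _ _ _ _ _
  (is_derive_plus _ _ _ _ _ (D cQ) (D cH)) (D cV1)) (D cV2)) (D cW)).
Qed.

(* The singular coefficients enter only through the derivatives of [bb] and not at all through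
 [ss]: this is the antisymmetry that makes the estimate uniform in [eps]. *)
Lemma energy_base {a b} h (m : cmp -> fld a b) al bb ss V t K : oi a b t -> 0 <= h ->
 (forall c x y z, Rabs (fder None (m c) t x y z) <= K) ->
 (forall c i x y z, Rabs (fder (Some i) (al c i) t x y z) <= K) ->
 (forall i x y z, Rabs (fder (Some i) bb t x y z) <= K) ->
 exists dE, is_derive (fun s => E0 m s V) t dE /\
  Rabs dE <= (13 * K + 1) * nS t V + nS t (Lop h m al bb ss V).
Proof.
 intros Ht Hh Hm Hal Hbb.
 eexists. split; [now apply energy_derive|].
 assert (K0 : 0 <= K) by (etr; [apply Rabs_pos|apply (Hbb AxX 0 0 0)]).
 set (Rc := Lop h m al bb ss V).
 assert (EV : forall c, Iint t (V c * (m c * fder None (V c)))%fld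
  = Iint t (V c * Rc c)%fld - (Iint t (al c AxX * (Dh h AxX (V c) * V c))%fld
   + Iint t (al c AxY * (Dh h AxY (V c) * V c))%fld + Iint t (al c AxZ * (Dh h AxZ (V c) * V c))%fld)
   - Iint t (V c * coupling h bb ss V c)%fld).
 { intros c. rewrite <- !Iint_add, <- !Iint_sub by exact Ht. f_equal. unfold Rc, Lop, sum3. fring. }
 set (P := fun i => Iint t (bb * (Dh h i (V (vel i)) * V cQ + V (vel i) * Dh h i (V cQ)))%fld).
 assert (EC : sumc (fun c => Iint t (V c * coupling h bb ss V c)%fld) = P AxX + P AxY + P AxZ).
 { unfold sumc, P. rewrite <- !Iint_add by exact Ht. f_equal. unfold coupling, sum3, vel. fring. }
 assert (BP : forall i, Rabs (P i) <= K * (nrm2 t (V (vel i)) + nrm2 t (V cQ))).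
 { intros i. unfold P. apply Dh_skew; [exact Ht|exact Hh|apply Hbb]. }
 assert (BA : forall c i, Rabs (Iint t (al c i * (Dh h i (V c) * V c))%fld) <= K * nrm2 t (V c)).
 { intros c i. have B := Dh_skew h i t (al c i) (V c) (V c) K Ht Hh (Hal c i).
  replace (al c i * (Dh h i (V c) * V c + V c * Dh h i (V c)))%fld
   with (2 *: (al c i * (Dh h i (V c) * V c)))%fld in B by fring.
  rewrite Iint_scal, Rabs_mult, (Rabs_right 2) in B by (try exact Ht; lra). lra. }
 assert (BM : forall c, Rabs (Iint t (fder None (m c) * (V c * V c))%fld) <= K * nrm2 t (V c)).
 { intros c. apply Iint_bound; [exact Ht|apply Hm]. }
 assert (BR : forall c, 2 * Rabs (Iint t (V c * Rc c)%fld) <= nrm2 t (V c) + nrm2 t (Rc c)).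
 { intros c. now apply Iint_young. }
 rewrite (sumc_ext _ (fun c => (Iint t (fder None (m c) * (V c * V c))%fld + 2 * Iint t (V c * Rc c)%fld
   - 2 * (Iint t (al c AxX * (Dh h AxX (V c) * V c))%fld
   + Iint t (al c AxY * (Dh h AxY (V c) * V c))%fld + Iint t (al c AxZ * (Dh h AxZ (V c) * V c))%fld))
   - 2 * Iint t (V c * coupling h bb ss V c)%fld)) by (intros c; rewrite EV; ring).
 set (X := fun c => Iint t (fder None (m c) * (V c * V c))%fld + 2 * Iint t (V c * Rc c)%fld
   - 2 * (Iint t (al c AxX * (Dh h AxX (V c) * V c))%fld
   + Iint t (al c AxY * (Dh h AxY (V c) * V c))%fld + Iint t (al c AxZ * (Dh h AxZ (V c) * V c))%fld)).
 replace (sumc _) with (sumc X - 2 * (P AxX + P AxY + P AxZ)) by (rewrite <- EC; unfold sumc, X; ring).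
 (* [7 K] is [K] from the time derivative of the weight and [2 * 3 K] from the three advection
    terms; the three doubled pairings [P] add at most [6 K] on the component [cQ], whence [13 K]. *)
 assert (BX : forall c, Rabs (X c) <= (7 * K + 1) * nrm2 t (V c) + nrm2 t (Rc c)).
 { intros c. unfold X. have H1 := BM c. have H2 := BR c.
  have H3 := BA c AxX. have H4 := BA c AxY. have H5 := BA c AxZ.
  apply Rabs_le_between in H1. apply Rabs_le_between in H3. apply Rabs_le_between in H4. apply Rabs_le_between in H5.
  have H6 := Rle_abs (Iint t (V c * Rc c)%fld). have H7 := Rle_abs (- Iint t (V c * Rc c)%fld). rewrite Rabs_Ropp in H7.
  apply Rabs_le. lra. }
 assert (NN : forall c, 0 <= nrm2 t (V c)) by (intros; now apply nrm2_nonneg).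
 have Q0 := NN cQ. have Q1 := NN cH. have Q2 := NN cV1. have Q3 := NN cV2. have Q4 := NN cW.
 have B1 := BX cQ. have B2 := BX cH. have B3 := BX cV1. have B4 := BX cV2. have B5 := BX cW.
 have C1 := BP AxX. have C2 := BP AxY. have C3 := BP AxZ. simpl vel in C1, C2, C3.
 apply Rabs_le_between in B1, B2, B3, B4, B5, C1, C2, C3.
 unfold nS, sumc. apply Rabs_le.
 assert (K * nrm2 t (V cQ) >= 0) by (apply Rle_ge, Rmult_le_pos; easy).
 assert (K * nrm2 t (V cH) >= 0) by (apply Rle_ge, Rmult_le_pos; easy).
 assert (K * nrm2 t (V cV1) >= 0) by (apply Rle_ge, Rmult_le_pos; easy).
 assert (K * nrm2 t (V cV2) >= 0) by (apply Rle_ge, Rmult_le_pos; easy).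
 assert (K * nrm2 t (V cW) >= 0) by (apply Rle_ge, Rmult_le_pos; easy).
 fold Rc. split; lra.
Qed.

Lemma Zw_opp {a b} e l (f : fld a b) : Zw e l (fopp f) = fopp (Zw e l f).
Proof. apply Zw_scal. Qed.

Lemma Zw_mul_com {a b} e l (f g : fld a b) : Zw e l (f * g)%fld = (f * Zw e l g + com e l f g)%fld.
Proof. unfold com. fring. Qed.

Definition comL {a b} (e : R) (l : list (option axis)) (h : R) (m : cmp -> fld a b) (al : cmp -> axis -> fld a b)
  (bb ss : fld a b) (V : cmp -> fld a b) (c : cmp) : fld a b :=
 (com e l (m c) (fder None (V c)) + sum3 (fun i => com e l (al c i) (Dh h i (V c)))
 + match c with
  | cQ => sum3 (fun i => com e l bb (Dh h i (V (vel i))))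
  | cH => fopp (com e l ss (V cW))
  | cV1 => com e l bb (Dh h AxX (V cQ))
  | cV2 => com e l bb (Dh h AxY (V cQ))
  | cW => com e l bb (Dh h AxZ (V cQ)) + com e l ss (V cH)
  end)%fld.

Lemma Zw_Lop {a b} e l h (m : cmp -> fld a b) al bb ss V c :
 Lop h m al bb ss (fun c => Zw e l (V c)) c
 = (Zw e l (Lop h m al bb ss V c) - comL e l h m al bb ss V c)%fld.
Proof.
 unfold Lop, comL, sum3, coupling.
 destruct c; unfold sum3, vel; rewrite ?Zw_add, ?Zw_opp, ?Zw_add, !Zw_mul_com, !Zw_der, !Zw_Dh; fring.
Qed.

Definition Ek {a b} (e : R) (k : nat) (m : cmp -> fld a b) (t : R) (V : cmp -> fld a b) : R :=
 SW k (fun l => E0 m t (fun c => Zw e l (V c))).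

Lemma nrm2_add_le {a b} t (f g : fld a b) A B : oi a b t -> nrm2 t f <= A -> nrm2 t g <= B ->
 nrm2 t (f + g)%fld <= 2 * A + 2 * B.
Proof. intros Ht HA HB. etr; [now apply nrm2_add|lra]. Qed.

Lemma nrm2_sub_le {a b} t (f g : fld a b) A B : oi a b t -> nrm2 t f <= A -> nrm2 t g <= B ->
 nrm2 t (f - g)%fld <= 2 * A + 2 * B.
Proof. intros Ht HA HB. etr; [now apply nrm2_sub|lra]. Qed.

Lemma NS_SW {a b} e k t (V : cmp -> fld a b) : NS e k t V = SW k (fun l => nS t (fun c => Zw e l (V c))).
Proof. unfold NS, nS, sumc, Nk. now rewrite !SW_plus. Qed.

Lemma energy_words k : exists Ck, 0 <= Ck /\ forall a b e h (m : cmp -> fld a b) al bb ss V t K B,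
 oi a b t -> 0 <= h ->
 (forall c x y z, Rabs (fder None (m c) t x y z) <= K) ->
 (forall c i x y z, Rabs (fder (Some i) (al c i) t x y z) <= K) ->
 (forall i x y z, Rabs (fder (Some i) bb t x y z) <= K) ->
 (forall l c, (length l <= k)%nat -> nrm2 t (Zw e l (Lop h m al bb ss V c)) <= B) ->
 (forall l c, (length l <= k)%nat -> nrm2 t (com e l (m c) (fder None (V c))) <= B) ->
 (forall l c i, (length l <= k)%nat -> nrm2 t (com e l (al c i) (Dh h i (V c))) <= B) ->
 (forall l c i, (length l <= k)%nat -> nrm2 t (com e l bb (Dh h i (V c))) <= B) ->
 (forall l c, (length l <= k)%nat -> nrm2 t (com e l ss (V c)) <= B) ->
 exists dE, is_derive (fun s => Ek e k m s V) t dE /\ Rabs dE <= (13 * K + 1) * NS e k t V + Ck * B.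
Proof.
 destruct (SW_const k 1) as [n [Hn En]].
 (* Every addition costs a factor 2: the commutators of one component sum to at most [64 B], and
    together with the source this gives [130 B]. Five components give [650 B], and [n] counts the
    words. *)
 exists (650 * n). split; [lra|].
 intros a b e h m al bb ss V t K B Ht Hh Hm Hal Hbb BL B1 B2 B3 B4.
 assert (B0 : 0 <= B) by (etr; [apply (nrm2_nonneg t (com e nil ss (V cQ)) Ht)|apply B4; simpl; lia]).
 assert (HR : forall l c, (length l <= k)%nat -> nrm2 t (Lop h m al bb ss (fun c => Zw e l (V c)) c) <= 130 * B).
 { intros l c Hl. rewrite Zw_Lop.
  assert (S3 : forall F : axis -> fld a b, (forall i, nrm2 t (F i) <= B) -> nrm2 t (sum3 F) <= 10 * B).
  { intros F HF. unfold sum3. etr; [apply nrm2_add_le; [exact Ht| |apply HF]|].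
   - apply nrm2_add_le; [exact Ht|apply HF|apply HF].
   - lra. }
  assert (BC : nrm2 t (comL e l h m al bb ss V c) <= 64 * B).
  { unfold comL. etr; [apply (nrm2_add_le t _ _ (22 * B) (10 * B) Ht)|lra].
   - etr; [apply (nrm2_add_le t _ _ B (10 * B) Ht)|lra]; [now apply B1|].
    apply S3. intros i. now apply B2.
   - destruct c.
    + apply S3. intros i. now apply B3.
    + rewrite nrm2_opp by exact Ht. have Q := B4 l cW Hl. lra.
    + have Q := B3 l cQ AxX Hl. lra.
    + have Q := B3 l cQ AxY Hl. lra.
    + etr; [apply (nrm2_add_le t _ _ B B Ht); [now apply B3|now apply B4]|lra]. }
  etr; [apply nrm2_sub_le; [exact Ht|apply BL; exact Hl|exact BC]|]. lra. }
 set (D := fun l => cid _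
  (energy_base h m al bb ss (fun c => Zw e l (V c)) t K Ht Hh Hm Hal Hbb)).
 exists (SW k (fun l => proj1_sig (D l))). split.
 - unfold Ek. apply (SW_derive k (fun l s => E0 m s (fun c => Zw e l (V c))) (fun l _ => proj1_sig (D l))).
  intros l. exact (proj1 (proj2_sig (D l))).
 - assert (HD : forall l, (length l <= k)%nat ->
   Rabs (proj1_sig (D l)) <= (13 * K + 1) * nS t (fun c => Zw e l (V c)) + 650 * B * 1).
  { intros l Hl. etr; [exact (proj2 (proj2_sig (D l)))|].
   apply Rplus_le_compat_l. unfold nS, sumc.
   have Q1 := HR l cQ Hl. have Q2 := HR l cH Hl. have Q3 := HR l cV1 Hl.
   have Q4 := HR l cV2 Hl. have Q5 := HR l cW Hl. lra. }
  replace ((13 * K + 1) * NS e k t V + 650 * n * B) with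
   (SW k (fun l => (13 * K + 1) * nS t (fun c => Zw e l (V c)) + 650 * B * 1)).
  + apply Rabs_le. split.
   * rewrite <- (Rmult_1_l (SW k (fun l => (13 * K + 1) * _ + _))), Ropp_mult_distr_l, <- SW_scal.
    apply SW_le. intros l Hl. specialize (HD l Hl). apply Rabs_le_between in HD. lra.
   * apply SW_le. intros l Hl. specialize (HD l Hl). apply Rabs_le_between in HD. lra.
  + rewrite SW_plus, !SW_scal, En, <- NS_SW. ring.
Qed.

(* Bounds linear in the top order, and their calculus *)
Global Opaque Nk Dh.

(** The order regarded as already controlled when order [k] is estimated: the previous one, but
    never below 3, the order at which the nonlinear estimate closes on itself. *)
Definition pk (k : nat) : nat := Nat.max 3 (k - 1).

(* Boundedness of [f] at order [k] given that everything of order [pk k] is under control: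
 linear in the top-order quantity [X]. [TB1] is the same one derivative below. *)
Definition TB {a b} (e : R) (k : nat) (t C X : R) (f : fld a b) : Prop :=
 0 <= C /\ Nk e (pk k) t f <= C /\ Nk e k t f <= C * (1 + X).

Definition TB1 {a b} (e : R) (k : nat) (t C X : R) (f : fld a b) : Prop :=
 0 <= C /\ Nk e (pk k - 1) t f <= C /\ Nk e (k - 1) t f <= C * (1 + X).

Lemma TB_mul_ex k : (3 <= k)%nat -> exists K, 0 <= K /\ forall a b e t X C1 C2 (f g : fld a b), oi a b t -> 0 <= X ->
 TB e k t C1 X f -> TB e k t C2 X g -> TB e k t (K * C1 * C2) X (f * g)%fld.
Proof.
 intros Hk.
 destruct (prod_bound (pk k) (pk k) (pk k)) as [K1 [P1 H1]]; [unfold pk; lia..|].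
 assert (HT : exists K2, 0 <= K2 /\ forall a b e t (f g : fld a b), oi a b t ->
  Nk e k t (f * g)%fld <= K2 * (Nk e k t f * Nk e (pk k) t g + Nk e (pk k) t f * Nk e k t g)).
 { destruct (Nat.eq_dec k 3) as [->|Hk3].
  - exists K1. split; [easy|]. intros a b e t f g Ht. change (pk 3) with 3%nat in *.
   etr; [now apply H1|]. apply Rmult_le_compat_l; [easy|].
   assert (0 <= Nk e 3 t f * Nk e 3 t g) by (apply Rmult_le_pos; now apply N_nonneg). lra.
  - destruct (prod_tame (k - 3)) as [K2 [P2 H2]]. exists K2. split; [easy|]. intros a b e t f g Ht.
   have E := H2 a b e t f g Ht. replace (3 + (k - 3))%nat with k in E by lia.
   replace (2 + (k - 3))%nat with (pk k) in E by (unfold pk; lia). exact E. }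
 destruct HT as [K2 [P2 H2]].
 exists (K1 + 2 * K2). split; [lra|]. intros a b e t X C1 C2 f g Ht HX (Q1 & F1 & F2) (Q2 & G1 & G2).
 assert (QQ : 0 <= C1 * C2) by now apply Rmult_le_pos.
 have Nf := N_nonneg e (pk k) t f Ht. have Ng := N_nonneg e (pk k) t g Ht.
 have Nf' := N_nonneg e k t f Ht. have Ng' := N_nonneg e k t g Ht.
 rewrite Rmult_assoc.
 split; [apply Rmult_le_pos; lra|]. split.
 - etr; [now apply H1|].
  assert (Nk e (pk k) t f * Nk e (pk k) t g <= C1 * C2) by now apply Rmult_le_compat.
  assert (K1 * (Nk e (pk k) t f * Nk e (pk k) t g) <= K1 * (C1 * C2)) by now apply Rmult_le_compat_l.
  assert (0 <= K2 * (C1 * C2)) by now apply Rmult_le_pos. lra.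
 - etr; [now apply H2|].
  assert (D1 : Nk e k t f * Nk e (pk k) t g <= C1 * (1 + X) * C2) by now apply Rmult_le_compat.
  assert (D2 : Nk e (pk k) t f * Nk e k t g <= C1 * (C2 * (1 + X))) by now apply Rmult_le_compat.
  apply Rle_trans with (K2 * (2 * (C1 * C2 * (1 + X)))).
  + apply Rmult_le_compat_l; [easy|]. lra.
  + assert (0 <= K1 * (C1 * C2) * (1 + X)) by (apply Rmult_le_pos; [now apply Rmult_le_pos|lra]). lra.
Qed.

(** The constant is extracted as a function of [k], so that bounds of polynomial expressions compose
    by plain application and their constants can be left to unification through [eexists]. The value
    0 below order 3 is a default. *)
Definition Kmul (k : nat) : R := match le_dec 3 k with
 left H => proj1_sig (cid _ (TB_mul_ex k H)) | right _ => 0 end.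

Lemma TB_mul {a b} e k t X C1 C2 (f g : fld a b) : (3 <= k)%nat -> oi a b t -> 0 <= X ->
 TB e k t C1 X f -> TB e k t C2 X g -> TB e k t (Kmul k * C1 * C2) X (f * g)%fld.
Proof.
 intros Hk. unfold Kmul. destruct (le_dec 3 k) as [H|H]; [|easy].
 apply (proj2 (proj2_sig (cid _ (TB_mul_ex k H)))).
Qed.

Lemma TB1_mul_ex k : (3 <= k)%nat -> exists K, 0 <= K /\ forall a b e t X C1 C2 (f g : fld a b), oi a b t -> 0 <= X ->
 TB e k t C1 X f -> TB1 e k t C2 X g -> TB1 e k t (K * C1 * C2) X (f * g)%fld.
Proof.
 intros Hk.
 destruct (prod_bound (pk k - 1) (pk k - 1) (pk k - 1)) as [K1 [P1 H1]]; [unfold pk; lia..|].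
 destruct (prod_bound (k - 1) (k - 1) (k - 1)) as [K2 [P2 H2]]; [lia..|].
 exists (K1 + K2). split; [lra|]. intros a b e t X C1 C2 f g Ht HX (Q1 & F1 & F2) (Q2 & G1 & G2).
 assert (QQ : 0 <= C1 * C2) by now apply Rmult_le_pos.
 have M1 := N_mono e (pk k - 1) (pk k) t f Ht ltac:(lia).
 have M2 := N_mono e (k - 1) (pk k) t f Ht ltac:(unfold pk; lia).
 have Nf := N_nonneg e (pk k - 1) t f Ht. have Ng := N_nonneg e (pk k - 1) t g Ht.
 have Nf' := N_nonneg e (k - 1) t f Ht. have Ng' := N_nonneg e (k - 1) t g Ht.
 rewrite Rmult_assoc.
 split; [apply Rmult_le_pos; lra|]. split.
 - etr; [now apply H1|].
  assert (Nk e (pk k - 1) t f * Nk e (pk k - 1) t g <= C1 * C2) by (apply Rmult_le_compat; lra).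
  assert (K1 * (Nk e (pk k - 1) t f * Nk e (pk k - 1) t g) <= K1 * (C1 * C2)) by now apply Rmult_le_compat_l.
  assert (0 <= K2 * (C1 * C2)) by now apply Rmult_le_pos. lra.
 - etr; [now apply H2|].
  assert (D1 : Nk e (k - 1) t f * Nk e (k - 1) t g <= C1 * (C2 * (1 + X))) by (apply Rmult_le_compat; lra).
  apply Rle_trans with (K2 * (C1 * (C2 * (1 + X)))); [now apply Rmult_le_compat_l|].
  assert (0 <= K1 * (C1 * C2) * (1 + X)) by (apply Rmult_le_pos; [now apply Rmult_le_pos|lra]). lra.
Qed.

Definition Kmul1 (k : nat) : R := match le_dec 3 k with
 left H => proj1_sig (cid _ (TB1_mul_ex k H)) | right _ => 0 end.

Lemma TB1_mul {a b} e k t X C1 C2 (f g : fld a b) : (3 <= k)%nat -> oi a b t -> 0 <= X ->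
 TB e k t C1 X f -> TB1 e k t C2 X g -> TB1 e k t (Kmul1 k * C1 * C2) X (f * g)%fld.
Proof.
 intros Hk. unfold Kmul1. destruct (le_dec 3 k) as [H|H]; [|easy].
 apply (proj2 (proj2_sig (cid _ (TB1_mul_ex k H)))).
Qed.

(** At [k = 3] the controlled order is the top order and [com_bound] suffices; above, [com_tame]
    keeps the result linear in [X]. *)
Lemma com_TB_ex k : (3 <= k)%nat -> exists K, 0 <= K /\ forall a b e t X C1 C2 (f g : fld a b) l, oi a b t -> 0 <= X ->
 TB e k t C1 X f -> TB1 e k t C2 X g -> (length l <= k)%nat -> nrm2 t (com e l f g) <= K * C1 * C2 * (1 + X).
Proof.
 intros Hk. destruct (Nat.eq_dec k 3) as [->|Hk3].
 - destruct (com_bound 2 2 2) as [K [P H]]; [lia..|]. exists K. split; [easy|].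
  intros a b e t X C1 C2 f g l Ht HX (Q1 & F1 & F2) (Q2 & G1 & G2) Hl.
  change (pk 3) with 3%nat in *. change (3 - 1)%nat with 2%nat in *.
  etr; [now apply H|]. rewrite !Rmult_assoc. apply Rmult_le_compat_l; [easy|].
  apply Rmult_le_compat; try easy; now apply N_nonneg.
 - destruct (com_tame (k - 4)) as [K [P H]]. exists (2 * K). split; [lra|].
  intros a b e t X C1 C2 f g l Ht HX (Q1 & F1 & F2) (Q2 & G1 & G2) Hl.
  have E := H a b e t f g l Ht ltac:(lia).
  replace (4 + (k - 4))%nat with k in E by lia. replace (3 + (k - 4))%nat with (pk k) in E by (unfold pk; lia).
  replace (2 + (k - 4))%nat with (pk k - 1)%nat in E by (unfold pk; lia).
  replace (pk k) with (k - 1)%nat in E at 3 by (unfold pk; lia).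
  etr; [exact E|].
  assert (D1 : Nk e k t f * Nk e (pk k - 1) t g <= C1 * (1 + X) * C2) by (apply Rmult_le_compat; try easy; now apply N_nonneg).
  assert (D2 : Nk e (pk k) t f * Nk e (k - 1) t g <= C1 * (C2 * (1 + X))) by (apply Rmult_le_compat; try easy; now apply N_nonneg).
  replace (2 * K * C1 * C2 * (1 + X)) with (K * (C1 * (1 + X) * C2 + C1 * (C2 * (1 + X)))) by ring.
  apply Rmult_le_compat_l; lra.
Qed.

Definition Kcom (k : nat) : R := match le_dec 3 k with
 left H => proj1_sig (cid _ (com_TB_ex k H)) | right _ => 0 end.

Lemma com_TB {a b} e k t X C1 C2 (f g : fld a b) l : (3 <= k)%nat -> oi a b t -> 0 <= X ->
 TB e k t C1 X f -> TB1 e k t C2 X g -> (length l <= k)%nat -> nrm2 t (com e l f g) <= Kcom k * C1 * C2 * (1 + X).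
Proof.
 intros Hk. unfold Kcom. destruct (le_dec 3 k) as [H|H]; [|easy].
 apply (proj2 (proj2_sig (cid _ (com_TB_ex k H)))).
Qed.

Lemma TB_add {a b} e k t X C1 C2 (f g : fld a b) : oi a b t -> 0 <= X ->
 TB e k t C1 X f -> TB e k t C2 X g -> TB e k t (2 * (C1 + C2)) X (f + g)%fld.
Proof.
 intros Ht HX (Q1 & F1 & F2) (Q2 & G1 & G2). split; [lra|]. split.
 - etr; [now apply N_add|lra].
 - etr; [now apply N_add|lra].
Qed.

Lemma TB1_add {a b} e k t X C1 C2 (f g : fld a b) : oi a b t -> 0 <= X ->
 TB1 e k t C1 X f -> TB1 e k t C2 X g -> TB1 e k t (2 * (C1 + C2)) X (f + g)%fld.
Proof.
 intros Ht HX (Q1 & F1 & F2) (Q2 & G1 & G2). split; [lra|]. split.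
 - etr; [now apply N_add|lra].
 - etr; [now apply N_add|lra].
Qed.

Lemma TB_scal {a b} e k t X C c D (f : fld a b) : oi a b t -> 0 <= X -> Rabs c <= D ->
 TB e k t C X f -> TB e k t (D ^ 2 * C) X (c *: f)%fld.
Proof.
 intros Ht HX HD (Q & F1 & F2).
 assert (Hc : c ^ 2 <= D ^ 2) by (rewrite <- (pow2_abs c); apply pow_incr; split; [apply Rabs_pos|easy]).
 have P := pow2_ge_0 c.
 split; [apply Rmult_le_pos; lra|]. rewrite !N_scal by exact Ht. split.
 - apply Rmult_le_compat; try easy. now apply N_nonneg.
 - rewrite Rmult_assoc. apply Rmult_le_compat; try easy. now apply N_nonneg.
Qed.

Lemma TB1_scal {a b} e k t X C c D (f : fld a b) : oi a b t -> 0 <= X -> Rabs c <= D ->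
 TB1 e k t C X f -> TB1 e k t (D ^ 2 * C) X (c *: f)%fld.
Proof.
 intros Ht HX HD (Q & F1 & F2).
 assert (Hc : c ^ 2 <= D ^ 2) by (rewrite <- (pow2_abs c); apply pow_incr; split; [apply Rabs_pos|easy]).
 have P := pow2_ge_0 c.
 split; [apply Rmult_le_pos; lra|]. rewrite !N_scal by exact Ht. split.
 - apply Rmult_le_compat; try easy. now apply N_nonneg.
 - rewrite Rmult_assoc. apply Rmult_le_compat; try easy. now apply N_nonneg.
Qed.

Lemma TB_sub {a b} e k t X C1 C2 (f g : fld a b) : oi a b t -> 0 <= X ->
 TB e k t C1 X f -> TB e k t C2 X g -> TB e k t (2 * (C1 + (-1) ^ 2 * C2)) X (f - g)%fld.
Proof.
 intros Ht HX Hf Hg. unfold fsub, fopp. apply TB_add; try easy.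
 replace ((-1) ^ 2) with (1 ^ 2) by ring. apply TB_scal; try easy. rewrite Rabs_left; lra.
Qed.

Lemma TB1_opp {a b} e k t X C (f : fld a b) : oi a b t -> 0 <= X ->
 TB1 e k t C X f -> TB1 e k t (1 ^ 2 * C) X (fopp f)%fld.
Proof. intros Ht HX Hf. unfold fopp. apply TB1_scal; try easy. rewrite Rabs_left; lra. Qed.

Lemma TB_cst {a b} e k t X c D : oi a b t -> 0 <= X -> Rabs c <= D -> TB e k t (D ^ 2) X (@fcst a b c).
Proof.
 intros Ht HX HD.
 assert (Hc : c ^ 2 <= D ^ 2) by (rewrite <- (pow2_abs c); apply pow_incr; split; [apply Rabs_pos|easy]).
 have P := pow2_ge_0 c.
 split; [lra|]. rewrite !N_cst by exact Ht. split; [lra|]. nra.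
Qed.

Lemma TB_TB1 {a b} e k t X C (f : fld a b) : oi a b t -> TB e k t C X f -> TB1 e k t C X f.
Proof.
 intros Ht (Q & F1 & F2). split; [easy|]. split.
 - etr; [apply (N_mono e (pk k - 1) (pk k)); [easy|lia]|easy].
 - etr; [apply (N_mono e (k - 1) k); [easy|lia]|easy].
Qed.

Lemma TB1_Z {a b} e k t X C d (f : fld a b) : (3 <= k)%nat -> oi a b t -> TB e k t C X f -> TB1 e k t C X (Zd e d f).
Proof.
 intros Hk Ht (Q & F1 & F2). split; [easy|]. split.
 - etr; [now apply N_Z|]. replace (S (pk k - 1)) with (pk k) by (unfold pk; lia). easy.
 - etr; [now apply N_Z|]. replace (S (k - 1)) with k by lia. easy.
Qed.

Lemma TB1_Dh {a b} e k t X C h c (f : fld a b) : (3 <= k)%nat -> oi a b t -> 0 <= h -> TB e k t C X f -> TB1 e k t C X (Dh h c f).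
Proof.
 intros Hk Ht Hh (Q & F1 & F2). split; [easy|]. split.
 - etr; [now apply N_Dh|]. replace (S (pk k - 1)) with (pk k) by (unfold pk; lia). easy.
 - etr; [now apply N_Dh|]. replace (S (k - 1)) with k by lia. easy.
Qed.

Lemma TB_word {a b} e k t X C (f : fld a b) l : oi a b t -> TB e k t C X f -> (length l <= k)%nat ->
 nrm2 t (Zw e l f) <= C * (1 + X).
Proof. intros Ht (Q & F1 & F2) Hl. etr; [now apply (N_word e k)|easy]. Qed.

(** The supremum bound that [sup_bound] yields for a field whose squared norm of order 2 is at most
    [C]. *)
Definition sq (C : R) : R := sqrt (27 * C).

Lemma sup_le {a b} e k t C (f : fld a b) : oi a b t -> (2 <= k)%nat -> Nk e k t f <= C ->
 forall x y z, Rabs (f t x y z) <= sq C.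
Proof.
 intros Ht Hk HC x y z.
 have H := sup_bound e t f x y z Ht. have M := N_mono e 2 k t f Ht Hk.
 have P := N_nonneg e 2 t f Ht.
 unfold sq. rewrite <- sqrt_Rsqr_abs. apply sqrt_le_1_alt. rewrite Rsqr_pow2. lra.
Qed.

Lemma TB_sup {a b} e k t X C (f : fld a b) : oi a b t -> TB e k t C X f -> forall x y z, Rabs (f t x y z) <= sq C.
Proof. intros Ht (Q & F1 & F2). apply (sup_le e (pk k)); [easy|unfold pk; lia|easy]. Qed.

Lemma TB1_sup {a b} e k t X C (f : fld a b) : oi a b t -> TB1 e k t C X f -> forall x y z, Rabs (f t x y z) <= sq C.
Proof. intros Ht (Q & F1 & F2). apply (sup_le e (pk k - 1)); [easy|unfold pk; lia|easy]. Qed.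

Lemma TB_der_sup {a b} e k t X C d (f : fld a b) : (3 <= k)%nat -> oi a b t -> TB e k t C X f ->
 forall x y z, Rabs (Zd e d f t x y z) <= sq C.
Proof. intros Hk Ht H. apply (TB1_sup e k t X); [easy|now apply TB1_Z]. Qed.

Lemma zf_bound k : forall g (Hs : smooth1 g) (Hp : forall z, g (z + 1) = g z), exists K, 0 <= K /\
 forall a b e t, oi a b t -> Nk e k t (@fzf a b g Hs Hp) <= K.
Proof.
 assert (H0 : forall g (Hs : smooth1 g) (Hp : forall z, g (z + 1) = g z), exists K, 0 <= K /\
  forall a b t, oi a b t -> nrm2 t (@fzf a b g Hs Hp) <= K).
 { intros g Hs Hp. exists (I3 (fun _ _ z => g z ^ 2)). split.
  - apply I3_nonneg; [|intros; apply pow2_ge_0].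
   apply (c3_pow (fun _ _ z => g z)). intros t x y z. apply c4_zfun. now apply smooth1_continuous.
  - intros a b t Ht. rewrite nrm2_I3. right. apply I3_ext. intros. now rewrite fzf_at. }
 induction k; intros g Hs Hp.
 - destruct (H0 g Hs Hp) as [K [P H]]. exists K. split; [easy|]. intros. rewrite N_0. now apply H.
 - destruct (H0 g Hs Hp) as [K [P H]].
  have Hs' := smooth1_Derive g Hs.
  assert (Hp' : forall z, Derive g (z + 1) = Derive g z).
  { intros z. transitivity (Derive (fun r => g (r + 1)) z).
   - symmetry. apply is_derive_unique. apply is_derive_shift. apply Derive_correct. exact (Hs 1%nat (z + 1)).
   - apply Derive_ext. apply Hp. }
  destruct (IHk (Derive g) Hs' Hp') as [K' [P' H']].
  exists (K + K'). split; [lra|]. intros a b e t Ht. rewrite N_S. unfold sum4, Zd.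
  rewrite !(fder_zf _ g Hs Hp Hs' Hp'). rewrite N_scal, !N_cst by exact Ht.
  have E1 := H a b t Ht. have E2 := H' a b e t Ht. lra.
Qed.

Definition Kzf (k : nat) (g : R -> R) : R :=
 match excluded_middle_informative (smooth1 g /\ forall z, g (z + 1) = g z) with
 | left H => proj1_sig (cid _ (zf_bound k g (proj1 H) (proj2 H)))
       + proj1_sig (cid _ (zf_bound (pk k) g (proj1 H) (proj2 H)))
 | right _ => 0
 end.

Lemma TB_zf {a b} e k t X g Hs Hp : oi a b t -> 0 <= X -> TB e k t (Kzf k g) X (@fzf a b g Hs Hp).
Proof.
 intros Ht HX. unfold Kzf. destruct excluded_middle_informative as [H|H]; [|now destruct H].
 match goal with |- TB _ _ _ (proj1_sig ?A + proj1_sig ?B) _ _ =>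
  destruct A as [K [P E]], B as [K' [P' E']]; cbn [proj1_sig] end.
 rewrite (proof_irrelevance _ Hs (proj1 H)), (proof_irrelevance _ Hp (proj2 H)).
 specialize (E a b e t Ht). specialize (E' a b e t Ht).
 assert (0 <= (K + K') * X) by (apply Rmult_le_pos; lra).
 split; [lra|]. split; lra.
Qed.

Lemma TB_of_N {a b} e k t M X (f : fld a b) : oi a b t -> 0 <= M -> Nk e (pk k) t f <= M -> Nk e k t f <= X ->
 TB e k t (M + 1) X f.
Proof.
 intros Ht HM H1 H2. have P := N_nonneg e k t f Ht. split; [lra|]. split; [lra|]. nra.
Qed.

Lemma smooth1_prim g : smooth1 g -> smooth1 (fun z => RInt g 0 z).
Proof.
 intros H n z.
 assert (D : forall x, is_derive (fun z => RInt g 0 z) x (g x)).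
 { intros x. apply RInt_primitive. intros; now apply smooth1_continuous. }
 destruct n as [|[|n]]; [easy|eexists; apply D|].
 apply (ex_derive_ext (Derive_n g n)); [|exact (H (S n) z)].
 intros s. replace (S n) with (n + 1)%nat by lia. rewrite <- Derive_n_comp.
 apply Derive_n_ext. intros r. symmetry. apply is_derive_unique, D.
Qed.

(** An odd periodic function has mean zero over a period, as is seen on [[-1/2, 1/2]]. *)
Lemma prim_periodic g : smooth_odd_periodic g -> forall z, RInt g 0 (z + 1) = RInt g 0 z.
Proof.
 intros (Hs & Hp & Ho) z.
 assert (Hc : forall s, continuous g s) by (intros; now apply smooth1_continuous).
 assert (E : forall a b, ex_RInt g a b) by (intros; now apply ex_RInt_cont).
 rewrite <- (RInt_Chasles g 0 z (z + 1)) by apply E.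
 rewrite RInt_periodic by easy. rewrite <- (RInt_periodic g (-1/2)) by easy.
 replace (-1/2 + 1) with (1/2) by field.
 have Q := RInt_comp_lin (V:=RC) g (-1) 0 (-1/2) (1/2) (E _ _).
 replace (-1 * (-1/2) + 0) with (1/2) in Q by field. replace (-1 * (1/2) + 0) with (-1/2) in Q by field.
 rewrite (RInt_ext _ g) in Q.
 - rewrite <- (opp_RInt_swap (V:=RC) g (-1/2) (1/2)) in Q by apply E.
  unfold opp, plus in *; simpl in *. lra.
 - intros x _. unfold scal; simpl; unfold mult; simpl.
  replace (-1 * x + 0) with (- x) by ring. rewrite Ho. ring.
Qed.

Lemma Rpower_01 eps s : 0 < eps < 1 -> 0 <= s -> 0 < Rpower eps s <= 1.
Proof.
 intros He Hs. split; [apply exp_pos|]. unfold Rpower.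
 rewrite <- exp_0. destruct (Req_dec s 0) as [->|Hs0]; [rewrite Rmult_0_l; lra|].
 left. apply exp_increasing. assert (ln eps < 0) by (rewrite <- ln_1; apply ln_increasing; lra). nra.
Qed.

Lemma Rpower_abs1 eps s : 0 < eps < 1 -> 0 <= s -> Rabs (Rpower eps s) <= 1.
Proof. intros He Hs. destruct (Rpower_01 eps s He Hs). rewrite Rabs_right; lra. Qed.

(** * The symmetrised system *)

Section System.
Context (P : params) (HP : admissible P).

Lemma mu_pos : 0 < mu P < 1.
Proof. destruct HP as (H & _). unfold mu. lra. Qed.
Lemma nu_pos : 0 < nu P < / 2.
Proof. destruct HP as (H & _). lra. Qed.
Lemma G_sop : smooth_odd_periodic (G P). Proof. apply HP. Qed.
Lemma Hbar_sop : smooth_odd_periodic (Hbar P). Proof. apply HP. Qed.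
Lemma Gt_sop : smooth_odd_periodic (Gt P). Proof. apply HP. Qed.
Lemma calB_pos : 0 < calB P. Proof. apply HP. Qed.
Lemma varpi0_pos : 0 < varpi0 P. Proof. apply HP. Qed.
Lemma calA_pos : 0 < calA P.
Proof. destruct HP as (_ & H & H' & _). apply Rinv_0_lt_compat, Rmult_lt_0_compat; lra. Qed.

Definition fG {a b} : fld a b := fzf (G P) (proj1 G_sop) (proj1 (proj2 G_sop)).
Definition fHb {a b} : fld a b := fzf (Hbar P) (proj1 Hbar_sop) (proj1 (proj2 Hbar_sop)).
Definition fGt {a b} : fld a b := fzf (Gt P) (proj1 Gt_sop) (proj1 (proj2 Gt_sop)).
Definition fIG {a b} : fld a b := fzf (fun z => RInt (G P) 0 z) (smooth1_prim _ (proj1 G_sop)) (prim_periodic _ G_sop).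
Definition fIH {a b} : fld a b := fzf (fun z => RInt (Hbar P) 0 z) (smooth1_prim _ (proj1 Hbar_sop)) (prim_periodic _ Hbar_sop).

Definition phiF {a b} (eps : R) : fld a b := (C0 P *: fIG + Rpower eps (mu P) *: fIH)%fld.
Definition pW {a b} (eps : R) (W : cmp -> fld a b) : fld a b := (/ varpi0 P *: (W cQ - phiF eps))%fld.
Definition aW {a b} eps (W : cmp -> fld a b) : fld a b := (fcst 1 + eps *: pW eps W)%fld.
Definition xW {a b} eps (W : cmp -> fld a b) : fld a b :=
 (fGt * fHb + Rpower eps (nu P) *: (fGt * W cH))%fld.
Definition thW {a b} eps (W : cmp -> fld a b) : fld a b := (fcst (C0 P) + Rpower eps (mu P) *: xW eps W)%fld.
Definition gW {a b} (eps : R) : fld a b := (C0 P *: fG + Rpower eps (mu P) *: fHb)%fld.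
Definition mW {a b} eps (W : cmp -> fld a b) (c : cmp) : fld a b :=
 match c with cQ => fcst (calA P) | cH => (calB P *: aW eps W)%fld | _ => (aW eps W * thW eps W)%fld end.
Definition alW {a b} eps (W : cmp -> fld a b) c i : fld a b := (mW eps W c * W (vel i))%fld.
(** Equal to [aW / eps]. Written as a constant plus [pW], it shows that its derivatives and
    commutators are bounded uniformly in [eps]. *)
Definition bbW {a b} eps (W : cmp -> fld a b) : fld a b := (fcst (1 / eps) + pW eps W)%fld.
Definition ssW {a b} eps (W : cmp -> fld a b) : fld a b := (1 / Rpower eps (nu P) *: aW eps W)%fld.
Definition rrW {a b} eps (W V : cmp -> fld a b) (c : cmp) : fld a b :=
 match c with
 | cQ => (calA P *: (gW eps * V cW))%fld
 | cH => (calB P *: (aW eps W * (fGt * (W cH * V cW))))%fld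
 | _ => fcst 0
 end.

(* (CE) with coefficients frozen at [W], every equation but the first multiplied by
 [aW = 1 + eps (q - Phi) / varpi0]: the system is then symmetric and polynomial in [W]. *)
Definition SYM {a b} h eps (W V : cmp -> fld a b) : Prop :=
 forall c, Lop h (mW eps W) (alW eps W) (bbW eps W) (ssW eps W) V c = rrW eps W V c.

Definition Wb {a b} e k t M X (W : cmp -> fld a b) : Prop := forall c, TB e k t M X (W c).

Lemma TB_weaken {a b} e k t C D X (f : fld a b) : C <= D -> 0 <= X -> TB e k t C X f -> TB e k t D X f.
Proof.
 intros H HX (H1 & H2 & H3). split; [lra|]. split; [lra|]. nra.
Qed.

Lemma pW_TB k M : exists C, forall a b e t X eps (W : cmp -> fld a b), 0 < eps < 1 -> oi a b t -> 0 <= X ->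
 Wb e k t M X W -> TB e k t C X (pW eps W).
Proof.
 eexists. intros a b e t X eps W He Ht HX HW. have Hmu := mu_pos.
 apply TB_scal; [easy|easy|apply Rle_refl|]. apply TB_sub; [easy|easy|apply HW|].
 apply TB_add; [easy|easy|apply TB_scal; [easy|easy|apply Rle_refl|apply TB_zf; easy]|].
 apply TB_scal with (D := 1); [easy|easy|apply Rpower_abs1; lra|apply TB_zf; easy].
Qed.

Lemma xW_TB k M : (3 <= k)%nat -> exists C, forall a b e t X eps (W : cmp -> fld a b), 0 < eps < 1 -> oi a b t -> 0 <= X ->
 Wb e k t M X W -> TB e k t C X (xW eps W).
Proof.
 intros Hk. eexists. intros a b e t X eps W He Ht HX HW. have Hnu := nu_pos.
 apply TB_add; [easy|easy|apply TB_mul; [easy|easy|easy|apply TB_zf; easy|apply TB_zf; easy]|].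
 apply TB_scal with (D := 1); [easy|easy|apply Rpower_abs1; lra|].
 apply TB_mul; [easy|easy|easy|apply TB_zf; easy|apply HW].
Qed.

Lemma gW_TB k : exists C, forall a b e t X eps, 0 < eps < 1 -> oi a b t -> 0 <= X ->
 TB e k t C X (@gW a b eps).
Proof.
 eexists. intros a b e t X eps He Ht HX. have Hmu := mu_pos.
 apply TB_add; [easy|easy|apply TB_scal; [easy|easy|apply Rle_refl|apply TB_zf; easy]|].
 apply TB_scal with (D := 1); [easy|easy|apply Rpower_abs1; lra|apply TB_zf; easy].
Qed.

Lemma coef_TB k M : (3 <= k)%nat -> exists C, 0 <= C /\ forall a b e t X eps (W : cmp -> fld a b),
 0 < eps < 1 -> oi a b t -> 0 <= X -> Wb e k t M X W ->
 TB e k t C X (pW eps W) /\ TB e k t C X (xW eps W) /\ TB e k t C X (aW eps W) /\ TB e k t C X (thW eps W) /\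
 TB e k t C X (@gW a b eps) /\ TB e k t C X (@fGt a b) /\
 (forall c, TB e k t C X (mW eps W c)) /\ (forall c i, TB e k t C X (alW eps W c i)).
Proof.
 intros Hk. destruct (pW_TB k M) as [C1 H1]. destruct (xW_TB k M Hk) as [C2 H2]. destruct (gW_TB k) as [C3 H3].
 assert (H4 : exists C, forall a b e t X eps (W : cmp -> fld a b), 0 < eps < 1 -> oi a b t -> 0 <= X ->
  Wb e k t M X W -> TB e k t C X (aW eps W)).
 { eexists. intros a b e t X eps W He Ht HX HW.
  apply TB_add; [easy|easy|apply TB_cst; [easy|easy|apply Rle_refl]|].
  apply TB_scal with (D := 1); [easy|easy|rewrite Rabs_right; lra|]. now apply H1. }
 destruct H4 as [C4 H4].
 assert (H5 : exists C, forall a b e t X eps (W : cmp -> fld a b), 0 < eps < 1 -> oi a b t -> 0 <= X ->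
  Wb e k t M X W -> TB e k t C X (thW eps W)).
 { eexists. intros a b e t X eps W He Ht HX HW. have Hmu := mu_pos.
  apply TB_add; [easy|easy|apply TB_cst; [easy|easy|apply Rle_refl]|].
  apply TB_scal with (D := 1); [easy|easy|apply Rpower_abs1; lra|]. now apply H2. }
 destruct H5 as [C5 H5].
 set (m1 := Rabs (calA P) ^ 2). set (m2 := Rabs (calB P) ^ 2 * Rabs C4). set (m3 := Rabs (Kmul k * C4 * C5)).
 set (mm := m1 + m2 + m3).
 assert (P1 : 0 <= m1) by apply pow2_ge_0.
 assert (P2 : 0 <= m2) by (apply Rmult_le_pos; [apply pow2_ge_0|apply Rabs_pos]).
 assert (P3 : 0 <= m3) by apply Rabs_pos.
 assert (H6 : forall a b e t X eps (W : cmp -> fld a b), 0 < eps < 1 -> oi a b t -> 0 <= X ->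
  Wb e k t M X W -> forall c, TB e k t mm X (mW eps W c)).
 { intros a b e t X eps W He Ht HX HW.
  assert (T3 : TB e k t mm X (aW eps W * thW eps W)%fld).
  { apply (TB_weaken e k t (Kmul k * C4 * C5)); [unfold mm; have Q := Rle_abs (Kmul k * C4 * C5); fold m3 in Q; lra|easy|].
   apply TB_mul; [easy|easy|easy|now apply H4|now apply H5]. }
  intros c; destruct c; [| |exact T3|exact T3|exact T3].
  - apply (TB_weaken e k t m1); [unfold mm; lra|easy|]. apply TB_cst; [easy|easy|apply Rle_refl].
  - apply (TB_weaken e k t m2); [unfold mm; lra|easy|].
   apply TB_scal; [easy|easy|apply Rle_refl|]. apply (TB_weaken e k t C4); [apply Rle_abs|easy|now apply H4]. }
 set (D := Rabs C1 + Rabs C2 + Rabs C3 + Rabs C4 + Rabs C5 + Rabs (Kzf k (Gt P)) + mm + Rabs (Kmul k * mm * M)).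
 have A1 := Rle_abs C1. have A2 := Rle_abs C2. have A3 := Rle_abs C3. have A4 := Rle_abs C4.
 have A5 := Rle_abs C5. have A6 := Rle_abs (Kzf k (Gt P)). have A7 := Rle_abs (Kmul k * mm * M).
 have B1 := Rabs_pos C1. have B2 := Rabs_pos C2. have B3 := Rabs_pos C3. have B4 := Rabs_pos C4.
 have B5 := Rabs_pos C5. have B6 := Rabs_pos (Kzf k (Gt P)). have B7 := Rabs_pos (Kmul k * mm * M).
 assert (Pm : 0 <= mm) by (unfold mm; lra).
 exists D. split; [unfold D; lra|]. intros a b e t X eps W He Ht HX HW.
 split; [apply (TB_weaken e k t C1); [unfold D; lra|easy|now apply H1]|].
 split; [apply (TB_weaken e k t C2); [unfold D; lra|easy|now apply H2]|].
 split; [apply (TB_weaken e k t C4); [unfold D; lra|easy|now apply H4]|].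
 split; [apply (TB_weaken e k t C5); [unfold D; lra|easy|now apply H5]|].
 split; [apply (TB_weaken e k t C3); [unfold D; lra|easy|now apply H3]|].
 split; [apply (TB_weaken e k t (Kzf k (Gt P))); [unfold D; lra|easy|now apply TB_zf]|].
 split; intros c; [apply (TB_weaken e k t mm); [unfold D; lra|easy|now apply H6]|intros i].
 apply (TB_weaken e k t (Kmul k * mm * M)); [unfold D; lra|easy|].
 apply TB_mul; [easy|easy|easy|now apply H6|apply HW].
Qed.

(** The factor [eps] in [aW] turns the variable part of the buoyancy coefficient into [eps^(1 - nu)]
    times [pW], which is bounded since [nu < 1]; the singular part is constant and commutes with all
    derivatives. *)
Lemma ssW_split {a b} eps (W : cmp -> fld a b) : 0 < eps ->
 ssW eps W = (fcst (1 / Rpower eps (nu P)) + Rpower eps (1 - nu P) *: pW eps W)%fld.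
Proof.
 intros He. unfold ssW, aW. fring.
 replace (Rpower eps (1 - nu P)) with (1 / Rpower eps (nu P) * eps).
 - field. assert (0 < Rpower eps (nu P)) by apply exp_pos. lra.
 - unfold Rminus. rewrite Rpower_plus, Rpower_1, Rpower_Ropp by exact He. unfold Rdiv. ring.
Qed.

(** The part of the energy estimate common to its two uses. The only terms that involve the time
    variation of the weights are left as hypotheses: the uniform estimate and the purely spatial one
    control them by different means. *)
Lemma energy_system k M K0 B0 : (3 <= k)%nat -> 0 <= M -> 0 <= K0 -> 0 <= B0 ->
 exists C, 0 <= C /\ forall a b e h eps (W V : cmp -> fld a b) t X,
 0 < eps < 1 -> oi a b t -> 0 <= h -> 0 <= X -> Wb e k t M X W -> Wb e k t M X V ->
 (forall c x y z, Rabs (fder None (mW eps W c) t x y z) <= K0) ->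
 (forall l c, (length l <= k)%nat -> nrm2 t (com e l (mW eps W c) (fder None (V c))) <= B0 * (1 + X)) ->
 SYM h eps W V ->
 exists dE, is_derive (fun s => Ek e k (mW eps W) s V) t dE /\ Rabs dE <= C * (1 + X).
Proof.
 intros Hk HM HK0 HB0. destruct (coef_TB k M Hk) as [C [PC HC]].
 destruct (energy_words k) as [Ck [PCk HE]].
 set (K := K0 + sq C).
 assert (Psq : 0 <= sq C) by apply sqrt_pos.
 set (r1 := Rabs (calA P) ^ 2 * Rabs (Kmul k * C * M)).
 set (r2 := Rabs (calB P) ^ 2 * Rabs (Kmul k * C * (Kmul k * C * (Kmul k * M * M)))).
 assert (Pr1 : 0 <= r1) by (apply Rmult_le_pos; [apply pow2_ge_0|apply Rabs_pos]).
 assert (Pr2 : 0 <= r2) by (apply Rmult_le_pos; [apply pow2_ge_0|apply Rabs_pos]).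
 set (B := B0 + r1 + r2 + Rabs (Kcom k * C * M) + Rabs (Kcom k * (1 ^ 2 * C) * M)).
 have Q1 := Rle_abs (Kcom k * C * M). have Q2 := Rle_abs (Kcom k * (1 ^ 2 * C) * M).
 have Q3 := Rabs_pos (Kcom k * C * M). have Q4 := Rabs_pos (Kcom k * (1 ^ 2 * C) * M).
 assert (PB : 0 <= B) by (unfold B; lra).
 exists ((13 * K + 1) * 5 * (M + 1) + Ck * B). split.
 { apply Rplus_le_le_0_compat; apply Rmult_le_pos; try easy; [|lra]. unfold K; lra. }
 intros a b e h eps W V t X He Ht Hh HX HW HV Hdm Hct HS.
 destruct (HC a b e t X eps W He Ht HX HW) as (Tp & Tx & Ta & Tth & Tg & TGt & Tm & Tal).
 assert (UP : forall c, 0 <= c -> c <= B -> c * (1 + X) <= B * (1 + X)) by (intros; apply Rmult_le_compat_r; lra).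
 destruct (HE a b e h (mW eps W) (alW eps W) (bbW eps W) (ssW eps W) V t K (B * (1 + X)) Ht Hh) as [dE [D1 D2]].
 - intros c x y z. etr; [apply Hdm|]. unfold K; lra.
 - intros c i x y z. etr; [apply (TB_der_sup e k t X C (Some i) (alW eps W c i) Hk Ht (Tal c i))|]. unfold K; lra.
 - intros i x y z. unfold bbW. rewrite fder_add, fder_cst, fadd_at, fcst_at, Rplus_0_l by exact Ht.
  etr; [apply (TB_der_sup e k t X C (Some i) (pW eps W) Hk Ht Tp)|]. unfold K; lra.
 - intros l c Hl. rewrite HS.
  assert (T0 : TB e k t 0 X (@fcst a b 0)).
  { split; [lra|]. rewrite !N_cst by exact Ht. split; [lra|]. nra. }
  destruct c; cbn [rrW];
   [| |etr; [apply (TB_word e k t X 0); [exact Ht|exact T0|exact Hl]|rewrite Rmult_0_l; apply Rmult_le_pos; lra]..].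
  + etr; [apply (TB_word e k t X r1); [easy| |easy]|apply UP; unfold B; lra].
   apply TB_scal; [easy|easy|apply Rle_refl|]. apply (TB_weaken e k t (Kmul k * C * M)); [apply Rle_abs|easy|].
   apply TB_mul; [easy|easy|easy|easy|apply HV].
  + etr; [apply (TB_word e k t X r2); [easy| |easy]|apply UP; unfold B; lra].
   apply TB_scal; [easy|easy|apply Rle_refl|].
   apply (TB_weaken e k t (Kmul k * C * (Kmul k * C * (Kmul k * M * M)))); [apply Rle_abs|easy|].
   apply TB_mul; [easy|easy|easy|easy|]. apply TB_mul; [easy|easy|easy|easy|]. apply TB_mul; [easy|easy|easy|apply HW|apply HV].
 - intros l c Hl. etr; [now apply Hct|]. apply UP; unfold B; lra.
 - intros l c i Hl. etr; [apply (com_TB e k t X C M _ _ l Hk Ht HX); [|apply TB1_Dh; [easy|easy|easy|apply HV]|easy]|].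
  + exact (Tal c i).
  + apply Rmult_le_compat_r; [lra|unfold B; lra].
 - intros l c i Hl. unfold bbW. rewrite com_add, com_cst.
  replace (fcst 0 + com e l (pW eps W) (Dh h i (V c)))%fld with (com e l (pW eps W) (Dh h i (V c))) by fring.
  etr; [apply (com_TB e k t X C M _ _ l Hk Ht HX); [|apply TB1_Dh; [easy|easy|easy|apply HV]|easy]|].
  + exact Tp.
  + apply Rmult_le_compat_r; [lra|unfold B; lra].
 - intros l c Hl. rewrite ssW_split by lra. rewrite com_add, com_cst.
  set (g := (Rpower eps (1 - nu P) *: pW eps W)%fld).
  replace (fcst 0 + com e l g (V c))%fld with (com e l g (V c)) by fring.
  etr; [apply (com_TB e k t X (1 ^ 2 * C) M _ _ l Hk Ht HX); [| |easy]|].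
  + have Hnu := nu_pos. unfold g. apply TB_scal; [easy|easy|apply Rpower_abs1; lra|easy].
  + apply TB_TB1; [easy|apply HV].
  + apply Rmult_le_compat_r; [lra|unfold B; lra].
 - exists dE. split; [exact D1|]. etr; [exact D2|].
  assert (HN : NS e k t V <= 5 * (M + 1) * (1 + X)).
  { unfold NS, sumc.
   assert (T : forall c, Nk e k t (V c) <= M * (1 + X)) by (intros c; apply HV).
   have T1 := T cQ. have T2 := T cH. have T3 := T cV1. have T4 := T cV2. have T5 := T cW. lra. }
  assert ((13 * K + 1) * NS e k t V <= (13 * K + 1) * (5 * (M + 1) * (1 + X))) by (apply Rmult_le_compat_l; [unfold K; lra|easy]).
  lra.
Qed.

(* With [e = eps^sigma], [sigma <= mu], the weights are constants up to [O(e)]; this is what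
 lets the weighted time derivative absorb the commutators with the weights. *)
Definition mtW {a b} eps sigma (W : cmp -> fld a b) (c : cmp) : fld a b :=
 match c with
 | cQ => fcst 0
 | cH => (calB P *: (Rpower eps (1 - sigma) *: pW eps W))%fld
 | _ => (Rpower eps (mu P - sigma) *: xW eps W + Rpower eps (1 - sigma) *: (pW eps W * thW eps W))%fld
 end.

Definition m0 (c : cmp) : R := match c with cQ => calA P | cH => calB P | _ => C0 P end.

Lemma mW_split {a b} eps sigma (W : cmp -> fld a b) c : 0 < eps ->
 mW eps W c = (fcst (m0 c) + Rpower eps sigma *: mtW eps sigma W c)%fld.
Proof.
 intros He.
 assert (E1 : Rpower eps sigma * Rpower eps (1 - sigma) = eps).
 { rewrite <- Rpower_plus. replace (sigma + (1 - sigma)) with 1 by ring. now apply Rpower_1. }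
 assert (E2 : Rpower eps sigma * Rpower eps (mu P - sigma) = Rpower eps (mu P)).
 { rewrite <- Rpower_plus. f_equal. ring. }
 destruct c; cbn [mW mtW m0]; unfold aW, thW.
 - fring.
 - fring. rewrite <- (Rmult_assoc (Rpower eps sigma)), (Rmult_comm (Rpower eps sigma)), (Rmult_assoc (calB P)),
   <- (Rmult_assoc (Rpower eps sigma)), E1. ring.
 all: apply fld_eq; intros; fat; set (x' := xW eps W _ _ _ _); set (p' := pW eps W _ _ _ _);
  transitivity (C0 P + Rpower eps sigma * Rpower eps (mu P - sigma) * x'
   + Rpower eps sigma * Rpower eps (1 - sigma) * (p' * (C0 P + Rpower eps (mu P) * x'))); [rewrite E1, E2; ring|ring].
Qed.

Lemma mtW_TB k M sigma : (3 <= k)%nat -> sigma <= mu P -> exists C, 0 <= C /\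
 forall a b e t X eps (W : cmp -> fld a b), 0 < eps < 1 -> oi a b t -> 0 <= X ->
 Wb e k t M X W -> forall c, TB e k t C X (mtW eps sigma W c).
Proof.
 intros Hk Hs. destruct (coef_TB k M Hk) as [C [PC HC]]. have Hmu := mu_pos.
 set (d1 := Rabs (calB P) ^ 2 * (1 ^ 2 * C)).
 set (d2 := 2 * (1 ^ 2 * C + 1 ^ 2 * (Kmul k * C * C))).
 have A1 := Rle_abs d1. have A2 := Rle_abs d2. have B1 := Rabs_pos d1. have B2 := Rabs_pos d2.
 exists (Rabs d1 + Rabs d2). split; [lra|].
 intros a b e t X eps W He Ht HX HW.
 destruct (HC a b e t X eps W He Ht HX HW) as (Tp & Tx & Ta & Tth & _).
 assert (T2 : TB e k t (Rabs d1 + Rabs d2) X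
  (Rpower eps (mu P - sigma) *: xW eps W + Rpower eps (1 - sigma) *: (pW eps W * thW eps W))%fld).
 { apply (TB_weaken e k t d2); [lra|easy|]. apply TB_add; [easy|easy| |].
  - apply TB_scal; [easy|easy|apply Rpower_abs1; lra|exact Tx].
  - apply TB_scal; [easy|easy|apply Rpower_abs1; lra|]. apply TB_mul; [easy|easy|easy|exact Tp|exact Tth]. }
 intros c; destruct c; [| |exact T2|exact T2|exact T2].
 - split; [lra|]. cbn [mtW]. rewrite !N_cst by exact Ht. split; [lra|].
  replace (0 ^ 2) with 0 by ring. apply Rmult_le_pos; lra.
 - apply (TB_weaken e k t d1); [lra|easy|]. apply TB_scal; [easy|easy|apply Rle_refl|].
  apply TB_scal; [easy|easy|apply Rpower_abs1; lra|exact Tp].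
Qed.

(** The commutator of the weights with [fder None V] is the dangerous term, since the time
    derivative alone is not bounded uniformly in [eps]. The weights being constants plus [e] times
    [mtW], the factor [e] moves onto the time derivative, and [e] times that derivative is one of
    the letters of the norm. *)
Lemma energy_uniform k M sigma : (3 <= k)%nat -> 0 <= M -> sigma <= mu P ->
 exists C, 0 <= C /\ forall a b h eps (W V : cmp -> fld a b) t X,
 0 < eps < 1 -> oi a b t -> 0 <= h -> 0 <= X ->
 Wb (Rpower eps sigma) k t M X W -> Wb (Rpower eps sigma) k t M X V -> SYM h eps W V ->
 exists dE, is_derive (fun s => Ek (Rpower eps sigma) k (mW eps W) s V) t dE /\ Rabs dE <= C * (1 + X).
Proof.
 intros Hk HM Hs. destruct (mtW_TB k M sigma Hk Hs) as [D [PD HD]].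
 assert (PB : 0 <= Rabs (Kcom k * D * M)) by apply Rabs_pos.
 assert (Psq : 0 <= sq D) by apply sqrt_pos.
 destruct (energy_system k M (sq D) _ Hk HM Psq PB) as [C [PC HC]].
 exists C. split; [easy|]. intros a b h eps W V t X He Ht Hh HX HW HV HS.
 set (e := Rpower eps sigma) in *.
 have HT := HD a b e t X eps W He Ht HX HW.
 apply (HC a b e h eps W V t X); try assumption.
 - intros c x y z. rewrite (mW_split eps sigma) by lra. fold e.
  rewrite fder_add, fder_cst, fadd_at, fcst_at, Rplus_0_l by exact Ht. rewrite fder_scal.
  exact (TB_der_sup e k t X D None _ Hk Ht (HT c) x y z).
 (* [com_scal_swap] moves the factor [e] from the weight to the time derivative; the constant part
    of the weight has no commutator. *)
 - intros l c Hl. rewrite (mW_split eps sigma) by lra. fold e. rewrite com_add, com_cst, com_scal_swap.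
  change (e *: fder None (V c))%fld with (Zd e None (V c)).
  set (g := com e l _ _). replace (fcst 0 + g)%fld with g by fring. unfold g.
  apply Rle_trans with (Kcom k * D * M * (1 + X)); [|apply Rmult_le_compat_r; [lra|apply Rle_abs]].
  apply com_TB; [easy|easy|easy|exact (HT c)| |easy]. apply TB1_Z; [easy|easy|apply HV].
Qed.

End System.

(** * Inverses of fields bounded below *)

Definition ge0 {a b} (c : R) (f : fld a b) : Prop := forall t x y z, oi a b t -> c <= f t x y z.

Lemma ge0_neq {a b} c (f : fld a b) : 0 < c -> ge0 c f -> forall t x y z, oi a b t -> f t x y z <> 0.
Proof. intros Hc H t x y z Ht. have E := H t x y z Ht. lra. Qed.

Lemma Zd_inv {a b} e d (f : fld a b) : (forall t x y z, oi a b t -> f t x y z <> 0) ->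
 Zd e d (finv f) = fopp (Zd e d f * (finv f * finv f))%fld.
Proof.
 intros H. destruct d; unfold Zd; rewrite fder_inv by exact H; [reflexivity|]. fring.
Qed.

Lemma inv_sup {a b} c (f : fld a b) t x y z : 0 < c -> ge0 c f -> oi a b t -> finv f t x y z ^ 2 <= (/ c) ^ 2.
Proof.
 intros Hc H Ht. rewrite finv_at by now apply (ge0_neq c).
 apply pow_incr. have E := H t x y z Ht. split.
 - left; apply Rinv_0_lt_compat; lra.
 - apply Rinv_le_contravar; lra.
Qed.

Lemma inv_nrm2 {a b} c (f : fld a b) t : 0 < c -> ge0 c f -> oi a b t -> nrm2 t (finv f) <= (/ c) ^ 2.
Proof.
 intros Hc H Ht. rewrite nrm2_I3. rewrite <- (I3_const ((/ c) ^ 2)). apply I3_le.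
 - apply c3_pow. now apply fld_c3.
 - apply c3_const.
 - intros. now apply inv_sup.
Qed.

Lemma N_opp {a b} e k t (f : fld a b) : oi a b t -> Nk e k t (fopp f) = Nk e k t f.
Proof. intros Ht. unfold fopp. rewrite N_scal by exact Ht. ring. Qed.

Lemma sum4_N {a b} e k t (f : fld a b) : oi a b t -> sum4 (fun d => Nk e k t (Zd e d f)) <= Nk e (S k) t f.
Proof. intros Ht. rewrite N_S. have H := nrm2_nonneg t f Ht. lra. Qed.

(** From the derivative [- f' / f^2] of the inverse and the algebra property at order [j]. The bound
    is linear in the top-order norm of [f]. *)
Lemma inv_step j : (2 <= j)%nat -> exists K, 0 <= K /\ forall a b e t (f : fld a b) c, 0 < c -> ge0 c f -> oi a b t ->
 Nk e (S j) t (finv f) <= (/ c) ^ 2 + K * (Nk e (S j) t f * Nk e j t (finv f) ^ 2).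
Proof.
 intros Hj. destruct (prod_bound j j j) as [K [PK HK]]; [lia..|].
 exists (K * K). split; [now apply Rmult_le_pos|]. intros a b e t f c Hc H Ht.
 rewrite N_S. apply Rplus_le_compat; [now apply inv_nrm2|].
 set (r := finv f). have Pr := N_nonneg e j t r Ht.
 apply Rle_trans with (sum4 (fun d => K * K * Nk e j t r ^ 2 * Nk e j t (Zd e d f))).
 - apply sum4_le. intros d. unfold r. rewrite Zd_inv by (now apply (ge0_neq c)). fold r. rewrite N_opp by exact Ht.
  etr; [now apply HK|].
  have E := HK a b e t r r Ht. have Pd := N_nonneg e j t (Zd e d f) Ht.
  assert (K * (Nk e j t (Zd e d f) * Nk e j t (r * r)%fld) <= K * (Nk e j t (Zd e d f) * (K * (Nk e j t r * Nk e j t r)))).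
  { apply Rmult_le_compat_l; [easy|]. apply Rmult_le_compat_l; easy. }
  lra.
 - rewrite sum4_scal. have E := sum4_N e j t f Ht.
  replace (K * K * (Nk e (S j) t f * Nk e j t r ^ 2)) with (K * K * Nk e j t r ^ 2 * Nk e (S j) t f) by ring.
  apply Rmult_le_compat_l; [|easy]. apply Rmult_le_pos; [now apply Rmult_le_pos|apply pow2_ge_0].
Qed.

(** The base of the induction lies below the orders at which [prod_bound] gives an algebra. The
    pointwise bound [1 / c] is used instead, first for the inverse and its square at order 1, and
    then in the product of an order 2 and an order 1 field. *)
Lemma inv_N2 C c : 0 < c -> exists D, 0 <= D /\ forall a b e t (f : fld a b), ge0 c f -> oi a b t ->
 Nk e 3 t f <= C -> Nk e 2 t (finv f) <= D.
Proof.
 intros Hc. destruct (prod_bound 1 2 1) as [K [PK HK]]; [lia..|].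
 set (i2 := (/ c) ^ 2). assert (Pi : 0 <= i2) by apply pow2_ge_0.
 set (D1 := i2 + i2 * i2 * Rabs C). set (D2 := i2 * i2 + 4 * i2 * D1).
 exists (i2 + Rabs C * (K * D2)).
 have PC := Rabs_pos C.
 assert (P1 : 0 <= D1) by (unfold D1; assert (0 <= i2 * i2 * Rabs C) by (apply Rmult_le_pos; [now apply Rmult_le_pos|easy]); lra).
 assert (P2 : 0 <= D2) by (unfold D2; assert (0 <= i2 * i2) by (now apply Rmult_le_pos); assert (0 <= i2 * D1) by (now apply Rmult_le_pos); lra).
 assert (0 <= Rabs C * (K * D2)) by (apply Rmult_le_pos; [easy|now apply Rmult_le_pos]).
 split; [lra|]. intros a b e t f Hf Ht HC.
 assert (HC' : Nk e 3 t f <= Rabs C) by (etr; [exact HC|apply Rle_abs]).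
 set (r := finv f).
 assert (S0 : nrm2 t r <= i2) by now apply inv_nrm2.
 assert (Sr : forall g : fld a b, nrm2 t (r * g)%fld <= i2 * nrm2 t g) by (intros; apply prod_sup; [easy|intros; now apply inv_sup]).
 assert (HZ : forall d, nrm2 t (Zd e d r) <= i2 * i2 * nrm2 t (Zd e d f)).
 { intros d. unfold r. rewrite Zd_inv by (now apply (ge0_neq c)). fold r. rewrite nrm2_opp by exact Ht.
  replace (Zd e d f * (r * r))%fld with (r * (r * Zd e d f))%fld by fring.
  etr; [apply Sr|]. rewrite Rmult_assoc. apply Rmult_le_compat_l; [easy|apply Sr]. }
 assert (N1 : Nk e 1 t r <= D1).
 { rewrite N_S. unfold D1. apply Rplus_le_compat; [easy|].
  apply Rle_trans with (sum4 (fun d => i2 * i2 * Nk e 0 t (Zd e d f))); [apply sum4_le; intros; rewrite !N_0; apply HZ|].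
  rewrite sum4_scal. apply Rmult_le_compat_l; [now apply Rmult_le_pos|].
  etr; [now apply sum4_N|]. etr; [apply (N_mono e 1 3); [easy|lia]|easy]. }
 assert (N1' : Nk e 1 t (r * r)%fld <= D2).
 { rewrite N_S. unfold D2. apply Rplus_le_compat; [etr; [apply Sr|now apply Rmult_le_compat_l]|].
  apply Rle_trans with (sum4 (fun d => 4 * i2 * Nk e 0 t (Zd e d r))).
  - apply sum4_le. intros d. rewrite Z_mul, !N_0.
   replace (Zd e d r * r + r * Zd e d r)%fld with (2 *: (r * Zd e d r))%fld by fring.
   rewrite nrm2_scal by exact Ht. have Q := Sr (Zd e d r). lra.
  - rewrite sum4_scal. apply Rmult_le_compat_l; [lra|]. etr; [now apply sum4_N|easy]. }
 rewrite N_S. apply Rplus_le_compat; [easy|].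
 apply Rle_trans with (sum4 (fun d => (K * D2) * Nk e 2 t (Zd e d f))).
 - apply sum4_le. intros d. unfold r. rewrite Zd_inv by (now apply (ge0_neq c)). fold r. rewrite N_opp by exact Ht.
  etr; [now apply HK|]. rewrite Rmult_assoc. apply Rmult_le_compat_l; [easy|].
  rewrite Rmult_comm. apply Rmult_le_compat_r; [now apply N_nonneg|easy].
 - rewrite sum4_scal, Rmult_comm. apply Rmult_le_compat_r; [now apply Rmult_le_pos|].
  etr; [now apply sum4_N|easy].
Qed.

Lemma inv_N j C c : (2 <= j)%nat -> 0 < c -> exists D, 0 <= D /\ forall a b e t (f : fld a b), ge0 c f -> oi a b t ->
 Nk e (Nat.max j 3) t f <= C -> Nk e j t (finv f) <= D.
Proof.
 intros Hj Hc. induction j as [|j IH]; [lia|].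
 destruct (Nat.eq_dec j 1) as [->|Hj1]; [exact (inv_N2 C c Hc)|].
 destruct IH as [D [PD HD]]; [lia|]. destruct (inv_step j) as [K [PK HK]]; [lia|].
 exists ((/ c) ^ 2 + K * (Rabs C * D ^ 2)).
 assert (0 <= K * (Rabs C * D ^ 2)) by (apply Rmult_le_pos; [easy|apply Rmult_le_pos; [apply Rabs_pos|apply pow2_ge_0]]).
 split; [have Q := pow2_ge_0 (/ c); lra|]. intros a b e t f Hf Ht HC.
 replace (Nat.max (S j) 3) with (S j) in HC by lia.
 etr; [exact (HK a b e t f c Hc Hf Ht)|]. apply Rplus_le_compat_l, Rmult_le_compat_l; [easy|].
 apply Rmult_le_compat; [now apply N_nonneg|apply pow2_ge_0|etr; [exact HC|apply Rle_abs]|].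
 apply pow_incr. split; [now apply N_nonneg|]. apply HD; [easy|easy|].
 etr; [apply (N_mono e (Nat.max j 3) (S j)); [easy|lia]|exact HC].
Qed.

Lemma inv_TB k C c : (3 <= k)%nat -> 0 < c -> exists D, 0 <= D /\ forall a b e t X (f : fld a b), ge0 c f -> oi a b t -> 0 <= X ->
 TB e k t C X f -> TB e k t D X (finv f).
Proof.
 intros Hk Hc. destruct (inv_N (pk k) C c) as [D1 [P1 H1]]; [unfold pk; lia|easy|].
 destruct (inv_N (k - 1) C c) as [D2 [P2 H2]]; [lia|easy|]. destruct (inv_step (k - 1)) as [K [PK HK]]; [lia|].
 set (D3 := (/ c) ^ 2 + K * (Rabs C * D2 ^ 2)).
 assert (P3 : 0 <= D3).
 { unfold D3. assert (0 <= K * (Rabs C * D2 ^ 2)) by (apply Rmult_le_pos; [easy|apply Rmult_le_pos; [apply Rabs_pos|apply pow2_ge_0]]).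
  have Q := pow2_ge_0 (/ c); lra. }
 exists (D1 + D3). split; [lra|]. intros a b e t X f Hf Ht HX (Q & F1 & F2).
 assert (E1 : Nk e (pk k) t (finv f) <= D1).
 { apply H1; [easy|easy|]. replace (Nat.max (pk k) 3) with (pk k) by (unfold pk; lia). easy. }
 split; [lra|]. split; [lra|].
 assert (E2 : Nk e (k - 1) t (finv f) <= D2).
 { apply H2; [easy|easy|]. etr; [apply (N_mono e _ (pk k)); [easy|unfold pk; lia]|easy]. }
 have E := HK a b e t f c Hc Hf Ht. replace (S (k - 1)) with k in E by lia.
 etr; [exact E|].
 apply Rle_trans with ((/ c) ^ 2 + K * (Rabs C * (1 + X) * D2 ^ 2)).
 - apply Rplus_le_compat_l, Rmult_le_compat_l; [easy|]. apply Rmult_le_compat; [now apply N_nonneg|apply pow2_ge_0| |].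
  + etr; [exact F2|]. apply Rmult_le_compat_r; [lra|apply Rle_abs].
  + apply pow_incr. split; [now apply N_nonneg|easy].
 - assert (0 <= D1 * (1 + X)) by (apply Rmult_le_pos; lra).
  assert (0 <= (/ c) ^ 2 * X) by (apply Rmult_le_pos; [apply pow2_ge_0|easy]).
  unfold D3. lra.
Qed.

Section Frozen.
Context (P : params) (HP : admissible P).
Local Notation mw := (mW P HP). Local Notation bbw := (bbW P HP).
Local Notation aw := (aW P HP).
Local Notation thw := (thW P HP). Local Notation gw := (gW P HP).

Definition adv {a b} h (W : cmp -> fld a b) (f : fld a b) : fld a b := sum3 (fun i => W (vel i) * Dh h i f)%fld.

(** Right-hand side with coefficients frozen at [W] and differences of mesh [h]; at [h = 0] and
    [W = V] it is [CE_rhs], as shown in [Lam_rhs]. Every component has the shape [a - adv - b],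
    whence the zero fields and the double negative in [cH]: bounds and limits then follow a single
    pattern. *)
Definition Lam {a b} h eps (W V : cmp -> fld a b) (c : cmp) : fld a b :=
 match c with
 | cQ => (gw eps * V cW - adv h W (V cQ) - / calA P *: (bbw eps W * sum3 (fun i => Dh h i (V (vel i)))))%fld
 | cH => (fGt P HP * (W cH * V cW) - adv h W (V cH) - (- / (calB P * Rpower eps (nu P))) *: V cW)%fld
 | cV1 => (fcst 0 - adv h W (V cV1) - finv (thw eps W) * (1 / eps *: Dh h AxX (V cQ)))%fld
 | cV2 => (fcst 0 - adv h W (V cV2) - finv (thw eps W) * (1 / eps *: Dh h AxY (V cQ)))%fld
 | cW => (fcst 0 - adv h W (V cW)
     - finv (thw eps W) * (1 / eps *: Dh h AxZ (V cQ) + 1 / Rpower eps (nu P) *: V cH))%fld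
 end.

Lemma Lam_SYM {a b} h eps (W V : cmp -> fld a b) kap : 0 < eps -> 0 < kap -> ge0 kap (thw eps W) ->
 (forall c, fder None (V c) = Lam h eps W V c) -> SYM P HP h eps W V.
Proof.
 intros He Hk Hth H c. unfold Lop. rewrite H.
 have HA := calA_pos P HP. have HB := calB_pos P HP.
 assert (Hr : 0 < Rpower eps (nu P)) by apply exp_pos.
 apply fld_eq. intros t x y z Ht. have Hn := Hth t x y z Ht.
 assert (Ei : forall x y z, finv (thw eps W) t x y z = / thw eps W t x y z)
  by (intros; apply finv_at; now apply (ge0_neq kap)).
 destruct c; cbn [Lam coupling rrW mW vel]; unfold alW, adv, sum3; cbn [vel mW]; fat; rewrite ?Ei.
 - unfold bbW; fat. field. lra.
 - unfold ssW; fat. field. lra.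
 - unfold bbW, aW; fat. field. lra.
 - unfold bbW, aW; fat. field. lra.
 - unfold bbW, ssW, aW; fat. field. lra.
Qed.

Lemma TB1_sum3 {a b} e k t X C (F : axis -> fld a b) : oi a b t -> 0 <= X -> (forall i, TB1 e k t C X (F i)) ->
 TB1 e k t (2 * (2 * (C + C) + C)) X (sum3 F).
Proof. intros Ht HX H. unfold sum3. apply TB1_add; [easy|easy|apply TB1_add; [easy|easy|apply H|apply H]|apply H]. Qed.

Lemma TB1_sub {a b} e k t X C1 C2 (f g : fld a b) : oi a b t -> 0 <= X ->
 TB1 e k t C1 X f -> TB1 e k t C2 X g -> TB1 e k t (2 * (C1 + 1 ^ 2 * C2)) X (f - g)%fld.
Proof. intros Ht HX Hf Hg. unfold fsub. apply TB1_add; [easy|easy|easy|now apply TB1_opp]. Qed.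

Lemma TB1_weaken {a b} e k t C D X (f : fld a b) : C <= D -> 0 <= X -> TB1 e k t C X f -> TB1 e k t D X f.
Proof. intros H HX (H1 & H2 & H3). split; [lra|]. split; [lra|]. nra. Qed.

(** The constant depends on [eps], through [1 / eps] and [1 / eps^nu]: this bound serves the
    construction of solutions for fixed [eps], not the uniform estimate. *)
Lemma Lam_TB k M kap eps : (3 <= k)%nat -> 0 < kap -> 0 < eps < 1 -> exists C, 0 <= C /\
 forall a b e h t X (W V : cmp -> fld a b), oi a b t -> 0 <= h -> 0 <= X -> Wb e k t M X W -> Wb e k t M X V ->
 ge0 kap (thw eps W) -> forall c, TB1 e k t C X (Lam h eps W V c).
Proof.
 intros Hk Hkap He. destruct (coef_TB P HP k M Hk) as [C [PC HC]].
 destruct (inv_TB k C kap Hk Hkap) as [Ci [PCi HCi]].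
 assert (HL : exists D, forall a b e h t X (W V : cmp -> fld a b), oi a b t -> 0 <= h -> 0 <= X -> Wb e k t M X W -> Wb e k t M X V ->
  ge0 kap (thw eps W) -> TB1 e k t D X (Lam h eps W V cQ)).
 { eexists. intros a b e h t X W V Ht Hh HX HW HV Hth.
  destruct (HC a b e t X eps W He Ht HX HW) as (Tp & Tx & Ta & Tth & Tg & TGt & Tm & Tal).
  assert (TD : forall c i, TB1 e k t M X (Dh h i (V c))) by (intros; apply TB1_Dh; [easy|easy|easy|apply HV]).
  cbn [Lam].
  apply TB1_sub; [easy|easy|apply TB1_sub; [easy|easy| |]|].
  - apply TB1_mul; [easy|easy|easy|exact Tg|apply TB_TB1; [easy|apply HV]].
  - apply TB1_sum3; [easy|easy|]. intros i. apply TB1_mul; [easy|easy|easy|apply HW|apply TD].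
  - apply TB1_scal; [easy|easy|apply Rle_refl|]. apply TB1_mul; [easy|easy|easy| |apply TB1_sum3; [easy|easy|intros; apply TD]].
   apply TB_add; [easy|easy|apply TB_cst; [easy|easy|apply Rle_refl]|exact Tp]. }
 destruct HL as [D1 L1].
 assert (HL : exists D, forall a b e h t X (W V : cmp -> fld a b), oi a b t -> 0 <= h -> 0 <= X -> Wb e k t M X W -> Wb e k t M X V ->
  ge0 kap (thw eps W) -> TB1 e k t D X (Lam h eps W V cH)).
 { eexists. intros a b e h t X W V Ht Hh HX HW HV Hth.
  destruct (HC a b e t X eps W He Ht HX HW) as (Tp & Tx & Ta & Tth & Tg & TGt & Tm & Tal).
  assert (TD : forall c i, TB1 e k t M X (Dh h i (V c))) by (intros; apply TB1_Dh; [easy|easy|easy|apply HV]).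
  assert (T1 : forall c, TB1 e k t M X (V c)) by (intros; apply TB_TB1; [easy|apply HV]).
  cbn [Lam].
  apply TB1_sub; [easy|easy|apply TB1_sub; [easy|easy| |]|].
  - apply TB1_mul; [easy|easy|easy|exact TGt|]. apply TB1_mul; [easy|easy|easy|apply HW|apply T1].
  - apply TB1_sum3; [easy|easy|]. intros i. apply TB1_mul; [easy|easy|easy|apply HW|apply TD].
  - apply TB1_scal; [easy|easy|apply Rle_refl|apply T1]. }
 destruct HL as [D2 L2].
 assert (HL : exists D, forall a b e h t X (W V : cmp -> fld a b) c i k1 k2, oi a b t -> 0 <= h -> 0 <= X -> Wb e k t M X W -> Wb e k t M X V ->
  ge0 kap (thw eps W) -> Rabs k1 <= 1 / eps -> Rabs k2 <= 1 / Rpower eps (nu P) ->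
  TB1 e k t D X (fcst 0 - adv h W (V c) - finv (thw eps W) * (k1 *: Dh h i (V cQ) + k2 *: V cH))%fld).
 { eexists. intros a b e h t X W V c i k1 k2 Ht Hh HX HW HV Hth Hk1 Hk2.
  destruct (HC a b e t X eps W He Ht HX HW) as (Tp & Tx & Ta & Tth & Tg & TGt & Tm & Tal).
  assert (TD : forall c i, TB1 e k t M X (Dh h i (V c))) by (intros; apply TB1_Dh; [easy|easy|easy|apply HV]).
  assert (T1 : forall c, TB1 e k t M X (V c)) by (intros; apply TB_TB1; [easy|apply HV]).
  apply TB1_sub; [easy|easy|apply TB1_sub; [easy|easy| |]|].
  - apply TB_TB1; [easy|]. apply TB_cst; [easy|easy|apply Rle_refl].
  - apply TB1_sum3; [easy|easy|]. intros j. apply TB1_mul; [easy|easy|easy|apply HW|apply TD].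
  - apply TB1_mul; [easy|easy|easy|apply HCi; assumption|].
   apply TB1_add; [easy|easy| |]; (apply TB1_scal; [easy|easy|eassumption|]); [apply TD|apply T1]. }
 destruct HL as [D3 L3].
 exists (Rabs D1 + Rabs D2 + Rabs D3).
 have A1 := Rle_abs D1. have A2 := Rle_abs D2. have A3 := Rle_abs D3.
 have B1 := Rabs_pos D1. have B2 := Rabs_pos D2. have B3 := Rabs_pos D3.
 split; [lra|]. intros a b e h t X W V Ht Hh HX HW HV Hth c.
 assert (Pe : 0 < 1 / eps) by (apply Rdiv_lt_0_compat; lra).
 assert (Pr : 0 < 1 / Rpower eps (nu P)) by (apply Rdiv_lt_0_compat; [lra|apply exp_pos]).
 assert (E0 : Rabs 0 <= 1 / Rpower eps (nu P)) by (rewrite Rabs_R0; lra).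
 assert (E1 : Rabs (1 / eps) <= 1 / eps) by (rewrite Rabs_right; lra).
 assert (E2 : Rabs (1 / Rpower eps (nu P)) <= 1 / Rpower eps (nu P)) by (rewrite Rabs_right; lra).
 assert (Z0 : forall f g : fld a b, f = (f + 0 *: g)%fld) by (intros; fring).
 destruct c.
 - apply (TB1_weaken e k t D1); [lra|easy|now apply L1].
 - apply (TB1_weaken e k t D2); [lra|easy|now apply L2].
 - apply (TB1_weaken e k t D3); [lra|easy|]. cbn [Lam]. rewrite (Z0 (1 / eps *: Dh h AxX (V cQ))%fld (V cH)). now apply L3.
 - apply (TB1_weaken e k t D3); [lra|easy|]. cbn [Lam]. rewrite (Z0 (1 / eps *: Dh h AxY (V cQ))%fld (V cH)). now apply L3.
 - apply (TB1_weaken e k t D3); [lra|easy|]. cbn [Lam]. now apply L3.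
Qed.

Lemma mW_dt_sup C K eps : 0 <= C -> 0 <= K -> 0 < eps < 1 -> exists K0, 0 <= K0 /\
 forall a b (W : cmp -> fld a b) t, oi a b t ->
 (forall c x y z, Rabs (fder None (W c) t x y z) <= K) ->
 (forall x y z, Rabs (aw eps W t x y z) <= C) -> (forall x y z, Rabs (thw eps W t x y z) <= C) ->
 (forall x y z, Rabs (@fGt P HP a b t x y z) <= C) ->
 (forall x y z, Rabs (fder None (aw eps W) t x y z) <= K0) /\
 (forall x y z, Rabs (fder None (thw eps W) t x y z) <= K0) /\
 forall c x y z, Rabs (fder None (mw eps W c) t x y z) <= K0.
Proof.
 intros HC HK He.
 set (Ka := eps * (/ varpi0 P * K)). set (Kt := Rpower eps (mu P) * (Rpower eps (nu P) * (C * K))).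
 assert (Hv : 0 < / varpi0 P) by (apply Rinv_0_lt_compat, varpi0_pos, HP).
 assert (Hr1 : 0 < Rpower eps (mu P)) by apply exp_pos. assert (Hr2 : 0 < Rpower eps (nu P)) by apply exp_pos.
 assert (PKa : 0 <= Ka) by (unfold Ka; repeat apply Rmult_le_pos; lra).
 assert (PKt : 0 <= Kt) by (unfold Kt; repeat apply Rmult_le_pos; lra).
 have HB := calB_pos P HP.
 assert (PB : 0 <= calB P * Ka) by (apply Rmult_le_pos; lra).
 assert (PC1 : 0 <= C * (Ka + Kt)) by (apply Rmult_le_pos; lra).
 exists (Ka + Kt + calB P * Ka + C * (Ka + Kt)). split; [lra|].
 intros a b W t Ht HW Ha Hth HG.
 assert (Fz : forall g Hs Hp, fder None (@fzf a b g Hs Hp) = fcst 0).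
 { intros g Hs Hp.
  assert (Hp' : forall z, Derive g (z + 1) = Derive g z).
  { intros z. transitivity (Derive (fun r => g (r + 1)) z).
   - symmetry. apply is_derive_unique. apply is_derive_shift. apply Derive_correct. exact (Hs 1%nat (z + 1)).
   - apply Derive_ext. apply Hp. }
  exact (fder_zf None g Hs Hp (smooth1_Derive g Hs) Hp'). }
 assert (Ea : fder None (aw eps W) = (eps *: (/ varpi0 P *: fder None (W cQ)))%fld).
 { unfold aW, pW, phiF, fIG, fIH. rewrite fder_add, fder_cst, !fder_scal, fder_sub, fder_add, !fder_scal, !Fz. fring. }
 assert (Et : fder None (thw eps W) = (Rpower eps (mu P) *: (Rpower eps (nu P) *: (fGt P HP * fder None (W cH))))%fld).
 { unfold thW, xW, fGt, fHb. rewrite fder_add, fder_cst, !fder_scal, fder_add, fder_scal, !fder_mul, !Fz. fring. }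
 assert (Ba : forall x y z, Rabs (fder None (aw eps W) t x y z) <= Ka).
 { intros x y z. rewrite Ea. fat. rewrite !Rabs_mult, (Rabs_right eps), (Rabs_right (/ varpi0 P)) by lra.
  unfold Ka. repeat (apply Rmult_le_compat_l; [lra|]). apply HW. }
 assert (Bt : forall x y z, Rabs (fder None (thw eps W) t x y z) <= Kt).
 { intros x y z. rewrite Et. fat. rewrite !Rabs_mult, (Rabs_right (Rpower eps (mu P))), (Rabs_right (Rpower eps (nu P))) by lra.
  unfold Kt. repeat (apply Rmult_le_compat_l; [lra|]). apply Rmult_le_compat; try apply Rabs_pos; [apply HG|apply HW]. }
 split; [intros; etr; [apply Ba|lra]|]. split; [intros; etr; [apply Bt|lra]|].
 assert (Bm : forall x y z, Rabs (fder None (aw eps W * thw eps W)%fld t x y z) <= C * (Ka + Kt)).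
 { intros x y z. rewrite fder_mul. fat. etr; [apply Rabs_triang|]. rewrite !Rabs_mult.
  assert (Rabs (fder None (aw eps W) t x y z) * Rabs (thw eps W t x y z) <= Ka * C)
   by (apply Rmult_le_compat; try apply Rabs_pos; [apply Ba|apply Hth]).
  assert (Rabs (aw eps W t x y z) * Rabs (fder None (thw eps W) t x y z) <= C * Kt)
   by (apply Rmult_le_compat; try apply Rabs_pos; [apply Ha|apply Bt]). lra. }
 intros c x y z. destruct c; cbn [mW].
 - rewrite fder_cst, fcst_at, Rabs_R0 by exact Ht. lra.
 - rewrite fder_scal, fscal_at, Rabs_mult, (Rabs_right (calB P)) by lra.
  assert (calB P * Rabs (fder None (aw eps W) t x y z) <= calB P * Ka) by (apply Rmult_le_compat_l; [lra|apply Ba]). lra.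
 - have Q := Bm x y z; lra.
 - have Q := Bm x y z; lra.
 - have Q := Bm x y z; lra.
Qed.

(** With [e = 0] time derivatives are absent from the norm; those in the commutators are replaced
    through the equation and bounded by [Lam_TB], at the price of a constant depending on [eps] but
    not on [h]. *)
Lemma energy_spatial k M K1 kap eps : (3 <= k)%nat -> 0 <= M -> 0 <= K1 -> 0 < kap -> 0 < eps < 1 ->
 exists C, 0 <= C /\ forall a b h (W V : cmp -> fld a b) t X,
 oi a b t -> 0 <= h -> 0 <= X -> Wb 0 k t M X W -> Wb 0 k t M X V ->
 (forall c x y z, Rabs (fder None (W c) t x y z) <= K1) -> ge0 kap (thw eps W) ->
 (forall c, fder None (V c) = Lam h eps W V c) ->
 exists dE, is_derive (fun s => Ek 0 k (mw eps W) s V) t dE /\ Rabs dE <= C * (1 + X).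
Proof.
 intros Hk HM HK1 Hkap He.
 destruct (coef_TB P HP k M Hk) as [C [PC HC]]. destruct (Lam_TB k M kap eps Hk Hkap He) as [D [PD HD]].
 destruct (mW_dt_sup (sq C) K1 eps (sqrt_pos _) HK1 He) as [K0 [PK0 HK0]].
 assert (PB : 0 <= Rabs (Kcom k * C * D)) by apply Rabs_pos.
 destruct (energy_system P HP k M K0 _ Hk HM PK0 PB) as [C' [PC' HC']].
 exists C'. split; [easy|]. intros a b h W V t X Ht Hh HX HW HV HdW Hth HL.
 destruct (HC a b 0 t X eps W He Ht HX HW) as (Tp & Tx & Ta & Tth & Tg & TGt & Tm & Tal).
 apply (HC' a b 0 h eps W V t X); try assumption.
 - apply (HK0 a b W t); try assumption; apply (TB_sup 0 k t X); assumption.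
 - intros l c Hl. rewrite HL. apply Rle_trans with (Kcom k * C * D * (1 + X)); [|apply Rmult_le_compat_r; [lra|apply Rle_abs]].
  apply com_TB; [easy|easy|easy|apply Tm|now apply HD|easy].
 - apply (Lam_SYM h eps W V kap); try assumption; lra.
Qed.

End Frozen.

(* Continuity method, Gronwall inequalities and limits of fields *)
Global Opaque Zd.

(** Continuity method on the set of times up to which [g <= M]. Its supremum [m] satisfies
    [g m <= M'] because the hypothesis asks for the weak bound before [m] only; the gap [M' < M] and
    continuity then push past [m]. *)
Lemma bootstrap (g : R -> R) T M M' : M' < M -> (forall r, 0 <= r < T -> continuous g r) ->
 (forall r, 0 <= r < T -> (forall s, 0 <= s < r -> g s <= M) -> g r <= M') ->
 forall r, 0 <= r < T -> g r <= M'.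
Proof.
 intros HM Hc Hs r1 Hr1.
 set (E := fun r => 0 <= r <= r1 /\ forall s, 0 <= s < r -> g s <= M).
 destruct (completeness E) as [m [Hub Hlub]].
 - exists r1. intros r [Hr _]. lra.
 - exists 0. split; [lra|]. intros; lra.
 - assert (Hm0 : 0 <= m) by (apply Hub; split; [lra|intros; lra]).
  assert (Hm1 : m <= r1) by (apply Hlub; intros r [Hr _]; lra).
  assert (Hm : forall s, 0 <= s < m -> g s <= M).
  { intros s Hs'. apply NNPP. intros Hn.
   assert (m <= s); [|lra]. apply Hlub. intros r [Hr HE]. destruct (Rle_dec r s); [easy|]. exfalso. apply Hn, HE. lra. }
  assert (Hgm : g m <= M') by (apply Hs; [lra|exact Hm]).
  destruct (Req_dec m r1) as [<-|Hne]; [exact Hgm|exfalso].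
  assert (Hd : 0 < M - M') by lra.
  assert (Hlt : m < r1) by (destruct Hm1; [easy|contradiction]).
  assert (HmT : 0 <= m < T) by (split; lra).
  destruct (proj1 (filterlim_locally _ _) (Hc m HmT) (mkposreal _ Hd)) as [dl Hdl].
  have Hdp := cond_pos dl.
  set (r2 := Rmin r1 (m + dl / 2)).
  assert (Hr2 : m < r2 <= r1 /\ r2 <= m + dl / 2) by (unfold r2, Rmin; destruct Rle_dec; lra).
  assert (HE : E r2); [|have Q := Hub r2 HE; lra].
  split; [lra|]. intros s Hs'. destruct (Rlt_dec s m); [apply Hm; lra|].
  assert (Q' : Rabs (g s - g m) < M - M') by (apply (Hdl s), R_ball, Rabs_def1; lra).
  apply Rabs_def2 in Q'. lra.
Qed.

Lemma nonincreasing_of_derive (f df : R -> R) T : (forall r, 0 <= r < T -> is_derive f r (df r)) ->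
 (forall r, 0 <= r < T -> df r <= 0) -> forall r, 0 <= r < T -> f r <= f 0.
Proof.
 intros Hd Hn r Hr. destruct (Req_dec r 0) as [->|Hr0]; [lra|].
 destruct (MVT_gen f 0 r df) as [c [Hc1 Hc2]].
 - rewrite Rmin_left, Rmax_right by lra. intros; apply Hd; lra.
 - rewrite Rmin_left, Rmax_right by lra. intros x Hx. apply continuity_pt_filterlim.
  apply continuous_of_ex_derive. eexists. apply Hd. lra.
 - rewrite Rmin_left, Rmax_right in Hc1 by lra. have Q := Hn c ltac:(lra). nra.
Qed.

Lemma exp_le x y : x <= y -> exp x <= exp y.
Proof. intros [H| ->]; [left; now apply exp_increasing|lra]. Qed.

(** The function [(y + B) exp (- C r)] is nonincreasing. *)
Lemma gronwall_zero (y dy : R -> R) T C B : 0 <= C ->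
 (forall r, 0 <= r < T -> is_derive y r (dy r)) -> y 0 <= 0 ->
 (forall r, 0 <= r < T -> dy r <= C * (y r + B)) ->
 forall r, 0 <= r < T -> y r <= B * (exp (C * r) - 1).
Proof.
 intros HC Hd H0 Hle r Hr.
 set (f := fun r => (y r + B) * exp (- C * r)).
 set (df := fun r => dy r * exp (- C * r) + (y r + B) * (- C * exp (- C * r))).
 assert (Hf : f r <= f 0).
 { apply (nonincreasing_of_derive f df T); [| |exact Hr].
  - intros s Hs. unfold f, df.
   apply (is_derive_mult (K:=RA) (fun r => y r + B) (fun r => exp (- C * r))); [| |apply Rmult_comm].
   + replace (dy s) with (plus (dy s) 0) by (unfold plus; simpl; ring).
    apply (is_derive_plus (K:=RA) (V:=RN)); [now apply Hd|apply (is_derive_const (K:=RA) (V:=RN))].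
   + auto_derive; [easy|ring].
  - intros s Hs. unfold df. have He := exp_pos (- C * s). have Q := Hle s Hs.
   replace (dy s * exp (- C * s) + (y s + B) * (- C * exp (- C * s))) with ((dy s - C * (y s + B)) * exp (- C * s)) by ring.
   nra. }
 unfold f in Hf. rewrite Rmult_0_r, exp_0 in Hf.
 have He := exp_pos (C * r).
 assert (E : exp (- C * r) * exp (C * r) = 1) by (rewrite <- exp_plus; replace (- C * r + C * r) with 0 by ring; apply exp_0).
 assert (Q : (y r + B) * exp (- C * r) * exp (C * r) <= B * exp (C * r)) by (apply Rmult_le_compat_r; lra).
 rewrite Rmult_assoc, E in Q. lra.
Qed.

(* Comparison with [z = c K e^(L r)], for which [z' = 3 C K e^(L r)] when [L = 3 C / c]. *)
Lemma gronwall_chain (y dy : R -> R) T C c K : 0 <= C -> 0 < c -> 1 <= K ->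
 (forall r, 0 <= r < T -> is_derive y r (dy r)) -> y 0 <= c * K ->
 (forall r, 0 <= r < T -> dy r <= C * (1 + y r / c + K * exp (3 * C / c * r))) ->
 forall r, 0 <= r < T -> y r <= c * K * exp (3 * C / c * r).
Proof.
 intros HC Hc HK Hd H0 Hle r Hr. set (L := 3 * C / c) in *. set (z := fun r => c * K * exp (L * r)).
 assert (PL : 0 <= C / c) by now apply Rdiv_le_0_compat.
 have G := gronwall_zero (fun r => y r - z r) (fun r => dy r - L * z r) T (C / c) 0 PL.
 change (y r <= z r). assert (Q : y r - z r <= 0 * (exp (C / c * r) - 1)); [|lra]. apply G; [| | |exact Hr].
 - intros s Hs. apply (is_derive_minus (K:=RA) (V:=RN)); [now apply Hd|]. unfold z. auto_derive; [easy|ring].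
 - unfold z. rewrite Rmult_0_r, exp_0. lra.
 - intros s Hs. have Q := Hle s Hs.
  assert (He : 1 <= exp (L * s)) by (rewrite <- exp_0; apply exp_le, Rmult_le_pos; [now apply Rdiv_le_0_compat; lra|lra]).
  assert (E1 : L * z s = 3 * (C * K * exp (L * s))) by (unfold z; set (ex := exp (L * s)); unfold L; field; lra).
  assert (E2 : C / c * z s = C * K * exp (L * s)) by (unfold z; set (ex := exp (L * s)); field; lra).
  assert (E3 : C <= C * K * exp (L * s)).
  { rewrite <- (Rmult_1_r C) at 1. rewrite Rmult_assoc. apply Rmult_le_compat_l; [easy|]. nra. }
  assert (E4 : C * (y s / c) = C / c * y s) by (field; lra). lra.
Qed.

(** The derivatives converge uniformly in the Cauchy sense, the functions only pointwise: the mean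
    value theorem applied to [f n - f m], with [m] sent to infinity, makes the difference quotients
    of [f n] uniformly close to those of [g]. *)
Lemma is_derive_uniform_limit (f df : nat -> R -> R) (g : R -> R) (l x : R) (del : posreal) :
 (forall n r, ball x del r -> is_derive (f n) r (df n r)) ->
 (forall r, ball x del r -> forall eta, 0 < eta -> exists n0, forall n, (n0 <= n)%nat -> Rabs (f n r - g r) <= eta) ->
 (forall eta, 0 < eta -> exists n0, forall n m r, (n0 <= n)%nat -> (n0 <= m)%nat -> ball x del r -> Rabs (df n r - df m r) <= eta) ->
 (forall eta, 0 < eta -> exists n0, forall n, (n0 <= n)%nat -> Rabs (df n x - l) <= eta) ->
 is_derive g x l.
Proof.
 intros Hd Hf Hc Hl. apply is_derive_Reals. intros eps Heps.
 assert (H4 : 0 < eps / 4) by lra.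
 destruct (Hc _ H4) as [n1 H1]. destruct (Hl _ H4) as [n2 H2]. set (n := Nat.max n1 n2).
 assert (Hx : ball x del x) by apply ball_center.
 destruct (proj1 (is_derive_Reals _ _ _) (Hd n x Hx) (eps / 4) H4) as [d1 Hd1].
 assert (Hp : 0 < Rmin d1 del) by (apply Rmin_pos; apply cond_pos).
 exists (mkposreal _ Hp). intros h Hh0 Hh. simpl in Hh.
 assert (Hh1 : Rabs h < d1) by (eapply Rlt_le_trans; [exact Hh|apply Rmin_l]).
 assert (Hh2 : Rabs h < del) by (eapply Rlt_le_trans; [exact Hh|apply Rmin_r]).
 have Q1 := Hd1 h Hh0 Hh1.
 assert (Hb : forall r, Rmin x (x + h) <= r <= Rmax x (x + h) -> ball x del r).
 { intros r Hr. apply R_ball.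
  apply Rabs_def2 in Hh2. unfold Rmin, Rmax in Hr. destruct (Rle_dec x (x + h)); apply Rabs_def1; lra. }
 assert (Hxh : ball x del (x + h)) by (apply Hb; split; [apply Rmin_r|apply Rmax_r]).
 assert (Q2 : Rabs ((f n (x + h) - g (x + h)) - (f n x - g x)) <= eps / 4 * Rabs h).
 { apply le_epsilon. intros eta Heta. assert (He2 : 0 < eta / 2) by lra.
  destruct (Hf _ Hxh _ He2) as [m1 M1]. destruct (Hf _ Hx _ He2) as [m2 M2].
  set (m := Nat.max n1 (Nat.max m1 m2)).
  have A1 := M1 m ltac:(lia). have A2 := M2 m ltac:(lia).
  assert (A3 : Rabs ((f n (x + h) - f m (x + h)) - (f n x - f m x)) <= eps / 4 * Rabs (x + h - x)).
  { apply (MVT_Rabs_le (fun r => f n r - f m r) (fun r => df n r - df m r)).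
   - intros r Hr. apply (is_derive_minus (K:=RA) (V:=RN)); apply Hd, Hb; lra.
   - intros r Hr. apply continuous_of_ex_derive. eexists.
    apply (is_derive_minus (K:=RA) (V:=RN)); apply Hd, Hb; lra.
   - intros r Hr. apply H1; [lia|lia|apply Hb; lra]. }
  replace (x + h - x) with h in A3 by ring.
  apply Rabs_le_between in A1. apply Rabs_le_between in A2. apply Rabs_le_between in A3. apply Rabs_le. lra. }
 have Q3 := H2 n ltac:(lia).
 assert (Hp' : 0 < Rabs h) by now apply Rabs_pos_lt.
 replace ((g (x + h) - g x) / h - l) with (((f n (x + h) - f n x) / h - df n x) + (df n x - l)
  - ((f n (x + h) - g (x + h)) - (f n x - g x)) / h) by (field; easy).
 assert (Q4 : Rabs (((f n (x + h) - g (x + h)) - (f n x - g x)) / h) <= eps / 4).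
 { unfold Rdiv. rewrite Rabs_mult, Rabs_inv. apply Rmult_le_reg_r with (Rabs h); [easy|].
  rewrite Rmult_assoc, Rinv_l, Rmult_1_r by lra. exact Q2. }
 apply Rabs_def2 in Q1. apply Rabs_le_between in Q3. apply Rabs_le_between in Q4. apply Rabs_def1; lra.
Qed.

(** With [e = 1] the letters are the derivatives themselves. The convergence is uniform in space and
    on compact time intervals, for each word separately. *)
Definition Kcauchy {a b} (f : nat -> fld a b) : Prop :=
 forall l t1 t2 eta, oi a b t1 -> oi a b t2 -> 0 < eta -> exists n0, forall n m t x y z,
  (n0 <= n)%nat -> (n0 <= m)%nat -> t1 <= t <= t2 -> Rabs (Zw 1 l (f n) t x y z - Zw 1 l (f m) t x y z) <= eta.

Lemma Zd1 {a b} d (f : fld a b) : Zd 1 d f = fder d f.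
Proof. Transparent Zd. destruct d; unfold Zd; [reflexivity|fring]. Opaque Zd. Qed.

Lemma Zw_cons {a b} e d l (f : fld a b) : Zw e (d :: l) f = Zd e d (Zw e l f).
Proof. reflexivity. Qed.

(** Each word has its own limit [G l], continuous as a locally uniform limit. Differentiating under
    the limit shows that the derivative of [G l] in direction [d] is [G (d :: l)], so [G nil] is
    smooth and its words are the [G l]. *)
Lemma fld_limit {a b} (f : nat -> fld a b) : Kcauchy f -> exists g : fld a b,
 forall l t x y z eta, oi a b t -> 0 < eta -> exists n0, forall n, (n0 <= n)%nat ->
  Rabs (Zw 1 l (f n) t x y z - Zw 1 l g t x y z) <= eta.
Proof.
 intros HK.
 assert (HL : forall l t x y z, exists v, oi a b t -> forall eta, 0 < eta -> exists n0, forall n, (n0 <= n)%nat ->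
  Rabs (Zw 1 l (f n) t x y z - v) <= eta).
 { intros l t x y z. destruct (classic (oi a b t)) as [Ht|Ht]; [|now exists 0].
  destruct (Rcomplete.R_complete (fun n => Zw 1 l (f n) t x y z)) as [v Hv].
  - intros eta Heta. destruct (HK l t t (eta / 2) Ht Ht ltac:(lra)) as [n0 H0]. exists n0. intros n m Hn Hm.
   unfold R_dist. eapply Rle_lt_trans; [apply H0; [exact Hn|exact Hm|lra]|lra].
  - exists v. intros _ eta Heta. destruct (Hv eta Heta) as [n0 H0]. exists n0. intros n Hn. left. now apply H0. }
 set (G := fun l t x y z => proj1_sig (cid _ (HL l t x y z))).
 assert (HG : forall l t x y z, oi a b t -> forall eta, 0 < eta -> exists n0, forall n, (n0 <= n)%nat ->
  Rabs (Zw 1 l (f n) t x y z - G l t x y z) <= eta).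
 { intros l t x y z. exact (proj2_sig (cid _ (HL l t x y z))). }
 assert (HU : forall l t1 t2 eta, oi a b t1 -> oi a b t2 -> 0 < eta -> exists n0, forall n t x y z,
  (n0 <= n)%nat -> t1 <= t <= t2 -> Rabs (Zw 1 l (f n) t x y z - G l t x y z) <= eta).
 { intros l t1 t2 eta H1 H2 Heta. destruct (HK l t1 t2 (eta / 2) H1 H2 ltac:(lra)) as [n0 H0].
  exists n0. intros n t x y z Hn Ht.
  assert (It : oi a b t) by (unfold oi in *; lra).
  destruct (HG l t x y z It (eta / 2) ltac:(lra)) as [n1 H3].
  have Q1 := H0 n (Nat.max n0 n1) t x y z Hn ltac:(lia) Ht. have Q2 := H3 (Nat.max n0 n1) ltac:(lia).
  apply Rabs_le_between in Q1. apply Rabs_le_between in Q2. apply Rabs_le. lra. }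
 assert (Hloc : forall t, oi a b t -> exists t1 t2, oi a b t1 /\ oi a b t2 /\ t1 < t < t2).
 { intros t [Ha Hb]. exists ((a + t) / 2), ((t + b) / 2). unfold oi. lra. }
 assert (HC : forall l t x y z, oi a b t -> c4 (G l) t x y z).
 { intros l t x y z Ht. destruct (Hloc t Ht) as (t1 & t2 & I1 & I2 & Hb).
  apply filterlim_locally. intros eps. have He := cond_pos eps.
  destruct (HU l t1 t2 (eps / 4) I1 I2 ltac:(lra)) as [n0 H0].
  have C4 := Sm_c4 _ _ (fv_sm (Zw 1 l (f n0))) t x y z Ht.
  assert (He4 : 0 < eps / 4) by lra.
  destruct (proj1 (filterlim_locally _ _) C4 (mkposreal _ He4)) as [dl Hdl].
  assert (Hp : 0 < Rmin dl (Rmin (t - t1) (t2 - t))) by (repeat apply Rmin_pos; try lra; apply cond_pos).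
  exists (mkposreal _ Hp). intros [[[t' x'] y'] z'] HB.
  assert (HB' : ball (t, x, y, z) dl (t', x', y', z')) by (eapply ball_le; [apply Rmin_l|exact HB]).
  have Q0 := Hdl _ HB'. simpl in Q0. apply ball_R in Q0.
  destruct HB as [[[HBt _] _] _]. simpl in HBt.
  apply ball_R in HBt.
  assert (Hbt : Rabs (t' + - t) < Rmin (t - t1) (t2 - t)) by (eapply Rlt_le_trans; [exact HBt|apply Rmin_r]).
  have L1 := Rmin_l (t - t1) (t2 - t). have L2 := Rmin_r (t - t1) (t2 - t).
  apply Rabs_def2 in Hbt.
  have Q1 := H0 n0 t x y z (le_n _) ltac:(lra). have Q2 := H0 n0 t' x' y' z' (le_n _) ltac:(lra).
  apply R_ball.
  apply Rabs_def2 in Q0. apply Rabs_le_between in Q1. apply Rabs_le_between in Q2. apply Rabs_def1; lra. }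
 assert (HD : forall l d t x y z, oi a b t -> is_pdt d (G l) t x y z (G (d :: l) t x y z)).
 { intros l d t x y z Ht. destruct (Hloc t Ht) as (t1 & t2 & I1 & I2 & Hb).
  assert (Hp : 0 < Rmin (t - t1) (t2 - t)) by (apply Rmin_pos; lra).
  assert (HT2 : forall r, ball (tcoord d t x y z) (Rmin (t - t1) (t2 - t)) r ->
   forall F F' : tfield, exists t' x' y' z', t1 <= t' <= t2 /\ tslice d F t x y z r = F t' x' y' z' /\ tslice d F' t x y z r = F' t' x' y' z').
  { intros r Hr F F'. apply ball_R in Hr; cbn [pos] in Hr.
   have L1 := Rmin_l (t - t1) (t2 - t). have L2 := Rmin_r (t - t1) (t2 - t). apply Rabs_def2 in Hr.
   destruct d as [[]|]; cbn [tslice slice tcoord coord] in *.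
   - exists t, r, y, z. repeat split; lra.
   - exists t, x, r, z. repeat split; lra.
   - exists t, x, y, r. repeat split; lra.
   - exists r, x, y, z. repeat split; lra. }
  unfold is_pdt.
  apply (is_derive_uniform_limit (fun n => tslice d (Zw 1 l (f n)) t x y z)
   (fun n => tslice d (Zw 1 (d :: l) (f n)) t x y z) _ _ _ (mkposreal _ Hp)).
  - intros n r Hr.
   assert (E : forall t' x' y' z', t1 <= t' <= t2 -> is_pdt d (Zw 1 l (f n)) t' x' y' z' (Zw 1 (d :: l) (f n) t' x' y' z')).
   { intros t' x' y' z' Ht'. rewrite Zw_cons, Zd1. apply fld_is. unfold oi in *; lra. }
   apply ball_R in Hr; cbn [pos] in Hr.
   have L1 := Rmin_l (t - t1) (t2 - t). have L2 := Rmin_r (t - t1) (t2 - t). apply Rabs_def2 in Hr.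
   destruct d as [[]|]; cbn [tslice slice tcoord coord] in *.
   + exact (E t r y z ltac:(lra)). + exact (E t x r z ltac:(lra)).
   + exact (E t x y r ltac:(lra)). + exact (E r x y z ltac:(lra)).
  - intros r Hr eta Heta. destruct (HU l t1 t2 eta I1 I2 Heta) as [n0 H0]. exists n0. intros n Hn.
   destruct (HT2 r Hr (Zw 1 l (f n)) (G l)) as (t' & x' & y' & z' & Ht' & -> & ->). now apply H0.
  - intros eta Heta. destruct (HK (d :: l) t1 t2 eta I1 I2 Heta) as [n0 H0]. exists n0. intros n m r Hn Hm Hr.
   destruct (HT2 r Hr (Zw 1 (d :: l) (f n)) (Zw 1 (d :: l) (f m))) as (t' & x' & y' & z' & Ht' & -> & ->). now apply H0.
  - intros eta Heta. destruct (HG (d :: l) t x y z Ht eta Heta) as [n0 H0]. exists n0. intros n Hn.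
   rewrite tslice_coord. now apply H0. }
 assert (HS : forall l, Sm (oi a b) (G l)).
 { intros l n. revert l; induction n; intros l.
  - split; [apply HC|easy].
  - apply (Cn_step n _ _ (fun d => G (d :: l))); [apply open_oi|apply HC|intros; now apply HD|intros; apply IHn]. }
 assert (HPer : forall t, oi a b t -> periodic (G nil t)).
 { intros t Ht x y z.
  assert (U : forall x y z x' y' z', (forall n, f n t x y z = f n t x' y' z') -> G nil t x y z = G nil t x' y' z').
  { intros x1 y1 z1 x2 y2 z2 He.
   apply Rminus_diag_uniq, Rabs_eq_0. apply Rle_antisym; [|apply Rabs_pos].
   apply le_epsilon. intros eta Heta.
   destruct (HG nil t x1 y1 z1 Ht (eta / 2) ltac:(lra)) as [n1 H1]. destruct (HG nil t x2 y2 z2 Ht (eta / 2) ltac:(lra)) as [n2 H2].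
   specialize (H1 (Nat.max n1 n2) ltac:(lia)). specialize (H2 (Nat.max n1 n2) ltac:(lia)).
   unfold Zw in H1, H2; simpl in H1, H2. rewrite (He (Nat.max n1 n2)) in H1.
   apply Rabs_le_between in H1. apply Rabs_le_between in H2. rewrite Rplus_0_l. apply Rabs_le; lra. }
  repeat split; apply U; intros n; apply (fv_per (f n) t Ht). }
 exists (mkfld a b (G nil) (HS nil) HPer).
 assert (EZ : forall l t x y z, oi a b t -> Zw 1 l (mkfld a b (G nil) (HS nil) HPer) t x y z = G l t x y z).
 { induction l as [|d l IH]; intros t x y z Ht.
  - unfold Zw; simpl. now rewrite mkfld_at.
  - rewrite Zw_cons, Zd1, fder_at by exact Ht. apply is_pdt_unique.
   apply (is_pdt_ext (oi a b) d (G l)); [apply open_oi|exact Ht| |now apply HD]. intros. symmetry. now apply IH. }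
 intros l t x y z eta Ht Heta. rewrite EZ by exact Ht. now apply HG.
Qed.

(** * Pointwise bounds on derivatives *)

Lemma N_Zw {a b} e j t l (f : fld a b) : oi a b t -> Nk e j t (Zw e l f) <= Nk e (j + length l) t f.
Proof.
 intros Ht. revert j; induction l as [|d l IH]; intros j.
 - simpl. rewrite Nat.add_0_r. apply Rle_refl.
 - rewrite Zw_cons. etr; [now apply N_Z|]. etr; [apply IH|].
  simpl length. replace (S j + length l)%nat with (j + S (length l))%nat by lia. apply Rle_refl.
Qed.

Lemma N_ex_derive {a b} e k t (f : fld a b) : oi a b t -> ex_derive (fun s => Nk e k s f) t.
Proof.
 intros Ht. eexists.
 apply (SW_derive k (fun l s => nrm2 s (Zw e l f)) (fun l s => Iint s (fder None (Zw e l f * Zw e l f)%fld))).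
 intros l. exact (Iint_time t (Zw e l f * Zw e l f)%fld Ht).
Qed.

Lemma NS_continuous {a b} e k t (V : cmp -> fld a b) : oi a b t -> continuous (fun s => NS e k s V) t.
Proof.
 intros Ht. assert (C : forall c, continuous (fun s => Nk e k s (V c)) t)
  by (intros; apply continuous_of_ex_derive; now apply N_ex_derive).
 exact (continuous_plus _ _ _ (continuous_plus _ _ _ (continuous_plus _ _ _
  (continuous_plus _ _ _ (C cQ) (C cH)) (C cV1)) (C cV2)) (C cW)).
Qed.

Lemma N_local {a b} e k t1 t2 (f : fld a b) : oi a b t1 -> oi a b t2 -> exists K, 0 <= K /\
 forall t, t1 <= t <= t2 -> Nk e k t f <= K.
Proof.
 intros H1 H2. destruct (Rle_dec t1 t2) as [H|H]; [|exists 0; split; [lra|intros; lra]].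
 destruct (continuity_ab_maj (fun t => Nk e k t f) t1 t2 H) as [m [Hm Hm']].
 - intros t Ht. apply continuity_pt_filterlim, continuous_of_ex_derive, N_ex_derive. unfold oi in *; lra.
 - exists (Nk e k m f). split; [apply N_nonneg; unfold oi in *; lra|]. intros t Ht. now apply Hm.
Qed.

(** The bound is split into a constant [C], on which operations act, and an amplitude [B], which a
    linear operator passes on unchanged. In the Picard iteration the amplitude carries the
    dependence on the step and on time. *)
Definition SB {a b} (e : R) (r : nat) (t C B : R) (f : fld a b) : Prop :=
 forall l, (length l <= r)%nat -> forall x y z, Rabs (Zw e l f t x y z) <= C * B.

Lemma SB_weaken {a b} e r t C D B (f : fld a b) : C <= D -> 0 <= B -> SB e r t C B f -> SB e r t D B f.
Proof. intros H HB Hf l Hl x y z. etr; [now apply Hf|]. now apply Rmult_le_compat_r. Qed.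

Lemma SB_Z {a b} e r t C B d (f : fld a b) : SB e (S r) t C B f -> SB e r t C B (Zd e d f).
Proof. intros H l Hl x y z. rewrite <- Zw_app. apply H. rewrite length_app; simpl; lia. Qed.

Lemma SB_S {a b} e r t C B (f : fld a b) : SB e (S r) t C B f -> SB e r t C B f.
Proof. intros H l Hl. apply H; lia. Qed.

Lemma SB_add {a b} e r t C1 C2 B (f g : fld a b) : SB e r t C1 B f -> SB e r t C2 B g -> SB e r t (C1 + C2) B (f + g)%fld.
Proof.
 intros Hf Hg l Hl x y z. rewrite Zw_add, fadd_at. etr; [apply Rabs_triang|].
 have Q1 := Hf l Hl x y z. have Q2 := Hg l Hl x y z. lra.
Qed.

Lemma SB_scal {a b} e r t C B k (f : fld a b) : SB e r t C B f -> SB e r t (Rabs k * C) B (k *: f)%fld.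
Proof.
 intros Hf l Hl x y z. rewrite Zw_scal, fscal_at, Rabs_mult, Rmult_assoc.
 apply Rmult_le_compat_l; [apply Rabs_pos|now apply Hf].
Qed.

Lemma SB_sub {a b} e r t C1 C2 B (f g : fld a b) : SB e r t C1 B f -> SB e r t C2 B g -> SB e r t (C1 + C2) B (f - g)%fld.
Proof.
 intros Hf Hg. unfold fsub, fopp. apply SB_add; [easy|].
 replace C2 with (Rabs (-1) * C2) by (rewrite Rabs_left; lra). now apply SB_scal.
Qed.

Lemma SB_mul {a b} e r t C1 C2 B (f g : fld a b) : 0 <= C1 -> 0 <= C2 -> 0 <= B ->
 SB e r t C1 1 f -> SB e r t C2 B g -> SB e r t (2 ^ r * (C1 * C2)) B (f * g)%fld.
Proof.
 intros P1 P2 PB. revert f g; induction r; intros f g Hf Hg l Hl x y z.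
 - destruct l; [|simpl in Hl; lia]. unfold Zw; simpl. rewrite fmul_at, Rabs_mult.
  have Q1 := Hf nil (le_n _) x y z. have Q2 := Hg nil (le_n _) x y z. unfold Zw in Q1, Q2; simpl in Q1, Q2.
  replace (1 * (C1 * C2) * B) with (C1 * 1 * (C2 * B)) by ring. apply Rmult_le_compat; try apply Rabs_pos; easy.
 - assert (Hp : 0 <= 2 ^ r * (C1 * C2) * B) by (repeat apply Rmult_le_pos; try easy; apply pow_le; lra).
  destruct l as [|d l _] using rev_ind.
  + have Q := IHr f g (SB_S _ _ _ _ _ _ Hf) (SB_S _ _ _ _ _ _ Hg) nil ltac:(simpl; lia) x y z.
   simpl pow. lra.
  + rewrite length_app in Hl; simpl in Hl. rewrite Zw_app, Z_mul, Zw_add, fadd_at.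
   etr; [apply Rabs_triang|].
   have Q1 := IHr (Zd e d f) g (SB_Z _ _ _ _ _ _ _ Hf) (SB_S _ _ _ _ _ _ Hg) l ltac:(lia) x y z.
   have Q2 := IHr f (Zd e d g) (SB_S _ _ _ _ _ _ Hf) (SB_Z _ _ _ _ _ _ _ Hg) l ltac:(lia) x y z.
   simpl pow. lra.
Qed.

Lemma SB_Dh {a b} e r t C B h c (f : fld a b) : 0 < h -> SB e r t C B f -> SB e r t (/ h * C) B (Dh h c f).
Proof.
 intros Hh Hf l Hl x y z. rewrite Zw_Dh, Dh_at by lra.
 set (F := Zw e l f t).
 assert (Q : forall s, Rabs (slice c F x y z s) <= C * B) by (intros; destruct c; now apply Hf).
 have Q1 := Q (coord c x y z + h). have Q2 := Q (coord c x y z - h).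
 unfold Rdiv. rewrite Rabs_mult, Rabs_inv, (Rabs_right (2 * h)) by lra.
 apply Rmult_le_reg_r with (2 * h); [lra|]. rewrite Rmult_assoc, Rinv_l, Rmult_1_r by lra.
 replace (/ h * C * B * (2 * h)) with (C * B + C * B) by (field; lra).
 unfold Rminus. etr; [apply Rabs_triang|]. rewrite Rabs_Ropp. unfold Rminus in Q2. lra.
Qed.

Lemma SB_local {a b} e r t1 t2 (f : fld a b) : oi a b t1 -> oi a b t2 -> exists C, 0 <= C /\
 forall t, t1 <= t <= t2 -> SB e r t C 1 f.
Proof.
 intros H1 H2. destruct (N_local e (2 + r) t1 t2 f H1 H2) as [K [PK HK]].
 exists (sq K). split; [apply sqrt_pos|]. intros t Ht l Hl x y z. rewrite Rmult_1_r.
 assert (It : oi a b t) by (unfold oi in *; lra).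
 apply (sup_le e 2); [easy|lia|]. etr; [now apply N_Zw|].
 etr; [apply (N_mono e _ (2 + r)); [easy|lia]|now apply HK].
Qed.

Fixpoint cnt (l : list (option axis)) : nat :=
 match l with nil => 0 | None :: l => S (cnt l) | Some _ :: l => cnt l end.

Lemma cnt_app l l' : cnt (l ++ l') = (cnt l + cnt l')%nat.
Proof. induction l as [|[]]; simpl; lia. Qed.

(** Bounds uniform in [n] but not in the word. Time letters are counted apart from the length,
    because an evolution equation trades one time derivative for spatial ones: bounds are propagated
    by induction on [j] for all [r] at once. *)
Definition UB {a b} (T : R -> Prop) (r j : nat) (f : nat -> fld a b) : Prop :=
 forall l, (length l <= r)%nat -> (cnt l <= j)%nat -> exists K, forall n t x y z, T t -> Rabs (Zw 1 l (f n) t x y z) <= K.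

Lemma UB_mono {a b} T r r' j j' (f : nat -> fld a b) : (r' <= r)%nat -> (j' <= j)%nat -> UB T r j f -> UB T r' j' f.
Proof. intros Hr Hj H l Hl Hc. apply H; lia. Qed.

Lemma UB_Z {a b} T r j d (f : nat -> fld a b) : (cnt (d :: nil) <= j)%nat -> UB T (S r) j f ->
 UB T r (j - cnt (d :: nil)) (fun n => Zd 1 d (f n)).
Proof.
 intros Hd H l Hl Hc. destruct (H (l ++ d :: nil)%list) as [K HK].
 - rewrite length_app; simpl; lia.
 - rewrite cnt_app; lia.
 - exists K. intros n t x y z Ht. rewrite <- Zw_app. now apply HK.
Qed.

Lemma UB_add {a b} T r j (f g : nat -> fld a b) : UB T r j f -> UB T r j g -> UB T r j (fun n => f n + g n)%fld.
Proof.
 intros Hf Hg l Hl Hc. destruct (Hf l Hl Hc) as [K1 H1]. destruct (Hg l Hl Hc) as [K2 H2].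
 exists (K1 + K2). intros n t x y z Ht. rewrite Zw_add, fadd_at. etr; [apply Rabs_triang|].
 apply Rplus_le_compat; auto.
Qed.

Lemma UB_scal {a b} T r j k (f : nat -> fld a b) : UB T r j f -> UB T r j (fun n => k *: f n)%fld.
Proof.
 intros Hf l Hl Hc. destruct (Hf l Hl Hc) as [K1 H1]. exists (Rabs k * K1). intros n t x y z Ht.
 rewrite Zw_scal, fscal_at, Rabs_mult. apply Rmult_le_compat_l; [apply Rabs_pos|auto].
Qed.

Lemma UB_sub {a b} T r j (f g : nat -> fld a b) : UB T r j f -> UB T r j g -> UB T r j (fun n => f n - g n)%fld.
Proof. intros Hf Hg. unfold fsub, fopp. apply UB_add; [easy|now apply UB_scal]. Qed.

Lemma UB_mul {a b} T r : forall j (f g : nat -> fld a b), UB T r j f -> UB T r j g -> UB T r j (fun n => f n * g n)%fld.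
Proof.
 induction r; intros j f g Hf Hg l Hl Hc.
 - destruct l; [|simpl in Hl; lia]. destruct (Hf nil Hl Hc) as [K1 H1]. destruct (Hg nil Hl Hc) as [K2 H2].
  exists (K1 * K2). intros n t x y z Ht. specialize (H1 n t x y z Ht). specialize (H2 n t x y z Ht).
  unfold Zw in *; simpl in *. rewrite fmul_at, Rabs_mult. apply Rmult_le_compat; try apply Rabs_pos; easy.
 - destruct l as [|d l _] using rev_ind.
  + have Hf' := UB_mono T (S r) r j j f ltac:(lia) ltac:(lia) Hf. have Hg' := UB_mono T (S r) r j j g ltac:(lia) ltac:(lia) Hg.
   apply (IHr j f g Hf' Hg' nil); simpl; lia.
  + rewrite length_app in Hl; simpl in Hl. rewrite cnt_app in Hc.
   set (j' := (j - cnt (d :: nil))%nat).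
   have Zf := UB_Z T r j d f ltac:(lia) Hf. have Zg := UB_Z T r j d g ltac:(lia) Hg.
   have Hf' := UB_mono T (S r) r j j' f ltac:(lia) ltac:(unfold j'; lia) Hf.
   have Hg' := UB_mono T (S r) r j j' g ltac:(lia) ltac:(unfold j'; lia) Hg.
   destruct (IHr j' _ _ Zf Hg' l ltac:(lia) ltac:(unfold j'; lia)) as [K1 H1].
   destruct (IHr j' _ _ Hf' Zg l ltac:(lia) ltac:(unfold j'; lia)) as [K2 H2].
   exists (K1 + K2). intros n t x y z Ht. rewrite Zw_app, Z_mul, Zw_add, fadd_at.
   etr; [apply Rabs_triang|]. apply Rplus_le_compat; auto.
Qed.

Lemma UB_inv {a b} T j c (f : nat -> fld a b) : (forall t, T t -> oi a b t) -> 0 < c -> (forall n, ge0 c (f n)) ->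
 forall r, UB T r j f -> UB T r j (fun n => finv (f n)).
Proof.
 intros HT Hc Hge r. revert j; induction r; intros j Hf.
 all: assert (B0 : exists K, forall n t x y z, T t -> Rabs (finv (f n) t x y z) <= K) by
 (exists (/ c); intros n t x y z Ht; rewrite finv_at by (now apply (ge0_neq c));
  have Q := Hge n t x y z (HT t Ht); rewrite Rabs_inv, Rabs_right by lra; apply Rinv_le_contravar; lra).
 - intros l Hl _. destruct l; [exact B0|simpl in Hl; lia].
 - intros l Hl Hcn. destruct l as [|d l _] using rev_ind; [exact B0|].
  rewrite length_app in Hl; simpl in Hl. rewrite cnt_app in Hcn.
  set (j' := (j - cnt (d :: nil))%nat).
  have Zf := UB_Z T r j d f ltac:(lia) Hf.
  assert (Hi : UB T r j' (fun n => finv (f n))).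
  { apply (UB_mono T r r j); [lia|unfold j'; lia|]. apply IHr. apply (UB_mono T (S r) r j j); [lia|lia|easy]. }
  destruct (UB_mul T r j' _ _ Zf (UB_mul T r j' _ _ Hi Hi) l ltac:(lia) ltac:(unfold j'; lia)) as [K HK].
  exists K. intros n t x y z Ht. rewrite Zw_app, Zd_inv by (now apply (ge0_neq c)).
  unfold fopp. rewrite Zw_scal, fscal_at. rewrite Rabs_mult, (Rabs_left (-1)) by lra.
  replace (- (-1)) with 1 by ring. rewrite Rmult_1_l. now apply HK.
Qed.

Lemma UB_Dh {a b} T r j c (h : nat -> R) (f : nat -> fld a b) : (forall t, T t -> oi a b t) ->
 UB T (S r) j f -> UB T r j (fun n => Dh (h n) c (f n)).
Proof.
 intros HT Hf l Hl Hc. destruct (Hf (Some c :: l)%list) as [K HK]; [simpl; lia|simpl; lia|].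
 exists K. intros n t x y z Ht. rewrite Zw_Dh. apply Dh_sup; [now apply HT|].
 intros x' y' z'. have Q := HK n t x' y' z' Ht. rewrite Zw_cons, Zd1 in Q. exact Q.
Qed.

(** As derivatives commute, one time letter can be made the innermost one, where an evolution
    equation applies. *)
Lemma cnt_extract l : (1 <= cnt l)%nat -> exists l', cnt l = S (cnt l') /\ (length l' <= length l)%nat /\
 forall a b (f : fld a b), Zw 1 l f = Zw 1 l' (fder None f).
Proof.
 induction l as [|[c|] l IH]; intros H; [simpl in H; lia| |].
 - destruct (IH H) as (l' & H1 & H2 & H3). exists (Some c :: l')%list. repeat split; [exact H1|simpl; lia|].
  intros a b f. rewrite !Zw_cons. now rewrite H3.
 - exists l. repeat split; [simpl; lia|]. intros a b f. rewrite Zw_cons, <- Zd1. now rewrite Zw_Z.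
Qed.

Lemma UB_time {a b} T r j (f : nat -> fld a b) : UB T r 0 f -> UB T r j (fun n => fder None (f n)) -> UB T r (S j) f.
Proof.
 intros H0 H1 l Hl Hc. destruct (Nat.eq_dec (cnt l) 0) as [E|E]; [apply H0; lia|].
 destruct (cnt_extract l ltac:(lia)) as (l' & E1 & E2 & E3).
 destruct (H1 l' ltac:(lia) ltac:(lia)) as [K HK]. exists K. intros n t x y z Ht. rewrite E3. now apply HK.
Qed.

Lemma UB_const {a b} t1 t2 r j (f : fld a b) : oi a b t1 -> oi a b t2 -> UB (fun t => t1 <= t <= t2) r j (fun _ => f).
Proof.
 intros H1 H2 l Hl _. destruct (SB_local 1 r t1 t2 f H1 H2) as [C [PC HC]]. exists (C * 1).
 intros n t x y z Ht. now apply HC.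
Qed.

Lemma UB_zf {a b} T r j g Hs Hp : (forall t, T t -> oi a b t) -> UB T r j (fun _ => @fzf a b g Hs Hp).
Proof.
 intros HT l Hl _. destruct (zf_bound (2 + r) g Hs Hp) as [K [PK HK]].
 exists (sq K). intros n t x y z Ht. have It := HT t Ht.
 apply (sup_le 1 2); [easy|lia|]. etr; [now apply N_Zw|].
 etr; [apply (N_mono 1 _ (2 + r)); [easy|lia]|now apply HK].
Qed.

Lemma UB_cst {a b} T r j k : (forall t, T t -> oi a b t) -> UB T r j (fun _ => @fcst a b k).
Proof.
 intros HT l Hl _. exists (sq (k ^ 2)). intros n t x y z Ht. have It := HT t Ht.
 apply (sup_le 1 2); [easy|lia|]. etr; [now apply N_Zw|]. rewrite N_cst by easy. apply Rle_refl.
Qed.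

Lemma UB0_of_SB {a b} T r (f : nat -> fld a b) :
 (forall l, (length l <= r)%nat -> exists K, forall n t x y z, T t -> Rabs (Zw 0 l (f n) t x y z) <= K) -> UB T r 0 f.
Proof.
 intros H l Hl Hc. destruct (H l Hl) as [K HK]. exists K. intros n t x y z Ht.
 replace (Zw 1 l (f n)) with (Zw 0 l (f n)); [now apply HK|].
 clear - Hc. Transparent Zd. induction l as [|[c|] l IH]; simpl in Hc; [easy| |lia]. rewrite !Zw_cons, IH by easy. reflexivity. Opaque Zd.
Qed.

(** Landau inequality. Over a segment of length [s / 2] the mean value theorem gives a point where
    the derivative is at most [4 A / s], and the second derivative controls the variation up to the
    given point. In the time direction [s < b - a] leaves room on one side of [t]. *)
Lemma landau {a b} d (f : fld a b) K A s : 0 < s -> s < b - a -> a < b ->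
 (forall t x y z, oi a b t -> Rabs (f t x y z) <= A) ->
 (forall t x y z, oi a b t -> Rabs (fder d (fder d f) t x y z) <= K) ->
 forall t x y z, oi a b t -> Rabs (fder d f t x y z) <= 4 * A / s + K * s.
Proof.
 intros Hs Hsb Hab HA HK t x y z Ht.
 assert (K0 : 0 <= K) by (etr; [apply Rabs_pos|apply (HK t x y z Ht)]).
 assert (W : forall (g dg ddg : R -> R) u v l, u <> v -> (forall r, Rmin u v <= r <= Rmax u v -> is_derive g r (dg r)) ->
  (forall r, Rmin u v <= r <= Rmax u v -> is_derive dg r (ddg r)) -> Rabs (g u) <= A -> Rabs (g v) <= A ->
  (forall r, Rmin u v <= r <= Rmax u v -> Rabs (ddg r) <= K) -> Rabs (v - u) = s / 2 -> l = dg u -> Rabs l <= 4 * A / s + K * s).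
 { intros g dg ddg u v l Huv H1 H2 B1 B2 B3 Hd ->.
  destruct (MVT_gen g u v dg) as [c [Hc1 Hc2]].
  - intros; apply H1; lra.
  - intros; apply continuity_pt_filterlim, continuous_of_ex_derive. eexists; now apply H1.
  - assert (Q : Rabs (dg u - dg c) <= K * Rabs (u - c)).
   { assert (Hin : forall r, Rmin c u <= r <= Rmax c u -> Rmin u v <= r <= Rmax u v).
    { intros r Hr. clear - Hr Hc1. unfold Rmin, Rmax in *. destruct (Rle_dec u v), (Rle_dec c u); lra. }
    apply (MVT_Rabs_le dg ddg).
    - intros; apply H2, Hin; lra.
    - intros; apply continuous_of_ex_derive; eexists; apply H2, Hin; lra.
    - intros; apply B3, Hin; lra. }
   assert (Hcu : Rabs (u - c) <= s / 2).
   { rewrite <- Hd. clear - Hc1. unfold Rmin, Rmax, Rabs in *.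
    destruct (Rle_dec u v), (Rcase_abs (u - c)), (Rcase_abs (v - u)); lra. }
   assert (Q2 : Rabs (dg c) <= 4 * A / s).
   { replace (dg c) with ((g v - g u) / (v - u)) by (rewrite Hc2; field; lra).
    unfold Rdiv. rewrite Rabs_mult, Rabs_inv, Hd.
    replace (4 * A * / s) with (2 * A * / (s / 2)) by (field; lra).
    apply Rmult_le_compat_r; [left; apply Rinv_0_lt_compat; lra|].
    unfold Rminus. etr; [apply Rabs_triang|]. rewrite Rabs_Ropp. lra. }
   assert (K * Rabs (u - c) <= K * (s / 2)) by now apply Rmult_le_compat_l.
   assert (0 <= K * s) by (apply Rmult_le_pos; lra).
   replace (dg u) with ((dg u - dg c) + dg c) by ring. etr; [apply Rabs_triang|]. lra. }
 destruct d as [c|].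
 - apply (W (slice c (f t) x y z) (slice c (fder (Some c) f t) x y z) (slice c (fder (Some c) (fder (Some c) f) t) x y z)
   (coord c x y z) (coord c x y z + s / 2)); try lra.
  + intros; now apply fld_slice_derive.
  + intros; now apply fld_slice_derive.
  + rewrite slice_coord. now apply HA.
  + destruct c; now apply HA.
  + intros r _. destruct c; now apply HK.
  + rewrite Rabs_right; lra.
  + now rewrite slice_coord.
 - assert (DT : forall (g : fld a b) r, oi a b r -> is_derive (fun s => g s x y z) r (fder None g r x y z)).
  { intros g r Hr. exact (fld_is None g r x y z Hr). }
  assert (Hv : exists v, oi a b v /\ v <> t /\ Rabs (v - t) = s / 2).
  { unfold oi in *. destruct (Rlt_dec (t + s / 2) b).
   - exists (t + s / 2). repeat split; try lra. rewrite Rabs_right; lra.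
   - exists (t - s / 2). repeat split; try lra. rewrite Rabs_left; lra. }
  destruct Hv as (v & Iv & Hvt & Hvs).
  assert (Hin : forall r, Rmin t v <= r <= Rmax t v -> oi a b r) by (intros; now apply (oi_conv a b t v)).
  apply (W (fun r => f r x y z) (fun r => fder None f r x y z) (fun r => fder None (fder None f) r x y z) t v); auto.
Qed.

(** * Linear problems *)

Lemma ftint_sub {a b} t0 H0 (f g : fld a b) : ftint t0 H0 (f - g)%fld = (ftint t0 H0 f - ftint t0 H0 g)%fld.
Proof.
 apply fld_eq. intros t x y z Ht. rewrite fsub_at, !ftint_at by exact Ht.
 rewrite (RInt_ext _ (fun s => minus (f s x y z) (g s x y z))) by (intros; rewrite fsub_at; reflexivity).
 apply (RInt_minus (V:=RC)); apply (Sm_ex_RInt a b); try easy; apply fv_sm.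
Qed.

Lemma ftint_0 {a b} t0 H0 : ftint t0 H0 (@fcst a b 0) = fcst 0.
Proof.
 apply fld_eq. intros t x y z Ht. rewrite ftint_at, fcst_at by exact Ht.
 rewrite (RInt_ext _ (fun _ => 0)).
 - rewrite RInt_const. unfold scal; simpl; unfold mult; simpl. ring.
 - intros s Hs. apply fcst_at. apply (oi_conv a b t0 t); try easy; lra.
Qed.

Lemma Zd0_None {a b} (f : fld a b) : Zd 0 None f = fcst 0.
Proof. Transparent Zd. unfold Zd. Opaque Zd. fring. Qed.

Lemma Zd_Some {a b} e c (f : fld a b) : Zd e (Some c) f = fder (Some c) f.
Proof. reflexivity. Qed.

Lemma Zw0_tint {a b} t0 H0 l (f : fld a b) : Zw 0 l (ftint t0 H0 f) = ftint t0 H0 (Zw 0 l f).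
Proof.
 induction l as [|d l IH]; [reflexivity|]. rewrite !Zw_cons, IH.
 destruct d as [c|]; [rewrite !Zd_Some; apply fder_tint_Some|]. now rewrite !Zd0_None, ftint_0.
Qed.

(** Integration against the weight [exp (L |t - t0|)] gains a factor [1 / L]: Picard iterations
    contract on time intervals of any length. *)
Lemma RInt_exp_bound (g : R -> R) t0 t A L : 0 < L -> 0 <= A -> ex_RInt g t0 t ->
 (forall s, Rmin t0 t <= s <= Rmax t0 t -> Rabs (g s) <= A * exp (L * Rabs (s - t0))) ->
 Rabs (RInt g t0 t) <= A / L * exp (L * Rabs (t - t0)).
Proof.
 intros HL HA Hex Hg.
 assert (HAL : 0 <= A / L) by (apply Rmult_le_pos; [easy|left; now apply Rinv_0_lt_compat]).
 assert (W : forall sg u v, u <= v -> (sg = 1 \/ sg = -1) -> ex_RInt g u v ->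
  (forall s, u <= s <= v -> Rabs (g s) <= A * exp (L * (sg * (s - t0)))) ->
  Rabs (RInt g u v) <= sg * (A / L * exp (L * (sg * (v - t0))) - A / L * exp (L * (sg * (u - t0))))).
 { intros sg u v Huv Hsg He Hb.
  apply (norm_RInt_le g (fun s => A * exp (L * (sg * (s - t0)))) u v (RInt g u v)); [easy|exact Hb| |].
  - now apply (RInt_correct (V:=RC)).
  - have Q := is_RInt_derive (fun s => sg * (A / L * exp (L * (sg * (s - t0))))) (fun s => A * exp (L * (sg * (s - t0)))) u v.
   replace (sg * (A / L * exp (L * (sg * (v - t0))) - A / L * exp (L * (sg * (u - t0)))))
    with (minus (sg * (A / L * exp (L * (sg * (v - t0))))) (sg * (A / L * exp (L * (sg * (u - t0))))))
    by (unfold minus, plus, opp; simpl; ring).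
   apply Q; intros s _.
   + auto_derive; [easy|]. unfold Rminus. set (ex := exp _).
    replace (sg * (A / L * (L * (sg * 1) * ex))) with (sg * sg * (A * ex)) by (field; lra).
    destruct Hsg as [-> | ->]; ring.
   + apply continuous_of_ex_derive. auto_derive. easy. }
 destruct (Rle_dec t0 t) as [H|H].
 - rewrite Rmin_left, Rmax_right in Hg by lra. rewrite (Rabs_right (t - t0)) by lra.
  have Q := W 1 t0 t H (or_introl eq_refl) Hex.
  replace (1 * (t0 - t0)) with 0 in Q by ring. rewrite Rmult_0_r, exp_0, !Rmult_1_l in Q.
  etr; [apply Q|lra]. intros s Hs. rewrite Rmult_1_l. rewrite <- (Rabs_right (s - t0)) by lra. now apply Hg.
 - rewrite Rmin_right, Rmax_left in Hg by lra. rewrite (Rabs_left (t - t0)) by lra.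
  rewrite <- (opp_RInt_swap (V:=RC) g t t0) by now apply ex_RInt_swap.
  unfold opp; simpl. rewrite Rabs_Ropp.
  have Q := W (-1) t t0 ltac:(lra) (or_intror eq_refl) (ex_RInt_swap _ _ _ Hex).
  replace (-1 * (t0 - t0)) with 0 in Q by ring. rewrite Rmult_0_r, exp_0 in Q.
  replace (-1 * (t - t0)) with (- (t - t0)) in Q by ring.
  etr; [apply Q|lra]. intros s Hs. replace (-1 * (s - t0)) with (- (s - t0)) by ring.
  destruct (Req_dec s t0) as [->|Hn].
  + replace (- (t0 - t0)) with (Rabs (t0 - t0)) by (rewrite Rminus_diag, Rabs_R0; ring). apply Hg; lra.
  + rewrite <- (Rabs_left (s - t0)) by lra. now apply Hg.
Qed.

(** The index [n0] is chosen before the sequence, which makes the conclusion uniform over all points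
    of space and time. *)
Lemma geom_cauchy K rho eta : 0 <= rho < 1 -> 0 <= K -> 0 < eta -> exists n0, forall u : nat -> R,
 (forall n, Rabs (u (S n) - u n) <= K * rho ^ n) ->
 forall n m, (n0 <= n)%nat -> (n0 <= m)%nat -> Rabs (u n - u m) <= eta.
Proof.
 intros Hr HK He. set (D := K / (1 - rho)).
 assert (HD : 0 <= D) by (apply Rmult_le_pos; [easy|left; apply Rinv_0_lt_compat; lra]).
 destruct (pow_lt_1_zero rho ltac:(rewrite Rabs_right; lra) (eta / 2 / (D + 1))) as [n0 H0].
 { repeat apply Rdiv_lt_0_compat; lra. }
 exists n0. intros u Hu.
 assert (B : forall k n, Rabs (u (n + k)%nat - u n) <= D * (rho ^ n - rho ^ (n + k))).
 { induction k; intros n.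
  - rewrite Nat.add_0_r, !Rminus_diag, Rabs_R0. lra.
  - replace (n + S k)%nat with (S (n + k)) by lia.
   replace (u (S (n + k)) - u n) with ((u (S (n + k)) - u (n + k)%nat) + (u (n + k)%nat - u n)) by ring.
   etr; [apply Rabs_triang|]. have Q1 := Hu (n + k)%nat. have Q2 := IHk n.
   assert (E : K * rho ^ (n + k) = D * (rho ^ (n + k) - rho ^ S (n + k))) by (unfold D; simpl; field; lra). lra. }
 assert (B0 : forall n, (n0 <= n)%nat -> Rabs (u n - u n0) <= eta / 2).
 { intros n Hn. replace n with (n0 + (n - n0))%nat by lia. etr; [apply B|].
  have P := pow_le rho (n0 + (n - n0)) ltac:(lra). have Q := H0 n0 (le_n _).
  rewrite Rabs_right in Q by (apply Rle_ge, pow_le; lra).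
  apply Rle_trans with ((D + 1) * (eta / 2 / (D + 1))); [|right; field; lra].
  apply Rmult_le_compat; try lra. assert (P2 : rho ^ (n0 + (n - n0)) <= rho ^ n0); [|lra].
  rewrite pow_add. rewrite <- (Rmult_1_r (rho ^ n0)) at 2. apply Rmult_le_compat_l; [apply pow_le; lra|].
  rewrite <- (pow1 (n - n0)). apply pow_incr; lra. }
 intros n m Hn Hm. have Q1 := B0 n Hn. have Q2 := B0 m Hm.
 apply Rabs_le_between in Q1. apply Rabs_le_between in Q2. apply Rabs_le. lra.
Qed.

Definition PL {a b} (f : nat -> fld a b) (g : fld a b) : Prop :=
 forall t x y z, oi a b t -> is_lim_seq (fun n => f n t x y z) (g t x y z).

Lemma PL_add {a b} (f g : nat -> fld a b) f' g' : PL f f' -> PL g g' -> PL (fun n => f n + g n)%fld (f' + g')%fld.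
Proof.
 intros Hf Hg t x y z Ht. rewrite fadd_at.
 apply (is_lim_seq_ext (fun n => f n t x y z + g n t x y z)); [intros; now rewrite fadd_at|].
 apply is_lim_seq_plus'; auto.
Qed.

Lemma PL_mul {a b} (f g : nat -> fld a b) f' g' : PL f f' -> PL g g' -> PL (fun n => f n * g n)%fld (f' * g')%fld.
Proof.
 intros Hf Hg t x y z Ht. rewrite fmul_at.
 apply (is_lim_seq_ext (fun n => f n t x y z * g n t x y z)); [intros; now rewrite fmul_at|].
 apply is_lim_seq_mult'; auto.
Qed.

Lemma PL_scal {a b} k (f : nat -> fld a b) f' : PL f f' -> PL (fun n => k *: f n)%fld (k *: f')%fld.
Proof.
 intros Hf t x y z Ht. rewrite fscal_at.
 apply (is_lim_seq_ext (fun n => k * f n t x y z)); [intros; now rewrite fscal_at|].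
 apply (is_lim_seq_scal_l _ k (Finite _)); auto.
Qed.

Lemma PL_sub {a b} (f g : nat -> fld a b) f' g' : PL f f' -> PL g g' -> PL (fun n => f n - g n)%fld (f' - g')%fld.
Proof. intros Hf Hg. unfold fsub, fopp. apply PL_add; [easy|now apply PL_scal]. Qed.

Lemma PL_const {a b} (f : fld a b) : PL (fun _ => f) f.
Proof. intros t x y z Ht. apply is_lim_seq_const. Qed.

Lemma PL_sum3 {a b} (F : nat -> axis -> fld a b) F' : (forall i, PL (fun n => F n i) (F' i)) -> PL (fun n => sum3 (F n)) (sum3 F').
Proof. intros H. unfold sum3. apply PL_add; [apply PL_add|]; apply H. Qed.

Lemma PL_unique {a b} (f : nat -> fld a b) g g' : PL f g -> PL f g' -> g = g'.
Proof.
 intros H H'. apply fld_eq. intros t x y z Ht.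
 have Q := is_lim_seq_unique _ _ (H t x y z Ht). rewrite (is_lim_seq_unique _ _ (H' t x y z Ht)) in Q. now injection Q.
Qed.

Lemma PL_shift {a b} (f : nat -> fld a b) g : PL f g -> PL (fun n => f (S n)) g.
Proof. intros H t x y z Ht. apply (is_lim_seq_incr_1 (fun n => f n t x y z)). auto. Qed.

Lemma PL_of_limit {a b} (f : nat -> fld a b) g l :
 (forall t x y z eta, oi a b t -> 0 < eta -> exists n0, forall n, (n0 <= n)%nat -> Rabs (Zw 1 l (f n) t x y z - Zw 1 l g t x y z) <= eta) ->
 PL (fun n => Zw 1 l (f n)) (Zw 1 l g).
Proof.
 intros H t x y z Ht. apply is_lim_seq_Reals. intros eta He.
 destruct (H t x y z (eta / 2) Ht ltac:(lra)) as [n0 H0]. exists n0. intros n Hn.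
 unfold R_dist. eapply Rle_lt_trans; [now apply H0|lra].
Qed.

Lemma fields_limit {a b} (V : nat -> cmp -> fld a b) : (forall c, Kcauchy (fun n => V n c)) ->
 exists VL, (forall c, PL (fun n => V n c) (VL c)) /\ forall c d, PL (fun n => fder d (V n c)) (fder d (VL c)).
Proof.
 intros HKc. set (VL := fun c => proj1_sig (cid _ (fld_limit _ (HKc c)))).
 assert (HVL : forall c l, PL (fun n => Zw 1 l (V n c)) (Zw 1 l (VL c))).
 { intros c l. apply (PL_of_limit (fun n => V n c)). exact (proj2_sig (cid _ (fld_limit _ (HKc c))) l). }
 exists VL. split; [intros c; exact (HVL c nil)|]. intros c d t x y z Ht. have Q := HVL c (d :: nil) t x y z Ht. rewrite Zw_cons, Zd1 in Q.
 apply (is_lim_seq_ext (fun n => Zw 1 (d :: nil) (V n c) t x y z)); [|exact Q]. intros n. now rewrite Zw_cons, Zd1.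
Qed.

Section LinearSolve.
Context (P : params) (HP : admissible P).
Local Notation thw := (thW P HP). Local Notation lam := (Lam P HP). Local Notation bbw := (bbW P HP).

Lemma Lam_lim {a b} (h : nat -> R) h' eps (W V : nat -> cmp -> fld a b) W' V' :
 (forall c, PL (fun n => W n c) (W' c)) -> (forall c, PL (fun n => V n c) (V' c)) ->
 (forall c i, PL (fun n => Dh (h n) i (V n c)) (Dh h' i (V' c))) ->
 PL (fun n => finv (thw eps (W n))) (finv (thw eps W')) ->
 forall c, PL (fun n => lam (h n) eps (W n) (V n) c) (lam h' eps W' V' c).
Proof.
 intros HW HV HD Hi.
 assert (Hadv : forall c, PL (fun n => adv (h n) (W n) (V n c)) (adv h' W' (V' c))).
 { intros c. apply (PL_sum3 (fun n i => W n (vel i) * Dh (h n) i (V n c))%fld). intros i. apply PL_mul; [apply HW|apply HD]. }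
 assert (Hbb : PL (fun n => bbw eps (W n)) (bbw eps W')).
 { apply PL_add; [apply PL_const|]. apply PL_scal, PL_sub; [apply HW|apply PL_const]. }
 assert (H0 : PL (fun _ => @fcst a b 0) (fcst 0)) by apply PL_const.
 intros c; destruct c; cbn [Lam]; (apply PL_sub; [apply PL_sub; [|apply Hadv]|]); try exact H0.
 - apply PL_mul; [apply PL_const|apply HV].
 - apply PL_scal, PL_mul; [exact Hbb|]. apply (PL_sum3 (fun n i => Dh (h n) i (V n (vel i)))). intros; apply HD.
 - apply PL_mul; [apply PL_const|apply PL_mul; [apply HW|apply HV]].
 - apply PL_scal, HV.
 - apply PL_mul; [exact Hi|apply PL_scal, HD].
 - apply PL_mul; [exact Hi|apply PL_scal, HD].
 - apply PL_mul; [exact Hi|apply PL_add; [apply PL_scal, HD|apply PL_scal, HV]].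
Qed.

Lemma Lam_UB {a b} T j (h : nat -> R) eps (W V : nat -> cmp -> fld a b) : (forall t, T t -> oi a b t) ->
 (forall c r, UB T r j (fun n => W n c)) -> (forall c r, UB T r j (fun n => V n c)) ->
 (forall r, UB T r j (fun n => finv (thw eps (W n)))) ->
 forall c r, UB T r j (fun n => lam (h n) eps (W n) (V n) c).
Proof.
 intros HT HW HV Hi c r.
 assert (HD : forall c i, UB T r j (fun n => Dh (h n) i (V n c))) by (intros; now apply UB_Dh).
 assert (S3 : forall F : nat -> axis -> fld a b, (forall i, UB T r j (fun n => F n i)) -> UB T r j (fun n => sum3 (F n))).
 { intros F HF. unfold sum3. apply UB_add; [apply UB_add|]; apply HF. }
 assert (Hadv : forall c, UB T r j (fun n => adv (h n) (W n) (V n c))).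
 { intros c'. apply (S3 (fun n i => W n (vel i) * Dh (h n) i (V n c'))%fld). intros i. apply UB_mul; [apply HW|apply HD]. }
 assert (Hphi : UB T r j (fun _ => @phiF P HP a b eps)) by (apply UB_add; apply UB_scal, UB_zf; easy).
 assert (Hbb : UB T r j (fun n => bbw eps (W n))).
 { apply UB_add; [now apply UB_cst|]. apply UB_scal, UB_sub; [apply HW|exact Hphi]. }
 assert (Hg : UB T r j (fun _ => @gW P HP a b eps)) by (apply UB_add; apply UB_scal, UB_zf; easy).
 assert (Hc0 : UB T r j (fun _ => @fcst a b 0)) by now apply UB_cst.
 destruct c; cbn [Lam]; (apply UB_sub; [apply UB_sub; [|apply Hadv]|]); try exact Hc0.
 - apply UB_mul; [exact Hg|apply HV].
 - apply UB_scal, UB_mul; [exact Hbb|]. apply (S3 (fun n i => Dh (h n) i (V n (vel i)))). intros; apply HD.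
 - apply UB_mul; [now apply UB_zf|apply UB_mul; [apply HW|apply HV]].
 - apply UB_scal, HV.
 - apply UB_mul; [apply Hi|apply UB_scal, HD].
 - apply UB_mul; [apply Hi|apply UB_scal, HD].
 - apply UB_mul; [apply Hi|apply UB_add; [apply UB_scal, HD|apply UB_scal, HV]].
Qed.

Lemma Lam_lin {a b} h eps (W V V' : cmp -> fld a b) k c :
 lam h eps W (fun c => V c - k *: V' c)%fld c = (lam h eps W V c - k *: lam h eps W V' c)%fld.
Proof. destruct c; cbn [Lam]; unfold adv, sum3; rewrite !Dh_sub, !Dh_scal; fring. Qed.

(** For [h > 0] differences lose no derivative: [Lam] is a bounded linear operator on fields with
    [r] bounded derivatives, with a norm that degenerates like [1 / h]. *)
Lemma Lam_SB r h eps K : 0 < h -> 0 <= K -> exists C, 0 <= C /\ forall a b t B (W V : cmp -> fld a b), 0 <= B ->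
 (forall c, SB 0 r t K 1 (W c)) -> SB 0 r t K 1 (@gW P HP a b eps) -> SB 0 r t K 1 (bbw eps W) ->
 SB 0 r t K 1 (@fGt P HP a b) -> SB 0 r t K 1 (finv (thw eps W)) -> SB 0 r t K 1 (@fcst a b 0) ->
 (forall c, SB 0 r t 1 B (V c)) -> forall c, SB 0 r t C B (lam h eps W V c).
Proof.
 intros Hh HK.
 assert (P2 : 0 <= 2 ^ r) by (apply pow_le; lra).
 assert (Ph : 0 <= / h * 1) by (rewrite Rmult_1_r; left; now apply Rinv_0_lt_compat).
 set (m := fun x => 2 ^ r * (K * x)).
 assert (Pm : forall x, 0 <= x -> 0 <= m x) by (intros; apply Rmult_le_pos; [easy|now apply Rmult_le_pos]).
 set (ca := m (/ h * 1) + m (/ h * 1) + m (/ h * 1)).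
 set (cd := / h * 1 + / h * 1 + / h * 1).
 set (k1 := Rabs (/ calA P)). set (k2 := Rabs (- / (calB P * Rpower eps (nu P)))). set (k3 := Rabs (1 / eps)). set (k4 := Rabs (1 / Rpower eps (nu P))).
 assert (Pca : 0 <= ca) by (unfold ca; have Q := Pm _ Ph; lra). assert (Pcd : 0 <= cd) by (unfold cd; lra).
 have Q1 := Rabs_pos (/ calA P). have Q2 := Rabs_pos (- / (calB P * Rpower eps (nu P))).
 have Q3 := Rabs_pos (1 / eps). have Q4 := Rabs_pos (1 / Rpower eps (nu P)).
 fold k1 in Q1. fold k2 in Q2. fold k3 in Q3. fold k4 in Q4.
 assert (R1 : 0 <= k1 * m cd) by (apply Rmult_le_pos; [easy|now apply Pm]).
 assert (R2 : 0 <= k3 * (/ h * 1) + k4 * 1) by (apply Rplus_le_le_0_compat; [now apply Rmult_le_pos|lra]).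
 have R3 := Pm _ R2. have R4 := Pm 1 ltac:(lra). have R5 := Pm _ R4.
 exists (m 1 + m (m 1) + ca + k1 * m cd + k2 * 1 + m (k3 * (/ h * 1) + k4 * 1)).
 split; [lra|]. intros a b t B W V HB HW Hg Hbb HG Hi H0 HV c.
 assert (HD : forall c i, SB 0 r t (/ h * 1) B (Dh h i (V c))) by (intros; now apply SB_Dh).
 assert (Hadv : forall c, SB 0 r t ca B (adv h W (V c))).
 { intros c'. unfold adv, sum3, ca. apply SB_add; [apply SB_add|]; (apply SB_mul; [lra|exact Ph|lra|apply HW|apply HD]). }
 assert (Z0 : SB 0 r t 0 B (@fcst a b 0)).
 { intros l Hl x y z. destruct (oi_dec a b t) as [Ht|Ht]; [|rewrite fv_out by easy; rewrite Rabs_R0; lra].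
  assert (E : Zw 0 l (@fcst a b 0) = fcst 0).
  { replace (@fcst a b 0) with (0 *: @fcst a b 0)%fld at 1 by fring. rewrite Zw_scal. fring. }
  rewrite E, fcst_at, Rabs_R0 by easy. lra. }
 assert (Hm : forall f g x, 0 <= x -> SB 0 r t K 1 f -> SB 0 r t x B g -> SB 0 r t (m x) B (f * g : fld a b)%fld).
 { intros f g x Hx Hf Hg'. now apply SB_mul. }
 assert (HV3 : forall i, SB 0 r t (m (k3 * (/ h * 1) + k4 * 1)) B (finv (thw eps W) * (1 / eps *: Dh h i (V cQ)))%fld).
 { intros i. apply (SB_weaken 0 r t (m (k3 * (/ h * 1)))); [|easy|].
  - unfold m. apply Rmult_le_compat_l; [easy|]. apply Rmult_le_compat_l; lra.
  - apply Hm; [now apply Rmult_le_pos|easy|]. apply SB_scal, HD. }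
 destruct c; cbn [Lam].
 - apply (SB_weaken 0 r t (m 1 + ca + k1 * m cd)); [lra|easy|].
  apply SB_sub; [apply SB_sub; [apply Hm; [lra|easy|apply HV]|apply Hadv]|].
  apply SB_scal, Hm; [easy|easy|]. unfold sum3, cd. apply SB_add; [apply SB_add|]; apply HD.
 - apply (SB_weaken 0 r t (m (m 1) + ca + k2 * 1)); [lra|easy|].
  apply SB_sub; [apply SB_sub; [apply Hm; [easy|easy|apply Hm; [lra|apply HW|apply HV]]|apply Hadv]|].
  apply SB_scal, HV.
 - apply (SB_weaken 0 r t (0 + ca + m (k3 * (/ h * 1) + k4 * 1))); [lra|easy|].
  apply SB_sub; [apply SB_sub; [exact Z0|apply Hadv]|apply HV3].
 - apply (SB_weaken 0 r t (0 + ca + m (k3 * (/ h * 1) + k4 * 1))); [lra|easy|].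
  apply SB_sub; [apply SB_sub; [exact Z0|apply Hadv]|apply HV3].
 - apply (SB_weaken 0 r t (0 + ca + m (k3 * (/ h * 1) + k4 * 1))); [lra|easy|].
  apply SB_sub; [apply SB_sub; [exact Z0|apply Hadv]|]. apply Hm; [easy|easy|]. apply SB_add; apply SB_scal; [apply HD|apply HV].
Qed.

Fixpoint picard {a b} t0 (H0 : oi a b t0) h eps (W U0 : cmp -> fld a b) (n : nat) (c : cmp) : fld a b :=
 match n with
 | O => U0 c
 | S m => (U0 c + ftint t0 H0 (lam h eps W (picard t0 H0 h eps W U0 m) c))%fld
 end.

(** With positive mesh this is a linear differential equation with bounded generator. The Picard
    increments decay like [2^-n] in every spatial derivative on the whole interval; time derivatives
    of the increments are read off the equation, and the iterates converge together with all
    derivatives. *)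
Lemma linear_solve {a b} t0 (H0 : oi a b t0) h eps (W U0 : cmp -> fld a b) : 0 < h ->
 (forall c, fder None (U0 c) = fcst 0) ->
 exists V, (forall c, fder None (V c) = lam h eps W V c) /\ forall c x y z, V c t0 x y z = U0 c t0 x y z.
Proof.
 intros Hh HU0. set (V := picard t0 H0 h eps W U0).
 set (D := fun n c => (V (S n) c - V n c)%fld).
 assert (D0 : forall c, D 0%nat c = ftint t0 H0 (lam h eps W U0 c)).
 { intros c. unfold D. change (V 1%nat c) with (U0 c + ftint t0 H0 (lam h eps W U0 c))%fld. change (V 0%nat c) with (U0 c).
  generalize (ftint t0 H0 (lam h eps W U0 c)). intros f. fring. }
 assert (lsub : forall X Y c, lam h eps W (fun c => X c - Y c)%fld c = (lam h eps W X c - lam h eps W Y c)%fld).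
 { intros X Y c. have Q := Lam_lin h eps W X Y 1 c.
  replace (fun c => X c - Y c)%fld with (fun c => X c - 1 *: Y c)%fld by (extensionality c'; fring). rewrite Q. fring. }
 assert (DS : forall n c, D (S n) c = ftint t0 H0 (lam h eps W (D n) c)).
 { intros n c. change (D n) with (fun c => V (S n) c - V n c)%fld. rewrite lsub, ftint_sub.
  unfold D. change (V (S (S n)) c) with (U0 c + ftint t0 H0 (lam h eps W (V (S n)) c))%fld.
  change (V (S n) c) with (U0 c + ftint t0 H0 (lam h eps W (V n) c))%fld at 1.
  generalize (ftint t0 H0 (lam h eps W (V (S n)) c)) (ftint t0 H0 (lam h eps W (V n) c)). intros f g. fring. }
 assert (Hloc : forall t1 t2, oi a b t1 -> oi a b t2 -> t1 <= t0 <= t2 -> forall r, exists B L, 0 <= B /\ 0 < L /\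
  forall n t c, t1 <= t <= t2 -> SB 0 r t 1 (B * (/ 2) ^ n * exp (L * Rabs (t - t0))) (D n c)).
 { intros t1 t2 I1 I2 Ht0 r.
  assert (LB : forall fs : list (fld a b), exists K, 0 <= K /\ forall f, In f fs -> forall t, t1 <= t <= t2 -> SB 0 r t K 1 f).
  { induction fs as [|f fs IH]; [exists 0; split; [lra|easy]|].
   destruct IH as [K [PK HK]]. destruct (SB_local 0 r t1 t2 f I1 I2) as [K' [PK' HK']].
   exists (K + K'). split; [lra|]. intros g [<-|Hg] t Ht.
   - apply (SB_weaken 0 r t K'); [lra|lra|now apply HK'].
   - apply (SB_weaken 0 r t K); [lra|lra|now apply HK]. }
  destruct (LB (W cQ :: W cH :: W cV1 :: W cV2 :: W cW :: gW P HP eps :: bbw eps W :: fGt P HP :: finv (thw eps W) :: fcst 0 :: nil)) as [K [PK HK]].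
  destruct (LB (D 0%nat cQ :: D 0%nat cH :: D 0%nat cV1 :: D 0%nat cV2 :: D 0%nat cW :: nil)) as [B [PB HB]].
  destruct (Lam_SB r h eps K Hh PK) as [C [PC HC]].
  (* This makes [C / L <= 1/2], the contraction factor of one step in the weighted bound. *)
  set (L := 2 * C + 1). exists B, L. split; [easy|]. split; [unfold L; lra|].
  assert (Ex : forall t, 1 <= exp (L * Rabs (t - t0))).
  { intros t. rewrite <- exp_0. apply exp_le, Rmult_le_pos; [unfold L; lra|apply Rabs_pos]. }
  induction n; intros t c Ht.
  - intros l Hl x y z. assert (Q : SB 0 r t B 1 (D 0%nat c)) by (apply HB; [clear; destruct c; [left|right; left|do 2 right; left|do 3 right; left|do 4 right; left]; reflexivity|easy]).
   etr; [now apply Q|]. simpl. have E := Ex t. nra.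
  - intros l Hl x y z. rewrite DS, Zw0_tint. assert (It : oi a b t) by (unfold oi in *; lra).
   rewrite ftint_at by exact It.
   set (Bn := B * (/ 2) ^ n). assert (PBn : 0 <= Bn) by (apply Rmult_le_pos; [easy|apply pow_le; lra]).
   apply Rle_trans with (C * Bn / L * exp (L * Rabs (t - t0))).
   + apply RInt_exp_bound; [unfold L; lra|now apply Rmult_le_pos|apply (Sm_ex_RInt a b); [apply fv_sm|easy|easy]|].
    intros s Hs. assert (Hs' : t1 <= s <= t2) by (unfold Rmin, Rmax in Hs; destruct Rle_dec; lra).
    assert (PE : 0 <= Bn * exp (L * Rabs (s - t0))) by (apply Rmult_le_pos; [easy|have Q := Ex s; lra]).
    assert (Q : SB 0 r s C (Bn * exp (L * Rabs (s - t0))) (lam h eps W (D n) c)).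
    { apply HC; try easy; try (apply HK; [cbn [In]; clear; tauto|easy]).
     - intros c'; apply HK; [clear; destruct c'; cbn [In]; tauto|easy].
     - intros c'. unfold Bn. now apply IHn. }
    have Q' := Q l Hl x y z. lra.
   + rewrite Rmult_1_l. apply Rmult_le_compat_r; [have Q := Ex t; lra|]. unfold Bn. simpl.
    replace (C * (B * (/ 2) ^ n) / L) with (C / L * (B * (/ 2) ^ n)) by (unfold Rdiv; ring).
    replace (B * (/ 2 * (/ 2) ^ n)) with (/ 2 * (B * (/ 2) ^ n)) by ring.
    apply Rmult_le_compat_r; [exact PBn|]. apply Rle_div_l; unfold L; lra. }
 (* Rescaled increments. Their spatial words are bounded uniformly in [n] by the geometric decay;
    words with more time letters follow from the relation between [D (S n)] and [D n]. *)
 set (g := fun c n => (2 ^ n *: D n c)%fld).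
 assert (HUB : forall t1 t2, oi a b t1 -> oi a b t2 -> t1 <= t0 <= t2 -> forall j c r, UB (fun t => t1 <= t <= t2) r j (g c)).
 { intros t1 t2 I1 I2 Ht0.
  set (T := fun t => t1 <= t <= t2).
  assert (HT : forall t, T t -> oi a b t) by (unfold T, oi in *; intros; lra).
  assert (U00 : forall c r, UB T r 0 (g c)).
  { intros c r. destruct (Hloc t1 t2 I1 I2 Ht0 r) as (B & L & PB & PL' & HB).
   apply UB0_of_SB. intros l Hl. exists (B * exp (L * (t2 - t1))). intros n t x y z Ht.
   have Q := HB n t c Ht l Hl x y z. unfold g. rewrite Zw_scal, fscal_at, Rabs_mult.
   rewrite (Rabs_right (2 ^ n)) by (apply Rle_ge, pow_le; lra).
   assert (Pn : 0 < 2 ^ n) by (apply pow_lt; lra).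
   apply Rle_trans with (2 ^ n * (1 * (B * (/ 2) ^ n * exp (L * Rabs (t - t0))))); [apply Rmult_le_compat_l; [lra|exact Q]|].
   rewrite pow_inv. replace (2 ^ n * (1 * (B * / 2 ^ n * exp (L * Rabs (t - t0))))) with (B * exp (L * Rabs (t - t0))) by (field; lra).
   apply Rmult_le_compat_l; [easy|].
   assert (Hle : L * Rabs (t - t0) <= L * (t2 - t1)) by (apply Rmult_le_compat_l; [lra|]; apply Rabs_le; unfold T in Ht; lra).
   now apply exp_le. }
  induction j; intros c r; [apply U00|].
  apply UB_time; [apply U00|].
  assert (Hlam : UB T r j (fun n => lam h eps W (fun c => g c n) c)).
  { apply (Lam_UB T j (fun _ => h) eps (fun _ => W) (fun n c => g c n)); try easy; intros; now apply UB_const. }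
  have Hlam0 := UB_const t1 t2 r j (lam h eps W U0 c) I1 I2.
  intros l Hl Hc. destruct (Hlam l Hl Hc) as [K1 H1]. destruct (Hlam0 l Hl Hc) as [K2 H2].
  exists (2 * Rabs K1 + Rabs K2). intros n t x y z Ht.
  have A1 := Rle_abs K1. have A2 := Rle_abs K2. have A3 := Rabs_pos K1. have A4 := Rabs_pos K2.
  unfold g. rewrite fder_scal. destruct n.
  - rewrite D0, fder_tint_None. replace (2 ^ 0 *: lam h eps W U0 c)%fld with (lam h eps W U0 c) by (simpl; fring).
   have Q := H2 0%nat t x y z Ht. lra.
  - rewrite DS, fder_tint_None.
   assert (E : lam h eps W (fun c => g c n) c = (2 ^ n *: lam h eps W (D n) c)%fld).
   { have Q := Lam_lin h eps W (fun c => fcst 0) (D n) (- 2 ^ n) c.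
    assert (Eg : (fun c => g c n) = (fun c => fcst 0 - - 2 ^ n *: D n c)%fld) by (extensionality c'; unfold g; fring).
    rewrite Eg, Q. replace (lam h eps W (fun _ => fcst 0) c) with (@fcst a b 0); [fring|].
    have Q2 := Lam_lin h eps W (fun c => fcst 0) (fun c => fcst 0) 1 c.
    assert (E0 : (fun _ : cmp => @fcst a b 0) = (fun c => fcst 0 - 1 *: fcst 0)%fld) by (extensionality c'; fring).
    cbv beta in Q2. rewrite <- E0 in Q2. rewrite Q2. generalize (lam h eps W (fun _ : cmp => @fcst a b 0) c). intros f. fring. }
   have Q := H1 n t x y z Ht. rewrite E in Q.
   replace (2 ^ S n *: lam h eps W (D n) c)%fld with (2 *: (2 ^ n *: lam h eps W (D n) c))%fld by (simpl pow; fring).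
   rewrite Zw_scal, fscal_at, Rabs_mult, (Rabs_right 2) by lra. lra. }
 assert (HKc : forall c, Kcauchy (fun n => V n c)).
 { intros c l t1 t2 eta I1 I2 Heta.
  set (s1 := Rmin t1 t0). set (s2 := Rmax t2 t0).
  assert (J1 : oi a b s1) by (unfold s1, Rmin; destruct Rle_dec; easy).
  assert (J2 : oi a b s2) by (unfold s2, Rmax; destruct Rle_dec; easy).
  have L1 := Rmin_l t1 t0. have L2 := Rmin_r t1 t0. have L3 := Rmax_l t2 t0. have L4 := Rmax_r t2 t0.
  destruct (HUB s1 s2 J1 J2 ltac:(unfold s1, s2; lra) (cnt l) c (length l) l (le_n _) (le_n _)) as [K HK].
  destruct (geom_cauchy (Rabs K) (/ 2) eta) as [n0 Hn0]; [lra|apply Rabs_pos|easy|].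
  exists n0. intros n m t x y z Hn Hm Ht.
  apply (Hn0 (fun n => Zw 1 l (V n c) t x y z)); [|easy|easy]. intros j.
  have Q := HK j t x y z ltac:(unfold s1, s2; lra). unfold g in Q. rewrite Zw_scal, fscal_at, Rabs_mult in Q.
  rewrite (Rabs_right (2 ^ j)) in Q by (apply Rle_ge, pow_le; lra). unfold D in Q. rewrite Zw_sub, fsub_at in Q.
  assert (Pn : 0 < 2 ^ j) by (apply pow_lt; lra). rewrite pow_inv.
  apply Rmult_le_reg_l with (2 ^ j); [easy|]. etr; [exact Q|].
  replace (2 ^ j * (Rabs K * / 2 ^ j)) with (Rabs K) by (field; lra). apply Rle_abs. }
 destruct (fields_limit V HKc) as (VL & HP0 & HP1).
 exists VL. split.
 - intros c. apply (PL_unique (fun n => fder None (V (S n) c))).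
  + apply (PL_shift (fun n => fder None (V n c))).
   apply HP1.
  + assert (E : forall n, fder None (V (S n) c) = lam h eps W (V n) c).
   { intros n. unfold V. cbn [picard]. rewrite fder_add, HU0, fder_tint_None. fring. }
   intros t x y z Ht. apply (is_lim_seq_ext (fun n => lam h eps W (V n) c t x y z)); [intros n; now rewrite E|].
   refine (Lam_lim (fun _ => h) h eps (fun _ => W) V W VL _ HP0 _ _ c t x y z Ht).
   * intros; apply PL_const.
   * intros c' i t' x' y' z' Ht'. rewrite Dh_at by lra.
    apply (is_lim_seq_ext (fun n => (slice i (V n c' t') x' y' z' (coord i x' y' z' + h) - slice i (V n c' t') x' y' z' (coord i x' y' z' - h)) * / (2 * h))).
    { intros n. now rewrite Dh_at by lra. }
    unfold Rdiv. apply (is_lim_seq_scal_r _ (/ (2 * h)) (Finite _)).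
    apply is_lim_seq_minus'; destruct i; cbn [slice coord]; now apply HP0.
   * apply PL_const.
 - intros c x y z.
  have Q := is_lim_seq_unique _ _ (HP0 c t0 x y z H0).
  assert (Q2 : is_lim_seq (fun n => V n c t0 x y z) (U0 c t0 x y z)).
  { apply (is_lim_seq_ext (fun _ => U0 c t0 x y z)); [|apply is_lim_seq_const].
   intros n. destruct n; [reflexivity|]. unfold V. cbn [picard]. rewrite fadd_at, ftint_at, RInt_point by exact H0.
   unfold zero; simpl. ring. }
  apply is_lim_seq_unique in Q2. cbv beta in Q. rewrite Q2 in Q. injection Q. easy.
Qed.

End LinearSolve.

(** * Interpolation and differences of two solutions *)

Lemma Zw0_parts {a b} t l (f g : fld a b) : oi a b t -> exists s, Rabs s <= 1 /\
 Iint t (Zw 0 l f * g)%fld = s * Iint t (f * Zw 0 (rev l) g)%fld.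
Proof.
 intros Ht. revert g. induction l as [|d l IH]; intros g.
 - exists 1. split; [rewrite Rabs_R1; lra|]. now rewrite Rmult_1_l.
 - rewrite Zw_cons. destruct d as [c|].
  + destruct (IH (fder (Some c) g)) as [s [Hs Es]]. exists (- s). split; [now rewrite Rabs_Ropp|].
   rewrite Zd_Some, Iint_parts, Es by exact Ht. cbn [rev]. rewrite Zw_app, Zd_Some. ring.
  + exists 0. split; [rewrite Rabs_R0; lra|]. rewrite Zd0_None, Rmult_0_l.
   replace (fcst 0 * g)%fld with (@fcst a b 0) by fring. now apply Iint_cst.
Qed.

Lemma Zw_app2 {a b} e l l' (f : fld a b) : Zw e (l ++ l') f = Zw e l (Zw e l' f).
Proof. unfold Zw. apply fold_right_app. Qed.

(** All letters of one factor are moved onto the other by integration by parts, and Cauchy-Schwarz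
    is applied. The factor [s] is a sign, or 0 if the word contains a time letter, since these act
    as zero when [e = 0]. *)
Lemma interpolation {a b} t l (f : fld a b) : oi a b t ->
 nrm2 t (Zw 0 l f) ^ 2 <= nrm2 t f * nrm2 t (Zw 0 (rev l ++ l) f).
Proof.
 intros Ht. destruct (Zw0_parts t l f (Zw 0 l f) Ht) as [s [Hs Es]].
 Transparent nrm2. unfold nrm2 at 1. Opaque nrm2. rewrite Es, <- Zw_app2.
 have Q := Iint_cs t f (Zw 0 (rev l ++ l) f) Ht. rewrite Rpow_mult_distr.
 assert (s ^ 2 <= 1) by (rewrite <- (pow2_abs s); have Q0 := Rabs_pos s; nra).
 have Q1 := pow2_ge_0 (Iint t (f * Zw 0 (rev l ++ l) f)%fld). nra.
Qed.

Lemma N_interpolation k : exists m, 0 <= m /\ forall a b t A K (f : fld a b), oi a b t -> 0 <= A -> 0 <= K ->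
 nrm2 t f <= A -> Nk 0 (k + k) t f <= K -> Nk 0 k t f <= m * sqrt (A * K).
Proof.
 destruct (SW_const k 1) as [m [Hm Em]]. exists m. split; [easy|]. intros a b t A K f Ht HA HK Hf HN.
 apply Rle_trans with (SW k (fun _ => sqrt (A * K) * 1)).
 - Transparent Nk. unfold Nk. Opaque Nk. apply SW_le. intros l Hl. rewrite Rmult_1_r. apply le_of_sq_le; [apply sqrt_pos|].
  rewrite pow2_sqrt by (now apply Rmult_le_pos). etr; [now apply interpolation|].
  apply Rmult_le_compat; [now apply nrm2_nonneg|now apply nrm2_nonneg|easy|].
  etr; [|exact HN]. apply N_word; [easy|]. rewrite length_app, length_rev. lia.
 - rewrite SW_scal, Em. lra.
Qed.

(** Interpolating order 2 between a vanishing L^2 norm and order 4 gives a vanishing norm of order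
    2, hence a vanishing supremum. *)
Lemma nrm2_zero {a b} t (f : fld a b) : oi a b t -> nrm2 t f <= 0 -> forall x y z, f t x y z = 0.
Proof.
 intros Ht H x y z. destruct (N_interpolation 2) as [m [Hm H2]].
 have Q := H2 a b t 0 (Nk 0 4 t f) f Ht (Rle_refl 0) (N_nonneg 0 4 t f Ht) H (Rle_refl _).
 rewrite Rmult_0_l, sqrt_0, Rmult_0_r in Q. have Q1 := sup_bound 0 t f x y z Ht. nra.
Qed.

(** Two bounded fields, close in L^2 in the squared norm. The relation is stable under ring
    operations, so the difference of two coefficients or two source terms is estimated by following
    their syntax. *)
Definition DB {a b} (t C Y : R) (f f' : fld a b) : Prop :=
 (forall x y z, Rabs (f t x y z) <= C) /\ (forall x y z, Rabs (f' t x y z) <= C) /\ nrm2 t (f - f')%fld <= C * Y.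

(* [8 C^3] dominates the growth of the constant in [DB] under one ring operation. *)
Definition Cdb (K : R) (d : nat) : R := Nat.iter d (fun C => 8 * C ^ 3) K.

Lemma Cdb_ge K d : 1 <= K -> 1 <= Cdb K d.
Proof. intros HK. induction d; [easy|]. change (Cdb K (S d)) with (8 * Cdb K d ^ 3). have Q := pow_R1_Rle _ 3 IHd. lra. Qed.

Lemma cube_ge C : 1 <= C -> C <= C ^ 3 /\ C * C <= C ^ 3.
Proof. intros H. replace (C ^ 3) with (C * (C * C)) by ring. assert (C <= C * C) by nra. split; nra. Qed.

Lemma Cdb_mono K d : 1 <= K -> K <= Cdb K d.
Proof.
 intros HK. induction d; [apply Rle_refl|]. have Q := Cdb_ge K d HK.
 change (Cdb K (S d)) with (8 * Cdb K d ^ 3). have Q1 := cube_ge _ Q. lra.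
Qed.

Section DBcalc.
Context {a b : R} (t Y K : R) (Ht : oi a b t) (HY : 0 <= Y) (HK : 1 <= K).

Lemma DB_atom d (f f' : fld a b) : DB t K Y f f' -> DB t (Cdb K d) Y f f'.
Proof.
 intros (H1 & H2 & H3). have Q := Cdb_mono K d HK.
 split; [|split]; [intros x y z; etr; [apply H1|easy]|intros x y z; etr; [apply H2|easy]|nra].
Qed.

Lemma DB_same d (f : fld a b) : (forall x y z, Rabs (f t x y z) <= K) -> DB t (Cdb K d) Y f f.
Proof.
 intros H. apply DB_atom. split; [easy|]. split; [easy|].
 replace (f - f)%fld with (@fcst a b 0) by fring. rewrite nrm2_cst0 by easy. apply Rmult_le_pos; lra.
Qed.

Lemma DB_add d (f f' g g' : fld a b) : DB t (Cdb K d) Y f f' -> DB t (Cdb K d) Y g g' -> DB t (Cdb K (S d)) Y (f + g)%fld (f' + g')%fld.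
Proof.
 intros (H1 & H2 & H3) (G1 & G2 & G3). have Q := Cdb_ge K d HK. change (Cdb K (S d)) with (8 * Cdb K d ^ 3).
 set (C := Cdb K d) in *. have Q1 := cube_ge _ Q. assert (B : 2 * C <= 8 * C ^ 3) by lra.
 split; [|split].
 - intros x y z. rewrite fadd_at. have T := Rabs_triang (f t x y z) (g t x y z). specialize (H1 x y z). specialize (G1 x y z). lra.
 - intros x y z. rewrite fadd_at. have T := Rabs_triang (f' t x y z) (g' t x y z). specialize (H2 x y z). specialize (G2 x y z). lra.
 - replace (f + g - (f' + g'))%fld with ((f - f') + (g - g'))%fld by fring.
  etr; [now apply nrm2_add|]. assert (0 <= C * Y) by (apply Rmult_le_pos; lra).
  assert (4 * (C * Y) <= 8 * C ^ 3 * Y); [|lra]. replace (8 * C ^ 3 * Y) with (8 * C ^ 2 * (C * Y)) by ring. nra.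
Qed.

Lemma DB_mul d (f f' g g' : fld a b) : DB t (Cdb K d) Y f f' -> DB t (Cdb K d) Y g g' -> DB t (Cdb K (S d)) Y (f * g)%fld (f' * g')%fld.
Proof.
 intros (H1 & H2 & H3) (G1 & G2 & G3). have Q := Cdb_ge K d HK. change (Cdb K (S d)) with (8 * Cdb K d ^ 3).
 set (C := Cdb K d) in *. have Q1 := cube_ge _ Q. assert (B : C * C <= 8 * C ^ 3) by lra.
 split; [|split].
 - intros x y z. rewrite fmul_at, Rabs_mult. etr; [|exact B]. apply Rmult_le_compat; [apply Rabs_pos|apply Rabs_pos|apply H1|apply G1].
 - intros x y z. rewrite fmul_at, Rabs_mult. etr; [|exact B]. apply Rmult_le_compat; [apply Rabs_pos|apply Rabs_pos|apply H2|apply G2].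
 - replace (f * g - f' * g')%fld with (f * (g - g') + g' * (f - f'))%fld by fring.
  etr; [now apply nrm2_add|]. assert (0 <= C * Y) by (apply Rmult_le_pos; lra).
  assert (S2 : forall u : fld a b, (forall x y z, Rabs (u t x y z) <= C) -> forall x y z, u t x y z ^ 2 <= C ^ 2).
  { intros u Hu x y z. rewrite <- (pow2_abs (u t x y z)). specialize (Hu x y z). have P := Rabs_pos (u t x y z). nra. }
  have P1 := prod_sup t f (g - g')%fld (C ^ 2) Ht (S2 f H1). have P2 := prod_sup t g' (f - f')%fld (C ^ 2) Ht (S2 g' G2).
  assert (C2 : 0 <= C ^ 2) by nra.
  have M1 := Rmult_le_compat_l _ _ _ C2 G3. have M2 := Rmult_le_compat_l _ _ _ C2 H3.
  assert (0 <= C ^ 2 * (C * Y)) by (apply Rmult_le_pos; lra).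
  replace (8 * C ^ 3 * Y) with (8 * (C ^ 2 * (C * Y))) by ring. lra.
Qed.

Lemma DB_scal d k (f f' : fld a b) : Rabs k <= K -> DB t (Cdb K d) Y f f' -> DB t (Cdb K (S d)) Y (k *: f)%fld (k *: f')%fld.
Proof.
 intros Hk H. rewrite !fscal_cst. apply DB_mul; [|easy]. apply DB_same. intros; now rewrite fcst_at.
Qed.

Lemma DB_opp d (f f' : fld a b) : DB t (Cdb K d) Y f f' -> DB t (Cdb K (S d)) Y (fopp f)%fld (fopp f')%fld.
Proof. intros H. unfold fopp. apply DB_scal; [|easy]. rewrite Rabs_left by lra. lra. Qed.

Lemma DB_up d (f f' : fld a b) : DB t (Cdb K d) Y f f' -> DB t (Cdb K (S d)) Y f f'.
Proof.
 intros (H1 & H2 & H3). have Q := Cdb_ge K d HK. change (Cdb K (S d)) with (8 * Cdb K d ^ 3).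
 have Q1 := cube_ge _ Q. assert (B : Cdb K d <= 8 * Cdb K d ^ 3) by lra.
 split; [|split]; [intros x y z; etr; [apply H1|easy]|intros x y z; etr; [apply H2|easy]|nra].
Qed.

Lemma DB_sub d (f f' g g' : fld a b) : DB t (Cdb K d) Y f f' -> DB t (Cdb K d) Y g g' -> DB t (Cdb K (S (S d))) Y (f - g)%fld (f' - g')%fld.
Proof. intros Hf Hg. unfold fsub. apply DB_add; [now apply DB_up|now apply DB_opp]. Qed.

Lemma DB_sum3 d (F F' : axis -> fld a b) : (forall i, DB t (Cdb K d) Y (F i) (F' i)) -> DB t (Cdb K (S (S d))) Y (sum3 F) (sum3 F').
Proof. intros H. unfold sum3. apply DB_add; [apply DB_add|apply DB_up]; apply H. Qed.
End DBcalc.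

Lemma Lop_sub {a b} h (m : cmp -> fld a b) al bb ss V V' c :
 Lop h m al bb ss (fun c => V c - V' c)%fld c = (Lop h m al bb ss V c - Lop h m al bb ss V' c)%fld.
Proof. destruct c; unfold Lop, coupling, sum3; rewrite ?fder_sub, ?Dh_sub; fring. Qed.

Section Difference.
Context (P : params) (HP : admissible P).
Local Notation thw := (thW P HP). Local Notation aw := (aW P HP). Local Notation mw := (mW P HP).
Local Notation Lsys h eps W := (Lop h (mW P HP eps W) (alW P HP eps W) (bbW P HP eps W) (ssW P HP eps W)).

(** Subtracting the system of [V'] from that of [V] leaves the operator of [W] acting on [V - V'],
    with a source made of differences of coefficients applied to [V']. Only [V'] needs bounded
    derivatives, and the two meshes may differ. *)
Lemma diff_source eps K : exists C, 0 <= C /\ forall a b h h' (W V W' V' : cmp -> fld a b) t Y, oi a b t -> 0 <= Y ->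
 (forall c x y z, Rabs (W c t x y z) <= K /\ Rabs (V c t x y z) <= K /\ Rabs (W' c t x y z) <= K /\ Rabs (V' c t x y z) <= K) ->
 (forall c x y z, Rabs (fder None (V' c) t x y z) <= K) ->
 (forall c i x y z, Rabs (fder (Some i) (V' c) t x y z) <= K) ->
 (forall c, nrm2 t (W c - W' c)%fld <= Y) -> (forall c, nrm2 t (V c - V' c)%fld <= Y) ->
 (forall c i, nrm2 t (Dh h i (V' c) - Dh h' i (V' c))%fld <= Y) ->
 SYM P HP h eps W V -> SYM P HP h' eps W' V' ->
 nS t (Lsys h eps W (fun c => V c - V' c)%fld) <= C * Y.
Proof.
 set (zs := sq (Kzf 3 (G P)) + sq (Kzf 3 (Hbar P)) + sq (Kzf 3 (Gt P)) + sq (Kzf 3 (fun z => RInt (G P) 0 z)) + sq (Kzf 3 (fun z => RInt (Hbar P) 0 z))).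
 set (K' := 1 + Rabs K + zs + Rabs (C0 P) + Rabs (Rpower eps (mu P)) + Rabs (/ varpi0 P) + Rabs eps + Rabs (Rpower eps (nu P)) +
  Rabs (calA P) + Rabs (calB P) + Rabs (1 / eps) + Rabs (1 / Rpower eps (nu P))).
 assert (sqp : forall x, 0 <= sq x) by (intros; apply sqrt_pos).
 have Z1 := sqp (Kzf 3 (G P)). have Z2 := sqp (Kzf 3 (Hbar P)). have Z3 := sqp (Kzf 3 (Gt P)).
 have Z4 := sqp (Kzf 3 (fun z => RInt (G P) 0 z)). have Z5 := sqp (Kzf 3 (fun z => RInt (Hbar P) 0 z)).
 have A0 := Rabs_pos K. have A1 := Rabs_pos (C0 P). have A2 := Rabs_pos (Rpower eps (mu P)). have A3 := Rabs_pos (/ varpi0 P).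
 have A4 := Rabs_pos eps. have A5 := Rabs_pos (Rpower eps (nu P)). have A6 := Rabs_pos (calA P). have A7 := Rabs_pos (calB P).
 have A8 := Rabs_pos (1 / eps). have A9 := Rabs_pos (1 / Rpower eps (nu P)). have KK := Rle_abs K.
 assert (HK' : 1 <= K') by (unfold K', zs; lra). assert (HKK : K <= K') by (unfold K', zs; lra).
 (* Five components; each is a difference of two compared pairs, whence the 4. The operator and the
    source have depth 16, so any depth from 16 on would do. *)
 exists (5 * (4 * Cdb K' 30)). split; [have Q := Cdb_ge K' 30 HK'; lra|].
 intros a b h h' W V W' V' t Y Ht HY HS Ht' Hx HW HV HD S1 S2.
 assert (kle : forall k, k <= K -> k <= K') by (intros; lra).
 assert (nY : forall f : fld a b, nrm2 t f <= Y -> nrm2 t f <= K' * Y) by (intros; nra).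
 assert (aW' : forall d c, DB t (Cdb K' d) Y (W c) (W' c)).
 { intros d c. apply DB_atom; [easy|easy|]. split; [intros; apply kle, HS|split; [intros; apply kle, HS|apply nY, HW]]. }
 assert (aV : forall d c, DB t (Cdb K' d) Y (V c) (V' c)).
 { intros d c. apply DB_atom; [easy|easy|]. split; [intros; apply kle, HS|split; [intros; apply kle, HS|apply nY, HV]]. }
 assert (aV' : forall d c, DB t (Cdb K' d) Y (V' c) (V' c)) by (intros d c; apply DB_same; [easy|easy|easy|]; intros; apply kle, HS).
 assert (aT : forall d c, DB t (Cdb K' d) Y (fder None (V' c)) (fder None (V' c))).
 { intros d c; apply DB_same; [easy|easy|easy|]; intros; apply kle, Ht'. }
 assert (aD : forall d c i, DB t (Cdb K' d) Y (Dh h i (V' c)) (Dh h' i (V' c))).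
 { intros d c i. apply DB_atom; [easy|easy|]. split; [|split; [|apply nY, HD]]; intros; apply kle, Dh_sup; easy. }
 assert (aZ : forall d g Hs Hp, sq (Kzf 3 g) <= K' -> DB t (Cdb K' d) Y (@fzf a b g Hs Hp) (fzf g Hs Hp)).
 { intros d g Hs Hp Hg. apply DB_same; [easy|easy|easy|]. intros x y z. etr; [|exact Hg].
  apply (TB_sup 0 3 t 0 (Kzf 3 g) (fzf g Hs Hp) Ht). now apply TB_zf; [|lra]. }
 assert (aC : forall d k, Rabs k <= K' -> DB t (Cdb K' d) Y (@fcst a b k) (fcst k)).
 { intros d k Hk. apply DB_same; [easy|easy|easy|]. intros. now rewrite fcst_at. }
 assert (Hphi : forall d, DB t (Cdb K' (S (S d))) Y (@phiF P HP a b eps) (phiF P HP eps)).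
 { intros d. apply DB_add; [easy|easy|easy| |]; (apply DB_scal; [easy|easy|easy| |]); [unfold K', zs; lra|apply aZ|unfold K', zs; lra|apply aZ]; unfold K', zs; lra. }
 assert (Hp : forall d, DB t (Cdb K' (5 + d)) Y (pW P HP eps W) (pW P HP eps W')).
 { intros d. apply DB_scal; [easy|easy|easy|unfold K', zs; lra|]. apply DB_sub; [easy|easy|easy|apply aW'|apply Hphi]. }
 assert (Ha : forall d, DB t (Cdb K' (7 + d)) Y (aw eps W) (aw eps W')).
 { intros d. apply DB_add; [easy|easy|easy|apply aC; rewrite Rabs_R1; easy|]. apply DB_scal; [easy|easy|easy|unfold K', zs; lra|]. apply Hp. }
 assert (Hth : forall d, DB t (Cdb K' (5 + d)) Y (thw eps W) (thw eps W')).
 { intros d. apply DB_add; [easy|easy|easy|apply aC; unfold K', zs; lra|]. apply DB_scal; [easy|easy|easy|unfold K', zs; lra|].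
  apply DB_add; [easy|easy|easy| |].
  - apply DB_mul; [easy|easy|easy|apply aZ; unfold K', zs; lra|apply aZ; unfold K', zs; lra].
  - apply DB_scal; [easy|easy|easy|unfold K', zs; lra|]. apply DB_mul; [easy|easy|easy|apply aZ; unfold K', zs; lra|apply aW']. }
 assert (Hm : forall d c, DB t (Cdb K' (8 + d)) Y (mw eps W c) (mw eps W' c)).
 { intros d c. assert (Q : DB t (Cdb K' (8 + d)) Y (aw eps W * thw eps W)%fld (aw eps W' * thw eps W')%fld).
  { apply DB_mul; [easy|easy|easy|apply Ha|apply (Hth (2 + d)%nat)]. }
  destruct c; cbn [mW]; [apply aC; unfold K', zs; lra| |exact Q|exact Q|exact Q].
  apply DB_scal; [easy|easy|easy|unfold K', zs; lra|apply Ha]. }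
 assert (Hbb : forall d, DB t (Cdb K' (6 + d)) Y (bbW P HP eps W) (bbW P HP eps W')).
 { intros d. apply DB_add; [easy|easy|easy|apply aC; unfold K', zs; lra|apply Hp]. }
 assert (Hss : forall d, DB t (Cdb K' (8 + d)) Y (ssW P HP eps W) (ssW P HP eps W')).
 { intros d. apply DB_scal; [easy|easy|easy|unfold K', zs; lra|apply Ha]. }
 assert (HL : forall d c, DB t (Cdb K' (16 + d)) Y (Lsys h eps W V' c) (Lsys h' eps W' V' c)).
 { intros d c. unfold Lop. apply DB_add; [easy|easy|easy|apply DB_add; [easy|easy|easy| |]|].
  - apply DB_mul; [easy|easy|easy|apply (Hm (5 + d)%nat)|apply aT].
  - apply DB_sum3; [easy|easy|easy|]. intros i. apply DB_mul; [easy|easy|easy| |apply aD].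
   apply DB_mul; [easy|easy|easy|apply (Hm (2 + d)%nat)|apply aW'].
  - assert (B1 : forall d i c, DB t (Cdb K' (7 + d)) Y (bbW P HP eps W * Dh h i (V' c))%fld (bbW P HP eps W' * Dh h' i (V' c))%fld).
   { intros d' i c'. apply DB_mul; [easy|easy|easy|apply Hbb|apply aD]. }
   destruct c; cbn [coupling].
   + apply DB_sum3; [easy|easy|easy|]. intros i. apply (B1 (6 + d)%nat).
   + apply DB_opp; [easy|easy|easy|]. apply DB_mul; [easy|easy|easy|apply (Hss (5 + d)%nat)|apply aV'].
   + apply (B1 (8 + d)%nat).
   + apply (B1 (8 + d)%nat).
   + apply DB_add; [easy|easy|easy|apply (B1 (7 + d)%nat)|]. apply DB_mul; [easy|easy|easy|apply (Hss (5 + d)%nat)|apply aV']. }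
 assert (HR : forall d c, DB t (Cdb K' (16 + d)) Y (rrW P HP eps W V c) (rrW P HP eps W' V' c)).
 { intros d c. assert (Q0 : DB t (Cdb K' (16 + d)) Y (@fcst a b 0) (fcst 0)) by (apply aC; rewrite Rabs_R0; lra).
  destruct c; cbn [rrW]; [| |exact Q0|exact Q0|exact Q0].
  - apply DB_scal; [easy|easy|easy|unfold K', zs; lra|]. apply DB_mul; [easy|easy|easy| |apply aV].
   apply DB_add; [easy|easy|easy| |]; (apply DB_scal; [easy|easy|easy| |]); [unfold K', zs; lra|apply aZ|unfold K', zs; lra|apply aZ]; unfold K', zs; lra.
  - apply DB_scal; [easy|easy|easy|unfold K', zs; lra|]. apply DB_mul; [easy|easy|easy|apply (Ha (7 + d)%nat)|].
   apply DB_mul; [easy|easy|easy|apply aZ; unfold K', zs; lra|]. apply DB_mul; [easy|easy|easy|apply aW'|apply aV]. }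
 assert (Hc : forall c, nrm2 t (Lsys h eps W (fun c => V c - V' c)%fld c) <= 4 * Cdb K' 30 * Y).
 { intros c. rewrite Lop_sub, S1. destruct (HL 14%nat c) as (_ & _ & L1). destruct (HR 14%nat c) as (_ & _ & L2).
  change (16 + 14)%nat with 30%nat in *. rewrite (S2 c) in L1.
  replace (rrW P HP eps W V c - Lsys h eps W V' c)%fld
   with ((rrW P HP eps W V c - rrW P HP eps W' V' c) - (Lsys h eps W V' c - rrW P HP eps W' V' c))%fld by fring.
  etr; [now apply nrm2_sub|]. lra. }
 unfold nS, sumc. have C1 := Hc cQ. have C2 := Hc cH. have C3 := Hc cV1. have C4 := Hc cV2. have C5 := Hc cW. lra.
Qed.

End Difference.

Lemma sumc_scal k F : sumc (fun c => k * F c) = k * sumc F.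
Proof. unfold sumc. ring. Qed.

Lemma E0_lower {a b} (m : cmp -> fld a b) t V k : oi a b t -> (forall c x y z, k <= m c t x y z) -> k * nS t V <= E0 m t V.
Proof.
 intros Ht H. unfold nS, E0. rewrite <- sumc_scal. apply sumc_le. intros c.
 Transparent nrm2. unfold nrm2. Opaque nrm2. rewrite <- Iint_scal by easy. apply Iint_le; [easy|].
 intros x y z. fat. have Q := H c x y z. nra.
Qed.

Lemma E0_upper {a b} (m : cmp -> fld a b) t V k : oi a b t -> (forall c x y z, m c t x y z <= k) -> E0 m t V <= k * nS t V.
Proof.
 intros Ht H. unfold nS, E0. rewrite <- sumc_scal. apply sumc_le. intros c.
 Transparent nrm2. unfold nrm2. Opaque nrm2. rewrite <- Iint_scal by easy. apply Iint_le; [easy|].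
 intros x y z. fat. have Q := H c x y z. nra.
Qed.

Lemma Ek_lower {a b} e n (m : cmp -> fld a b) t V k : oi a b t -> (forall c x y z, k <= m c t x y z) -> k * NS e n t V <= Ek e n m t V.
Proof.
 intros Ht H. rewrite NS_SW, <- SW_scal. unfold Ek. apply SW_le. intros l _. now apply E0_lower.
Qed.

Lemma Ek_upper {a b} e n (m : cmp -> fld a b) t V k : oi a b t -> (forall c x y z, m c t x y z <= k) -> Ek e n m t V <= k * NS e n t V.
Proof.
 intros Ht H. rewrite NS_SW, <- SW_scal. unfold Ek. apply SW_le. intros l _. now apply E0_upper.
Qed.

Lemma nS_small_eq {a b} t (V V' : cmp -> fld a b) : oi a b t -> nS t (fun c => V c - V' c)%fld <= 0 ->
 forall c x y z, V c t x y z = V' c t x y z.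
Proof.
 intros Ht H c x y z. assert (Q : nrm2 t (V c - V' c)%fld <= 0).
 { etr; [|exact H]. apply (sumc_term (fun c => nrm2 t (V c - V' c)%fld)). intros; now apply nrm2_nonneg. }
 have Q' := nrm2_zero t _ Ht Q x y z. rewrite fsub_at in Q'. lra.
Qed.

Lemma E0_diff_zero {a b} (m V V' : cmp -> fld a b) t : oi a b t -> (forall c x y z, V c t x y z = V' c t x y z) ->
 E0 m t (fun c => V c - V' c)%fld = 0.
Proof.
 intros Ht H. unfold E0. rewrite (sumc_ext _ (fun _ => 0)); [unfold sumc; ring|]. intros c. rewrite <- (Iint_cst (a:=a) (b:=b) t 0 Ht).
 Transparent Iint. unfold Iint. Opaque Iint. f_equal. ext3 x y z. fat. rewrite H. ring.
Qed.

Lemma is_derive_affine (f : R -> R) l t0 sg r : is_derive f (t0 + sg * r) l -> is_derive (fun r => f (t0 + sg * r)) r (sg * l).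
Proof.
 intros H. apply (is_derive_comp f (fun r => t0 + sg * r) r l sg); [exact H|]. auto_derive; [easy|ring].
Qed.

Section Difference.
Context (P : params) (HP : admissible P).
Local Notation thw := (thW P HP). Local Notation aw := (aW P HP). Local Notation mw := (mW P HP).

(** Lower bound of the weights [calA], [calB a] and [a theta] when [a] and [theta] are at least
    [kap]. *)
Definition cmin (kap : R) : R := Rmin (calA P) (Rmin (calB P * kap) (kap * kap)).

Lemma cmin_pos kap : 0 < kap -> 0 < cmin kap.
Proof.
 intros H. have Q := calA_pos P HP. have Q2 := calB_pos P HP. unfold cmin.
 repeat apply Rmin_glb_lt; [easy|now apply Rmult_lt_0_compat|now apply Rmult_lt_0_compat].
Qed.

Lemma mW_lower {a b} eps (W : cmp -> fld a b) t kap : oi a b t -> 0 < kap ->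
 (forall x y z, kap <= aw eps W t x y z) -> (forall x y z, kap <= thw eps W t x y z) ->
 forall c x y z, cmin kap <= mw eps W c t x y z.
Proof.
 intros Ht Hk Ha Hth c x y z. have Q1 := Rmin_l (calA P) (Rmin (calB P * kap) (kap * kap)).
 have Q2 := Rmin_r (calA P) (Rmin (calB P * kap) (kap * kap)). have Q3 := Rmin_l (calB P * kap) (kap * kap).
 have Q4 := Rmin_r (calB P * kap) (kap * kap). fold (cmin kap) in *. have HB := calB_pos P HP.
 have A1 := Ha x y z. have A2 := Hth x y z.
 assert (M : cmin kap <= (aw eps W * thw eps W)%fld t x y z) by (rewrite fmul_at; nra).
 destruct c; cbn [mW]; [rewrite fcst_at by easy; lra|rewrite fscal_at; nra|exact M|exact M|exact M].
Qed.

(** Serves both uniqueness, with [W = V], [W' = V'] and no mesh, and the contraction of the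
    iteration, where [W] and [V'] are the same iterate and [Y] contains the consistency error. The
    constant sees norms of order 3 only. *)
Lemma diff_energy eps M K1 : 0 < eps < 1 -> 0 <= M -> 0 <= K1 -> exists C, 0 <= C /\
 forall a b h h' (W V W' V' : cmp -> fld a b) t Y, oi a b t -> 0 <= h -> 0 <= h' -> 0 <= Y ->
 (forall c, Nk 0 3 t (W c) <= M /\ Nk 0 3 t (V c) <= M /\ Nk 0 3 t (W' c) <= M /\ Nk 0 3 t (V' c) <= M) ->
 (forall c x y z, Rabs (fder None (W c) t x y z) <= K1) -> (forall c x y z, Rabs (fder None (V' c) t x y z) <= K1) ->
 nS t (fun c => W c - W' c)%fld <= Y -> (forall c i, nrm2 t (Dh h i (V' c) - Dh h' i (V' c))%fld <= Y) ->
 SYM P HP h eps W V -> SYM P HP h' eps W' V' ->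
 exists dE, is_derive (fun s => E0 (mw eps W) s (fun c => V c - V' c)%fld) t dE /\
  Rabs dE <= C * (nS t (fun c => V c - V' c)%fld + Y).
Proof.
 intros He HM HK1.
 destruct (coef_TB P HP 3 (M + 1) (le_n 3)) as [D [PD HD]].
 set (K := K1 + sq (M + 1)).
 assert (sqp : forall x, 0 <= sq x) by (intros; apply sqrt_pos). have S1 := sqp (M + 1). have S2 := sqp D.
 destruct (diff_source P HP eps K) as [C1 [PC1 HC1]].
 destruct (mW_dt_sup P HP (sq D) K1 eps) as [K0 [PK0 HK0]]; [easy|easy|easy|].
 set (KK := K0 + sq D).
 exists (13 * KK + 1 + C1). split; [unfold KK; lra|].
 intros a b h h' W V W' V' t Y Ht Hh Hh' HY HN HWt HVt HWW HDD HS HS'.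
 assert (TBs : forall f : fld a b, Nk 0 3 t f <= M -> TB 0 3 t (M + 1) M f) by (intros f Hf; now apply TB_of_N).
 assert (HWb : Wb 0 3 t (M + 1) M W) by (intros c; apply TBs, HN).
 destruct (HD a b 0 t M eps W He Ht HM HWb) as (Tp & _ & Ta & Tth & _ & TG & _ & Tal).
 assert (sup : forall f : fld a b, Nk 0 3 t f <= M -> forall x y z, Rabs (f t x y z) <= K).
 { intros f Hf x y z. have Q := TB_sup 0 3 t M (M + 1) f Ht (TBs f Hf) x y z. unfold K. lra. }
 destruct (HK0 a b W t Ht HWt (TB_sup _ _ _ _ _ _ Ht Ta) (TB_sup _ _ _ _ _ _ Ht Tth) (TB_sup _ _ _ _ _ _ Ht TG)) as (_ & _ & Hm).
 destruct (energy_base h (mw eps W) (alW P HP eps W) (bbW P HP eps W) (ssW P HP eps W) (fun c => V c - V' c)%fld t KK) as [dE [Ed Eb]]; [easy|easy| | | |].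
 - intros c x y z. etr; [apply Hm|unfold KK; lra].
 - intros c i x y z. etr; [|unfold KK; apply Rplus_le_compat_r, PK0]. rewrite Rplus_0_l.
  exact (TB_der_sup 0 3 t M D (Some i) _ (le_n 3) Ht (Tal c i) x y z).
 - intros i x y z. etr; [|unfold KK; apply Rplus_le_compat_r, PK0]. rewrite Rplus_0_l.
  unfold bbW. rewrite fder_add, fder_cst, fadd_at, fcst_at, Rplus_0_l by easy.
  exact (TB_der_sup 0 3 t M D (Some i) _ (le_n 3) Ht Tp x y z).
 - exists dE. split; [exact Ed|]. set (n := nS t (fun c => V c - V' c)%fld) in *.
  assert (Pn : 0 <= n) by now apply nS_nonneg.
  assert (T : forall (A B : cmp -> fld a b) c, nrm2 t (A c - B c)%fld <= nS t (fun c => A c - B c)%fld).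
  { intros A B c. apply (sumc_term (fun c => nrm2 t (A c - B c)%fld)). intros; now apply nrm2_nonneg. }
  have Q := HC1 a b h h' W V W' V' t (n + Y) Ht ltac:(lra).
  assert (Q' : nS t (Lop h (mw eps W) (alW P HP eps W) (bbW P HP eps W) (ssW P HP eps W) (fun c => V c - V' c)%fld) <= C1 * (n + Y)).
  { apply Q; clear Q.
   - intros c x y z. destruct (HN c) as (N1 & N2 & N3 & N4). repeat split; now apply sup.
   - intros c x y z. etr; [apply HVt|unfold K; lra].
   - intros c i x y z. destruct (HN c) as (N1 & N2 & N3 & N4).
    have Q := TB_der_sup 0 3 t M (M + 1) (Some i) _ (le_n 3) Ht (TBs _ N4) x y z. rewrite Zd_Some in Q. unfold K. lra.
   - intros c. have Q := T W W' c. lra.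
   - intros c. have Q := T V V' c. fold n in Q. lra.
   - intros c i. have Q := HDD c i. lra.
   - easy.
   - easy. }
  assert (PKK : 0 <= (13 * KK + 1) * Y) by (apply Rmult_le_pos; [unfold KK; lra|easy]). lra.
Qed.

(** The derivative of the energy of the difference is bounded by a multiple of that energy, which
    vanishes at [t0]. The sign [sg] runs Gronwall in both time directions, so that the fields agree
    on the whole open interval. *)
Lemma uniqueness {a b} eps kap (V V' : cmp -> fld a b) t0 : 0 < eps < 1 -> 0 < kap -> oi a b t0 ->
 ge0 kap (aw eps V) -> ge0 kap (thw eps V) -> ge0 kap (thw eps V') ->
 (forall c, fder None (V c) = Lam P HP 0 eps V V c) -> (forall c, fder None (V' c) = Lam P HP 0 eps V' V' c) ->
 (forall c x y z, V c t0 x y z = V' c t0 x y z) ->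
 forall c, V c = V' c.
Proof.
 intros He Hk Ht0 Ha Hth Hth' HV HV' H0.
 have SV := Lam_SYM P HP 0 eps V V kap (proj1 He) Hk Hth HV.
 have SV' := Lam_SYM P HP 0 eps V' V' kap (proj1 He) Hk Hth' HV'.
 assert (W : forall sg T, Rabs sg = 1 -> (forall r, 0 <= r <= T -> oi a b (t0 + sg * r)) ->
  forall r, 0 <= r < T -> nS (t0 + sg * r) (fun c => V c - V' c)%fld <= 0).
 { intros sg T Hsg HT.
  destruct (Rlt_dec 0 T) as [PT|PT]; [|intros; lra].
  set (t1 := Rmin t0 (t0 + sg * T)). set (t2 := Rmax t0 (t0 + sg * T)).
  have IT := HT T ltac:(lra).
  assert (I1 : oi a b t1) by (unfold t1, Rmin; destruct Rle_dec; easy).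
  assert (I2 : oi a b t2) by (unfold t2, Rmax; destruct Rle_dec; easy).
  assert (It : forall r, 0 <= r < T -> t1 <= t0 + sg * r <= t2).
  { intros r Hr. unfold t1, t2, Rmin, Rmax. destruct Rle_dec; split; unfold Rabs in Hsg; destruct Rcase_abs in Hsg; nra. }
  assert (BN : forall f : fld a b, exists K, 0 <= K /\ forall t, t1 <= t <= t2 -> Nk 0 3 t f <= K /\ forall x y z, Rabs (fder None f t x y z) <= K).
  { intros f. destruct (N_local 0 3 t1 t2 f I1 I2) as [A [PA HA]]. destruct (SB_local 0 0 t1 t2 (fder None f) I1 I2) as [B [PB HB]].
   exists (A + B). split; [lra|]. intros t Ht. split; [have Q := HA t Ht; lra|]. intros x y z.
   have Q := HB t Ht nil (le_n 0) x y z. change (Zw 0 nil (fder None f)) with (fder None f) in Q. lra. }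
  assert (BS : exists K, 0 <= K /\ forall t, t1 <= t <= t2 -> forall c,
   (Nk 0 3 t (V c) <= K /\ forall x y z, Rabs (fder None (V c) t x y z) <= K) /\ (Nk 0 3 t (V' c) <= K /\ forall x y z, Rabs (fder None (V' c) t x y z) <= K)).
  { set (B := fun f => proj1_sig (cid _ (BN f))).
   have HB := fun f => proj2_sig (cid _ (BN f)). cbv beta in HB. change (forall f, 0 <= B f /\ forall t, t1 <= t <= t2 -> Nk 0 3 t f <= B f /\ forall x y z, Rabs (fder None f t x y z) <= B f) in HB.
   exists (sumc (fun c => B (V c)) + sumc (fun c => B (V' c))).
   assert (P1 : forall c, B (V c) <= sumc (fun c => B (V c))) by (intros; apply (sumc_term (fun c => B (V c))); intros; apply HB).
   assert (P2 : forall c, B (V' c) <= sumc (fun c => B (V' c))) by (intros; apply (sumc_term (fun c => B (V' c))); intros; apply HB).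
   have P3 := proj1 (HB (V cQ)). have P4 := P1 cQ. have P5 := proj1 (HB (V' cQ)). have P6 := P2 cQ.
   split; [lra|]. intros t Ht c. have Q1 := P1 c. have Q2 := P2 c.
   destruct (proj2 (HB (V c)) t Ht) as [A1 A2]. destruct (proj2 (HB (V' c)) t Ht) as [A3 A4].
   split; (split; [lra|]); intros x y z; [have Q := A2 x y z|have Q := A4 x y z]; lra. }
  destruct BS as [K [PK HK]].
  destruct (diff_energy eps K K He PK PK) as [C [PC HC]].
  set (E := fun s => E0 (mw eps V) s (fun c => V c - V' c)%fld).
  have Kc := cmin_pos kap Hk.
  assert (Lo : forall t, oi a b t -> cmin kap * nS t (fun c => V c - V' c)%fld <= E t).
  { intros t Ht. apply (E0_lower (mw eps V) t (fun c => V c - V' c)%fld (cmin kap) Ht). apply mW_lower; [easy|easy|intros; now apply Ha|intros; now apply Hth]. }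
  have G := gronwall_zero (fun r => E (t0 + sg * r)) (fun r => sg * Derive E (t0 + sg * r)) T (2 * C / cmin kap) 0.
  assert (PC2 : 0 <= 2 * C / cmin kap) by (apply Rmult_le_pos; [lra|left; now apply Rinv_0_lt_compat]).
  assert (DE : forall r, 0 <= r < T -> ex_derive E (t0 + sg * r) /\ Rabs (Derive E (t0 + sg * r)) <= C * (2 * nS (t0 + sg * r) (fun c => V c - V' c)%fld)).
  { intros r Hr. set (t := t0 + sg * r). assert (Ht : oi a b t) by (apply HT; lra).
   destruct (HC a b 0 0 V V V' V' t (nS t (fun c => V c - V' c)%fld) Ht) as [dE [E1 E2]]; try lra; try easy.
   - now apply nS_nonneg.
   - intros c. destruct (HK t (It r Hr) c) as [[? ?] [? ?]]. repeat split; easy.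
   - intros c. apply (HK t (It r Hr) c).
   - intros c. apply (HK t (It r Hr) c).
   - intros c i. replace (Dh 0 i (V' c) - Dh 0 i (V' c))%fld with (@fcst a b 0) by fring. rewrite nrm2_cst0 by easy. now apply nS_nonneg.
   - split; [now exists dE|]. rewrite (is_derive_unique _ _ _ E1 : Derive E t = dE). etr; [exact E2|]. apply Req_le. ring. }
  intros r Hr. have Q := Lo (t0 + sg * r) (HT r ltac:(lra)).
  assert (Er : E (t0 + sg * r) <= 0).
  { etr; [apply (G PC2)|rewrite Rmult_0_l; lra]; [| | |exact Hr].
   - intros r' Hr'. apply is_derive_affine, Derive_correct, DE, Hr'.
   - rewrite Rmult_0_r, Rplus_0_r. apply Req_le. now apply E0_diff_zero.
   - intros r' Hr'. destruct (DE r' Hr') as [_ Q']. have L := Lo (t0 + sg * r') (HT r' ltac:(lra)).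
    etr; [apply Rle_abs|]. rewrite Rabs_mult, Hsg, Rmult_1_l. etr; [exact Q'|].
    apply Rmult_le_reg_r with (cmin kap); [easy|].
    replace (2 * C / cmin kap * (E (t0 + sg * r') + 0) * cmin kap) with (2 * C * E (t0 + sg * r')) by (field; lra).
    replace (C * (2 * nS (t0 + sg * r') (fun c => V c - V' c)%fld) * cmin kap) with (2 * C * (cmin kap * nS (t0 + sg * r') (fun c => V c - V' c)%fld)) by ring.
    apply Rmult_le_compat_l; lra. }
  nra. }
 intros c. apply fld_eq. intros t x y z Ht. apply nS_small_eq; [easy|].
 destruct (Rle_dec t0 t) as [Hle|Hle].
 - set (T := (t - t0) + (b - t) / 2). unfold oi in Ht, Ht0.
  have Q := W 1 T Rabs_R1. replace t with (t0 + 1 * (t - t0)) by ring. apply Q; [|unfold T; lra].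
  intros r Hr. unfold oi, T in *. lra.
 - set (T := (t0 - t) + (t - a) / 2). unfold oi in Ht, Ht0.
  have Q := W (-1) T ltac:(rewrite Rabs_left; lra). replace t with (t0 + -1 * (t0 - t)) by ring. apply Q; [|unfold T; lra].
  intros r Hr. unfold oi, T in *. lra.
Qed.

End Difference.

(** * Data on a time slice and the invariant of the iteration *)

Lemma Sm_freeze I J f t0 : open I -> Sm J f -> J t0 -> Sm I (fun _ => f t0).
Proof.
 intros HI Hf H0 n. revert f Hf; induction n; intros f Hf.
 - split; [|easy]. intros. apply c4_slice, (Sm_c4 J); easy.
 - apply (Cn_step n I _ (fun d => match d with Some c => fun _ => pdt (Some c) f t0 | None => fun _ _ _ _ => 0 end)); [easy| | |].
  + intros. apply c4_slice, (Sm_c4 J); easy.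
  + intros d t x y z Ht. destruct d as [c|].
   * apply (Sm_is J f (Some c) Hf t0 x y z H0).
   * apply (is_derive_const (K:=RA) (V:=RN)).
  + intros d. destruct d; [apply IHn, Sm_pdt, Hf|now apply Cn_const].
Qed.

Definition frz {a b} (a' b' : R) (f : fld a b) (t0 : R) (H : oi a b t0) : fld a' b' :=
 mkfld a' b' (fun _ => f t0) (Sm_freeze _ _ f t0 (open_oi a' b') (fv_sm f) H) (fun _ _ => fv_per f t0 H).

Lemma frz_at {a b} a' b' (f : fld a b) t0 H t x y z : oi a' b' t -> frz a' b' f t0 H t x y z = f t0 x y z.
Proof. intros Ht. unfold frz. now rewrite mkfld_at. Qed.

Lemma frz_None {a b} a' b' (f : fld a b) t0 H : fder None (frz a' b' f t0 H) = fcst 0.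
Proof.
 apply fder_unique. intros t x y z Ht. rewrite fcst_at by easy. unfold frz.
 apply (is_pdt_ext (oi a' b') None (fun _ => f t0)); [apply open_oi|easy|intros; now rewrite mkfld_at|].
 apply (is_derive_const (K:=RA) (V:=RN)).
Qed.

(** With [e = 0] words see only one time slice; norms of fields living on different time intervals
    can thus be compared. *)
Lemma Zw0_slice {a b a' b'} (f : fld a b) (g : fld a' b') t t' l : oi a b t -> oi a' b' t' ->
 (forall x y z, f t x y z = g t' x y z) -> forall x y z, Zw 0 l f t x y z = Zw 0 l g t' x y z.
Proof.
 intros Ht Ht' H. induction l as [|d l IH]; [exact H|].
 intros x y z. rewrite !Zw_cons. destruct d as [c|].
 - rewrite !Zd_Some, <- !fld_pd by easy. replace (Zw 0 l g t') with (Zw 0 l f t); [easy|].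
  ext3 u v w; apply IH.
 - rewrite !Zd0_None, !fcst_at by easy. reflexivity.
Qed.

Lemma N0_slice {a b a' b'} (f : fld a b) (g : fld a' b') t t' k : oi a b t -> oi a' b' t' ->
 (forall x y z, f t x y z = g t' x y z) -> Nk 0 k t f = Nk 0 k t' g.
Proof.
 intros Ht Ht' H. Transparent Nk. unfold Nk. Opaque Nk. apply SW_ext. intros l. rewrite !nrm2_I3. f_equal.
 ext3 x y z. now rewrite (Zw0_slice f g t t').
Qed.

Lemma NS0_slice {a b a' b'} (V : cmp -> fld a b) (V' : cmp -> fld a' b') t t' k : oi a b t -> oi a' b' t' ->
 (forall c x y z, V c t x y z = V' c t' x y z) -> NS 0 k t V = NS 0 k t' V'.
Proof. intros Ht Ht' H. apply sumc_ext. intros c. now apply N0_slice. Qed.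

Lemma Ek_ex_derive {a b} e k (m V : cmp -> fld a b) t : oi a b t -> ex_derive (fun s => Ek e k m s V) t.
Proof.
 intros Ht. eexists. unfold Ek. apply (SW_derive k (fun l s => E0 m s (fun c => Zw e l (V c))) (fun l s => Derive (fun r => E0 m r (fun c => Zw e l (V c))) s) t).
 intros l. apply Derive_correct. eexists. now apply energy_derive.
Qed.

Lemma two_sided (tau t0 : R) (Q : R -> Prop) :
 (forall sg, Rabs sg = 1 -> forall r, 0 <= r < tau -> Q (t0 + sg * r)) -> forall t, oi (t0 - tau) (t0 + tau) t -> Q t.
Proof.
 intros H t Ht. unfold oi in Ht. destruct (Rle_dec t0 t).
 - replace t with (t0 + 1 * (t - t0)) by ring. apply H; [apply Rabs_R1|lra].
 - replace t with (t0 + -1 * (t0 - t)) by ring. apply H; [rewrite Rabs_left; lra|lra].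
Qed.

Lemma oi_sided tau t0 sg r : Rabs sg = 1 -> 0 <= r < tau -> oi (t0 - tau) (t0 + tau) (t0 + sg * r).
Proof. intros Hs Hr. unfold oi. unfold Rabs in Hs. destruct Rcase_abs in Hs; split; nra. Qed.

Section LocalExistence.
Context (P : params) (HP : admissible P).
Local Notation thw := (thW P HP). Local Notation aw := (aW P HP). Local Notation mw := (mW P HP). Local Notation lam := (Lam P HP).

Lemma aW_at {a b} eps (W : cmp -> fld a b) t x y z : oi a b t ->
 aw eps W t x y z = 1 + eps * / varpi0 P * (W cQ t x y z - Phi P eps z).
Proof.
 intros Ht. unfold aW, pW, phiF, fIG, fIH, Phi. fat. rewrite !fzf_at by easy. ring.
Qed.

Lemma thW_at {a b} eps (W : cmp -> fld a b) t x y z : oi a b t ->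
 thw eps W t x y z = C0 P + Rpower eps (mu P) * Gt P z * Hbar P z + Rpower eps (mu P + nu P) * Gt P z * W cH t x y z.
Proof.
 intros Ht. unfold thW, xW, fGt, fHb. fat. rewrite !fzf_at by easy. rewrite Rpower_plus. ring.
Qed.

(** The properties that the iteration must preserve: order 3, first time derivative, and
    hyperbolicity. *)
Definition Good {a b} eps kap M K1 (V : cmp -> fld a b) : Prop :=
 (forall t c, oi a b t -> Nk 0 3 t (V c) <= M) /\ (forall t c x y z, oi a b t -> Rabs (fder None (V c) t x y z) <= K1) /\
 ge0 kap (aw eps V) /\ ge0 kap (thw eps V).

(** The constants are chosen in the order [M], [K1], [tau0]: [M] from the data and the coercivity of
    the weights, [K1] from [M] through the equation, and the lifespan from both. None depends on the
    mesh, on the data beyond [M0] and [kap], or on the place in the iteration. *)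
Lemma good_step M0 kap eps : 0 < eps < 1 -> 0 <= M0 -> 0 < kap -> exists M K1 tau0, M0 <= M /\ 0 <= K1 /\ 0 < tau0 /\
 forall tau t0 h (U0 W V : cmp -> fld (t0 - tau) (t0 + tau)), 0 < tau <= tau0 -> 0 <= h ->
 NS 0 3 t0 U0 <= M0 -> (forall x y z, kap <= aw eps U0 t0 x y z) -> (forall x y z, kap <= thw eps U0 t0 x y z) ->
 (forall c x y z, W c t0 x y z = U0 c t0 x y z) -> (forall c x y z, V c t0 x y z = U0 c t0 x y z) ->
 (forall c, fder None (V c) = lam h eps W V c) -> Good eps (kap / 2) M K1 W -> Good eps (kap / 2) M K1 V.
Proof.
 intros He HM0 Hk. assert (Hk2 : 0 < kap / 2) by lra.
 assert (sqp : forall x, 0 <= sq x) by (intros; apply sqrt_pos).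
 destruct (coef_TB P HP 3 (M0 + 1) (le_n 3)) as [D0 [PD0 HD0]].
 set (cm := cmin P (kap / 2)). assert (Pcm : 0 < cm) by now apply cmin_pos.
 (* The initial energy is at most [Cm M0] and controls [cm] times the norm; the 1 leaves room for
    the bootstrap. *)
 set (Cm := sq D0). set (M := Cm * M0 / cm + M0 + 1).
 assert (PCM : 0 <= Cm * M0 / cm) by (apply Rmult_le_pos; [apply Rmult_le_pos; [apply sqp|easy]|left; now apply Rinv_0_lt_compat]).
 assert (PM : 0 <= M) by (unfold M; lra).
 destruct (Lam_TB P HP 3 (M + 1) (kap / 2) eps (le_n 3) Hk2 He) as [CL [PCL HCL]].
 set (K1 := sq CL).
 destruct (coef_TB P HP 3 (M + 1) (le_n 3)) as [D [PD HD]].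
 destruct (mW_dt_sup P HP (sq D) K1 eps (sqp D) (sqp CL) He) as [K0 [PK0 HK0]].
 destruct (energy_spatial P HP 3 (M + 1) K1 (kap / 2) eps (le_n 3) ltac:(lra) (sqp CL) Hk2 He) as [CE [PCE HCE]].
 set (B := CE * (1 + M)). assert (PB : 0 <= B) by (apply Rmult_le_pos; lra).
 (* Up to [tau0] the coefficients lose at most [kap / 2] and the energy gains at most [cm / 2]. *)
 set (tau0 := Rmin (kap / 2 / (K0 + 1)) (cm / 2 / (B + 1))).
 assert (T1 : 0 < kap / 2 / (K0 + 1)) by (apply Rdiv_lt_0_compat; lra).
 assert (T2 : 0 < cm / 2 / (B + 1)) by (apply Rdiv_lt_0_compat; lra).
 exists M, K1, tau0. split; [unfold M; lra|]. split; [apply sqp|]. split; [now apply Rmin_glb_lt|].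
 intros tau t0 h U0 W V Htau Hh HU Hua Hut HW0 HV0 HV (WN & Wt & Wa & Wth).
 have Ta := Rmin_l (kap / 2 / (K0 + 1)) (cm / 2 / (B + 1)). have Tb := Rmin_r (kap / 2 / (K0 + 1)) (cm / 2 / (B + 1)). fold tau0 in Ta, Tb.
 set (a := t0 - tau) in *. set (b := t0 + tau) in *.
 assert (I0 : oi a b t0) by (unfold oi, a, b; lra).
 assert (TBs : forall t (f : fld a b), oi a b t -> Nk 0 3 t f <= M -> TB 0 3 t (M + 1) M f) by (intros t f Ht Hf; now apply TB_of_N).
 assert (Wb0 : forall t, oi a b t -> Wb 0 3 t (M + 1) M W) by (intros t Ht c; apply TBs; auto).
 set (E := fun s => Ek 0 3 (mw eps W) s V).
 assert (ED : forall t, oi a b t -> ex_derive E t) by (intros; now apply Ek_ex_derive).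
 assert (EB : forall t, oi a b t -> NS 0 3 t V <= M -> Rabs (Derive E t) <= B).
 { intros t Ht HN. assert (WbV : Wb 0 3 t (M + 1) M V) by (intros c; apply TBs; [easy|]; etr; [now apply (NS_term 0 3 t V c)|easy]).
  destruct (HCE a b h W V t M) as [dE [D1 D2]]; [easy|easy|lra|now apply Wb0|easy|intros; now apply Wt|easy|easy|].
  rewrite (is_derive_unique _ _ _ D1 : Derive E t = dE). exact D2. }
 assert (Elo : forall t, oi a b t -> cm * NS 0 3 t V <= E t).
 { intros t Ht. apply (Ek_lower 0 3 (mw eps W) t V cm Ht). apply mW_lower; [easy|easy|intros; now apply Wa|intros; now apply Wth]. }
 assert (EU : E t0 <= Cm * M0).
 { assert (NW : Wb 0 3 t0 (M0 + 1) M0 W).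
  { intros c. assert (Q : Nk 0 3 t0 (W c) <= M0) by (rewrite (N0_slice (W c) (U0 c) t0 t0) by auto; etr; [now apply (NS_term 0 3 t0 U0 c)|easy]).
   now apply TB_of_N. }
  destruct (HD0 a b 0 t0 M0 eps W He I0 HM0 NW) as (_ & _ & _ & _ & _ & _ & Tm & _).
  apply Rle_trans with (Cm * NS 0 3 t0 V).
  - apply (Ek_upper 0 3 (mw eps W) t0 V Cm I0). intros c x y z. etr; [apply Rle_abs|]. exact (TB_sup 0 3 t0 M0 D0 _ I0 (Tm c) x y z).
  - apply Rmult_le_compat_l; [apply sqp|]. now rewrite (NS0_slice V U0 t0 t0). }
 assert (HN : forall t, oi a b t -> NS 0 3 t V <= M - 1 / 2).
 { apply two_sided. intros sg Hsg.
  apply (bootstrap (fun r => NS 0 3 (t0 + sg * r) V) tau M (M - 1 / 2)); [lra| |].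
  - intros r Hr. apply (continuous_comp (fun r => t0 + sg * r) (fun s => NS 0 3 s V)).
   + apply continuous_of_ex_derive. auto_derive. easy.
   + apply NS_continuous. now apply oi_sided.
  - intros r Hr Hprev. have Ir := oi_sided tau t0 sg r Hsg Hr. have Q := Elo _ Ir.
   assert (ER : E (t0 + sg * r) <= Cm * M0 + B * tau).
   { destruct (Req_dec r 0) as [->|Hr0]; [rewrite Rmult_0_r, Rplus_0_r; assert (0 <= B * tau) by (apply Rmult_le_pos; lra); lra|].
    destruct (MVT_cor2 (fun s => E (t0 + sg * s)) (fun s => sg * Derive E (t0 + sg * s)) 0 r) as [s [Es Hs]]; [lra| |].
    - intros s Hs. apply is_derive_Reals, is_derive_affine, Derive_correct, ED, oi_sided; [easy|lra].
    - rewrite Rmult_0_r, Rplus_0_r in Es.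
     have Q1 := EB (t0 + sg * s) (oi_sided tau t0 sg s Hsg ltac:(lra)) (Hprev s ltac:(lra)).
     assert (Q2 : sg * Derive E (t0 + sg * s) <= B) by (etr; [apply Rle_abs|]; rewrite Rabs_mult, Hsg, Rmult_1_l; exact Q1).
     assert (Q3 : sg * Derive E (t0 + sg * s) * (r - 0) <= B * tau) by (etr; [apply Rmult_le_compat_r; [lra|exact Q2]|apply Rmult_le_compat_l; lra]). lra. }
   assert (Bt : B * tau <= cm / 2).
   { assert (Q1 : (B + 1) * (cm / 2 / (B + 1)) = cm / 2) by (field; lra). assert (Q2 : B * tau <= (B + 1) * (cm / 2 / (B + 1))) by (apply Rmult_le_compat; lra). lra. }
   apply Rmult_le_reg_l with cm; [easy|]. unfold M. replace (cm * (Cm * M0 / cm + M0 + 1 - 1 / 2)) with (Cm * M0 + cm * M0 + cm / 2) by (field; lra).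
   assert (0 <= cm * M0) by (apply Rmult_le_pos; lra). lra. }
 assert (VN : forall t c, oi a b t -> Nk 0 3 t (V c) <= M).
 { intros t c Ht. have Q1 := NS_term 0 3 t V c Ht. have Q2 := HN t Ht. lra. }
 assert (WbV : forall t, oi a b t -> Wb 0 3 t (M + 1) M V) by (intros t Ht c; apply TBs; auto).
 assert (Vt : forall t c x y z, oi a b t -> Rabs (fder None (V c) t x y z) <= K1).
 { intros t c x y z Ht. rewrite HV. unfold K1. apply (TB1_sup 0 3 t M CL _ Ht).
  apply (HCL a b 0 h t M W V Ht Hh PM (Wb0 t Ht) (WbV t Ht) Wth c). }
 assert (Dd : forall t, oi a b t -> (forall x y z, Rabs (fder None (aw eps V) t x y z) <= K0) /\ (forall x y z, Rabs (fder None (thw eps V) t x y z) <= K0)).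
 { intros t Ht. destruct (HD a b 0 t M eps V He Ht PM (WbV t Ht)) as (_ & _ & Ta' & Tth & _ & TG & _).
  destruct (HK0 a b V t Ht) as (Q1 & Q2 & _); [intros; now apply Vt|exact (TB_sup 0 3 t M D _ Ht Ta')|exact (TB_sup 0 3 t M D _ Ht Tth)|exact (TB_sup 0 3 t M D _ Ht TG)|easy]. }
 assert (Kt : K0 * tau <= kap / 2).
 { assert (Q1 : (K0 + 1) * (kap / 2 / (K0 + 1)) = kap / 2) by (field; lra). assert (Q2 : K0 * tau <= (K0 + 1) * (kap / 2 / (K0 + 1))) by (apply Rmult_le_compat; lra). lra. }
 assert (GE : forall f : fld a b, (forall t, oi a b t -> forall x y z, Rabs (fder None f t x y z) <= K0) -> (forall x y z, kap <= f t0 x y z) -> ge0 (kap / 2) f).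
 { intros f Hf H0 t x y z Ht.
  assert (Q : Rabs (f t x y z - f t0 x y z) <= K0 * Rabs (t - t0)).
  { apply (MVT_Rabs_le (fun s => f s x y z) (fun s => fder None f s x y z) t0 t K0).
   - intros s Hs. apply (fld_is None f s x y z). apply (oi_conv a b t0 t); try easy; lra.
   - intros s Hs. apply continuous_of_ex_derive. eexists. apply (fld_is None f s x y z). apply (oi_conv a b t0 t); easy.
   - intros s Hs. apply Hf. apply (oi_conv a b t0 t); try easy; lra. }
  assert (Rabs (t - t0) <= tau) by (apply Rabs_le; unfold oi, a, b in Ht; lra).
  assert (K0 * Rabs (t - t0) <= K0 * tau) by (apply Rmult_le_compat_l; lra).
  apply Rabs_le_between in Q. have Q1 := H0 x y z. lra. }
 split; [exact VN|]. split; [exact Vt|]. split; apply GE.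
 - intros t Ht; exact (proj1 (Dd t Ht)).
 - intros x y z. rewrite aW_at by easy. rewrite HV0, <- aW_at by easy. apply Hua.
 - intros t Ht; exact (proj2 (Dd t Ht)).
 - intros x y z. rewrite thW_at by easy. rewrite HV0, <- thW_at by easy. apply Hut.
Qed.

End LocalExistence.

Lemma exp_small C : 0 <= C -> exists d, 0 < d /\ exp (C * d) <= 9 / 8.
Proof.
 intros HC. set (d := ln (9 / 8) / (C + 1)).
 assert (L : 0 < ln (9 / 8)) by (rewrite <- ln_1; apply ln_increasing; lra).
 exists d. split; [apply Rdiv_lt_0_compat; lra|]. apply Rle_trans with (exp (ln (9 / 8))); [|rewrite exp_ln; lra]. apply exp_le.
 assert (Q : (C + 1) * d = ln (9 / 8)) by (unfold d; field; lra). assert (0 < d) by (apply Rdiv_lt_0_compat; lra). lra.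
Qed.

Lemma NS_N {a b} e k t K (V : cmp -> fld a b) : (forall c, Nk e k t (V c) <= K) -> NS e k t V <= 5 * K.
Proof. intros H. unfold NS. etr; [apply sumc_le; exact H|]. unfold sumc. lra. Qed.

(** * Local existence and uniqueness *)

Section Iteration.
Context (P : params) (HP : admissible P).
Local Notation mw := (mW P HP). Local Notation lam := (Lam P HP).

(** The mesh at step [n] is [2^-n]: consistency errors are then of size [4^-n] in the squared norm,
    the rate at which the iteration contracts. *)
Record Iter (eps kap M K1 tau t0 : R) (V : nat -> cmp -> fld (t0 - tau) (t0 + tau)) : Prop := {
 it_0 : forall c, fder None (V 0%nat c) = fcst 0;
 it_const : forall c t x y z, oi (t0 - tau) (t0 + tau) t -> V 0%nat c t x y z = V 0%nat c t0 x y z;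
 it_S : forall n c, fder None (V (S n) c) = lam ((/ 2) ^ n) eps (V n) (V (S n)) c;
 it_init : forall n c x y z, V n c t0 x y z = V 0%nat c t0 x y z;
 it_good : forall n, Good P HP eps kap M K1 (V n) }.

Arguments it_0 {_ _ _ _ _ _ _}. Arguments it_const {_ _ _ _ _ _ _}. Arguments it_S {_ _ _ _ _ _ _}.
Arguments it_init {_ _ _ _ _ _ _}. Arguments it_good {_ _ _ _ _ _ _}.

Lemma it_exists eps kap M K1 tau t0 (U0 : cmp -> fld (t0 - tau) (t0 + tau)) : 0 < tau ->
 (forall c, fder None (U0 c) = fcst 0) -> (forall c t x y z, oi (t0 - tau) (t0 + tau) t -> U0 c t x y z = U0 c t0 x y z) ->
 Good P HP eps kap M K1 U0 ->
 (forall h (W V : cmp -> fld (t0 - tau) (t0 + tau)), 0 <= h -> (forall c x y z, W c t0 x y z = U0 c t0 x y z) -> (forall c x y z, V c t0 x y z = U0 c t0 x y z) ->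
  (forall c, fder None (V c) = lam h eps W V c) -> Good P HP eps kap M K1 W -> Good P HP eps kap M K1 V) ->
 exists V, V 0%nat = U0 /\ Iter eps kap M K1 tau t0 V.
Proof.
 intros Ht HU HUc HG Hstep. assert (I0 : oi (t0 - tau) (t0 + tau) t0) by (unfold oi; lra).
 assert (P2 : forall n, 0 < (/ 2) ^ n) by (intros; apply pow_lt; lra).
 set (step := fun n W => proj1_sig (cid _ (linear_solve P HP t0 I0 ((/ 2) ^ n) eps W U0 (P2 n) HU))).
 assert (Hs : forall n W, (forall c, fder None (step n W c) = lam ((/ 2) ^ n) eps W (step n W) c) /\ forall c x y z, step n W c t0 x y z = U0 c t0 x y z).
 { intros n W. exact (proj2_sig (cid _ (linear_solve P HP t0 I0 ((/ 2) ^ n) eps W U0 (P2 n) HU))). }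
 set (V := nat_rect (fun _ => cmp -> fld (t0 - tau) (t0 + tau)) U0 step).
 assert (Vi : forall n c x y z, V n c t0 x y z = U0 c t0 x y z) by (intros n; destruct n; [easy|apply (Hs n (V n))]).
 exists V. split; [easy|]. split; [easy|easy|intros n; apply (Hs n (V n))|exact Vi|].
 induction n; [easy|]. apply (Hstep ((/ 2) ^ n) (V n)); [have Q := P2 n; lra|apply Vi|apply Vi|apply (Hs n (V n))|easy].
Qed.

Section Bounds.
Context (eps kap M K1 : R) (He : 0 < eps < 1) (Hk : 0 < kap) (HM : 0 <= M) (HK1 : 0 <= K1).

Lemma it_sym tau t0 V n : Iter eps kap M K1 tau t0 V -> SYM P HP ((/ 2) ^ n) eps (V n) (V (S n)).
Proof. intros H. apply (Lam_SYM P HP _ eps (V n) (V (S n)) kap); [easy|easy|apply (it_good H n)|apply (it_S H)]. Qed.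

Lemma it_low tau t0 V n : Iter eps kap M K1 tau t0 V -> forall t c x y z, oi (t0 - tau) (t0 + tau) t ->
 cmin P kap <= mw eps (V n) c t x y z.
Proof.
 intros H t c x y z Ht. destruct (it_good H n) as (_ & _ & Ha & Hth).
 apply mW_lower; [easy|easy|intros; now apply Ha|intros; now apply Hth].
Qed.

(** Beyond order 3 the estimate is linear in the top-order norms of two consecutive iterates, so one
    exponential bounds all iterates by [gronwall_chain]. The interval does not shrink as [k]
    grows. *)
Lemma it_high tau t0 V : 0 < tau -> Iter eps kap M K1 tau t0 V -> forall k, exists K, 0 <= K /\
 forall n t, oi (t0 - tau) (t0 + tau) t -> NS 0 k t (V n) <= K.
Proof.
 intros Htau H. set (a := t0 - tau) in *. set (b := t0 + tau) in *. assert (I0 : oi a b t0) by (unfold oi, a, b; lra).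
 assert (B3 : forall k, (k <= 3)%nat -> exists K, 0 <= K /\ forall n t, oi a b t -> NS 0 k t (V n) <= K).
 { intros k Hk3. exists (5 * M). split; [lra|]. intros n t Ht. apply NS_N. intros c.
  etr; [now apply (N_mono 0 k 3)|]. apply (it_good H n). exact Ht. }
 assert (P2 : forall n, 0 < (/ 2) ^ n) by (intros; apply pow_lt; lra).
 intros k. induction k as [|k [K' [PK' IH]]]; [apply B3; lia|].
 destruct (le_dec (S k) 3) as [Hk3|Hk3]; [now apply B3|].
 assert (Epk : pk (S k) = k) by (unfold pk; lia).
 destruct (energy_spatial P HP (S k) (K' + 1) K1 kap eps) as [C [PC HC]]; [lia|lra|easy|easy|easy|].
 destruct (coef_TB P HP 3 (M + 1) (le_n 3)) as [D [PD HD]].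
 set (c := cmin P kap). assert (Pc : 0 < c) by now apply cmin_pos.
 set (n0 := NS 0 (S k) t0 (V 0%nat)). assert (Pn0 : 0 <= n0) by now apply NS_nonneg.
 assert (PsD : 0 <= sq D) by apply sqrt_pos.
 assert (Pq : 0 <= sq D / c) by (apply Rmult_le_pos; [easy|left; now apply Rinv_0_lt_compat]).
 set (K := 1 + n0 + sq D / c * n0). assert (Pq2 : 0 <= sq D / c * n0) by now apply Rmult_le_pos.
 assert (HK : 1 <= K) by (unfold K; lra).
 set (L := 3 * C / c). assert (PL : 0 <= L) by (apply Rmult_le_pos; [lra|left; now apply Rinv_0_lt_compat]).
 assert (N0 : forall t, oi a b t -> NS 0 (S k) t (V 0%nat) = n0) by (intros t Ht; apply NS0_slice; [easy|easy|intros; now apply (it_const H)]).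
 assert (main : forall sg, Rabs sg = 1 -> forall n r, 0 <= r < tau -> NS 0 (S k) (t0 + sg * r) (V n) <= K * exp (L * r)).
 { intros sg Hsg. induction n; intros r Hr.
  - rewrite N0 by now apply oi_sided. assert (1 <= exp (L * r)) by (rewrite <- exp_0; apply exp_le, Rmult_le_pos; lra). unfold K in *. nra.
  - set (E := fun s => Ek 0 (S k) (mw eps (V n)) s (V (S n))).
   assert (Lo : forall t, oi a b t -> c * NS 0 (S k) t (V (S n)) <= E t).
   { intros t Ht. apply (Ek_lower 0 (S k) (mw eps (V n)) t (V (S n)) c Ht). intros; now apply (it_low tau t0 V n H). }
   assert (ER : E (t0 + sg * r) <= c * K * exp (3 * C / c * r)).
   { revert r Hr. apply (gronwall_chain (fun r => E (t0 + sg * r)) (fun r => sg * Derive E (t0 + sg * r)) tau C c K); [easy|easy|easy| | |].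
    - intros r Hr. apply is_derive_affine, Derive_correct, Ek_ex_derive. now apply oi_sided.
    - rewrite Rmult_0_r, Rplus_0_r. apply Rle_trans with (sq D * NS 0 (S k) t0 (V (S n))).
     + apply (Ek_upper 0 (S k) (mw eps (V n)) t0 (V (S n)) (sq D) I0). intros c' x y z. etr; [apply Rle_abs|].
      assert (W3 : Wb 0 3 t0 (M + 1) M (V n)) by (intros c''; apply TB_of_N; try easy; now apply (it_good H n)).
      destruct (HD a b 0 t0 M eps (V n) He I0 HM W3) as (_ & _ & _ & _ & _ & _ & Tm & _). exact (TB_sup 0 3 t0 M D _ I0 (Tm c') x y z).
     + rewrite (NS0_slice (V (S n)) (V 0%nat) t0 t0) by (try easy; intros; apply (it_init H)). fold n0.
      unfold K. replace (c * (1 + n0 + sq D / c * n0)) with (c * (1 + n0) + sq D * n0) by (field; lra).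
      assert (0 <= c * (1 + n0)) by (apply Rmult_le_pos; lra). lra.
    - intros r Hr. have Ir := oi_sided tau t0 sg r Hsg Hr. set (t := t0 + sg * r) in *.
     have Pn1 := NS_nonneg 0 (S k) t (V n) Ir. have Pn2 := NS_nonneg 0 (S k) t (V (S n)) Ir.
     set (X := NS 0 (S k) t (V n) + NS 0 (S k) t (V (S n))).
     assert (WB : forall m, NS 0 (S k) t (V m) <= X -> Wb 0 (S k) t (K' + 1) X (V m)).
     { intros m Hm c'. apply TB_of_N; [easy|easy|rewrite Epk|].
      - etr; [now apply (NS_term 0 k t (V m) c')|now apply IH].
      - etr; [now apply (NS_term 0 (S k) t (V m) c')|easy]. }
     destruct (HC a b ((/ 2) ^ n) (V n) (V (S n)) t X) as [dE [D1 D2]].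
     + easy.
     + have Q := P2 n; lra.
     + unfold X; lra.
     + apply WB; unfold X; lra.
     + apply WB; unfold X; lra.
     + intros c' x y z; exact (proj1 (proj2 (it_good H n)) t c' x y z Ir).
     + apply (it_good H n).
     + apply (it_S H).
     + rewrite (is_derive_unique _ _ _ D1 : Derive E t = dE). etr; [apply Rle_abs|]. rewrite Rabs_mult, Hsg, Rmult_1_l.
      etr; [exact D2|]. apply Rmult_le_compat_l; [easy|].
      have Q1 := IHn r Hr. fold t L in Q1. have Q2 := Lo t Ir.
      assert (Q3 : NS 0 (S k) t (V (S n)) <= E t / c) by (apply Rle_div_r; [easy|lra]). fold L. unfold X. lra. }
   have Q := Lo _ (oi_sided tau t0 sg r Hsg Hr). apply Rmult_le_reg_l with c; [easy|]. fold L in ER. lra. }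
 exists (K * exp (L * tau)). split; [apply Rmult_le_pos; [lra|left; apply exp_pos]|].
 intros n. apply two_sided. intros sg Hsg r Hr. etr; [now apply main|].
 apply Rmult_le_compat_l; [lra|]. apply exp_le, Rmult_le_compat_l; lra.
Qed.

(** The constant [Cg] limiting [tau] comes from [diff_energy] and hence from order 3 alone; the
    fourth-order norms, needed for the consistency of the differences, enter only the amplitude
    [A]. *)
Lemma it_contract : exists Cg, 0 <= Cg /\ forall tau t0 V, 0 < tau -> exp (Cg * tau) <= 9 / 8 -> Iter eps kap M K1 tau t0 V ->
 exists A, 0 <= A /\ forall n t, oi (t0 - tau) (t0 + tau) t -> nS t (fun c => V (S n) c - V n c)%fld <= A * (/ 4) ^ n.
Proof.
 destruct (diff_energy P HP eps M K1 He HM HK1) as [C [PC HC]].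
 set (c := cmin P kap). assert (Pc : 0 < c) by now apply cmin_pos.
 exists (C / c). split; [apply Rmult_le_pos; [easy|left; now apply Rinv_0_lt_compat]|].
 intros tau t0 V Htau Hexp H. set (a := t0 - tau) in *. set (b := t0 + tau) in *.
 destruct (it_high tau t0 V Htau H 4) as [K4 [PK4 HK4]].
 set (S4 := sq K4). assert (PS4 : 0 <= S4) by apply sqrt_pos.
 assert (P2 : forall n, 0 < (/ 2) ^ n) by (intros; apply pow_lt; lra).
 (* [20 M] covers the first increment, five components of at most [2 (M + M)] each. The other term
    dominates the consistency error, whose factor [9/4] is [(1 + 1/2)^2] for the meshes [2^-n] and
    [2^-(n+1)]. *)
 set (A := 20 * M + 9 * S4 ^ 2). exists A. assert (PA : 0 <= A) by (unfold A; have Q := pow2_ge_0 S4; lra). split; [easy|].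
 assert (D2 : forall n c' i t x y z, oi a b t -> Rabs (fder (Some i) (fder (Some i) (V n c')) t x y z) <= S4).
 { intros n c' i t x y z Ht. unfold S4. apply (sup_le 0 2 t K4 _ Ht (le_n 2)).
  etr; [|exact (HK4 n t Ht)]. etr; [|now apply (NS_term 0 4 t (V n) c')].
  exact (N_Zw 0 2 t (Some i :: Some i :: nil) (V n c') Ht). }
 induction n; intros t Ht.
 - rewrite pow_O, Rmult_1_r. apply Rle_trans with (5 * (2 * (M + M))); [|unfold A; have Q := pow2_ge_0 S4; lra].
  assert (Q : forall c', nrm2 t (V 1%nat c' - V 0%nat c')%fld <= 2 * (M + M)).
  { intros c'. etr; [now apply nrm2_sub|]. rewrite <- !(N_0 0). destruct (it_good H 0%nat) as [G0 _]. destruct (it_good H 1%nat) as [G1 _].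
   assert (Q0 : Nk 0 3 t (V 0%nat c') <= M) by exact (G0 t c' Ht). assert (Q1 : Nk 0 3 t (V 1%nat c') <= M) by exact (G1 t c' Ht). have Q2 := N_mono 0 0 3 t (V 0%nat c') Ht ltac:(lia). have Q3 := N_mono 0 0 3 t (V 1%nat c') Ht ltac:(lia). lra. }
  unfold nS, sumc. have q1 := Q cQ. have q2 := Q cH. have q3 := Q cV1. have q4 := Q cV2. have q5 := Q cW. lra.
 - set (Y := A * (/ 4) ^ n + S4 ^ 2 * (9 / 4) * (/ 4) ^ n).
  assert (P4 : 0 < (/ 4) ^ n) by (apply pow_lt; lra).
  assert (PS : 0 <= S4 ^ 2 * (9 / 4) * (/ 4) ^ n) by (apply Rmult_le_pos; [have Q := pow2_ge_0 S4|]; lra).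
  assert (PAn : 0 <= A * (/ 4) ^ n) by (apply Rmult_le_pos; lra).
  assert (PY : 0 <= Y) by (unfold Y; lra).
  set (E := fun s => E0 (mw eps (V (S n))) s (fun c => V (S (S n)) c - V (S n) c)%fld).
  assert (Lo : forall t, oi a b t -> c * nS t (fun c => V (S (S n)) c - V (S n) c)%fld <= E t).
  { intros s Hs. apply (E0_lower (mw eps (V (S n))) s (fun c => V (S (S n)) c - V (S n) c)%fld c Hs). intros; now apply (it_low tau t0 V (S n) H). }
  assert (DE : forall t, oi a b t -> ex_derive E t /\ Rabs (Derive E t) <= C * (nS t (fun c => V (S (S n)) c - V (S n) c)%fld + Y)).
  { intros s Hs. destruct (HC a b ((/ 2) ^ S n) ((/ 2) ^ n) (V (S n)) (V (S (S n))) (V n) (V (S n)) s Y) as [dE [D1 D3]]; [easy|left; apply P2|left; apply P2|easy| | | | | | | |].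
   - intros c'. repeat split; [apply (proj1 (it_good H (S n)))|apply (proj1 (it_good H (S (S n))))|apply (proj1 (it_good H n))|apply (proj1 (it_good H (S n)))]; exact Hs.
   - intros c' x y z; exact (proj1 (proj2 (it_good H (S n))) s c' x y z Hs).
   - intros c' x y z; exact (proj1 (proj2 (it_good H (S n))) s c' x y z Hs).
   - etr; [now apply IHn|]. unfold Y. lra.
   - intros c' i. set (f := V (S n) c').
    assert (Bd : forall x y z, (Dh ((/ 2) ^ S n) i f - Dh ((/ 2) ^ n) i f)%fld s x y z ^ 2 <= S4 ^ 2 * (9 / 4) * (/ 4) ^ n).
    { intros x y z. rewrite fsub_at.
     have Q1 := Dh_consistent ((/ 2) ^ S n) i f s S4 Hs ltac:(left; apply P2) (fun x y z => D2 (S n) c' i s x y z Hs) x y z.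
     have Q2 := Dh_consistent ((/ 2) ^ n) i f s S4 Hs ltac:(left; apply P2) (fun x y z => D2 (S n) c' i s x y z Hs) x y z.
     apply Rabs_le_between in Q1. apply Rabs_le_between in Q2. change ((/ 2) ^ S n) with (/ 2 * (/ 2) ^ n) in *.
     replace ((/ 4) ^ n) with (((/ 2) ^ n) ^ 2) by (rewrite <- pow_mult, Nat.mul_comm, pow_mult; f_equal; lra).
     set (u := (/ 2) ^ n) in *. replace (S4 ^ 2 * (9 / 4) * u ^ 2) with ((S4 * u * (3 / 2)) ^ 2) by field. apply pow_maj_Rabs. apply Rabs_le. lra. }
    rewrite <- (Rmult_1_r (nrm2 s _)).
    replace (Dh ((/ 2) ^ S n) i f - Dh ((/ 2) ^ n) i f)%fld with ((Dh ((/ 2) ^ S n) i f - Dh ((/ 2) ^ n) i f) * fcst 1)%fld by fring.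
    etr; [rewrite Rmult_1_r; apply (prod_sup s _ (fcst 1) _ Hs Bd)|].
    rewrite <- (N_0 0), N_cst by easy. unfold Y. lra.
   - now apply it_sym with (1 := H).
   - now apply it_sym with (1 := H).
   - split; [now exists dE|]. rewrite (is_derive_unique _ _ _ D1 : Derive E s = dE). exact D3. }
  revert t Ht. apply two_sided. intros sg Hsg r Hr. have Ir := oi_sided tau t0 sg r Hsg Hr.
  assert (G : E (t0 + sg * r) <= c * Y * (exp (C / c * r) - 1)).
  { apply (gronwall_zero (fun r => E (t0 + sg * r)) (fun r => sg * Derive E (t0 + sg * r)) tau); [apply Rmult_le_pos; [easy|left; now apply Rinv_0_lt_compat]| | | |easy].
   - intros r' Hr'. apply is_derive_affine, Derive_correct, DE. now apply oi_sided.
   - rewrite Rmult_0_r, Rplus_0_r. apply Req_le. apply E0_diff_zero; [unfold oi, a, b; lra|]. intros c' x y z. now rewrite (it_init H (S (S n))), (it_init H (S n)).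
   - intros r' Hr'. have Ir' := oi_sided tau t0 sg r' Hsg Hr'. destruct (DE _ Ir') as [_ Q']. have L := Lo _ Ir'.
    etr; [apply Rle_abs|]. rewrite Rabs_mult, Hsg, Rmult_1_l. etr; [exact Q'|].
    replace (C / c * (E (t0 + sg * r') + c * Y)) with (C * (E (t0 + sg * r') / c + Y)) by (field; lra).
    apply Rmult_le_compat_l; [easy|]. apply Rplus_le_compat_r. apply Rle_div_r; [easy|lra]. }
  have L := Lo _ Ir.
  assert (Ex : exp (C / c * r) <= 9 / 8).
  { etr; [apply exp_le|exact Hexp]. apply Rmult_le_compat_l; [apply Rmult_le_pos; [easy|left; now apply Rinv_0_lt_compat]|lra]. }
  (* [exp - 1 <= 1/8] and [Y <= 2 A (1/4)^n] together give the factor [1/4] of the next step. *)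
  apply Rle_trans with (Y / 8).
  + apply Rmult_le_reg_l with c; [easy|]. etr; [exact L|]. etr; [exact G|].
   assert (0 <= c * Y) by (apply Rmult_le_pos; lra). replace (c * (Y / 8)) with (c * Y * (1 / 8)) by field. apply Rmult_le_compat_l; lra.
  + unfold Y. change ((/ 4) ^ S n) with (/ 4 * (/ 4) ^ n). assert (S4 ^ 2 * (9 / 4) <= A) by (unfold A; have Q := pow2_ge_0 S4; lra).
   assert (S4 ^ 2 * (9 / 4) * (/ 4) ^ n <= A * (/ 4) ^ n) by (apply Rmult_le_compat_r; lra). lra.
Qed.

End Bounds.
End Iteration.

Lemma Dh_0 {a b} c (f : fld a b) : Dh 0 c f = fder (Some c) f.
Proof. Transparent Dh. unfold Dh. Opaque Dh. destruct Req_dec_T; [easy|lra]. Qed.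

Section Limit.
Context (P : params) (HP : admissible P).
Local Notation thw := (thW P HP). Local Notation aw := (aW P HP). Local Notation lam := (Lam P HP).

(** Spatial words are bounded by [it_high]; each additional time letter is removed with the equation
    of the iterate, by induction on [j]. *)
Lemma it_UB eps kap M K1 tau t0 V : 0 < eps < 1 -> 0 < kap -> 0 <= M -> 0 <= K1 -> 0 < tau -> Iter P HP eps kap M K1 tau t0 V ->
 forall j c r, UB (oi (t0 - tau) (t0 + tau)) r j (fun n => V n c).
Proof.
 intros He Hk HM HK1 Htau H. set (a := t0 - tau) in *. set (b := t0 + tau) in *. set (T := oi a b).
 assert (HT : forall t, T t -> oi a b t) by easy.
 assert (U0 : forall c r, UB T r 0 (fun n => V n c)).
 { intros c r. apply UB0_of_SB. intros l Hl.
  destruct (it_high P HP eps kap M K1 He Hk HM HK1 tau t0 V Htau H (2 + length l)) as [K [PK HK]].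
  exists (sq K). intros n t x y z Ht. apply (sup_le 0 2 t K _ Ht (le_n 2)).
  etr; [exact (N_Zw 0 2 t l (V n c) Ht)|]. etr; [apply (NS_term 0 (2 + length l) t (V n) c Ht)|now apply HK]. }
 induction j; intros c r; [apply U0|]. apply UB_time; [apply U0|].
 assert (Uth : forall r, UB T r j (fun n => finv (thw eps (V n)))).
 { intros r'. apply (UB_inv T j kap); [easy|easy|intros n; apply (it_good P HP _ _ _ _ _ _ _ H n)|].
  apply UB_add; [now apply UB_cst|]. apply UB_scal, UB_add; [apply UB_mul; now apply UB_zf|]. apply UB_scal, UB_mul; [now apply UB_zf|apply IHj]. }
 assert (Hl : UB T r j (fun n => lam ((/ 2) ^ n) eps (V n) (V (S n)) c)).
 { apply (Lam_UB P HP T j (fun n => (/ 2) ^ n) eps V (fun n => V (S n))); [easy|intros; apply IHj| |exact Uth].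
  intros c' r' l L1 L2. destruct (IHj c' r' l L1 L2) as [K HK]. exists K. intros n. apply (HK (S n)). }
 intros l L1 L2. destruct (Hl l L1 L2) as [K HK]. destruct (UB_cst (a:=a) (b:=b) T r j 0 HT l L1 L2) as [K' HK'].
 exists (Rmax K K'). intros n t x y z Ht. destruct n.
 - rewrite (it_0 P HP _ _ _ _ _ _ _ H). etr; [now apply (HK' 0%nat)|apply Rmax_r].
 - rewrite (it_S P HP _ _ _ _ _ _ _ H). etr; [now apply HK|apply Rmax_l].
Qed.

(** L^2 contraction and bounds of order 4 interpolate to a geometric rate in the supremum. Every
    further derivative, in time or space, is obtained from [landau] with a uniform bound on the next
    one. *)
Lemma it_cauchy eps kap M K1 tau t0 V A : 0 < eps < 1 -> 0 < kap -> 0 <= M -> 0 <= K1 -> 0 < tau -> Iter P HP eps kap M K1 tau t0 V ->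
 0 <= A -> (forall n t, oi (t0 - tau) (t0 + tau) t -> nS t (fun c => V (S n) c - V n c)%fld <= A * (/ 4) ^ n) ->
 forall c, Kcauchy (fun n => V n c).
Proof.
 intros He Hk HM HK1 Htau H PA HA c. set (a := t0 - tau) in *. set (b := t0 + tau) in *.
 assert (W : forall l eta, 0 < eta -> exists n0, forall n m t x y z, (n0 <= n)%nat -> (n0 <= m)%nat -> oi a b t ->
  Rabs (Zw 1 l (V n c) t x y z - Zw 1 l (V m c) t x y z) <= eta).
 { induction l as [|d l IH]; intros eta Heta.
  - destruct (it_high P HP eps kap M K1 He Hk HM HK1 tau t0 V Htau H 4) as [K [PK HK]].
   destruct (N_interpolation 2) as [m [Pm Hm]].
   set (B := 27 * (m * sqrt (A * (2 * (K + K))))). assert (PB : 0 <= B) by (unfold B; apply Rmult_le_pos; [lra|]; apply Rmult_le_pos; [exact Pm|apply sqrt_pos]).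
   assert (S12 : 0 <= sqrt (/ 2) < 1).
   { split; [apply sqrt_pos|]. rewrite <- sqrt_1. apply sqrt_lt_1; lra. }
   destruct (geom_cauchy (sqrt B) (sqrt (/ 2)) eta S12 (sqrt_pos B) Heta) as [n0 Hn0].
   exists n0. intros n m' t x y z Hn Hm' Ht. apply (Hn0 (fun n => V n c t x y z)); [|easy|easy].
   intros j. rewrite <- fsub_at. set (f := (V (S j) c - V j c)%fld).
   assert (Nf : nrm2 t f <= A * (/ 4) ^ j).
   { etr; [|exact (HA j t Ht)]. apply (sumc_term (fun c => nrm2 t (V (S j) c - V j c)%fld)). intros; now apply nrm2_nonneg. }
   assert (N4 : Nk 0 4 t f <= 2 * (K + K)).
   { etr; [now apply N_sub|]. have Q1 := NS_term 0 4 t (V (S j)) c Ht. have Q2 := NS_term 0 4 t (V j) c Ht.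
    assert (Q3 : NS 0 4 t (V (S j)) <= K) by now apply HK. assert (Q4 : NS 0 4 t (V j) <= K) by now apply HK. lra. }
   assert (P4 : 0 <= (/ 4) ^ j) by (apply pow_le; lra).
   assert (PKK : 0 <= 2 * (K + K)) by lra. have N2 := Hm a b t (A * (/ 4) ^ j) (2 * (K + K)) f Ht (Rmult_le_pos _ _ PA P4) PKK Nf N4.
   assert (E2 : sqrt (A * (/ 4) ^ j * (2 * (K + K))) = sqrt (A * (2 * (K + K))) * (/ 2) ^ j).
   { replace (A * (/ 4) ^ j * (2 * (K + K))) with (A * (2 * (K + K)) * ((/ 2) ^ j * (/ 2) ^ j))
     by (rewrite <- Rpow_mult_distr; replace (/ 2 * / 2) with (/ 4) by lra; ring).
    rewrite sqrt_mult; [|apply Rmult_le_pos; lra|apply Rmult_le_pos; apply pow_le; lra]. rewrite sqrt_square; [easy|apply pow_le; lra]. }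
   rewrite E2 in N2. have Q := sup_bound 0 t f x y z Ht.
   apply le_of_sq_le; [apply Rmult_le_pos; [apply sqrt_pos|apply pow_le, S12]|].
   rewrite pow2_abs, Rpow_mult_distr, pow2_sqrt by easy. rewrite <- pow_mult, Nat.mul_comm, pow_mult, pow2_sqrt by lra. unfold B. lra.
  - destruct (it_UB eps kap M K1 tau t0 V He Hk HM HK1 Htau H (cnt (d :: d :: l)) c (length (d :: d :: l)) (d :: d :: l) (le_n _) (le_n _)) as [K HK].
   fold a b in HK. set (K' := 2 * Rabs K). assert (PK' : 0 <= K') by (unfold K'; have Q := Rabs_pos K; lra).
   (* The second-derivative term [K' s] takes half of [eta]; the word [l] is then required to be
      [eta s / 8] close, which makes the other term of [landau] equal to the other half. *)
   set (s := Rmin tau (eta / 2 / (K' + 1))). assert (Ps : 0 < eta / 2 / (K' + 1)) by (apply Rdiv_lt_0_compat; lra).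
   assert (s0 : 0 < s) by now apply Rmin_glb_lt. have s1 := Rmin_l tau (eta / 2 / (K' + 1)). have s2 := Rmin_r tau (eta / 2 / (K' + 1)). fold s in s1, s2.
   assert (Pe : 0 < eta * s / 8) by (apply Rdiv_lt_0_compat; [now apply Rmult_lt_0_compat|lra]).
   destruct (IH (eta * s / 8) Pe) as [n0 Hn0]. exists n0. intros n m t x y z Hn Hm Ht.
   rewrite <- fsub_at, <- Zw_sub, Zw_cons, Zd1.
   have Q := landau d (Zw 1 l (V n c - V m c)%fld) K' (eta * s / 8) s s0 ltac:(unfold a, b; lra) ltac:(unfold a, b; lra).
   etr; [apply Q; [| |exact Ht]|].
   + intros t' x' y' z' Ht'. rewrite Zw_sub, fsub_at. now apply Hn0.
   + intros t' x' y' z' Ht'. rewrite <- !Zd1, <- !Zw_cons, Zw_sub, fsub_at.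
    have Q1 := HK n t' x' y' z' Ht'. have Q2 := HK m t' x' y' z' Ht'. have Q3 := Rle_abs K.
    etr; [apply Rabs_triang|]. rewrite Rabs_Ropp. unfold K'. lra.
   + replace (4 * (eta * s / 8) / s) with (eta / 2) by (field; lra).
    assert (Q1 : (K' + 1) * (eta / 2 / (K' + 1)) = eta / 2) by (field; lra).
    assert (Q2 : K' * s <= (K' + 1) * (eta / 2 / (K' + 1))) by (apply Rmult_le_compat; lra). lra. }
 intros l t1 t2 eta I1 I2 Heta. destruct (W l eta Heta) as [n0 Hn0]. exists n0. intros n m t x y z Hn Hm Ht.
 apply Hn0; [easy|easy|]. unfold oi in *. lra.
Qed.

(** The differences converge to derivatives because the second derivatives of the iterates are
    bounded uniformly in [n], so the consistency error is of order [2^-n]. *)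
Lemma it_limit eps kap M K1 tau t0 V : 0 < eps < 1 -> 0 < kap -> 0 <= M -> 0 <= K1 -> 0 < tau -> Iter P HP eps kap M K1 tau t0 V ->
 (forall c, Kcauchy (fun n => V n c)) -> exists VL : cmp -> fld (t0 - tau) (t0 + tau),
 (forall c, fder None (VL c) = lam 0 eps VL VL c) /\ (forall c x y z, VL c t0 x y z = V 0%nat c t0 x y z) /\
 ge0 kap (aw eps VL) /\ ge0 kap (thw eps VL).
Proof.
 intros He Hk HM HK1 Htau H HKc. set (a := t0 - tau) in *. set (b := t0 + tau) in *. assert (I0 : oi a b t0) by (unfold oi, a, b; lra).
 destruct (fields_limit V HKc) as (VL & HP0 & HP1).
 assert (lim_ge : forall (f : nat -> fld a b) g, PL f g -> (forall n, ge0 kap (f n)) -> ge0 kap g).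
 { intros f g Hf Hg t x y z Ht. apply (is_lim_seq_le (fun _ => kap) (fun n => f n t x y z) kap (g t x y z)).
  - intros n. now apply Hg.
  - apply is_lim_seq_const.
  - now apply Hf. }
 assert (Pth : PL (fun n => thw eps (V n)) (thw eps VL)).
 { apply PL_add; [apply PL_const|]. apply PL_scal, PL_add; [apply PL_const|]. apply PL_scal, PL_mul; [apply PL_const|apply HP0]. }
 assert (Pa : PL (fun n => aw eps (V n)) (aw eps VL)).
 { apply PL_add; [apply PL_const|]. apply PL_scal, PL_scal, PL_sub; [apply HP0|apply PL_const]. }
 assert (Gth : forall n, ge0 kap (thw eps (V n))) by (intros n; exact (proj2 (proj2 (proj2 (it_good P HP _ _ _ _ _ _ _ H n))))).
 assert (Ga : forall n, ge0 kap (aw eps (V n))) by (intros n; exact (proj1 (proj2 (proj2 (it_good P HP _ _ _ _ _ _ _ H n))))).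
 have GthL := lim_ge _ _ Pth Gth.
 exists VL. split; [|split; [|split; [exact (lim_ge _ _ Pa Ga)|exact GthL]]].
 - intros c. apply (PL_unique (fun n => fder None (V (S n) c))).
  + exact (PL_shift (fun n => fder None (V n c)) _ (HP1 c None)).
  + intros t x y z Ht. apply (is_lim_seq_ext (fun n => lam ((/ 2) ^ n) eps (V n) (V (S n)) c t x y z)).
   { intros n. now rewrite (it_S P HP _ _ _ _ _ _ _ H). }
   refine (Lam_lim P HP (fun n => (/ 2) ^ n) 0 eps V (fun n => V (S n)) VL VL HP0 _ _ _ c t x y z Ht).
   * intros c'. exact (PL_shift (fun n => V n c') _ (HP0 c')).
   * intros c' i t' x' y' z' Ht'.
    destruct (it_UB eps kap M K1 tau t0 V He Hk HM HK1 Htau H 0 c' 2 (Some i :: Some i :: nil) (le_n _) (le_n _)) as [K HK].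
    assert (E0 : Dh 0 i (VL c') = fder (Some i) (VL c')) by apply Dh_0. rewrite E0.
    have Q1 := PL_shift (fun n => fder (Some i) (V n c')) _ (HP1 c' (Some i)) t' x' y' z' Ht'.
    replace (fder (Some i) (VL c') t' x' y' z') with (fder (Some i) (VL c') t' x' y' z' + 0) by ring.
    apply (is_lim_seq_ext (fun n => fder (Some i) (V (S n) c') t' x' y' z' + (Dh ((/ 2) ^ n) i (V (S n) c') t' x' y' z' - fder (Some i) (V (S n) c') t' x' y' z'))).
    { intros n. ring. }
    apply is_lim_seq_plus'; [exact Q1|]. apply is_lim_seq_abs_0.
    apply (is_lim_seq_le_le (fun _ => 0) _ (fun n => Rabs K * (/ 2) ^ n)).
    { intros n. split; [apply Rabs_pos|]. apply Dh_consistent; [easy|apply pow_le; lra|]. intros u v w.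
     have Q := HK (S n) t' u v w Ht'. rewrite !Zw_cons, !Zd1 in Q. change (Zw 1 nil (V (S n) c')) with (V (S n) c') in Q. exact (Rle_trans _ _ _ Q (Rle_abs K)). }
    { apply is_lim_seq_const. }
    { replace (Finite 0) with (Rbar_mult (Rabs K) 0) by (simpl; f_equal; ring). apply is_lim_seq_scal_l. apply is_lim_seq_geom. rewrite Rabs_right; lra. }
   * intros t' x' y' z' Ht'. rewrite finv_at by (apply (ge0_neq kap); easy).
    apply (is_lim_seq_ext (fun n => / thw eps (V n) t' x' y' z')); [intros n; now rewrite finv_at by (apply (ge0_neq kap); easy)|].
    apply (is_lim_seq_inv (fun n => thw eps (V n) t' x' y' z') (thw eps VL t' x' y' z')); [now apply Pth|].
    intros E. injection E. apply (ge0_neq kap); easy.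
 - intros c x y z. have Q := is_lim_seq_unique _ _ (HP0 c t0 x y z I0).
  assert (Q2 : is_lim_seq (fun n => V n c t0 x y z) (V 0%nat c t0 x y z)).
  { apply (is_lim_seq_ext (fun _ => V 0%nat c t0 x y z)); [|apply is_lim_seq_const]. intros n. symmetry. apply (it_init P HP _ _ _ _ _ _ _ H). }
  apply is_lim_seq_unique in Q2. cbv beta in Q. rewrite Q2 in Q. injection Q. easy.
Qed.

(** The solution extends to both sides of [t0]: when restarted inside the life of another solution
    it overlaps with it, and the two can be identified by uniqueness. *)
Lemma local_existence M0 kap eps : 0 < eps < 1 -> 0 <= M0 -> 0 < kap -> exists tau, 0 < tau /\
 forall a b (U : cmp -> fld a b) t0, oi a b t0 -> NS 0 3 t0 U <= M0 ->
 (forall x y z, kap <= aw eps U t0 x y z) -> (forall x y z, kap <= thw eps U t0 x y z) ->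
 exists V : cmp -> fld (t0 - tau) (t0 + tau), (forall c, fder None (V c) = lam 0 eps V V c) /\
  (forall c x y z, V c t0 x y z = U c t0 x y z) /\ ge0 (kap / 2) (aw eps V) /\ ge0 (kap / 2) (thw eps V).
Proof.
 intros He HM0 Hk. destruct (good_step P HP M0 kap eps He HM0 Hk) as (M & K1 & tau0 & HM & HK1 & Ht0 & Hstep).
 assert (Hk2 : 0 < kap / 2) by lra. assert (PM : 0 <= M) by lra.
 destruct (it_contract P HP eps (kap / 2) M K1 He Hk2 PM HK1) as [Cg [PCg HCg]].
 destruct (exp_small Cg PCg) as [d [Pd Hd]].
 set (tau := Rmin tau0 d). assert (T0 : 0 < tau) by now apply Rmin_glb_lt.
 have T1 := Rmin_l tau0 d. have T2 := Rmin_r tau0 d. fold tau in T1, T2.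
 exists tau. split; [easy|]. intros a b U t0 Ht HU Ha Hth.
 assert (I0 : oi (t0 - tau) (t0 + tau) t0) by (unfold oi; lra).
 (* The first iterate is the data, held constant in time. *)
 set (U0 := fun c => frz (t0 - tau) (t0 + tau) (U c) t0 Ht).
 assert (EU : forall c t x y z, oi (t0 - tau) (t0 + tau) t -> U0 c t x y z = U c t0 x y z) by (intros; now apply frz_at).
 assert (NU : forall t, oi (t0 - tau) (t0 + tau) t -> NS 0 3 t U0 = NS 0 3 t0 U) by (intros t It; apply NS0_slice; [easy|easy|intros; now apply EU]).
 assert (Da : forall t x y z, oi (t0 - tau) (t0 + tau) t -> kap <= aw eps U0 t x y z).
 { intros t x y z It. rewrite aW_at, EU by easy. rewrite <- (aW_at P HP eps U t0) by easy. apply Ha. }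
 assert (Dth : forall t x y z, oi (t0 - tau) (t0 + tau) t -> kap <= thw eps U0 t x y z).
 { intros t x y z It. rewrite thW_at, EU by easy. rewrite <- (thW_at P HP eps U t0) by easy. apply Hth. }
 destruct (it_exists P HP eps (kap / 2) M K1 tau t0 U0 T0) as [V [EV IV]].
 - intros c. apply frz_None.
 - intros c t x y z It. now rewrite !EU.
 - split; [|split; [|split]].
  + intros t c It. etr; [now apply (NS_term 0 3 t U0 c)|]. rewrite NU by easy. lra.
  + intros t c x y z It. unfold U0. rewrite frz_None, fcst_at, Rabs_R0 by easy. easy.
  + intros t x y z It. have Q := Da t x y z It. lra.
  + intros t x y z It. have Q := Dth t x y z It. lra.
 - intros h W V Hh HW HV HL HG. apply (Hstep tau t0 h U0 W V); [lra|easy|rewrite NU by easy; easy|intros; now apply Da|intros; now apply Dth|easy|easy|easy|easy].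
 - destruct (HCg tau t0 V T0) as [A [PA HA]]; [|exact IV|].
  + etr; [|exact Hd]. apply exp_le, Rmult_le_compat_l; lra.
  + destruct (it_limit eps (kap / 2) M K1 tau t0 V He Hk2 PM HK1 T0 IV (it_cauchy eps (kap / 2) M K1 tau t0 V A He Hk2 PM HK1 T0 IV PA HA)) as (VL & L1 & L2 & L3 & L4).
   exists VL. split; [exact L1|]. split; [|split; [exact L3|exact L4]].
   intros c x y z. rewrite L2, EV. now apply EU.
Qed.

End Limit.

(** * Initial values of the time derivatives *)

Definition cpt (c : cmp) : state -> sfield := match c with cQ => q | cH => h | cV1 => v1 | cV2 => v2 | cW => w end.

Lemma state_ext U V : (forall c x y z, cpt c U x y z = cpt c V x y z) -> U = V.
Proof.
 intros H. destruct U, V. f_equal; ext3 x y z;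
  [apply (H cQ)|apply (H cH)|apply (H cV1)|apply (H cV2)|apply (H cW)].
Qed.

(** Smooth functions of time are treated as fields constant in space, so the closure properties of
    [Sm] carry over. *)
Definition ST (I : R -> Prop) (f : R -> R) : Prop := Sm I (fun t _ _ _ => f t).

Lemma Sm_point I f x y z : open I -> Sm I f -> ST I (fun t => f t x y z).
Proof.
 intros HI Hf n. revert f Hf; induction n; intros f Hf.
 - split; [|easy]. intros t x' y' z' Ht. apply c4_intro.
  apply (c4_comp f (fun p : R * R * R * R => fst (fst (fst p))) (fun _ => x) (fun _ => y) (fun _ => z)); try cproj; try apply continuous_const. now apply (Sm_c4 I).
 - apply (Cn_step n I _ (fun d => match d with None => fun t _ _ _ => pdt None f t x y z | Some _ => fun _ _ _ _ => 0 end)); [easy| | |].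
  + intros t x' y' z' Ht. apply c4_intro.
   apply (c4_comp f (fun p : R * R * R * R => fst (fst (fst p))) (fun _ => x) (fun _ => y) (fun _ => z)); try cproj; try apply continuous_const. now apply (Sm_c4 I).
  + intros d t x' y' z' Ht. destruct d as [c|]; [destruct c; apply (is_derive_const (K:=RA) (V:=RN))|].
   exact (Sm_is I f None Hf t x y z Ht).
  + intros d. destruct d; [now apply Cn_const|]. apply IHn, Sm_pdt, Hf.
Qed.

Lemma ST_derive I f : ST I f -> ST I (Derive f).
Proof. intros H. exact (Sm_pdt I _ None H). Qed.

Lemma ST_ex I f t : ST I f -> I t -> ex_derive f t.
Proof. intros H Ht. exact (Sm_ex I _ None H t 0 0 0 Ht). Qed.

Definition nb (I : R -> Prop) : Prop := open I /\ I 0.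

Definition J (n : nat) (f g : R -> R) : Prop := forall k, (k <= n)%nat -> Derive_n f k 0 = Derive_n g k 0.

Lemma Derive_n_S f n t : Derive_n f (S n) t = Derive_n (Derive f) n t.
Proof. change (Derive f) with (Derive_n f 1). rewrite Derive_n_comp. f_equal. lia. Qed.

Lemma J_S n f g : J (S n) f g <-> f 0 = g 0 /\ J n (Derive f) (Derive g).
Proof.
 split.
 - intros H. split; [exact (H 0%nat ltac:(lia))|]. intros k Hk. rewrite <- !Derive_n_S. apply H. lia.
 - intros [H0 H] k Hk. destruct k; [exact H0|]. rewrite !Derive_n_S. apply H. lia.
Qed.

Lemma J_ext I n f f' g g' : nb I -> (forall t, I t -> f t = f' t) -> (forall t, I t -> g t = g' t) -> J n f g -> J n f' g'.
Proof.
 intros [HI H0] Hf Hg H k Hk. destruct (HI 0 H0) as [d Hd].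
 rewrite <- (Derive_n_ext_loc f f') by (exists d; intros; now apply Hf, Hd).
 rewrite <- (Derive_n_ext_loc g g') by (exists d; intros; now apply Hg, Hd). now apply H.
Qed.

Lemma J_plus I n : nb I -> forall f f' g g', ST I f -> ST I f' -> ST I g -> ST I g' -> J n f f' -> J n g g' ->
 J n (fun s => f s + g s) (fun s => f' s + g' s).
Proof.
 intros HI. induction n; intros f f' g g' S1 S2 S3 S4 Hf Hg.
 - intros k Hk. assert (k = 0)%nat as -> by lia. cbn [Derive_n]. now rewrite (Hf 0%nat (le_n _) : f 0 = f' 0), (Hg 0%nat (le_n _) : g 0 = g' 0).
 - apply J_S in Hf. apply J_S in Hg. apply J_S. split; [now rewrite (proj1 Hf), (proj1 Hg)|].
  apply (J_ext I n (fun s => Derive f s + Derive g s) _ (fun s => Derive f' s + Derive g' s) _ HI).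
  + intros t Ht. symmetry. apply Derive_plus; now apply (ST_ex I).
  + intros t Ht. symmetry. apply Derive_plus; now apply (ST_ex I).
  + apply IHn; [now apply ST_derive|now apply ST_derive|now apply ST_derive|now apply ST_derive|apply Hf|apply Hg].
Qed.

Lemma J_le n m f g : (n <= m)%nat -> J m f g -> J n f g.
Proof. intros H HJ k Hk. apply HJ. lia. Qed.

Lemma J_mult I n : nb I -> forall f f' g g', ST I f -> ST I f' -> ST I g -> ST I g' -> J n f f' -> J n g g' ->
 J n (fun s => f s * g s) (fun s => f' s * g' s).
Proof.
 intros HI. have HO := proj1 HI. induction n; intros f f' g g' S1 S2 S3 S4 Hf Hg.
 - intros k Hk. assert (k = 0)%nat as -> by lia. cbn [Derive_n]. now rewrite (Hf 0%nat (le_n _) : f 0 = f' 0), (Hg 0%nat (le_n _) : g 0 = g' 0).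
 - have Hf' := J_le n (S n) _ _ ltac:(lia) Hf. have Hg' := J_le n (S n) _ _ ltac:(lia) Hg.
  apply J_S in Hf. apply J_S in Hg. apply J_S. split; [now rewrite (proj1 Hf), (proj1 Hg)|].
  apply (J_ext I n (fun s => Derive f s * g s + f s * Derive g s) _ (fun s => Derive f' s * g' s + f' s * Derive g' s) _ HI).
  + intros t Ht. symmetry. apply Derive_mult; now apply (ST_ex I).
  + intros t Ht. symmetry. apply Derive_mult; now apply (ST_ex I).
  + assert (SM : forall g g', ST I g -> ST I g' -> ST I (fun s => g s * g' s)) by (intros; apply Sm_mult; easy).
   apply (J_plus I n HI (fun s => Derive f s * g s) (fun s => Derive f' s * g' s) (fun s => f s * Derive g s) (fun s => f' s * Derive g' s)); auto using ST_derive.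
   * apply (IHn (Derive f) (Derive f') g g'); auto using ST_derive. apply Hf.
   * apply (IHn f f' (Derive g) (Derive g')); auto using ST_derive. apply Hg.
Qed.

Lemma J_inv I n : nb I -> forall f f', (forall t, I t -> f t <> 0) -> (forall t, I t -> f' t <> 0) -> ST I f -> ST I f' -> J n f f' ->
 J n (fun s => / f s) (fun s => / f' s).
Proof.
 intros HI. have HO := proj1 HI. induction n; intros f f' N1 N2 S1 S2 Hf.
 - intros k Hk. assert (k = 0)%nat as -> by lia. cbn [Derive_n]. now rewrite (Hf 0%nat (le_n _) : f 0 = f' 0).
 - have Hf' := J_le n (S n) _ _ ltac:(lia) Hf. apply J_S in Hf. apply J_S. split; [now rewrite (proj1 Hf)|].
  assert (D : forall g, ST I g -> (forall t, I t -> g t <> 0) -> forall t, I t -> (-1 * Derive g t) * (/ g t * / g t) = Derive (fun s => / g s) t).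
  { intros g Sg Ng t Ht. rewrite Derive_inv; [field; now apply Ng|now apply (ST_ex I)|now apply Ng]. }
  apply (J_ext I n (fun s => (-1 * Derive f s) * (/ f s * / f s)) _ (fun s => (-1 * Derive f' s) * (/ f' s * / f' s)) _ HI); [now apply D|now apply D|].
  assert (SI : forall g, ST I g -> (forall t, I t -> g t <> 0) -> ST I (fun s => / g s)) by (intros g Sg Ng; apply Sm_inv; [easy|intros; now apply Ng|easy]).
  assert (SM : forall g g', ST I g -> ST I g' -> ST I (fun s => g s * g' s)) by (intros; apply Sm_mult; easy).
  assert (Sc : ST I (fun _ => -1)) by exact (Sm_const I (-1) HO).
  assert (Jc : J n (fun _ => -1) (fun _ => -1)) by easy.
  apply (J_mult I n HI (fun s => -1 * Derive f s) (fun s => -1 * Derive f' s) (fun s => / f s * / f s) (fun s => / f' s * / f' s)); auto using ST_derive.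
  + apply (J_mult I n HI (fun _ => -1) (fun _ => -1)); auto using ST_derive. apply Hf.
  + apply (J_mult I n HI (fun s => / f s) (fun s => / f' s)); auto.
Qed.

(** At each [t >= 0] the derivative of a smooth function is determined by increments to the right.
    This matters because (CE) is imposed for nonnegative times only, while [Derive_n] is
    two-sided. *)
Lemma J_one_sided I : nb I -> forall n f g, ST I f -> ST I g -> (forall t, I t -> 0 <= t -> f t = g t) -> J n f g.
Proof.
 intros [HI H0]. induction n; intros f g Sf Sg H.
 - intros k Hk. assert (k = 0)%nat as -> by lia. apply H; [easy|lra].
 - apply J_S. split; [apply H; [easy|lra]|]. apply IHn; [now apply ST_derive|now apply ST_derive|].
  intros t Ht Pt. have D1 := Derive_correct _ _ (ST_ex I f t Sf Ht). have D2 := Derive_correct _ _ (ST_ex I g t Sg Ht).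
  assert (D : is_derive (fun s => f s - g s) t (Derive f t - Derive g t)) by exact (is_derive_minus f g t _ _ D1 D2).
  set (l := Derive f t - Derive g t) in *. destruct (Req_dec l 0) as [E|E]; [unfold l in E; lra|exfalso].
  apply is_derive_Reals in D. assert (Pl : 0 < Rabs l / 2) by (have Q := Rabs_pos_lt l E; lra).
  destruct (D _ Pl) as [d Hd]. destruct (HI t Ht) as [d' Hd'].
  have Pd := cond_pos d. have Pd' := cond_pos d'. set (u := Rmin d d' / 2).
  have M1 := Rmin_l d d'. have M2 := Rmin_r d d'. assert (Pu : 0 < u) by (have Q := Rmin_glb_lt d d' 0 Pd Pd'; unfold u; lra).
  assert (Iu : I (t + u)).
  { apply Hd'. apply R_ball. rewrite Rabs_right; unfold u in *; lra. }
  have Q := Hd u ltac:(lra) ltac:(rewrite Rabs_right; unfold u in *; lra).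
  rewrite (H (t + u)), (H t) in Q by (easy || lra). replace ((g (t + u) - g (t + u) - (g t - g t)) / u - l) with (- l) in Q by (field; lra).
  rewrite Rabs_Ropp in Q. lra.
Qed.

(** Equality of jets at 0 with an unspecified neighbourhood of smoothness: inverting a function
    shrinks that neighbourhood, and the syntactic rules need not record by how much. *)
Definition JS (n : nat) (f g : R -> R) : Prop := exists I, nb I /\ ST I f /\ ST I g /\ J n f g.

Lemma ST_sub (I I' : R -> Prop) f : (forall t, I' t -> I t) -> ST I f -> ST I' f.
Proof.
 intros H Hf. apply smooth_on_Sm. apply smooth_on_Sm in Hf. intros l t x y z Ht. apply Hf. auto.
Qed.

Lemma nb_and I I' : nb I -> nb I' -> nb (fun t => I t /\ I' t).
Proof. intros [H1 H2] [H3 H4]. split; [|easy]. now apply open_and. Qed.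

Lemma JS_plus n f f' g g' : JS n f f' -> JS n g g' -> JS n (fun s => f s + g s) (fun s => f' s + g' s).
Proof.
 intros (I & HI & S1 & S2 & Hf) (I' & HI' & S3 & S4 & Hg). have HN := nb_and I I' HI HI'. set (K := fun t => I t /\ I' t) in *.
 assert (T1 : forall f, ST I f -> ST K f) by (intros; now apply (ST_sub I K); [intros t []|]).
 assert (T2 : forall f, ST I' f -> ST K f) by (intros; now apply (ST_sub I' K); [intros t []|]).
 exists K. split; [easy|]. split; [apply Sm_plus; [apply HN|now apply T1|now apply T2]|]. split; [apply Sm_plus; [apply HN|now apply T1|now apply T2]|].
 apply (J_plus K); auto.
Qed.

Lemma JS_mult n f f' g g' : JS n f f' -> JS n g g' -> JS n (fun s => f s * g s) (fun s => f' s * g' s).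
Proof.
 intros (I & HI & S1 & S2 & Hf) (I' & HI' & S3 & S4 & Hg). have HN := nb_and I I' HI HI'. set (K := fun t => I t /\ I' t) in *.
 assert (T1 : forall f, ST I f -> ST K f) by (intros; now apply (ST_sub I K); [intros t []|]).
 assert (T2 : forall f, ST I' f -> ST K f) by (intros; now apply (ST_sub I' K); [intros t []|]).
 exists K. split; [easy|]. split; [apply Sm_mult; [apply HN|now apply T1|now apply T2]|]. split; [apply Sm_mult; [apply HN|now apply T1|now apply T2]|].
 apply (J_mult K); auto.
Qed.

Lemma JS_const n k : JS n (fun _ => k) (fun _ => k).
Proof. exists (fun _ => True). split; [split; [apply open_true|easy]|]. split; [|split; [|easy]]; exact (Sm_const _ k open_true). Qed.

Lemma JS_opp n f g : JS n f g -> JS n (fun s => - f s) (fun s => - g s).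
Proof.
 intros H. replace (fun s => - f s) with (fun s => -1 * f s) by (extensionality s; ring).
 replace (fun s => - g s) with (fun s => -1 * g s) by (extensionality s; ring). exact (JS_mult n _ _ _ _ (JS_const n (-1)) H).
Qed.

Lemma JS_minus n f f' g g' : JS n f f' -> JS n g g' -> JS n (fun s => f s - g s) (fun s => f' s - g' s).
Proof. intros Hf Hg. exact (JS_plus n _ _ _ _ Hf (JS_opp n _ _ Hg)). Qed.

Lemma nonzero_near (u : R -> R) : continuous u 0 -> u 0 <> 0 -> exists d, 0 < d /\ forall t, oi (- d) d t -> u t <> 0.
Proof.
 intros Q Nu. assert (Pu : 0 < Rabs (u 0)) by now apply Rabs_pos_lt.
 destruct (Q (ball (u 0) (mkposreal _ Pu))) as [d Hd]; [now exists (mkposreal _ Pu)|]. exists d. split; [apply cond_pos|]. intros t Ht E.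
 assert (Q' : ball (u 0) (mkposreal _ Pu) (u t)).
 { apply Hd. apply R_ball. rewrite Rminus_0_r. now apply Rabs_def1; apply Ht. }
 apply ball_R in Q'; cbn [pos] in Q'. rewrite E, Rminus_0_l, Rabs_Ropp in Q'. lra.
Qed.

Lemma JS_inv n f g : JS n f g -> f 0 <> 0 -> JS n (fun s => / f s) (fun s => / g s).
Proof.
 intros (I & HI & S1 & S2 & H) N0. assert (N0' : g 0 <> 0) by now rewrite <- (H 0%nat ltac:(lia) : f 0 = g 0).
 destruct (nonzero_near f (continuous_of_ex_derive f 0 (ST_ex I f 0 S1 (proj2 HI))) N0) as [d [Pd Hd]]. destruct (nonzero_near g (continuous_of_ex_derive g 0 (ST_ex I g 0 S2 (proj2 HI))) N0') as [d' [Pd' Hd']].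
 set (K := fun t => I t /\ oi (- d) d t /\ oi (- d') d' t).
 assert (HK : nb K).
 { split; [|split; [apply HI|unfold oi; lra]]. unfold K. apply open_and; [apply HI|]. apply open_and; apply open_oi. }
 assert (T1 : forall f, ST I f -> ST K f) by (intros; now apply (ST_sub I K); [intros t []|]).
 exists K. split; [easy|]. split; [apply Sm_inv; [apply HK|intros t _ _ _ Ht; apply Hd, Ht|now apply T1]|].
 split; [apply Sm_inv; [apply HK|intros t _ _ _ Ht; apply Hd', Ht|now apply T1]|].
 apply (J_inv K); [easy|intros t Ht; apply Hd, Ht|intros t Ht; apply Hd', Ht|now apply T1|now apply T1|easy].
Qed.

Ltac js := match goal with
 | |- JS _ (fun s => @?a s + @?b s) _ => apply JS_plus; js
 | |- JS _ (fun s => @?a s - @?b s) _ => apply JS_minus; js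
 | |- JS _ (fun s => @?a s * @?b s) _ => apply JS_mult; js
 | |- JS _ (fun s => - @?a s) _ => apply JS_opp; js
 | |- JS _ (fun s => ?k) _ => apply JS_const
 | _ => idtac
 end.

Definition SmU (I : R -> Prop) (X : R -> state) : Prop := forall c, Sm I (fun t => cpt c (X t)).

(** [CE_rhs] is built by ring operations and one inverse from the state and its first spatial
    derivatives, and spatial derivatives commute with those in time; so its jet at 0 depends only on
    the jet of the state. *)
Lemma CE_rhs_JS (P : params) eps n I (X Y : R -> state) x y z c : nb I -> SmU I X -> SmU I Y ->
 (forall c x y z, J n (fun s => cpt c (X s) x y z) (fun s => cpt c (Y s) x y z)) ->
 vartheta P eps (X 0) x y z <> 0 ->
 JS n (fun s => cpt c (CE_rhs P eps (X s)) x y z) (fun s => cpt c (CE_rhs P eps (Y s)) x y z).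
Proof.
 intros HI HX HY HJ Hth.
 assert (A0 : forall c, JS n (fun s => cpt c (X s) x y z) (fun s => cpt c (Y s) x y z)).
 { intros c'. exists I. split; [easy|]. split; [apply (Sm_point I (fun t => cpt c' (X t))); [apply HI|apply HX]|].
  split; [apply (Sm_point I (fun t => cpt c' (Y t))); [apply HI|apply HY]|apply HJ]. }
 assert (Dc : forall (Z : R -> state) c d k t x y z, SmU I Z -> I t ->
  Derive_n (fun s => pd d (cpt c (Z s)) x y z) k t = pd d (fun x y z => Derive_n (fun s => cpt c (Z s) x y z) k t) x y z).
 { intros Z c' d k t x' y' z' HZ Ht.
  assert (G : forall k f, Sm I f -> forall t x y z, I t -> Derive_n (fun s => pdt (Some d) f s x y z) k t = pdt (Some d) (fun t x y z => Derive_n (fun s => f s x y z) k t) t x y z).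
  { clear - HI. induction k; intros f Hf t x y z Ht; [reflexivity|].
   rewrite Derive_n_S. destruct (proj1 HI t Ht) as [dl Hdl].
   transitivity (Derive_n (fun s => pdt (Some d) (pdt None f) s x y z) k t).
   - apply Derive_n_ext_loc. exists dl. intros s Hs. exact (pdt_comm I None (Some d) f (proj1 HI) Hf s x y z (Hdl s Hs)).
   - rewrite (IHk (pdt None f) (Sm_pdt I f None Hf) t x y z Ht). f_equal.
    ext3 t' x' y'; extensionality z'. now rewrite Derive_n_S. }
  exact (G k (fun t => cpt c' (Z t)) (HZ c') t x' y' z' Ht). }
 assert (A1 : forall c d, JS n (fun s => pd d (cpt c (X s)) x y z) (fun s => pd d (cpt c (Y s)) x y z)).
 { intros c' d. exists I. split; [easy|]. split; [apply (Sm_point I (pdt (Some d) (fun t => cpt c' (X t)))); [apply HI|apply Sm_pdt, HX]|].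
  split; [apply (Sm_point I (pdt (Some d) (fun t => cpt c' (Y t)))); [apply HI|apply Sm_pdt, HY]|].
  intros k Hk. rewrite !Dc by (easy || apply HI). f_equal. ext3 u v r. now apply HJ. }
 have Q0 := A0 cQ. have H0 := A0 cH. have V10 := A0 cV1. have V20 := A0 cV2. have W0 := A0 cW.
 have Q1 := A1 cQ. have H1 := A1 cH. have V11 := A1 cV1. have V21 := A1 cV2. have W1 := A1 cW. cbn [cpt] in *. clear A0 A1.
 assert (Ji : JS n (fun s => / vartheta P eps (X s) x y z) (fun s => / vartheta P eps (Y s) x y z)).
 { apply (JS_inv n (fun s => vartheta P eps (X s) x y z) (fun s => vartheta P eps (Y s) x y z)); [|exact Hth].
  unfold vartheta. js. exact H0. }
 destruct c; cbn [cpt CE_rhs q h v1 v2 w]; unfold advect, divergence; js;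
  match goal with
  | |- JS _ (fun s => / vartheta _ _ _ _ _ _) _ => exact Ji
  | |- JS _ (fun s => pd ?d (q _) _ _ _) _ => apply Q1
  | |- JS _ (fun s => pd ?d (h _) _ _ _) _ => apply H1
  | |- JS _ (fun s => pd ?d (v1 _) _ _ _) _ => apply V11
  | |- JS _ (fun s => pd ?d (v2 _) _ _ _) _ => apply V21
  | |- JS _ (fun s => pd ?d (w _) _ _ _) _ => apply W1
  | |- JS _ (fun s => q _ _ _ _) _ => exact Q0
  | |- JS _ (fun s => h _ _ _ _) _ => exact H0
  | |- JS _ (fun s => v1 _ _ _ _) _ => exact V10
  | |- JS _ (fun s => v2 _ _ _ _) _ => exact V20
  | |- JS _ (fun s => w _ _ _ _) _ => exact W0
  end.
Qed.

Lemma ST_id I : open I -> ST I (fun t => t).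
Proof.
 intros HI n. assert (C : forall t x y z, c4 (fun t _ _ _ => t) t x y z) by (intros; apply c4_intro; cproj).
 destruct n; [split; [intros; apply C|easy]|].
 apply (Cn_step n I _ (fun d _ _ _ _ => match d with None => 1 | _ => 0 end)); [easy|intros; apply C| |intros d; now apply Cn_const].
 intros d t x y z Ht. destruct d as [[]|]; try apply (is_derive_const (K:=RA) (V:=RN)).
 apply (is_derive_id (K:=RA)).
Qed.

Lemma ST_pow I k : open I -> ST I (fun t => t ^ k).
Proof. intros HI. induction k; [exact (Sm_const I 1 HI)|]. apply (Sm_mult I (fun t _ _ _ => t) (fun t _ _ _ => t ^ k)); [easy|now apply ST_id|easy]. Qed.

Lemma Sm_Derive_n I f k : Sm I f -> Sm I (fun t x y z => Derive_n (fun s => f s x y z) k t).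
Proof. intros Hf. induction k; [exact Hf|]. exact (Sm_pdt I _ None IHk). Qed.

Lemma ST_ex_n I f k t : ST I f -> I t -> ex_derive_n f k t.
Proof.
 intros Hf Ht. destruct k; [easy|]. apply (ST_ex I (Derive_n f k) t); [|easy]. exact (Sm_Derive_n I (fun t _ _ _ => f t) k Hf).
Qed.

Lemma cpt_axpy c a U V x y z : cpt c (axpy a U V) x y z = a * cpt c U x y z + cpt c V x y z.
Proof. now destruct c. Qed.

Lemma cpt_dtn c U t n x y z : cpt c (dtn U t n) x y z = Derive_n (fun s => cpt c (U s) x y z) n t.
Proof. now destruct c. Qed.

(** If the recursive values are the true derivatives up to order [m], the polynomial [taylor_in n]
    has the jet of [U] up to order [n], and vanishing derivatives beyond. *)
Lemma taylor_jet P eps U0 U I m : nb I -> SmU I U -> (forall k, (k <= m)%nat -> dt_in P eps U0 k = dtn U 0 k) ->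
 forall n, (n <= m)%nat -> SmU I (taylor_in P eps U0 n) /\ forall c x y z j,
 Derive_n (fun s => cpt c (taylor_in P eps U0 n s) x y z) j 0 = if (j <=? n)%nat then Derive_n (fun s => cpt c (U s) x y z) j 0 else 0.
Proof.
 intros HI HU H. induction n; intros Hn.
 - assert (E : forall c x y z, cpt c U0 x y z = cpt c (U 0) x y z).
  { intros c x y z. change U0 with (dt_in P eps U0 0). rewrite (H 0%nat Hn), cpt_dtn. reflexivity. }
  split.
  + intros c. apply (Sm_ext I (fun _ => cpt c (U 0))); [apply HI|intros; symmetry; apply E|].
   apply (Sm_freeze I I (fun t => cpt c (U t)) 0); [apply HI|apply HU|apply HI].
  + intros c x y z j. cbn [taylor_in]. destruct j; [apply E|]. cbn [Nat.leb]. apply Derive_n_const.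
 - destruct (IHn ltac:(lia)) as [S1 D1]. set (g := fun c x y z => Derive_n (fun s => cpt c (U s) x y z) (S n) 0).
  assert (E : forall c s x y z, cpt c (taylor_in P eps U0 (S n) s) x y z = s ^ S n * / INR (fact (S n)) * g c x y z + cpt c (taylor_in P eps U0 n s) x y z).
  { intros c s x y z. cbn [taylor_in]. rewrite cpt_axpy. f_equal. unfold Rdiv. f_equal.
   change (dtn (fun s0 => CE_rhs P eps (taylor_in P eps U0 n s0)) 0 n) with (dt_in P eps U0 (S n)). rewrite (H (S n) Hn). apply cpt_dtn. }
  assert (Sp : ST I (fun s => s ^ S n * / INR (fact (S n)))).
  { apply (Sm_mult I (fun s _ _ _ => s ^ S n) (fun _ _ _ _ => / INR (fact (S n)))); [apply HI|apply ST_pow, HI|apply Sm_const, HI]. }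
  split.
  + intros c. apply (Sm_ext I (fun s x y z => s ^ S n * / INR (fact (S n)) * g c x y z + cpt c (taylor_in P eps U0 n s) x y z)); [apply HI|intros; symmetry; apply E|].
   apply Sm_plus; [apply HI| |apply S1]. apply (Sm_mult I (fun s _ _ _ => s ^ S n * / INR (fact (S n))) (fun _ => g c)); [apply HI|exact Sp|].
   exact (Sm_freeze I I _ 0 (proj1 HI) (Sm_Derive_n I (fun t => cpt c (U t)) (S n) (HU c)) (proj2 HI)).
  + intros c x y z j. rewrite (Derive_n_ext _ (fun s => s ^ S n * / INR (fact (S n)) * g c x y z + cpt c (taylor_in P eps U0 n s) x y z)) by (intros; apply E).
   destruct (proj1 HI 0 (proj2 HI)) as [d Hd].
   rewrite Derive_n_plus.
   * rewrite Derive_n_scal_r, Derive_n_scal_r, Derive_n_pow, D1. have F := INR_fact_neq_0.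
    destruct (le_dec j (S n)) as [L|L].
    -- destruct (Nat.eq_dec j (S n)) as [->|N].
     ++ rewrite (proj2 (Nat.leb_gt (S n) n)) by lia. rewrite Nat.leb_refl, Nat.sub_diag. change (INR (fact 0)) with 1. change (0 ^ 0) with 1. unfold g. field. apply F.
     ++ rewrite (proj2 (Nat.leb_le j n)), (proj2 (Nat.leb_le j (S n))) by lia. rewrite pow_i by lia. ring.
    -- rewrite (proj2 (Nat.leb_gt j n)), (proj2 (Nat.leb_gt j (S n))) by lia. ring.
   * exists d. intros s Hs k _. apply (ST_ex_n I); [|now apply Hd].
    apply (Sm_mult I (fun s _ _ _ => s ^ S n * / INR (fact (S n))) (fun _ _ _ _ => g c x y z)); [apply HI|exact Sp|apply Sm_const, HI].
   * exists d. intros s Hs k _. apply (ST_ex_n I); [|now apply Hd]. apply (Sm_point I (fun t => cpt c (taylor_in P eps U0 n t))); [apply HI|apply S1].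
Qed.

Lemma CE_solved P eps U t x y z : admissible P -> CE_at P eps U t x y z -> vartheta P eps (U t) x y z <> 0 ->
 forall c, dt (fun s => cpt c (U s)) t x y z = cpt c (CE_rhs P eps (U t)) x y z.
Proof.
 intros HP HC Hth c. unfold CE_at in HC. cbv zeta beta in HC. destruct HC as (C1 & C2 & C3 & C4 & C5). have PA := calA_pos P HP. have PB := calB_pos P HP.
 assert (Pn : 0 < Rpower eps (nu P)) by apply exp_pos.
 destruct c; cbn [cpt CE_rhs q h v1 v2 w].
 - apply (Rmult_eq_reg_l (calA P)); [|lra].
  match type of C1 with calA P * (?d + ?a) + ?D = ?r => replace (calA P * d) with (r - D - calA P * a) by (rewrite <- C1; ring) end.
  rewrite (Rmult_plus_distr_l (calA P)), <- (Rmult_assoc (calA P) (/ calA P)), Rinv_r, Rmult_1_l by lra. ring.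
 - apply (Rmult_eq_reg_l (calB P)); [|lra].
  match type of C2 with calB P * (?d + ?a) - ?D = ?r => replace (calB P * d) with (r + D - calB P * a) by (rewrite <- C2; ring) end.
  rewrite (Rmult_plus_distr_l (calB P)), <- (Rmult_assoc (calB P) (/ calB P)), Rinv_r, Rmult_1_l by lra. ring.
 - apply (Rmult_eq_reg_l (vartheta P eps (U t) x y z)); [|easy].
  match type of C3 with ?th * (?d + ?a) + ?D = 0 => replace (th * d) with (- D - th * a) by lra; generalize D; intros DD end. field. easy.
 - apply (Rmult_eq_reg_l (vartheta P eps (U t) x y z)); [|easy].
  match type of C4 with ?th * (?d + ?a) + ?D = 0 => replace (th * d) with (- D - th * a) by lra; generalize D; intros DD end. field. easy.
 - apply (Rmult_eq_reg_l (vartheta P eps (U t) x y z)); [|easy].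
  match type of C5 with ?th * (?d + ?a) + ?D + ?D' = 0 => replace (th * d) with (- D - D' - th * a) by lra; generalize D D'; intros DD DD' end. field. easy.
Qed.

Lemma open_time delta T : open (fun t => - delta < t /\ Rbar_lt t T).
Proof. apply open_and; [apply open_gt|]. apply open_Rbar_lt. Qed.

Lemma solution_SmU P eps U0 T U : smooth_solution P eps U0 T U -> exists delta, 0 < delta /\ SmU (fun t => - delta < t /\ Rbar_lt t T) U.
Proof.
 intros (_ & (d & Pd & H) & _). exists d. split; [easy|]. intros c. apply smooth_on_Sm. apply H. destruct c; cbn [cpt In]; tauto.
Qed.

(** Induction on the order. The Taylor polynomial has the jet of the solution up to order [m], hence
    so have the right-hand sides; the equation turns the latter into the derivative of order
    [m + 1], [J_one_sided] bridging its validity for [t >= 0] only. *)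
Lemma dt_in_eq P eps U0 T U : admissible P -> smooth_solution P eps U0 T U ->
 (forall x y z, vartheta P eps U0 x y z <> 0) -> dt_in P eps U0 = dtn U 0.
Proof.
 intros HP HS Hth. destruct (solution_SmU _ _ _ _ _ HS) as [d [Pd HU]]. destruct HS as (PT & _ & Heq & HU0).
 set (I := fun t => - d < t /\ Rbar_lt t T) in *.
 assert (HI : nb I) by (split; [apply open_time|split; [lra|easy]]).
 assert (main : forall m k, (k <= m)%nat -> dt_in P eps U0 k = dtn U 0 k).
 { induction m; intros k Hk.
  - assert (k = 0)%nat as -> by lia. apply state_ext. intros c x y z. rewrite cpt_dtn. cbn [dt_in Derive_n]. now rewrite HU0.
  - destruct (Nat.eq_dec k (S m)) as [->|N]; [|apply IHm; lia].
   destruct (taylor_jet P eps U0 U I m HI HU IHm m (le_n m)) as [ST1 DT].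
   apply state_ext. intros c x y z. rewrite cpt_dtn, Derive_n_S. cbn [dt_in]. rewrite cpt_dtn.
   assert (HJ : JS m (fun s => cpt c (CE_rhs P eps (U s)) x y z) (fun s => cpt c (CE_rhs P eps (taylor_in P eps U0 m s)) x y z)).
   { apply (CE_rhs_JS P eps m I); [easy|easy|easy| |rewrite HU0; apply Hth].
    intros c' x' y' z' j Hj. rewrite DT. now rewrite (proj2 (Nat.leb_le j m)). }
   destruct HJ as (I' & HI' & S1 & S2 & HJ). rewrite <- (HJ m (le_n m)). symmetry.
   assert (Nth : exists e, 0 < e /\ forall t, oi (- e) e t -> vartheta P eps (U t) x y z <> 0).
   { assert (Q : continuous (fun t => vartheta P eps (U t) x y z) 0).
    { unfold vartheta. apply (continuous_plus (V:=RN)); [apply continuous_const|]. apply (continuous_mult (K:=RA)); [apply continuous_const|].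
     apply continuous_of_ex_derive. exact (Sm_ex I _ None (HU cH) 0 x y z (proj2 HI)). }
    apply (nonzero_near _ Q). rewrite HU0. apply Hth. }
   destruct Nth as [e [Pe Ne]].
   set (K := fun t => (I t /\ I' t) /\ oi (- e) e t).
   assert (HK : nb K) by (apply nb_and; [now apply nb_and|split; [apply open_oi|unfold oi; lra]]).
   apply (J_one_sided K HK m (Derive (fun s => cpt c (U s) x y z)) (fun s => cpt c (CE_rhs P eps (U s)) x y z)); [| | |apply le_n].
   + apply ST_derive. apply (ST_sub I K); [unfold K; tauto|]. apply (Sm_point I (fun t => cpt c (U t))); [apply HI|apply HU].
   + apply (ST_sub I' K); [unfold K; tauto|easy].
   + intros t [[It It'] Et] Pt. apply (CE_solved P eps U t x y z HP); [|now apply Ne].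
    destruct (Heq t Pt (proj2 It)) as (_ & _ & _ & _ & _ & _ & Q). apply Q. }
 extensionality n. now apply (main n).
Qed.

(** * Comparison of the energy with the Sobolev norms *)

Lemma mixed_second {a b} t i j (u : fld a b) : oi a b t ->
 2 * nrm2 t (fder (Some i) (fder (Some j) u)) <= nrm2 t (fder (Some i) (fder (Some i) u)) + nrm2 t (fder (Some j) (fder (Some j) u)).
Proof.
 (* Two integrations by parts turn the squared norm of the mixed derivative into the pairing of the
    two pure ones. *)
 intros Ht. assert (E : nrm2 t (fder (Some i) (fder (Some j) u)) = Iint t (fder (Some i) (fder (Some i) u) * fder (Some j) (fder (Some j) u))%fld).
 { Transparent nrm2. unfold nrm2 at 1. Opaque nrm2. rewrite Iint_parts by easy.
  rewrite (fder_comm (Some i) (Some j) u), (fder_comm (Some i) (Some j) (fder (Some i) u)), fmul_comm, Iint_parts by easy. ring. }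
 rewrite E. etr; [apply Rmult_le_compat_l; [lra|apply Rle_abs]|]. now apply Iint_young.
Qed.

(** The words that occur in [energy]: powers of a single spatial derivative applied to weighted time
    derivatives. *)
Definition pure {a b} (e : R) (n m : nat) (d : axis) (f : fld a b) : fld a b :=
 Nat.iter m (fder (Some d)) (Nat.iter n (Zd e None) f).

Definition ax3 (F : axis -> R) : R := F AxX + F AxY + F AxZ.

Definition PS {a b} (e t : R) (f : fld a b) : R :=
 sum_f_R0 (fun n => sum_f_R0 (fun m => ax3 (fun d => nrm2 t (pure e n m d f))) (3 - n)) 3.

Lemma sum_term F n k : (forall j, 0 <= F j) -> (k <= n)%nat -> F k <= sum_f_R0 F n.
Proof.
 intros HF. induction n; intros Hk; [assert (k = 0)%nat as -> by lia; apply Rle_refl|]. cbn [sum_f_R0].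
 destruct (Nat.eq_dec k (S n)) as [->|N]; [have Q := cond_pos_sum F n HF|have Q := IHn ltac:(lia); have Q' := HF (S n)]; lra.
Qed.

Lemma ax3_term F d : (forall d, 0 <= F d) -> F d <= ax3 F.
Proof. intros H. unfold ax3. have A := H AxX. have B := H AxY. have C := H AxZ. destruct d; lra. Qed.

Lemma PS_term {a b} e t n m (f : fld a b) : oi a b t -> (n + m <= 3)%nat -> ax3 (fun d => nrm2 t (pure e n m d f)) <= PS e t f.
Proof.
 intros Ht H. assert (P0 : forall n m, 0 <= ax3 (fun d => nrm2 t (pure e n m d f))).
 { intros n' m'. unfold ax3. have Q := fun d => nrm2_nonneg t (pure e n' m' d f) Ht. have A := Q AxX. have B := Q AxY. have C := Q AxZ. lra. }
 etr; [|apply (sum_term (fun n => sum_f_R0 (fun m => ax3 (fun d => nrm2 t (pure e n m d f))) (3 - n)) 3 n)].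
 - apply (sum_term (fun m => ax3 (fun d => nrm2 t (pure e n m d f))) (3 - n) m); [apply P0|lia].
 - intros n'. apply cond_pos_sum. apply P0.
 - lia.
Qed.

(** Only words with two different spatial letters need an argument; [mixed_second] reduces them to
    pure ones, after the time letters have been moved inside. *)
Lemma word_pure {a b} e t l (f : fld a b) : oi a b t -> (length l <= 3)%nat -> nrm2 t (Zw e l f) <= 2 * PS e t f.
Proof.
 intros Ht Hl. assert (nn : forall u : fld a b, 0 <= nrm2 t u) by (intros; now apply nrm2_nonneg).
 assert (T : forall n m d, (n + m <= 3)%nat -> nrm2 t (pure e n m d f) <= PS e t f).
 { intros n m d H. etr; [|now apply (PS_term e t n m)]. apply (ax3_term (fun d => nrm2 t (pure e n m d f))). intros; apply nn. }
 assert (PP : 0 <= PS e t f) by (etr; [apply nn|apply (T 0%nat 0%nat AxX); lia]).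
 assert (T2 : forall n i j, (n + 2 <= 3)%nat -> nrm2 t (fder (Some i) (fder (Some j) (Nat.iter n (Zd e None) f))) <= 2 * PS e t f).
 { intros n i j H. have Q := mixed_second t i j (Nat.iter n (Zd e None) f) Ht. have Qi := T n 2%nat i H. have Qj := T n 2%nat j H.
  unfold pure in Qi, Qj. cbn [Nat.iter nat_rect] in Qi, Qj. lra. }
 assert (T3 : forall i j k, nrm2 t (fder (Some i) (fder (Some j) (fder (Some k) f))) <= 2 * PS e t f).
 (* At order 3 two inequalities are coupled: the [iij] norm is bounded by the [iii] and [jji] norms,
    and the latter by the [jjj] and [iij] norms. The factor 2 on the left lets the unknowns be
    absorbed. Three different letters then reduce to this case. *)
 { assert (D : forall i j, nrm2 t (fder (Some i) (fder (Some i) (fder (Some j) f))) <= ax3 (fun d => nrm2 t (pure e 0 3 d f)) + nrm2 t (pure e 0 3 j f)).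
  { intros i j. have Q1 := mixed_second t i j (fder (Some i) f) Ht. have Q2 := mixed_second t j i (fder (Some j) f) Ht.
   rewrite (fder_comm (Some j) (Some i) f) in Q1.
   assert (A : nrm2 t (pure e 0 3 i f) <= ax3 (fun d => nrm2 t (pure e 0 3 d f))) by exact (ax3_term (fun d => nrm2 t (pure e 0 3 d f)) i (fun d => nn _)).
   change (pure e 0 3 j f) with (fder (Some j) (fder (Some j) (fder (Some j) f))).
   change (pure e 0 3 i f) with (fder (Some i) (fder (Some i) (fder (Some i) f))) in A.
   have N1 := nn (fder (Some j) (fder (Some j) (fder (Some j) f))). have N2 := nn (fder (Some i) (fder (Some i) (fder (Some i) f))). lra. }
  intros i j k. rewrite (fder_comm (Some j) (Some k) f). have Q := mixed_second t i k (fder (Some j) f) Ht.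
  have Q1 := D i j. have Q2 := D k j. have Q3 := T 0%nat 3%nat j ltac:(lia). have Q4 := PS_term e t 0 3 f Ht ltac:(lia). lra. }
 assert (T1 : forall n m d, (n + m <= 3)%nat -> nrm2 t (pure e n m d f) <= 2 * PS e t f) by (intros n m d H; have Q := T n m d H; lra).
 destruct l as [|d1 [|d2 [|d3 [|d4 l]]]]; [| | | |cbn [length] in Hl; lia]; rewrite ?Zw_cons; change (Zw e nil f) with f.
 - apply (T1 0%nat 0%nat AxX). lia.
 - destruct d1 as [i|]; [apply (T1 0%nat 1%nat i); lia|apply (T1 1%nat 0%nat AxX); lia].
 - destruct d1 as [i|], d2 as [j|]; rewrite ?Zd_Some, ?Z_der.
  + apply (T2 0%nat i j). lia.
  + apply (T1 1%nat 1%nat i). lia.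
  + apply (T1 1%nat 1%nat j). lia.
  + apply (T1 2%nat 0%nat AxX). lia.
 - destruct d1 as [i|], d2 as [j|], d3 as [k|]; rewrite ?Zd_Some, ?Z_der.
  + apply T3.
  + apply (T2 1%nat i j). lia.
  + apply (T2 1%nat i k). lia.
  + apply (T1 2%nat 1%nat i). lia.
  + apply (T2 1%nat j k). lia.
  + apply (T1 2%nat 1%nat j). lia.
  + apply (T1 2%nat 1%nat k). lia.
  + apply (T1 3%nat 0%nat AxX). lia.
Qed.

Lemma N_PS : exists m, 0 <= m /\ forall a b e t (f : fld a b), oi a b t -> Nk e 3 t f <= m * PS e t f.
Proof.
 destruct (SW_const 3 1) as [m [Hm Em]]. exists (2 * m). split; [lra|]. intros a b e t f Ht.
 apply Rle_trans with (SW 3 (fun _ => 2 * PS e t f * 1)); [|rewrite SW_scal, Em; lra].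
 Transparent Nk. unfold Nk. Opaque Nk. apply SW_le. intros l Hl. rewrite Rmult_1_r. now apply word_pure.
Qed.

Lemma iter_word {a b} e n m d (f : fld a b) : exists l, length l = (n + m)%nat /\ pure e n m d f = Zw e l f.
Proof.
 unfold pure. induction m.
 - rewrite Nat.add_0_r. induction n as [|n [l [Ll El]]]; [now exists nil|]. exists (None :: l). split; [cbn [length]; lia|].
  rewrite Zw_cons, <- El. reflexivity.
 - destruct IHm as [l [Ll El]]. exists (Some d :: l). split; [cbn [length]; lia|]. rewrite Zw_cons, <- El. reflexivity.
Qed.

Lemma PS_N {a b} e t (f : fld a b) : oi a b t -> PS e t f <= 30 * Nk e 3 t f.
Proof.
 intros Ht. assert (B : forall n m d, (n + m <= 3)%nat -> nrm2 t (pure e n m d f) <= Nk e 3 t f).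
 { intros n m d H. destruct (iter_word e n m d f) as [l [Ll ->]]. apply N_word; [easy|lia]. }
 assert (B3 : forall n m, (n + m <= 3)%nat -> ax3 (fun d => nrm2 t (pure e n m d f)) <= 3 * Nk e 3 t f).
 { intros n m H. unfold ax3. have Q1 := B n m AxX H. have Q2 := B n m AxY H. have Q3 := B n m AxZ H. lra. }
 unfold PS. cbn [sum_f_R0 Nat.sub].
 have A00 := B3 0%nat 0%nat ltac:(lia). have A01 := B3 0%nat 1%nat ltac:(lia). have A02 := B3 0%nat 2%nat ltac:(lia). have A03 := B3 0%nat 3%nat ltac:(lia).
 have A10 := B3 1%nat 0%nat ltac:(lia). have A11 := B3 1%nat 1%nat ltac:(lia). have A12 := B3 1%nat 2%nat ltac:(lia).
 have A20 := B3 2%nat 0%nat ltac:(lia). have A21 := B3 2%nat 1%nat ltac:(lia). have A30 := B3 3%nat 0%nat ltac:(lia). lra.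
Qed.

Lemma pure_at {a b} e n m d (f : fld a b) (A : tfield) t : oi a b t -> (forall s x y z, oi a b s -> f s x y z = A s x y z) ->
 pure e n m d f t = Nat.iter m (pd d) (fun x y z => e ^ n * Derive_n (fun s => A s x y z) n t).
Proof.
 intros Ht HA. unfold pure. induction m.
 - cbn [Nat.iter nat_rect]. ext3 x y z. revert t Ht. induction n; intros t Ht.
  + cbn [Nat.iter nat_rect pow Derive_n]. rewrite HA by easy. ring.
  + cbn [Nat.iter nat_rect]. set (g := nat_rect _ f (fun _ => Zd e None) n) in *.
   Transparent Zd. unfold Zd. Opaque Zd. rewrite fscal_at, fder_at by easy. cbn [pdt Derive_n]. unfold dt.
   rewrite (Derive_ext_loc _ (fun s => e ^ n * Derive_n (fun s => A s x y z) n s)).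
   * rewrite Derive_scal. cbn [pow]. ring.
   * destruct (open_oi a b t Ht) as [dl Hdl]. exists dl. intros s Hs. apply IHn. now apply Hdl.
 - change (Nat.iter (S m) (pd d) (fun x y z => e ^ n * Derive_n (fun s => A s x y z) n t))
   with (pd d (Nat.iter m (pd d) (fun x y z => e ^ n * Derive_n (fun s => A s x y z) n t))).
  rewrite <- IHm. change (Nat.iter (S m) (fder (Some d)) (Nat.iter n (Zd e None) f)) with (fder (Some d) (Nat.iter m (fder (Some d)) (Nat.iter n (Zd e None) f))).
  symmetry. now apply fld_pd.
Qed.

Lemma L2sq_nrm2 {a b} t (f : fld a b) : L2sq (f t) = nrm2 t f.
Proof. rewrite nrm2_I3. Transparent I3. unfold I3. Opaque I3. reflexivity. Qed.

Lemma sqrt_sum A B : 0 <= A -> 0 <= B -> A + B <= (sqrt A + sqrt B) ^ 2 <= 2 * (A + B).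
Proof.
 intros HA HB. have P1 := sqrt_pos A. have P2 := sqrt_pos B. have E1 := sqrt_sqrt A HA. have E2 := sqrt_sqrt B HB.
 have Q := pow2_ge_0 (sqrt A - sqrt B). split; nra.
Qed.

Lemma sumc_sum (F : cmp -> nat -> R) n : sumc (fun c => sum_f_R0 (F c) n) = sum_f_R0 (fun k => sumc (fun c => F c k)) n.
Proof. induction n; [reflexivity|]. cbn [sum_f_R0]. rewrite <- IHn. unfold sumc. ring. Qed.

Lemma energy_PS {a b} eps sigma (F : cmp -> fld a b) U t : oi a b t ->
 (forall c s x y z, oi a b s -> F c s x y z = cpt c (U s) x y z) ->
 sumc (fun c => PS (Rpower eps sigma) t (F c)) <= energy eps sigma (dtn U t) <= 2 * sumc (fun c => PS (Rpower eps sigma) t (F c)).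
Proof.
 intros Ht HF. set (e := Rpower eps sigma).
 assert (E : sumc (fun c => PS e t (F c)) = sum_f_R0 (fun n => sum_f_R0 (fun m => ax3 (fun d => sumc (fun c => nrm2 t (pure e n m d (F c))))) (3 - n)) 3).
 { unfold PS. rewrite sumc_sum. apply sum_eq. intros n Hn. rewrite sumc_sum. apply sum_eq. intros m Hm. unfold ax3, sumc. ring. }
 rewrite E.
 set (tm := fun n m d => (L2 (pure e n m d (F cQ) t) + L2 (pure e n m d (F cH) t)) ^ 2 + (L2_vec (pure e n m d (F cV1) t) (pure e n m d (F cV2) t) + L2 (pure e n m d (F cW) t)) ^ 2).
 assert (E2 : energy eps sigma (dtn U t) = sum_f_R0 (fun n => sum_f_R0 (fun m => ax3 (tm n m)) (3 - n)) 3).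
 { unfold energy. apply sum_eq. intros n Hn. apply sum_eq. intros m Hm. unfold ax3, tm.
  rewrite !(fun d c => pure_at e n m d (F c) (fun t => cpt c (U t)) t Ht (HF c)). reflexivity. }
 assert (B : forall n m d, sumc (fun c => nrm2 t (pure e n m d (F c))) <= tm n m d <= 2 * sumc (fun c => nrm2 t (pure e n m d (F c)))).
 { intros n m d. unfold tm, L2, L2_vec. rewrite !L2sq_nrm2. have N := fun c => nrm2_nonneg t (pure e n m d (F c)) Ht.
  have S1 := sqrt_sum _ _ (N cQ) (N cH). have S2 := sqrt_sum _ _ (Rplus_le_le_0_compat _ _ (N cV1) (N cV2)) (N cW). unfold sumc. lra. }
 rewrite E2. split.
 - apply sum_Rle. intros n Hn. apply sum_Rle. intros m Hm. unfold ax3. have Q1 := B n m AxX. have Q2 := B n m AxY. have Q3 := B n m AxZ. lra.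
 - rewrite scal_sum. apply sum_Rle. intros n Hn. rewrite Rmult_comm, scal_sum. apply sum_Rle. intros m Hm. unfold ax3. have Q1 := B n m AxX. have Q2 := B n m AxY. have Q3 := B n m AxZ. lra.
Qed.

Lemma energy_N : exists Cc, 0 < Cc /\ forall a b eps sigma (F : cmp -> fld a b) U t, oi a b t ->
 (forall c s x y z, oi a b s -> F c s x y z = cpt c (U s) x y z) ->
 NS (Rpower eps sigma) 3 t F <= Cc * energy eps sigma (dtn U t) /\ energy eps sigma (dtn U t) <= Cc * NS (Rpower eps sigma) 3 t F.
Proof.
 destruct N_PS as [m [Pm Hm]]. exists (m + 60). split; [lra|]. intros a b eps sigma F U t Ht HF.
 destruct (energy_PS eps sigma F U t Ht HF) as [E1 E2]. set (e := Rpower eps sigma) in *.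
 assert (Q1 : NS e 3 t F <= m * sumc (fun c => PS e t (F c))) by (unfold NS; rewrite <- sumc_scal; apply sumc_le; intros; now apply Hm).
 assert (Q2 : sumc (fun c => PS e t (F c)) <= 30 * NS e 3 t F) by (unfold NS; rewrite <- sumc_scal; apply sumc_le; intros; now apply PS_N).
 have Q3 := NS_nonneg e 3 t F Ht. assert (Q4 : 0 <= m * NS e 3 t F) by now apply Rmult_le_pos.
 assert (Q5 : m * sumc (fun c => PS e t (F c)) <= m * energy eps sigma (dtn U t)) by (apply Rmult_le_compat_l; lra).
 assert (Q6 : 0 <= sumc (fun c => PS e t (F c))).
 { unfold sumc. assert (Z : forall c, 0 <= PS e t (F c)).
  { intros c. etr; [apply (nrm2_nonneg t (pure e 0 0 AxX (F c)) Ht)|]. etr; [|apply (PS_term e t 0 0 (F c) Ht); lia].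
   apply (ax3_term (fun d => nrm2 t (pure e 0 0 d (F c)))). intros; now apply nrm2_nonneg. }
  have z1 := Z cQ. have z2 := Z cH. have z3 := Z cV1. have z4 := Z cV2. have z5 := Z cW. lra. }
 split; lra.
Qed.

Lemma continuous_sum (F : nat -> R -> R) n t : (forall k, continuous (F k) t) -> continuous (fun s => sum_f_R0 (fun k => F k s) n) t.
Proof.
 intros H. induction n; [apply H|]. cbn [sum_f_R0]. apply (continuous_plus (V:=RN)); [exact IHn|apply H].
Qed.

Lemma energy_continuous I U eps sigma t : open I -> SmU I U -> I t -> continuous (fun s => energy eps sigma (dtn U s)) t.
Proof.
 intros HI HU Ht. set (e := Rpower eps sigma).
 set (D := fun (n m : nat) d c s => Nat.iter m (pd d) (fun x y z => e ^ n * Derive_n (fun r => cpt c (U r) x y z) n s)).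
 assert (SD : forall n m d c, Sm I (D n m d c)).
 { intros n m d c. unfold D. induction m.
  - apply (Sm_mult I (fun _ _ _ _ => e ^ n)); [easy|now apply Sm_const|]. exact (Sm_Derive_n I (fun t => cpt c (U t)) n (HU c)).
  - exact (Sm_pdt I _ (Some d) IHm). }
 assert (CS : forall n m d c, continuous (fun s => L2sq (D n m d c s)) t).
 { intros n m d c. have Q := I3_continuous I (fun s x y z => D n m d c s x y z * D n m d c s x y z) HI.
  apply (continuous_ext (fun s => I3 (fun x y z => D n m d c s x y z * D n m d c s x y z))).
  - intros s. transitivity (I3 (fun x y z => D n m d c s x y z ^ 2)); [f_equal; ext3 x y z; ring|].
   Transparent I3. unfold I3. Opaque I3. reflexivity.
  - apply Q; [|easy]. intros; apply c4_mult; now apply (Sm_c4 I). }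
 assert (CL : forall n m d c, continuous (fun s => L2 (D n m d c s)) t) by (intros; unfold L2; apply continuous_sqrt_comp, CS).
 assert (CP : forall f g : R -> R, continuous f t -> continuous g t -> continuous (fun s => (f s + g s) ^ 2) t).
 { intros f g Hf Hg. have Q := continuous_plus (V:=RN) f g t Hf Hg.
  apply (continuous_ext (fun s => (f s + g s) * (f s + g s))); [intros s; cbn [pow]; now rewrite Rmult_1_r|]. exact (continuous_mult (K:=RA) _ _ t Q Q). }
 assert (T : forall n m d, continuous (fun s => (L2 (D n m d cQ s) + L2 (D n m d cH s)) ^ 2 + (L2_vec (D n m d cV1 s) (D n m d cV2 s) + L2 (D n m d cW s)) ^ 2) t).
 { intros n m d. apply (continuous_plus (V:=RN)); apply CP; [apply CL|apply CL| |apply CL].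
  unfold L2_vec. apply continuous_sqrt_comp. apply (continuous_plus (V:=RN)); apply CS. }
 unfold energy. apply (continuous_sum (fun n s => sum_f_R0 _ (3 - n))). intros n. apply (continuous_sum (fun m s => _)). intros m.
 apply (continuous_plus (V:=RN)); [apply (continuous_plus (V:=RN))|]; apply (T n m).
Qed.

(** * The uniform bound and continuation *)

Lemma Rpower_decr eps p r : 0 < eps < 1 -> p <= r -> Rpower eps r <= Rpower eps p.
Proof.
 intros He H. unfold Rpower. apply exp_le. assert (L : ln eps < 0) by (rewrite <- ln_1; apply ln_increasing; lra). nra.
Qed.

Lemma le_at_end (g : R -> R) r M : 0 < r -> continuous g r -> (forall s, 0 < s < r -> g s <= M) -> g r <= M.
Proof.
 intros Hr Hc H. destruct (Rle_dec (g r) M) as [L|L]; [easy|exfalso].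
 assert (Pd : 0 < g r - M) by lra. destruct (Hc (ball (g r) (mkposreal _ Pd))) as [d Hd]; [now exists (mkposreal _ Pd)|].
 set (s := r - Rmin r d / 2). have M1 := Rmin_l r d. have M2 := Rmin_r r d. have M3 := Rmin_glb_lt r d 0 Hr (cond_pos d).
 assert (Q : ball (g r) (mkposreal _ Pd) (g s)).
 { apply Hd. apply R_ball. apply Rabs_def1; unfold s; lra. }
 apply ball_R in Q; cbn [pos] in Q. apply Rabs_def2 in Q.
 have Q' := H s ltac:(unfold s; lra). lra.
Qed.

Section Apriori.
Context (P : params) (HP : admissible P).
Local Notation thw := (thW P HP). Local Notation aw := (aW P HP). Local Notation mw := (mW P HP). Local Notation lam := (Lam P HP).

Definition repr {a b} (F : cmp -> fld a b) (U : R -> state) : Prop := forall c s x y z, oi a b s -> F c s x y z = cpt c (U s) x y z.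

Lemma repr_der {a b} (F : cmp -> fld a b) U c d t x y z : repr F U -> oi a b t ->
 fder d (F c) t x y z = pdt d (fun s => cpt c (U s)) t x y z.
Proof. intros H Ht. rewrite fder_at by easy. apply (pdt_ext (oi a b)); [apply open_oi|intros; now apply H|easy]. Qed.

Lemma repr_th {a b} (F : cmp -> fld a b) U eps t x y z : repr F U -> oi a b t -> thw eps F t x y z = vartheta P eps (U t) x y z.
Proof. intros H Ht. rewrite thW_at, H by easy. reflexivity. Qed.

Lemma repr_a {a b} (F : cmp -> fld a b) U eps t x y z : repr F U -> oi a b t ->
 aw eps F t x y z = 1 + eps * / varpi0 P * (q (U t) x y z - Phi P eps z).
Proof. intros H Ht. rewrite aW_at, H by easy. reflexivity. Qed.

Lemma Lam_rhs {a b} (F : cmp -> fld a b) U eps kap t x y z c : 0 < eps -> 0 < kap -> repr F U -> ge0 kap (thw eps F) -> oi a b t ->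
 lam 0 eps F F c t x y z = cpt c (CE_rhs P eps (U t)) x y z.
Proof.
 intros He Hk HF Hth Ht. have PA := calA_pos P HP. have PB := calB_pos P HP. have Pv := varpi0_pos P HP.
 assert (Pn : 0 < Rpower eps (nu P)) by apply exp_pos.
 assert (Hi : finv (thw eps F) t x y z = / vartheta P eps (U t) x y z) by (rewrite finv_at by (apply (ge0_neq kap); easy); now rewrite (repr_th F U)).
 assert (Nv : vartheta P eps (U t) x y z <> 0) by (rewrite <- (repr_th F U) by easy; now apply (ge0_neq kap)).
 assert (HD : forall c i, Dh 0 i (F c) t x y z = pd i (cpt c (U t)) x y z) by (intros c' i; rewrite Dh_0; now apply (repr_der F U c' (Some i))).
 assert (Hadv : forall c, adv 0 F (F c) t x y z = advect (U t) (cpt c (U t)) x y z).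
 { intros c'. unfold adv, sum3, advect. fat. rewrite !HD, !HF by easy. reflexivity. }
 destruct c; cbn [Lam cpt CE_rhs q h v1 v2 w]; fat; rewrite ?Hi, ?Hadv, ?HD; cbn [cpt].
 - unfold sum3. fat. rewrite !HD. unfold gW, bbW, pW, phiF, fG, fHb, fIG, fIH, Phi, divergence. fat. rewrite !fzf_at, !HF by easy. cbn [cpt vel]. field. lra.
 - unfold fGt. rewrite fzf_at, !HF by easy. cbn [cpt]. field. lra.
 - ring.
 - ring.
 - rewrite !HF by easy. cbn [cpt]. ring.
Qed.

Lemma CE_of_rhs eps U t x y z : vartheta P eps (U t) x y z <> 0 ->
 (forall c, dt (fun s => cpt c (U s)) t x y z = cpt c (CE_rhs P eps (U t)) x y z) -> CE_at P eps U t x y z.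
Proof.
 intros Hth H. have PA := calA_pos P HP. have PB := calB_pos P HP.
 have H1 := H cQ. have H2 := H cH. have H3 := H cV1. have H4 := H cV2. have H5 := H cW. cbn [cpt CE_rhs q h v1 v2 w] in *.
 assert (IA : forall X, calA P * (/ calA P * X) = X) by (intros; field; lra).
 assert (IB : forall X, calB P * (/ calB P * X) = X) by (intros; field; lra).
 assert (IT : forall X, vartheta P eps (U t) x y z * (/ vartheta P eps (U t) x y z * X) = X) by (intros; field; easy).
 unfold CE_at. cbv zeta beta. rewrite H1, H2, H3, H4, H5. set (th := vartheta P eps (U t) x y z) in *.
 split; [|split; [|split; [|split]]].
 - match goal with |- calA P * (- ?a + / calA P * ?X + ?a) + _ = _ => replace (calA P * (- a + / calA P * X + a)) with X by (rewrite <- (IA X) at 1; ring) end. ring.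
 - match goal with |- calB P * (- ?a + / calB P * ?X + ?a) - _ = _ => replace (calB P * (- a + / calB P * X + a)) with X by (rewrite <- (IB X) at 1; ring) end. ring.
 - match goal with |- th * (- ?a - / th * ?X + ?a) + _ = 0 => replace (th * (- a - / th * X + a)) with (- X) by (rewrite <- (IT X) at 1; ring) end. ring.
 - match goal with |- th * (- ?a - / th * ?X + ?a) + _ = 0 => replace (th * (- a - / th * X + a)) with (- X) by (rewrite <- (IT X) at 1; ring) end. ring.
 - match goal with |- th * (- ?a - / th * ?X + ?a) + _ + _ = 0 => replace (th * (- a - / th * X + a)) with (- X) by (rewrite <- (IT X) at 1; ring) end. ring.
Qed.

Lemma solution_repr eps U0 T U (r : R) : smooth_solution P eps U0 T U -> Rbar_le r T -> exists F : cmp -> fld 0 r, repr F U.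
Proof.
 intros HS Hr. destruct (solution_SmU _ _ _ _ _ HS) as [d [Pd HU]]. destruct HS as (_ & _ & Heq & _).
 assert (It : forall t, oi 0 r t -> Rbar_lt t T).
 { intros t Ht. apply Rbar_lt_le_trans with (Finite r); [exact (proj2 Ht)|exact Hr]. }
 assert (SF : forall c, Sm (oi 0 r) (fun t => cpt c (U t))).
 { intros c. apply smooth_on_Sm. have Q := proj2 (smooth_on_Sm _ _) (HU c). intros l t x y z Ht. apply Q. split; [unfold oi in Ht; lra|now apply It]. }
 assert (PF : forall c t, oi 0 r t -> periodic (cpt c (U t))).
 { intros c t Ht. destruct (Heq t ltac:(unfold oi in Ht; lra) (It t Ht)) as [Q _]. apply Q. destruct c; cbn [cpt In]; tauto. }
 exists (fun c => mkfld 0 r (fun t => cpt c (U t)) (SF c) (PF c)). intros c s x y z Hs. now rewrite mkfld_at.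
Qed.

Lemma solution_Lam eps U0 T U (r : R) (F : cmp -> fld 0 r) kap : 0 < eps -> 0 < kap -> smooth_solution P eps U0 T U -> Rbar_le r T -> repr F U ->
 ge0 kap (thw eps F) -> forall c, fder None (F c) = lam 0 eps F F c.
Proof.
 intros He Hk HS Hr HF Hth c. apply fld_eq. intros t x y z Ht. rewrite (Lam_rhs F U eps kap) by easy.
 rewrite (repr_der F U c None) by easy. apply (CE_solved P eps U t x y z HP).
 - destruct HS as (_ & _ & Heq & _). destruct (Heq t ltac:(unfold oi in Ht; lra)) as (_ & _ & _ & _ & _ & _ & Q); [|apply Q].
  apply Rbar_lt_le_trans with (Finite r); [exact (proj2 Ht)|exact Hr].
 - rewrite <- (repr_th F U) by easy. now apply (ge0_neq kap).
Qed.

(** The norm controls only [e = eps^sigma] times the time derivative. But [q] and [h] enter the two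
    coefficients with the factors [eps] and [eps^(mu + nu)], both at most [e] since
    [sigma <= mu < 1]; so the coefficients vary at a rate independent of [eps]. Increments are taken
    from time 0 on [U] itself, [F] being defined after 0 only. *)
Lemma hyperbolic_persists M1 sigma kappa : 0 <= M1 -> sigma <= mu P -> exists K, 0 <= K /\
 forall eps U0 T U (r : R) (F : cmp -> fld 0 r), 0 < eps < 1 -> smooth_solution P eps U0 T U -> Rbar_le r T -> repr F U ->
 uniformly_hyperbolic P eps kappa U0 -> (forall s, oi 0 r s -> NS (Rpower eps sigma) 3 s F <= M1) ->
 forall s x y z, oi 0 r s -> kappa - K * s <= aw eps F s x y z /\ kappa - K * s <= thw eps F s x y z.
Proof.
 intros HM1 Hsig. have Pv := varpi0_pos P HP. assert (Piv : 0 < / varpi0 P) by now apply Rinv_0_lt_compat.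
 assert (PS : forall x, 0 <= sq x) by (intros; apply sqrt_pos).
 set (S1 := sq M1). set (G0 := sq (Kzf 3 (Gt P))). have PS1 := PS M1. fold S1 in PS1. have PG := PS (Kzf 3 (Gt P)). fold G0 in PG.
 assert (P1 : 0 <= / varpi0 P * S1) by (apply Rmult_le_pos; lra). assert (P2 : 0 <= G0 * S1) by now apply Rmult_le_pos.
 exists (/ varpi0 P * S1 + G0 * S1). split; [lra|].
 intros eps U0 T U r F He HS Hr HF Hh HN s x y z Hs. set (e := Rpower eps sigma) in *. assert (Pe : 0 < e) by apply exp_pos.
 have Hmu := mu_pos P HP. have Hnu := nu_pos P HP. assert (Mu : mu P = 1 - 2 * nu P) by easy.
 destruct (solution_SmU _ _ _ _ _ HS) as [d [Pd HU]]. destruct HS as (PT & _ & _ & HU0).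
 assert (It : forall t, 0 <= t <= s -> - d < t /\ Rbar_lt t T).
 { intros t Ht. split; [lra|]. apply Rbar_le_lt_trans with (Finite s); [exact (proj2 Ht)|]. apply Rbar_lt_le_trans with (Finite r); [exact (proj2 Hs)|exact Hr]. }
 assert (Inc : forall c, e * Rabs (cpt c (U s) x y z - cpt c (U 0) x y z) <= S1 * s).
 { intros c. destruct Hs as [Hs0 Hsr].
  assert (Q : Rabs (e * cpt c (U s) x y z - e * cpt c (U 0) x y z) <= S1 * Rabs (s - 0)).
  { apply (MVT_Rabs_le (fun t => e * cpt c (U t) x y z) (fun t => Zd e None (F c) t x y z) 0 s S1); rewrite Rmin_left, Rmax_right by lra; intros t Ht.
   - assert (Ot : oi 0 r t) by (unfold oi; lra). Transparent Zd. unfold Zd. Opaque Zd. rewrite fscal_at, (repr_der F U c None) by easy.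
    apply (is_derive_scal (fun t => cpt c (U t) x y z)). exact (Sm_is _ _ None (HU c) t x y z (It t ltac:(lra))).
   - apply (continuous_scal_r (K:=RA) (V:=RN) e (fun t => cpt c (U t) x y z)). apply continuous_of_ex_derive. exact (Sm_ex _ _ None (HU c) t x y z (It t Ht)).
   - assert (Ot : oi 0 r t) by (unfold oi; lra). apply (sup_le e 2 t M1 _ Ot (le_n 2)). etr; [now apply N_Z|].
    etr; [now apply (NS_term e 3 t F c)|now apply HN]. }
  rewrite <- Rmult_minus_distr_l, Rabs_mult, (Rabs_right e), (Rabs_right (s - 0)) in Q by lra. lra. }
 assert (LE : forall k c, Rabs k <= e -> Rabs (k * (cpt c (U s) x y z - cpt c (U 0) x y z)) <= S1 * s).
 { intros k c Hk. rewrite Rabs_mult. etr; [|apply (Inc c)]. apply Rmult_le_compat_r; [apply Rabs_pos|easy]. }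
 assert (Ps : 0 <= s) by (unfold oi in Hs; lra). assert (PSs : 0 <= S1 * s) by now apply Rmult_le_pos.
 destruct (Hh x y z) as [Hth Ha]. rewrite <- HU0 in Hth, Ha.
 rewrite (repr_a F U) by easy. rewrite (repr_th F U) by easy. split.
 - have Q := LE eps cQ. cbn [cpt] in Q.
  assert (Q1 : Rabs eps <= e). { rewrite Rabs_right by lra. rewrite <- (Rpower_1 eps) at 1 by lra. apply Rpower_decr; [easy|lra]. }
  specialize (Q Q1). apply Rabs_le_between in Q. assert (Q2 : - (S1 * s) * / varpi0 P <= eps * (q (U s) x y z - q (U 0) x y z) * / varpi0 P) by (apply Rmult_le_compat_r; lra).
  assert (0 <= G0 * S1 * s) by now apply Rmult_le_pos. lra.
 - have Q := LE (Rpower eps (mu P + nu P)) cH. cbn [cpt] in Q.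
  assert (Q1 : Rabs (Rpower eps (mu P + nu P)) <= e). { rewrite Rabs_right by (left; apply exp_pos). apply Rpower_decr; [easy|lra]. }
  specialize (Q Q1).
  assert (BG : Rabs (Gt P z) <= G0).
  { rewrite <- (fzf_at (a:=0) (b:=r) (Gt P) (proj1 (Gt_sop P HP)) (proj1 (proj2 (Gt_sop P HP))) s x y z Hs).
   apply (TB_sup 0 3 s 0 (Kzf 3 (Gt P)) _ Hs). now apply TB_zf; [|lra]. }
  assert (Q2 : Rabs (Gt P z * (Rpower eps (mu P + nu P) * (h (U s) x y z - h (U 0) x y z))) <= G0 * (S1 * s)).
  { rewrite Rabs_mult. apply Rmult_le_compat; [apply Rabs_pos|apply Rabs_pos|easy|easy]. }
  apply Rabs_le_between in Q2. unfold vartheta in *. assert (0 <= / varpi0 P * S1 * s) by now apply Rmult_le_pos. lra.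
Qed.

Lemma apriori sigma kappa Cin : 0 < sigma <= mu P -> 0 < kappa -> 0 < Cin -> exists Ts M', 0 < Ts /\ 0 < M' /\
 forall eps U0 T U, 0 < eps < 1 -> uniformly_hyperbolic P eps kappa U0 -> energy eps sigma (dt_in P eps U0) <= Cin ->
 smooth_solution P eps U0 T U -> forall r : R, 0 <= r < Ts -> Rbar_lt r T ->
 energy eps sigma (dtn U r) <= M' /\ (0 < r -> uniformly_hyperbolic P eps (kappa / 2) (U r)).
Proof.
 intros Hsig Hkap HCin. destruct energy_N as [Cc [PCc HCc]]. assert (Hk2 : 0 < kappa / 2) by lra.
 set (cm := cmin P (kappa / 2)). assert (Pcm : 0 < cm) by now apply cmin_pos.
 set (M00 := Cc * (Cin + 1)). assert (PM00 : 0 <= M00) by (apply Rmult_le_pos; lra).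
 destruct (coef_TB P HP 3 (M00 + 1) (le_n 3)) as [D0 [PD0 HD0]]. set (Cm := sq D0). assert (PCm : 0 <= Cm) by apply sqrt_pos.
 set (B0 := Cc * (Cm * M00) / cm). assert (PB0 : 0 <= B0) by (apply Rmult_le_pos; [repeat apply Rmult_le_pos; lra|left; now apply Rinv_0_lt_compat]).
 (* [B0 + Cc] is what the energy estimate returns, [Cin] covers time 0, and the 1 in [M] is the
    bootstrap gap. *)
 set (M' := B0 + Cc + Cin). set (M := M' + 1). set (M1 := Cc * M). assert (PM1 : 0 <= M1) by (apply Rmult_le_pos; unfold M, M'; lra).
 destruct (energy_uniform P HP 3 (M1 + 1) sigma (le_n 3) ltac:(lra) (proj2 Hsig)) as [C [PC HC]].
 set (B := C * (1 + M1)). assert (PB : 0 <= B) by (apply Rmult_le_pos; lra).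
 destruct (hyperbolic_persists M1 sigma kappa PM1 (proj2 Hsig)) as [K [PK HK]].
 (* Before [Ts] the coefficients lose at most [kappa / 2], and the weighted energy gains at most
    [cm]. *)
 set (Ts := Rmin (kappa / 2 / (K + 1)) (cm / (B + 1))).
 assert (T1 : 0 < kappa / 2 / (K + 1)) by (apply Rdiv_lt_0_compat; lra). assert (T2 : 0 < cm / (B + 1)) by (apply Rdiv_lt_0_compat; lra).
 have Ta := Rmin_l (kappa / 2 / (K + 1)) (cm / (B + 1)). have Tb := Rmin_r (kappa / 2 / (K + 1)) (cm / (B + 1)). fold Ts in Ta, Tb.
 assert (KT : forall s, s < Ts -> 0 <= s -> kappa / 2 <= kappa - K * s).
 { intros s Hs Ps. assert (E : (K + 1) * (kappa / 2 / (K + 1)) = kappa / 2) by (field; lra).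
  assert (K * s <= (K + 1) * (kappa / 2 / (K + 1))) by (apply Rmult_le_compat; lra). lra. }
 assert (BT : forall s, s < Ts -> 0 <= s -> B * s <= cm).
 { intros s Hs Ps. assert (E : (B + 1) * (cm / (B + 1)) = cm) by (field; lra). rewrite <- E. apply Rmult_le_compat; lra. }
 exists Ts, M'. split; [now apply Rmin_glb_lt|]. split; [unfold M'; lra|].
 intros eps U0 T U He Hh Hin HS. set (e := Rpower eps sigma).
 destruct (solution_SmU _ _ _ _ _ HS) as [d [Pd HU]]. have HI := open_time d T. set (I := fun t => - d < t /\ Rbar_lt t T) in *.
 have PT := proj1 HS.
 set (g := fun r => energy eps sigma (dtn U r)).
 assert (gc : forall r : R, 0 <= r -> Rbar_lt r T -> continuous g r).
 { intros r Pr Hr. assert (Ir : I r) by (split; [lra|exact Hr]). exact (energy_continuous I U eps sigma r HI HU Ir). }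
 assert (Nv : forall x y z, vartheta P eps U0 x y z <> 0) by (intros x y z; have Q := proj1 (Hh x y z); lra).
 assert (g0 : g 0 <= Cin) by (unfold g; rewrite <- (dt_in_eq P eps U0 T U HP HS Nv); exact Hin).
 assert (hyp : forall (r : R) (F : cmp -> fld 0 r), 0 < r <= Ts -> Rbar_le r T -> repr F U -> (forall s, 0 <= s < r -> g s <= M) ->
  (forall s, oi 0 r s -> NS e 3 s F <= M1) /\ (ge0 (kappa / 2) (aw eps F) /\ ge0 (kappa / 2) (thw eps F))).
 { intros r F Hr HrT HF Hg.
  assert (N1 : forall s, oi 0 r s -> NS e 3 s F <= M1).
  { intros s Hs. etr; [apply (HCc 0 r eps sigma F U s Hs HF)|]. apply Rmult_le_compat_l; [lra|]. apply Hg. unfold oi in Hs; lra. }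
  split; [exact N1|]. have Q := HK eps U0 T U r F He HS HrT HF Hh N1.
  split; intros s x y z Hs; have Q1 := Q s x y z Hs; have Q2 := KT s ltac:(unfold oi in Hs; lra) ltac:(unfold oi in Hs; lra); lra. }
 assert (main : forall b : R, b <= Ts -> Rbar_le b T -> forall r, 0 <= r < b -> g r <= M').
 { intros b Hb HbT.
  assert (rT : forall r, r < b -> Rbar_lt r T) by (intros r Hr; apply Rbar_lt_le_trans with (Finite b); [exact Hr|exact HbT]).
  apply (bootstrap g b M M'); [unfold M; lra|intros r Hr; apply gc; [lra|apply rT; lra]|].
  intros r Hr Hg. destruct (Req_dec r 0) as [->|Nr]; [unfold M'; lra|].
  apply le_at_end; [lra|apply gc; [lra|apply rT; lra]|]. intros s Hs.
  assert (HrT : Rbar_le r T) by (apply Rbar_lt_le, rT; lra).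
  destruct (solution_repr eps U0 T U r HS HrT) as [F HF].
  destruct (hyp r F ltac:(lra) HrT HF Hg) as (N1 & Ga & Gth).
  have SY := Lam_SYM P HP 0 eps F F (kappa / 2) (proj1 He) Hk2 Gth (solution_Lam eps U0 T U r F (kappa / 2) (proj1 He) Hk2 HS HrT HF Gth).
  assert (TBs : forall t, oi 0 r t -> Wb e 3 t (M1 + 1) M1 F).
  { intros t Ht c. assert (Q : Nk e 3 t (F c) <= M1) by (etr; [now apply (NS_term e 3 t F c)|now apply N1]). now apply TB_of_N. }
  set (E := fun t => Ek e 3 (mw eps F) t F).
  assert (DE : forall t, oi 0 r t -> ex_derive E t /\ Rabs (Derive E t) <= B).
  { intros t Ht. destruct (HC 0 r 0 eps F F t M1 He Ht (Rle_refl 0) PM1 (TBs t Ht) (TBs t Ht) SY) as [dE [E1 E2]].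
   split; [now exists dE|]. rewrite (is_derive_unique _ _ _ E1 : Derive E t = dE). exact E2. }
  assert (Pone : 0 < Cin + 1 - g 0) by lra.
  destruct (gc 0 (Rle_refl 0) PT (ball (g 0) (mkposreal _ Pone))) as [dl Hdl]; [now exists (mkposreal _ Pone)|].
  (* Fields live on an open interval that excludes 0. The estimate therefore starts at a positive
     [s1], so small that by continuity the energy is still at most [Cin + 1]. *)
  set (s1 := Rmin s dl / 2). have A1 := Rmin_l s dl. have A2 := Rmin_r s dl. have A3 := Rmin_glb_lt s dl 0 (proj1 Hs) (cond_pos dl).
  assert (H1 : 0 < s1 < s) by (unfold s1; lra).
  assert (G1 : g s1 <= Cin + 1).
  { assert (Q : ball (g 0) (mkposreal _ Pone) (g s1)).
   { apply Hdl. apply R_ball. apply Rabs_def1; unfold s1; lra. }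
   apply ball_R in Q; cbn [pos] in Q. apply Rabs_def2 in Q. lra. }
  assert (O1 : oi 0 r s1) by (unfold oi; lra). assert (O2 : oi 0 r s) by (unfold oi; lra).
  assert (NS1 : NS e 3 s1 F <= M00) by (etr; [apply (HCc 0 r eps sigma F U s1 O1 HF)|]; apply Rmult_le_compat_l; [lra|exact G1]).
  assert (E1 : E s1 <= Cm * M00).
  { assert (W0 : Wb e 3 s1 (M00 + 1) M00 F).
   { intros c. assert (Q : Nk e 3 s1 (F c) <= M00) by (etr; [now apply (NS_term e 3 s1 F c)|easy]). now apply TB_of_N. }
   destruct (HD0 0 r e s1 M00 eps F He O1 PM00 W0) as (_ & _ & _ & _ & _ & _ & Tm & _).
   apply Rle_trans with (Cm * NS e 3 s1 F); [|now apply Rmult_le_compat_l].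
   apply (Ek_upper e 3 (mw eps F) s1 F Cm O1). intros c x y z. etr; [apply Rle_abs|]. exact (TB_sup e 3 s1 M00 D0 _ O1 (Tm c) x y z). }
  destruct (MVT_cor2 E (fun t => Derive E t) s1 s) as [u [Eu Hu]]; [lra| |].
  { intros t Ht. apply is_derive_Reals, Derive_correct, DE. unfold oi; lra. }
  have Du := proj2 (DE u ltac:(unfold oi; lra)). have Du' := Rle_trans _ _ _ (Rle_abs _) Du.
  assert (E2 : E s <= Cm * M00 + cm).
  { assert (Q1 : Derive E u * (s - s1) <= B * s) by (etr; [apply Rmult_le_compat_r; [lra|exact Du']|apply Rmult_le_compat_l; lra]).
   have Q2 := BT s ltac:(lra) ltac:(lra). lra. }
  assert (E3 : cm * NS e 3 s F <= E s).
  { apply (Ek_lower e 3 (mw eps F) s F cm O2). apply mW_lower; [easy|easy|intros; now apply Ga|intros; now apply Gth]. }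
  etr; [apply (HCc 0 r eps sigma F U s O2 HF)|]. fold e.
  assert (E4 : NS e 3 s F <= Cm * M00 / cm + 1).
  { apply Rmult_le_reg_l with cm; [easy|]. replace (cm * (Cm * M00 / cm + 1)) with (Cm * M00 + cm) by (field; lra). lra. }
  apply Rle_trans with (Cc * (Cm * M00 / cm + 1)); [apply Rmult_le_compat_l; lra|]. unfold M', B0. apply Rle_trans with (Cc * (Cm * M00) / cm + Cc); [right; field; lra|lra]. }
 assert (bound : forall r : R, 0 <= r < Ts -> Rbar_lt r T -> exists b : R, r < b <= Ts /\ Rbar_le b T).
 { intros r Hr HrT. destruct T as [T'| |]; cbn in HrT; [|exists Ts; split; [lra|easy]|easy].
  exists (Rmin Ts T'). split; [split; [now apply Rmin_glb_lt|apply Rmin_l]|apply Rmin_r]. }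
 intros r Hr HrT. destruct (bound r Hr HrT) as (b & Hb & HbT). split; [apply (main b); [lra|easy|lra]|].
 intros Pr x y z. destruct (solution_repr eps U0 T U b HS HbT) as [F HF].
 destruct (hyp b F ltac:(lra) HbT HF) as (_ & Ga & Gth).
 { intros s Hs. have Q := main b ltac:(lra) HbT s Hs. unfold M. lra. }
 assert (Or : oi 0 b r) by (unfold oi; lra). split.
 - rewrite <- (repr_th F U) by easy. now apply Gth.
 - rewrite <- (repr_a F U) by easy. now apply Ga.
Qed.

End Apriori.

(** * Continuation of solutions and conclusion *)

Lemma N0_le {a b} e k t (f : fld a b) : oi a b t -> Nk 0 k t f <= Nk e k t f.
Proof.
 intros Ht. assert (D : forall l, Zw 0 l f = Zw e l f \/ Zw 0 l f = fcst 0).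
 { induction l as [|d l IH]; [now left|]. rewrite !Zw_cons. destruct d as [c|]; [|right; apply Zd0_None].
  destruct IH as [-> | ->]; [now left|right]. rewrite Zd_Some. apply fder_cst. }
 Transparent Nk. unfold Nk. Opaque Nk. apply SW_le. intros l _. destruct (D l) as [-> | ->]; [apply Rle_refl|]. rewrite nrm2_cst0 by easy. now apply nrm2_nonneg.
Qed.

Lemma fld_restrict {a b} a' b' (F : cmp -> fld a b) : a <= a' -> b' <= b -> exists F' : cmp -> fld a' b',
 forall c t x y z, oi a' b' t -> F' c t x y z = F c t x y z.
Proof.
 intros Ha Hb. assert (It : forall t, oi a' b' t -> oi a b t) by (unfold oi; intros; lra).
 assert (SF : forall c, Sm (oi a' b') (F c)).
 { intros c. apply smooth_on_Sm. have Q := proj2 (smooth_on_Sm _ _) (fv_sm (F c)). intros l t x y z Ht. apply Q. auto. }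
 exists (fun c => mkfld a' b' (F c) (SF c) (fun t Ht => fv_per (F c) t (It t Ht))). intros c t x y z Ht. now rewrite mkfld_at.
Qed.

Definition mkst (V : cmp -> sfield) : state := State (V cQ) (V cH) (V cV1) (V cV2) (V cW).

Lemma cpt_mkst V c : cpt c (mkst V) = V c.
Proof. now destruct c. Qed.

(** Parity in [z] of each unknown. *)
Definition sgc (c : cmp) : R := match c with cH | cW => -1 | _ => 1 end.

Section Continuation.
Context (P : params) (HP : admissible P).
Local Notation thw := (thW P HP). Local Notation aw := (aW P HP). Local Notation lam := (Lam P HP).

Lemma Lam_transfer {a b a' b'} (F : cmp -> fld a b) (F' : cmp -> fld a' b') U eps kap : 0 < eps -> 0 < kap -> repr F U -> repr F' U ->
 a <= a' -> b' <= b -> ge0 kap (thw eps F) -> (forall c, fder None (F c) = lam 0 eps F F c) ->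
 ge0 kap (thw eps F') /\ forall c, fder None (F' c) = lam 0 eps F' F' c.
Proof.
 intros He Hk HF HF' Ha Hb Hth H. assert (It : forall t, oi a' b' t -> oi a b t) by (unfold oi; intros; lra).
 assert (G : ge0 kap (thw eps F')).
 { intros t x y z Ht. rewrite (repr_th P HP F' U), <- (repr_th P HP F U) by auto. apply Hth. auto. }
 split; [exact G|]. intros c. apply fld_eq. intros t x y z Ht.
 rewrite (Lam_rhs P HP F' U eps kap), (repr_der F' U), <- (repr_der F U), H by auto. apply (Lam_rhs P HP F U eps kap); auto.
Qed.

Lemma prim_even g z : smooth_odd_periodic g -> RInt g 0 (- z) = RInt g 0 z.
Proof.
 intros (H1 & _ & H2). replace (RInt g 0 (- z)) with (RInt g (-1 * 0 + 0) (-1 * z + 0)) by (f_equal; ring).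
 rewrite <- (RInt_comp_lin (V:=RC)) by (apply ex_RInt_cont; intros x; now apply smooth1_continuous).
 apply RInt_ext. intros x _. replace (-1 * x + 0) with (- x) by ring. rewrite H2. unfold scal; simpl; unfold mult; simpl. ring.
Qed.

Definition refl {a b} (V : cmp -> fld a b) (c : cmp) : fld a b := (sgc c *: frefl (V c))%fld.

Lemma refl_at {a b} (V : cmp -> fld a b) c t x y z : refl V c t x y z = sgc c * V c t x y (- z).
Proof. unfold refl. now rewrite fscal_at, frefl_at. Qed.

Lemma refl_thW {a b} eps (V : cmp -> fld a b) t x y z : oi a b t -> thw eps (refl V) t x y z = thw eps V t x y (- z).
Proof.
 intros Ht. rewrite !thW_at, refl_at by easy. cbn [sgc]. rewrite (proj2 (proj2 (Gt_sop P HP)) z), (proj2 (proj2 (Hbar_sop P HP)) z). ring.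
Qed.

(** The system is invariant under reflection in [z], combined with the signs [sgc], because [G],
    [Hbar] and [Gt] are odd and the primitives of [G] and [Hbar] in [Phi] are even. *)
Lemma Lam_refl {a b} eps kap (V : cmp -> fld a b) : 0 < kap -> ge0 kap (thw eps V) ->
 (forall c, fder None (V c) = lam 0 eps V V c) -> forall c, fder None (refl V c) = lam 0 eps (refl V) (refl V) c.
Proof.
 intros Hk Hth H c. apply fld_eq. intros t x y z Ht.
 assert (Hth' : ge0 kap (thw eps (refl V))) by (intros t' x' y' z' Ht'; rewrite refl_thW by easy; now apply Hth).
 unfold refl at 1. rewrite fder_scal, fscal_at, fder_refl, frefl_at, H.
 set (si := fun i => match i with AxZ => -1 | _ => 1 end).
 assert (HD : forall c i, Dh 0 i (refl V c) t x y z = sgc c * si i * Dh 0 i (V c) t x y (- z)).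
 { intros c' i. rewrite !Dh_0. unfold refl. rewrite fder_scal, fscal_at, fder_refl. destruct i; cbn [si]; fat; rewrite ?frefl_at; ring. }
 assert (Hi : finv (thw eps (refl V)) t x y z = finv (thw eps V) t x y (- z)).
 { rewrite !finv_at by (apply (ge0_neq kap); easy). now rewrite refl_thW. }
 assert (Hadv : forall c, adv 0 (refl V) (refl V c) t x y z = sgc c * adv 0 V (V c) t x y (- z)).
 { intros c'. unfold adv, sum3. fat. rewrite !HD, !refl_at. cbn [vel sgc si]. ring. }
 destruct c; cbn [Lam]; fat; rewrite ?Hi, ?Hadv, ?HD, ?refl_at; cbn [sgc si].
 - unfold sum3. fat. rewrite !HD. unfold gW, bbW, pW, phiF, fG, fHb, fIG, fIH. fat. rewrite !fzf_at, refl_at, !prim_even by (easy || apply HP).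
  rewrite (proj2 (proj2 (G_sop P HP)) z), (proj2 (proj2 (Hbar_sop P HP)) z). cbn [vel sgc si]. ring.
 - unfold fGt. rewrite !fzf_at by easy. rewrite (proj2 (proj2 (Gt_sop P HP)) z). ring.
 - ring.
 - ring.
 - ring.
Qed.

Lemma CE_at_ext eps U U' t x y z : U' t = U t ->
 (forall c, dt (fun s => cpt c (U' s)) t x y z = dt (fun s => cpt c (U s)) t x y z) -> CE_at P eps U t x y z -> CE_at P eps U' t x y z.
Proof.
 intros E H. have H1 := H cQ. have H2 := H cH. have H3 := H cV1. have H4 := H cV2. have H5 := H cW. cbn [cpt] in *.
 unfold CE_at. cbv zeta beta. now rewrite E, H1, H2, H3, H4, H5.
Qed.

(* The lifespan in [local_existence] depends only on these bounds, so a solution restarted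
 shortly before [T] passes [T]. *)
Lemma continuation eps kap M0 U0 (T : R) U : 0 < eps < 1 -> 0 < kap -> 0 <= M0 -> smooth_solution P eps U0 T U ->
 (forall t, 0 < t < T -> uniformly_hyperbolic P eps kap (U t)) ->
 (forall (F : cmp -> fld 0 T) t, repr F U -> oi 0 T t -> NS 0 3 t F <= M0) ->
 exists T' U', T < T' /\ smooth_solution P eps U0 T' U' /\ forall t, t < T -> U' t = U t.
Proof.
 intros He Hk HM HS Hh HN. assert (PT : 0 < T) by exact (proj1 HS). assert (Hk2 : 0 < kap / 2) by lra.
 destruct (local_existence P HP M0 kap eps He HM Hk) as (tau & Ptau & LE).
 (* Positive, and within [tau / 2] of [T], so that [t0 + tau] lies beyond [T]. *)
 set (t0 := T - Rmin tau T / 2). have A1 := Rmin_l tau T. have A2 := Rmin_r tau T. have A3 := Rmin_glb_lt tau T 0 Ptau PT.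
 assert (Ht0 : 0 < t0 < T) by (unfold t0; lra). set (T' := t0 + tau). assert (HT' : T < T') by (unfold T', t0; lra).
 destruct (solution_repr P eps U0 T U T HS (Rbar_le_refl T)) as [F HF].
 assert (GaF : ge0 kap (aw eps F)) by (intros t x y z Ht; rewrite (repr_a P HP F U) by easy; now apply Hh).
 assert (GthF : ge0 kap (thw eps F)) by (intros t x y z Ht; rewrite (repr_th P HP F U) by easy; now apply Hh).
 destruct (LE 0 T F t0 Ht0 (HN F t0 HF Ht0) (fun x y z => GaF t0 x y z Ht0) (fun x y z => GthF t0 x y z Ht0)) as (V & VL & V0 & Va & Vth).
 have LF := solution_Lam P HP eps U0 T U T F kap (proj1 He) Hk HS (Rbar_le_refl T) HF GthF.
 set (lo := Rmax 0 (t0 - tau)). have B1 := Rmax_l 0 (t0 - tau). have B2 := Rmax_r 0 (t0 - tau). fold lo in B1, B2.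
 assert (B3 : lo < t0) by (apply Rmax_lub_lt; lra).
 set (UV := fun t => mkst (fun c => V c t)).
 assert (RV : repr V UV) by (intros c s x y z Hs; unfold UV; now rewrite cpt_mkst).
 destruct (fld_restrict lo T F B1 (Rle_refl T)) as [F1 HF1]. destruct (fld_restrict lo T V B2 ltac:(unfold T' in HT'; lra)) as [V1 HV1].
 assert (RF1 : repr F1 U) by (intros c s x y z Hs; rewrite HF1 by easy; apply HF; unfold oi in *; lra).
 assert (RV1 : repr V1 UV) by (intros c s x y z Hs; rewrite HV1 by easy; apply RV; unfold oi, T' in *; lra).
 assert (GthF2 : ge0 (kap / 2) (thw eps F)) by (intros t x y z Ht; have Q := GthF t x y z Ht; lra).
 destruct (Lam_transfer F F1 U eps (kap / 2) (proj1 He) Hk2 HF RF1 B1 (Rle_refl T) GthF2 LF) as [GF1 LF1].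
 destruct (Lam_transfer V V1 UV eps (kap / 2) (proj1 He) Hk2 RV RV1 B2 ltac:(unfold T' in HT'; lra) Vth VL) as [GV1 LV1].
 assert (Eq : forall c, F1 c = V1 c).
 { apply (uniqueness P HP eps (kap / 2) F1 V1 t0); [easy|easy|unfold oi; lra| |easy|easy|easy|easy|].
  - intros t x y z Ht. rewrite (repr_a P HP F1 U) by easy. have Q := proj2 (Hh t ltac:(unfold oi in Ht; lra) x y z). lra.
  - intros c x y z. rewrite HF1, HV1, V0 by (unfold oi; lra). reflexivity. }
 (* Before [T] the two solutions coincide on a whole interval by uniqueness; hence [V2] represents
    the glued solution across [T], which gives its smoothness there. *)
 set (U' := fun t => if Rlt_dec t T then U t else UV t).
 assert (EU : forall t, t < T -> U' t = U t) by (intros t Ht; unfold U'; now destruct Rlt_dec).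
 destruct (fld_restrict lo T' V B2 (Rle_refl T')) as [V2 HV2].
 assert (RV2' : repr V2 UV) by (intros c s x y z Hs; rewrite HV2 by easy; apply RV; unfold oi, T' in *; lra).
 assert (RV2 : repr V2 U').
 { intros c s x y z Hs. unfold U'. destruct Rlt_dec as [L|L]; [|now apply RV2'].
  assert (Os : oi lo T s) by (unfold oi in *; lra). rewrite HV2 by easy. rewrite <- HV1, <- Eq, RF1 by easy. reflexivity. }
 destruct (Lam_transfer V V2 UV eps (kap / 2) (proj1 He) Hk2 RV RV2' B2 (Rle_refl T') Vth VL) as [GV2 LV2].
 (* Local existence says nothing about parity. The reflected solution solves the same system with
    the same data at [t0], so uniqueness makes the two equal. *)
 assert (Par : forall c t x y z, oi lo T' t -> V2 c t x y (- z) = sgc c * V2 c t x y z).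
 { assert (Q : forall c, V2 c = refl V2 c).
  { apply (uniqueness P HP eps (kap / 2) V2 (refl V2) t0); [easy|easy|unfold oi; lra| |easy| |easy| |].
   - intros t x y z Ht. rewrite aW_at, HV2, <- (aW_at P HP eps V) by (unfold oi, T' in *; lra). apply Va. unfold oi, T' in *; lra.
   - intros t x y z Ht. rewrite refl_thW by easy. now apply GV2.
   - now apply (Lam_refl eps (kap / 2)).
   - intros c x y z. rewrite refl_at, !HV2, !V0, !HF by (unfold oi; lra). destruct HS as (_ & _ & Heq & _).
    destruct (Heq t0 ltac:(lra) (proj2 Ht0)) as (_ & P1 & P2 & P3 & P4 & P5 & _).
    destruct c; cbn [cpt sgc]; [rewrite P1|rewrite P2|rewrite P3|rewrite P4|rewrite P5]; ring. }
  intros c t x y z Ht. rewrite (Q c) at 1. rewrite refl_at, Ropp_involutive. reflexivity. }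
 exists T', U'. split; [exact HT'|]. split; [|exact EU].
 destruct (solution_SmU _ _ _ _ _ HS) as [d [Pd HU]]. destruct HS as (_ & _ & Heq & HU0).
 assert (inT : forall t, 0 <= t -> t < T' -> ~ t < T -> oi lo T' t) by (intros t H1 H2 H3; unfold oi; lra).
 assert (cs : forall c, In c (q :: h :: v1 :: v2 :: w :: nil) -> exists c', c = cpt c').
 { intros c Hc. cbn [In] in Hc. destruct Hc as [<-|[<-|[<-|[<-|[<-|[]]]]]]; [now exists cQ|now exists cH|now exists cV1|now exists cV2|now exists cW]. }
 assert (LtT : forall t, t < T -> locally t (fun s => U' s = U s)).
 { intros t Ht. assert (Pt : 0 < T - t) by lra. exists (mkposreal _ Pt). intros s Hs. apply EU.
  apply ball_R in Hs; cbn [pos] in Hs. apply Rabs_def2 in Hs. lra. }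
 split; [cbn; lra|]. split; [|split].
 - exists d. split; [easy|]. intros c Hc. destruct (cs c Hc) as [c' ->].
  assert (S1 : smooth_on (fun t => - d < t /\ Rbar_lt t T) (fun t => cpt c' (U' t))).
  { apply smooth_on_Sm. apply (Sm_ext _ (fun t => cpt c' (U t))); [apply open_time|intros t x y z [_ Ht]; now rewrite EU|apply HU]. }
  assert (S2 : smooth_on (oi lo T') (fun t => cpt c' (U' t))).
  { apply smooth_on_Sm. apply (Sm_ext _ (V2 c')); [apply open_oi|intros; now apply RV2|apply fv_sm]. }
  intros l t x y z [Hd Ht]. destruct (Rlt_dec t T) as [L|L]; [apply S1; now split|]. apply S2. apply inT; [lra|exact Ht|exact L].
 - intros t Pt Ht. destruct (Rlt_dec t T) as [L|L].
  + rewrite EU by easy. destruct (Heq t Pt L) as (Q1 & Q2 & Q3 & Q4 & Q5 & Q6 & Q7). repeat (split; [easy|]).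
   intros x y z. apply (CE_at_ext eps U U'); [now apply EU| |apply Q7]. intros c. apply Derive_ext_loc. apply (filter_imp (F:=locally t) (fun s => U' s = U s)); [|now apply LtT].
   intros s ->. reflexivity.
  + have Ot := inT t Pt Ht L.
   assert (EV : forall c x y z, cpt c (U' t) x y z = V2 c t x y z) by (intros; symmetry; now apply RV2).
   assert (pr : forall c x y z, cpt c (U' t) x y (- z) = sgc c * cpt c (U' t) x y z) by (intros; rewrite !EV; now apply Par).
   split; [|split; [|split; [|split; [|split; [|split]]]]].
   * intros c Hc. destruct (cs c Hc) as [c' ->]. intros x y z. rewrite !EV. apply (fv_per (V2 c') t Ot).
   * intros x y z. have Q := pr cQ x y z. cbn [cpt sgc] in Q. lra.
   * intros x y z. have Q := pr cH x y z. cbn [cpt sgc] in Q. lra.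
   * intros x y z. have Q := pr cV1 x y z. cbn [cpt sgc] in Q. lra.
   * intros x y z. have Q := pr cV2 x y z. cbn [cpt sgc] in Q. lra.
   * intros x y z. have Q := pr cW x y z. cbn [cpt sgc] in Q. lra.
   * intros x y z. apply (CE_of_rhs P HP).
    -- rewrite <- (repr_th P HP V2 U') by easy. now apply (ge0_neq (kap / 2)).
    -- intros c. rewrite <- (Lam_rhs P HP V2 U' eps (kap / 2)) by easy. rewrite <- LV2. symmetry. now apply (repr_der V2 U' c None).
 - rewrite EU; easy.
Qed.

End Continuation.

Theorem proposition4 (P : params) (HP : admissible P)
    (sigma kappa Cin : R) (Hsigma : 0 < sigma <= mu P)
    (Hkappa : 0 < kappa) (HCin : 0 < Cin) :
  exists Tsigma C : R, 0 < Tsigma /\ 0 < C /\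
    forall (eps : R) (U0 : state) (Tstar : Rbar) (U : R -> state),
      0 < eps < 1 ->
      uniformly_hyperbolic P eps kappa U0 ->
      energy eps sigma (dt_in P eps U0) <= Cin ->
      maximal_smooth_solution P eps U0 Tstar U ->
      Rbar_lt Tsigma Tstar /\
      forall s, 0 <= s <= Tsigma -> energy eps sigma (dtn U s) <= C * Cin.
Proof.
 destruct (apriori P HP sigma kappa Cin Hsigma Hkappa HCin) as (Ts & M' & PTs & PM' & AP).
 destruct energy_N as [Cc [PCc HCc]].
 (* The a priori bound holds on a half-open interval, whence the half; the quotient expresses the
    bound [M'] as a multiple of [Cin]. *)
 exists (Ts / 2), (M' / Cin). split; [lra|]. split; [now apply Rdiv_lt_0_compat|].
 intros eps U0 Tstar U He Hh Hin [HS Hmax]. have A := AP eps U0 Tstar U He Hh Hin HS.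
 assert (L : Rbar_lt (Ts / 2) Tstar).
 { destruct (Rbar_lt_dec (Ts / 2) Tstar) as [L|L]; [easy|exfalso]. have PT := proj1 HS.
  destruct Tstar as [T| |]; cbn in L, PT; [|now apply L|easy].
  (* If the maximal time were at most [Ts / 2], the a priori bound would hold up to it. The purely
     spatial norm required here is dominated by the weighted one, hence by [Cc M'], and the solution
     could be continued. *)
  destruct (continuation P HP eps (kappa / 2) (Cc * M') U0 T U He) as (T' & U' & H1 & H2 & H3); [lra|apply Rmult_le_pos; lra|easy| | |].
  - intros t Ht. apply A; cbn; lra.
  - intros F t HF Ht. etr; [apply sumc_le; intros c; apply (N0_le (Rpower eps sigma) 3 t (F c) Ht)|].
   etr; [apply (HCc 0 T eps sigma F U t Ht HF)|]. apply Rmult_le_compat_l; [lra|]. unfold oi in Ht. apply A; cbn; lra.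
  - apply (Hmax (Finite T') U' H1 H2). intros t _ Ht. apply H3. exact Ht. }
 split; [exact L|]. intros s Hs. replace (M' / Cin * Cin) with M' by (field; lra). apply A; [lra|].
 apply Rbar_le_lt_trans with (Finite (Ts / 2)); [apply Hs|exact L].
Qed.
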